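(* Suppose $\eta(n)\sim\beta\kappa(n)$ as $n\to\infty$ for some $\beta>0$. Then the weak limit $B:=\lim_{t\to\infty}(Z^{(1)}_t)^{1/\alpha}/\xi(Z^{(1)}_t)$ exists and is strictly positive almost surely, and as $t\to\infty$, $$\frac{u(t,Z^{(1)}_t)}{u(t,-Z^{(1)}_t)}\Rightarrow \exp\{\sqrt{2\beta}\,\sigma B N\},$$ where $\Rightarrow$ denotes convergence in law, $N$ is a standard normal random variable independent of $B$, and $\sigma>0$ is given by $\sigma^2=\frac{\alpha}{(\alpha-2)(\alpha-1)^2}$ if $\alpha>2$ and $\sigma^2=1$ if $\alpha=2$.
   Context: Fix $\alpha\ge 2$. Let $(\xi_0(z))_{z\in\mathbb Z}$ be i.i.d. Pareto random variables with parameter $\alpha$, i.e. $\mathrm{Prob}(\xi_0(z)>x)=x^{-\alpha}$ for $x\ge 1$. Let $p:\mathbb N\to[0,1]$ be eventually nondecreasing with $p(n)\to 1$, and $q=1-p$. Define the potential $\xi:\mathbb Z\to[1,\infty)$ by $\xi(n)=\xi_0(n)$ for $n\ge 0$ and, independently for each $n\ge1$ (and independently of $\xi_0$), $\xi(-n)=\xi_0(n)$ with probability $p(n)$ and $\xi(-n)=\xi_0(-n)$ with probability $q(n)$. Let $u$ be the solution of $\partial_t u=\Delta u+\xi u$ on $(0,\infty)\times\mathbb Z$, $u(0,\cdot)=\mathbf 1_{\{0\}}$, with $(\Delta f)(z)=\sum_{|y-z|=1}(f(y)-f(z))$, given by $u(t,z)=\mathbb E[\exp\{\int_0^t\xi(X_s)ds\}\mathbf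 1\{X_t=z\}]$ with $(X_s)$ the continuous-time random walk with generator $\Delta$ started at $0$. Let $D=\{z\in\mathbb N_0:\xi(z)=\xi(-z)\}$, $\Psi_t(z)=\xi(z)-\frac{|z|}{t}\log\xi(z)$, and $Z^{(1)}_t$ a maximiser of $\Psi_t$ over $D$. Let $\eta(n)=\sum_{z=1}^n q(z)$ and $\kappa(n)=n^{2/\alpha}$ if $\alpha>2$, $\kappa(n)=n/\log n$ if $\alpha=2$. *)

(* Defs.v *)
From HB Require Import structures.
From mathcomp Require Import all_boot all_order all_algebra.
From mathcomp Require Import all_classical all_reals all_analysis.
Set Implicit Arguments. Unset Strict Implicit. Unset Printing Implicit Defensive.
Import Order.TTheory GRing.Theory Num.Theory.
Import numFieldNormedType.Exports.
Local Open Scope classical_set_scope.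
Local Open Scope ring_scope.

Section Model.
Context {R : realType}.

Definition sigmaR {d} {T : measurableType d} (X : T -> R) : set (set T) :=
  [set A | exists B : set R, measurable B /\ A = X @^-1` B].
Definition sigmaB {T : Type} (X : T -> bool) : set (set T) :=
  [set A | exists B : set bool, A = X @^-1` B].

Definition kappa (alpha : R) (n : nat) : R :=
  if 2 < alpha then (n%:R) `^ (2 / alpha) else n%:R / ln n%:R.

Definition etaPAM (p : nat -> R) (n : nat) : R :=
  \sum_(1 <= z < n.+1) (1 - p z).

Definition sigmaPAM (alpha : R) : R :=
  if 2 < alpha then Num.sqrt (alpha / ((alpha - 2) * (alpha - 1) ^+ 2)) else 1.

Definition potential {T : Type} (xi0 : int -> T -> R) (c : nat -> T -> bool)
  (w : T) (z : int) : R :=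
  match z with
  | Posz n => xi0 z w
  | Negz n => if c n.+1 w then xi0 (Posz n.+1) w else xi0 z w
  end.

Definition Dset (xi : int -> R) : set nat := [set z : nat | xi z = xi (- (z%:Z))].

Definition Psi (xi : int -> R) (t : R) (z : int) : R :=
  xi z - ((`|z|%:R : R) / t) * ln (xi z).

(* Continuous-time simple random walk with generator Delta, started at 0,
   built from holding times tau k (i.i.d. Exp(2)) and steps eps k
   (i.i.d. fair signs: true = +1, false = -1). *)
Definition jump_time {T : Type} (tau : nat -> T -> R) (n : nat) (w : T) : R :=
  \sum_(k < n) tau k w.
Definition jump_chain {T : Type} (eps : nat -> T -> bool) (n : nat) (w : T) : int :=
  \sum_(k < n) (if eps k w then 1 else -1).
Definition walk {T : Type} (tau : nat -> T -> R) (eps : nat -> T -> bool)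
  (s : R) (w : T) : int :=
  jump_chain eps
    (xget 0%N [set n | jump_time tau n w <= s < jump_time tau n.+1 w]) w.

(* Feynman-Kac: u(t,z) = E[exp(int_0^t xi(X_s) ds) 1{X_t = z}] *)
Definition pam_u {d'} {T' : measurableType d'} (Q : probability T' R)
  (tau : nat -> T' -> R) (eps : nat -> T' -> bool)
  (xi : int -> R) (t : R) (z : int) : R :=
  fine (\int[Q]_(w in setT)
          (expR (Rintegral lebesgue_measure `[0, t]
                   (fun s => xi (walk tau eps s w)))
           * (walk tau eps t w == z)%:R)%:E).

Definition gauss_pdf (x : R) : R := expR (- (x ^+ 2) / 2) / Num.sqrt (2 * pi).

Definition bounded_continuous (f : R -> R) : Prop :=
  continuous f /\ exists M : R, forall x, `|f x| <= M.

End Model.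

Definition mutually_indep {d} {T : measurableType d} {R : realType}
  (P : probability T R) (I : eqType) (E : I -> set (set T)) : Prop :=
  forall (J : seq I) (A : I -> set T),
    uniq J -> (forall i, i \in J -> E i (A i)) ->
    P (\bigcap_(i in [set` J]) A i) = (\prod_(i <- J) P (A i))%E.

(* Main.v *)
(** Expanding the Feynman-Kac formula over the number of jumps turns u(t, z) into a sum of
    iterated Duhamel integrals.  Let n = Z_1(t) and y = xi(n).  On a box around n the
    solution is squeezed between exp((L - 2) t) times explicit profiles, products of
    continued fractions, where L solves the level equation L = y + psi_left + psi_right.
    The same applies to the reflected potential, and as xi(n) = xi(-n), with coins equal
    to 1 near n, the two levels differ by o(1 / t).  Hence
      ln (u(t, n) / u(t, -n)) = sum_(i < n) (ln (y - xi(-i)) - ln (y - xi(i))) + o(1).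
    Conditionally on n and y the summands are independent and symmetric, and vanish unless
    xi(i) and xi(-i) are drawn separately; since eta ~ beta kappa, the characteristic
    function of the sum tends to exp(- beta sigma^2 theta^2 B^2).  The law of the rescaled
    peak (n, y) comes from Riemann sums over the possible positions n.  Levy's continuity
    theorem applies by Gaussian smoothing; as u is not known to be measurable in xi, the
    last step is a form of Slutsky's lemma for non-measurable functionals. *)
Require Import Defs.
From HB Require Import structures.
From mathcomp Require Import all_boot all_order all_algebra.
From mathcomp Require Import all_classical all_reals all_analysis.
From mathcomp Require Import measurable_realfun.
From mathcomp Require Import ring lra zify.
Import Order.TTheory GRing.Theory Num.Theory.
Import numFieldNormedType.Exports.
Local Open Scope classical_set_scope.
Local Open Scope ring_scope.

Set Implicit Arguments.
Unset Strict Implicit.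
Unset Printing Implicit Defensive.

(** The obstacle is precision: the levels are multiplied by [t], so they must agree to o(1 / t),
    while the gap of the peak is only about a power of [t]. Each symmetric site next to the peak
    improves the agreement by a factor of order 1 / G^2, with G the gap, so a number of sites
    depending on alpha alone suffices; as [p] tends to 1, their coins are all 1 with high
    probability. The law of the peak is found site by site: a site counts as the peak if its
    rescaled value of [Psi] beats all others by a margin [e]. Such events are disjoint, so the
    expectation at the random peak is a sum over deterministic sites, each of which factorises over
    the other sites. The mass lost to the margin returns as [e] tends to 0, and as the limit has
    mass 1 nothing escapes. Separately drawn values are cut at b = a / omega, with a the height
    scale: far below a, so that logarithms are nearly linear, yet above all such values with high
    probability. At alpha = 2 only powers of ln t are left for this: the expected number of
    exceedances is of order omega^3 / ln t, hence omega = (ln t)^(1/4). *)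

Notation intT P := (Rintegral P setT) (only parsing).
Notation measT := (measurable_fun setT) (only parsing).

Lemma eq_ler {disp : Order.disp_t} {T : porderType disp} (x y : T) : x = y -> (x <= y)%O.
Proof. by move->. Qed.

Lemma measurable_scale {R : realType} {d} {T : measurableType d} (D : set T) (k : R) (f : T -> R) :
  measurable_fun D f -> measurable_fun D (fun x => k * f x).
Proof. by move=> mf; apply: measurable_funM. Qed.

(** * Bounded measurable functions, Fubini, and freezing of independent variables *)

Section BoundedMeasurable.
Context {R : realType} {d} {T : measurableType d}.
Implicit Types (f g : T -> R).

(** The bound holds everywhere, so the class does not depend on a measure: it passes unchanged to
    products, image laws and smaller sigma-algebras, and integrability against any probability is
    automatic. *)
Definition bmeas f :=
  measT f /\ exists M, forall x, `|f x| <= M.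

Lemma bmeas_cst (k : R) : bmeas (fun=> k).
Proof. by split; [exact: measurable_cst | exists `|k|]. Qed.

Lemma bmeasD f g : bmeas f -> bmeas g -> bmeas (fun x => f x + g x).
Proof.
move=> [mf [M hM]] [mg [N hN]]; split; first exact: measurable_funD.
by exists (M + N) => x; apply: (le_trans (ler_normD _ _)); apply: lerD.
Qed.

Lemma bmeasM f g : bmeas f -> bmeas g -> bmeas (fun x => f x * g x).
Proof.
move=> [mf [M hM]] [mg [N hN]]; split; first exact: measurable_funM.
by exists (M * N) => x; rewrite normrM; apply: ler_pM.
Qed.

Lemma bmeasN f : bmeas f -> bmeas (fun x => - f x).
Proof.
move=> [mf [M hM]]; split; first exact: measurableT_comp.
by exists M => x; rewrite normrN.
Qed.

Lemma bmeasB f g : bmeas f -> bmeas g -> bmeas (fun x => f x - g x).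
Proof. by move=> hf hg; apply: bmeasD => //; exact: bmeasN. Qed.

Lemma bmeas_bool (b : T -> bool) : measT b ->
  bmeas (fun x => (b x)%:R).
Proof.
move=> mb; split; last by exists 1 => x; case: (b x) => /=; rewrite ?normr1 ?normr0.
have -> : (fun x => (b x)%:R) = (fun x => if b x then 1 else 0 : R).
  by apply/funext => x; case: (b x).
by apply: measurable_fun_ifT => //; exact: measurable_cst.
Qed.

Lemma bmeas_indic (A : set T) : measurable A -> bmeas (\1_A : T -> R).
Proof.
move=> mA; split; first exact: measurable_indic.
by exists 1 => x; rewrite indicE; case: (x \in A) => /=; rewrite ?normr1 ?normr0.
Qed.

Lemma bmeas_sum (I : Type) (s : seq I) (P : pred I) (F : I -> T -> R) :
  (forall i, P i -> bmeas (F i)) -> bmeas (fun x => \sum_(i <- s | P i) F i x).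
Proof.
move=> h; elim: s => [|i s IH].
  by under eq_fun do rewrite big_nil; exact: bmeas_cst.
under eq_fun do rewrite big_cons.
by case: (boolP (P i)) => // Pi; apply: bmeasD => //; exact: h.
Qed.

Lemma bmeas_prod (I : Type) (s : seq I) (P : pred I) (F : I -> T -> R) :
  (forall i, P i -> bmeas (F i)) -> bmeas (fun x => \prod_(i <- s | P i) F i x).
Proof.
move=> h; elim: s => [|i s IH].
  by under eq_fun do rewrite big_nil; exact: bmeas_cst.
under eq_fun do rewrite big_cons.
by case: (boolP (P i)) => // Pi; apply: bmeasM => //; exact: h.
Qed.

Lemma bmeas_integrable (P : probability T R) f : bmeas f ->
  P.-integrable setT (EFin \o f).
Proof.
move=> [mf [M hM]]; apply: measurable_bounded_integrable => //.
  by apply: (le_lt_trans (probability_le1 P measurableT)); rewrite ltry.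
exists `|M|; split; first exact: num_real.
by move=> x Mx y _ /=; apply: (le_trans (hM y)); apply: (le_trans (ler_norm M)); exact: ltW.
Qed.

Lemma RintegralZl_prob (P : probability T R) (k : R) f : bmeas f ->
  intT P (fun x => k * f x) = k * intT P f.
Proof. by move=> bf; rewrite RintegralZl//; exact: bmeas_integrable. Qed.

Lemma Rintegral_prob_cst (P : probability T R) (k : R) :
  intT P (fun=> k) = k.
Proof. by rewrite Rintegral_cst//= probability_setT mulr1. Qed.

Lemma RintegralD_prob (P : probability T R) f g : bmeas f -> bmeas g ->
  intT P (fun x => f x + g x) = intT P f + intT P g.
Proof. by move=> bf bg; rewrite RintegralD//; exact: bmeas_integrable. Qed.

Lemma RintegralB_prob (P : probability T R) f g : bmeas f -> bmeas g ->
  intT P (fun x => f x - g x) = intT P f - intT P g.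
Proof. by move=> bf bg; rewrite RintegralB//; exact: bmeas_integrable. Qed.

Lemma Rintegral_sum_prob (P : probability T R) (I : Type) (s : seq I)
  (F : I -> T -> R) : (forall i, bmeas (F i)) ->
  intT P (fun x => \sum_(i <- s) F i x) =
  \sum_(i <- s) intT P (F i).
Proof.
move=> h; elim: s => [|i s IH].
  by rewrite big_nil; under eq_Rintegral do rewrite big_nil; rewrite Rintegral_prob_cst.
rewrite big_cons -IH -RintegralD_prob//; last exact: bmeas_sum.
by apply: eq_Rintegral => x _; rewrite big_cons.
Qed.

Lemma le_Rintegral_prob (P : probability T R) f g : bmeas f -> bmeas g ->
  (forall x, f x <= g x) -> intT P f <= intT P g.
Proof. by move=> bf bg h; apply: le_Rintegral => //; exact: bmeas_integrable. Qed.

Lemma normr_Rintegral_prob (P : probability T R) f M : bmeas f -> (forall x, `|f x| <= M) ->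
  `|intT P f| <= M.
Proof.
move=> bf fM; apply: (le_trans (le_normr_Rintegral measurableT (bmeas_integrable P bf))).
rewrite -[leRHS](Rintegral_prob_cst P M); apply: le_Rintegral_prob => //; last exact: bmeas_cst.
by split; [apply: measurableT_comp => //; case: bf | exists M => w; rewrite normr_id].
Qed.

Lemma Rintegral_indic_prob (P : probability T R) (A : set T) : measurable A ->
  intT P (\1_A) = fine (P A).
Proof. by move=> mA; rewrite /Rintegral integral_indic// setIT. Qed.

Lemma EFin_Rintegral_prob (P : probability T R) f : bmeas f ->
  (intT P f)%:E = (\int[P]_x (f x)%:E)%E.
Proof.
move=> bf; rewrite /Rintegral fineK//.
by apply: (integrable_fin_num measurableT); exact: (bmeas_integrable P bf).
Qed.

End BoundedMeasurable.

Lemma bmeas_comp {R : realType} {d1 d2} {T1 : measurableType d1}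
  {T2 : measurableType d2} (f : T2 -> R) (X : T1 -> T2) :
  measT X -> bmeas f -> bmeas (f \o X).
Proof.
move=> mX [mf [M hM]]; split; first exact: measurableT_comp.
by exists M => x /=.
Qed.

Section ProductFubini.
Context {R : realType} {d1 d2} {T1 : measurableType d1} {T2 : measurableType d2}
  (P1 : probability T1 R) (P2 : probability T2 R) (f : T1 * T2 -> R).
Hypothesis bf : bmeas f.

Lemma prob_fubini :
  [/\ bmeas (fun x => intT P2 (fun y => f (x, y))), bmeas (fun y => intT P1 (fun x => f (x, y))),
      Rintegral (P1 \x P2)%E setT f = intT P1 (fun x => intT P2 (fun y => f (x, y))) &
      Rintegral (P1 \x P2)%E setT f = intT P2 (fun y => intT P1 (fun x => f (x, y)))].
Proof.
have [mf [M hM]] := bf.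
have b1 x : bmeas (fun y => f (x, y)) by split; [exact: measurable_fun_pair2 | exists M].
have b2 y : bmeas (fun x => f (x, y)) by split; [exact: measurable_fun_pair1 | exists M].
have if_ : (P1 \x P2)%E.-integrable setT (EFin \o f).
  exact: (bmeas_integrable (P1 \x P2)%E bf).
have e1 x : fubini_F P2 (EFin \o f) x = (intT P2 (fun y => f (x, y)))%:E.
  by rewrite /fubini_F /= EFin_Rintegral_prob.
have e2 y : fubini_G P1 (EFin \o f) y = (intT P1 (fun x => f (x, y)))%:E.
  by rewrite /fubini_G /= EFin_Rintegral_prob.
have B1 : bmeas (fun x => intT P2 (fun y => f (x, y))).
  split; last by exists M => x; exact: normr_Rintegral_prob.
  by apply/measurable_EFinP; have := measurable_fubini_F if_; congr measurable_fun; apply/funext.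
have B2 : bmeas (fun y => intT P1 (fun x => f (x, y))).
  split; last by exists M => y; exact: normr_Rintegral_prob.
  by apply/measurable_EFinP; have := measurable_fubini_G if_; congr measurable_fun; apply/funext.
split => //; apply: EFin_inj; rewrite !EFin_Rintegral_prob//.
  by rewrite -integral12_prod_meas1//; apply: eq_integral => x _; exact: e1.
by rewrite -integral21_prod_meas1//; apply: eq_integral => x _; exact: e2.
Qed.

Lemma Rintegral_prod :
  Rintegral (P1 \x P2)%E setT f = intT P1 (fun x => intT P2 (fun y => f (x, y))).
Proof. by case: prob_fubini. Qed.

Lemma Rintegral_exchange :
  intT P1 (fun x => intT P2 (fun y => f (x, y))) = intT P2 (fun y => intT P1 (fun x => f (x, y))).
Proof. by have [_ _ <- <-] := prob_fubini. Qed.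

End ProductFubini.

Section IndependentFubini.
Context {R : realType} {d d1 d2 : measure_display} {T : measurableType d}
  {T1 : measurableType d1} {T2 : measurableType d2} (P : probability T R).
Variables (X : T -> T1) (Y : T -> T2).
Hypotheses (mX : measT X) (mY : measT Y).
Hypothesis indepXY : forall A B, measurable A -> measurable B ->
  P (X @^-1` A `&` Y @^-1` B) = (P (X @^-1` A) * P (Y @^-1` B))%E.

Let XY w := (X w, Y w).
Let mXY : measT XY.
Proof. exact: measurable_fun_pair. Qed.

HB.instance Definition _ := isMeasurableFun.Build _ _ _ _ X mX.
HB.instance Definition _ := isMeasurableFun.Build _ _ _ _ Y mY.
HB.instance Definition _ := isMeasurableFun.Build _ _ _ _ XY mXY.

Let PX : probability T1 R := distribution P X.
Let PY : probability T2 R := distribution P Y.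
Let PXY : probability (T1 * T2)%type R := distribution P XY.

Let PXYE (A : set (T1 * T2)) : measurable A -> (PX \x PY)%E A = PXY A.
Proof.
move=> mA; apply: product_measure_unique => // B C mB mC.
Qed.

(** Freezing of [X]: by independence the law of the pair agrees with the product of the two laws on
    rectangles, hence on all measurable sets, and Fubini applies to the product. *)
Lemma indep_fubini (f : T1 * T2 -> R) : bmeas f ->
  bmeas (fun x => intT P (fun w => f (x, Y w))) /\
  intT P (fun w => f (X w, Y w)) =
  intT P (fun w => intT P (fun w' => f (X w, Y w'))).
Proof.
move=> bf; have [mf [M hM]] := bf.
have bfy x : bmeas (fun w => f (x, Y w)).
  by split; [exact: (measurableT_comp (measurable_fun_pair2 x mf) mY) | exists M].
have innerE x : intT P (fun w => f (x, Y w)) =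
    intT PY (fun y => f (x, y)).
  rewrite /Rintegral integral_pushforward//.
    by apply/measurable_EFinP; exact: (measurable_fun_pair2 x mf).
  exact: (bmeas_integrable P (bfy x)).
have [bin _ e _] := prob_fubini PX PY bf.
have {}bin : bmeas (fun x => intT P (fun w => f (x, Y w))).
  by move: bin; congr bmeas; apply/funext => x; rewrite innerE.
split => //.
have b1 : bmeas (fun w => f (X w, Y w)) by exact: (bmeas_comp mXY bf).
have b2 : bmeas (fun w => intT P (fun w' => f (X w, Y w'))) by exact: (bmeas_comp mX bin).
transitivity (intT PXY f).
  rewrite /Rintegral integral_pushforward//; first by apply/measurable_EFinP.
  exact: (bmeas_integrable P b1).
transitivity (Rintegral (PX \x PY)%E setT f).
  by congr fine; apply: eq_measure_integral => A mA _; exact: esym (PXYE mA).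
rewrite e; transitivity (intT PX (fun x => intT P (fun w => f (x, Y w)))).
  by apply: eq_Rintegral => x _; rewrite innerE.
rewrite /Rintegral integral_pushforward//; first by apply/measurable_EFinP; case: bin.
exact: (bmeas_integrable P b2).
Qed.

End IndependentFubini.

(** * Independence of groups of variables taken from one independent family *)

Section FamilySigmaAlgebra.
Context {R : realType} {d} {T : measurableType d}
  (P : probability T R) (I : eqType) (E : I -> set (set T)).
Implicit Types J : pred I.

Definition cylinders J : set (set T) :=
  [set A | exists s : seq I, exists F : I -> set T,
    [/\ uniq s, {subset s <= J}, (forall i, i \in s -> E i (F i)) &
        A = \bigcap_(i in [set` s]) F i]].

(** The same sample space with the smaller sigma-algebra generated by the members of the family with
    index in [J]. A function measurable on [fam_space J] is one that depends on these members only,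
    so dependence is tracked by types instead of coordinate maps. *)
Definition fam_space J := g_sigma_algebraType (cylinders J).

Hypothesis E_T : forall i, E i setT.
Hypothesis E_I : forall i, setI_closed (E i).
Hypothesis E_meas : forall i A, E i A -> measurable A.
Hypothesis E_indep : mutually_indep P E.

Lemma cylindersT J : cylinders J setT.
Proof.
exists [::], (fun=> setT); split => //.
by apply/seteqP; split.
Qed.

Lemma cylinders_meas J : cylinders J `<=` measurable.
Proof.
move=> _ [s [F [us sJ EF ->]]]; elim: s {us sJ} EF => [|i s IH] EF.
  by rewrite (_ : \bigcap_(_ in _) _ = setT)//; apply/seteqP; split.
have -> : \bigcap_(j in [set` i :: s]) F j = F i `&` \bigcap_(j in [set` s]) F j.
  apply/seteqP; split => [x h|x [h1 h2] j /=].
    split=> [|j js]; apply: h => /=; first exact: mem_head.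
    by rewrite inE js orbT.
  by rewrite inE => /orP[/eqP ->//|]; exact: h2.
apply: measurableI; first by apply: (@E_meas i); apply: EF; exact: mem_head.
by apply: IH => j js; apply: EF; rewrite inE js orbT.
Qed.

Lemma cylinders_setI J : setI_closed (cylinders J).
Proof.
move=> _ _ [s1 [F1 [us1 s1J EF1 ->]]] [s2 [F2 [us2 s2J EF2 ->]]].
exists (undup (s1 ++ s2)), (fun i => (if i \in s1 then F1 i else setT) `&`
                                     (if i \in s2 then F2 i else setT)); split.
- exact: undup_uniq.
- by move=> i; rewrite mem_undup mem_cat => /orP[/s1J|/s2J].
- by move=> i _; apply: E_I; [case: ifP => [/EF1|] | case: ifP => [/EF2|]].
apply/seteqP; split => [x [h1 h2] i /= _|x h].
  by split; case: ifP => // si; [exact: h1 | exact: h2].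
split=> i /= si; have := h i; rewrite /= mem_undup mem_cat si ?orbT => /(_ isT);
  by case.
Qed.

Lemma fam_measurable J (A : set T) :
  measurable (A : set (fam_space J)) -> measurable A.
Proof.
apply: smallest_sub; first exact: sigma_algebra_measurable.
exact: cylinders_meas.
Qed.

Lemma fam_gen J i (A : set T) : J i -> E i A ->
  measurable (A : set (fam_space J)).
Proof.
move=> Ji EA; apply: sub_sigma_algebra; exists [:: i], (fun=> A); split => //.
- by move=> j; rewrite inE => /eqP ->.
- by move=> j; rewrite inE => /eqP ->.
apply/seteqP; split => [x Ax j //|x h]; apply: (h i).
by rewrite /= mem_seq1.
Qed.

Lemma fam_id J : measT (id : T -> fam_space J).
Proof. by move=> _ A mA; rewrite setTI; exact: (fam_measurable mA). Qed.

Lemma fam_meas_fun J {d'} {T' : measurableType d'} (f : T -> T') :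
  measT (f : fam_space J -> T') -> measT f.
Proof. by move=> mf; exact: (measurableT_comp mf (@fam_id J)). Qed.

Lemma fam_bmeas J (f : T -> R) :
  bmeas (f : fam_space J -> R) -> bmeas (f : T -> R).
Proof. by move=> [mf hf]; split => //; exact: fam_meas_fun mf. Qed.

Lemma fam_sub J J' {d'} {T' : measurableType d'} (f : T -> T') :
  {subset J <= J'} ->
  measT (f : fam_space J -> T') ->
  measT (f : fam_space J' -> T').
Proof.
move=> JJ' mf _ A mA; have := mf measurableT A mA; rewrite setTI.
apply: sub_sigma_algebra2 => _ [s [F [us sJ EF ->]]].
by exists s, F; split => // i /sJ; exact: JJ'.
Qed.

Lemma cylinders_indep J1 J2 A B : (forall i, J1 i -> J2 i -> False) ->
  cylinders J1 A -> cylinders J2 B -> P (A `&` B) = (P A * P B)%E.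
Proof.
move=> dis [s1 [F1 [us1 s1J EF1 ->]]] [s2 [F2 [us2 s2J EF2 ->]]].
pose F i := if i \in s1 then F1 i else F2 i.
have s12 i : i \in s1 -> i \in s2 -> False by move=> /s1J h1 /s2J; exact: dis.
have -> : \bigcap_(i in [set` s1]) F1 i `&` \bigcap_(i in [set` s2]) F2 i =
    \bigcap_(i in [set` s1 ++ s2]) F i.
  apply/seteqP; split => [x [h1 h2] i /=|x h].
    rewrite mem_cat /F => /orP[si|si]; first by rewrite si; exact: h1.
    by case: ifP => si1; [case: (s12 i) | exact: h2].
  split => i /= si; have := h i; rewrite /= mem_cat si ?orbT /F => /(_ isT).
    by rewrite si.
  by case: ifP => // si1; case: (s12 i).
rewrite !E_indep//.
- rewrite big_cat /=; congr (_ * _)%E; rewrite big_seq [RHS]big_seq;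
    apply: eq_bigr => i si; rewrite /F ?si//.
  by case: ifP => // si1; case: (s12 i).
- rewrite cat_uniq us1 us2 andbT /=; apply/hasPn => i si; apply/negP => si1.
  exact: (s12 i).
- move=> i; rewrite mem_cat /F; case: ifP => [si _|_ /= si]; first exact: EF1.
  exact: EF2.
Qed.

Lemma fam_indep J1 J2 (A B : set T) : (forall i, J1 i -> J2 i -> False) ->
  measurable (A : set (fam_space J1)) -> measurable (B : set (fam_space J2)) ->
  P (A `&` B) = (P A * P B)%E.
Proof.
move=> dis mA mB.
have fin A' : measurable A' -> (P A' < +oo)%E.
  by move=> mA'; apply: (le_lt_trans (probability_le1 P mA')); rewrite ltry.
(* One factor is extended at a time: for fixed [C], both sides are finite measures in the other set,
   and they agree on the pi-system of cylinders. *)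
have step (J : pred I) (C : set T) : measurable C ->
    (forall A', cylinders J A' -> P (A' `&` C) = (P A' * P C)%E) ->
    forall A', measurable (A' : set (fam_space J)) -> P (A' `&` C) = (P A' * P C)%E.
  move=> mC h A' mA'.
  have PC0 : 0 <= fine (P C) by rewrite fine_ge0.
  have PCE : P C = (fine (P C))%:E by rewrite fineK// ge0_fin_numE// fin.
  pose m1 := mrestr P mC; pose m2 := mscale (NngNum PC0) P.
  have e2 X : m2 X = (P X * P C)%E by rewrite /m2 /mscale /= -PCE muleC.
  rewrite -e2; change (m1 A' = m2 A').
  apply: (@g_sigma_algebra_measure_unique _ R T (cylinders J) _ (fun=> setT)) => //.
  - exact: cylinders_meas.
  - by move=> _; exact: cylindersT.
  - by rewrite bigcup_const.
  - exact: cylinders_setI.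
  - by move=> X hX; change (m1 X = m2 X); rewrite e2 /m1 /mrestr h.
  - by move=> _; rewrite /= /mrestr setTI fin.
apply: (@step J1) => //; first exact: fam_measurable mB.
move=> A' cA'; rewrite setIC muleC; apply: (@step J2) => //.
  exact: (cylinders_meas cA').
by move=> B' cB'; rewrite setIC muleC; exact: cylinders_indep cA' cB'.
Qed.

(** The independent second variable is the sample point itself, seen in [fam_space J2]; [f] may thus
    involve all the variables of [J2] at once. *)
Lemma fam_fubini J1 J2 {d1} {T1 : measurableType d1} (X : T -> T1)
    (f : T1 * fam_space J2 -> R) :
  (forall i, J1 i -> J2 i -> False) ->
  measT (X : fam_space J1 -> T1) -> bmeas f ->
  bmeas (fun x => intT P (fun w => f (x, w))) /\
  intT P (fun w => f (X w, w)) =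
  intT P (fun w => intT P (fun w' => f (X w, w'))).
Proof.
move=> dis mX bf.
apply: (@indep_fubini R _ _ _ T T1 (fam_space J2) P X id) => //.
- exact: fam_meas_fun mX.
- exact: fam_id.
- move=> A B mA mB; apply: (fam_indep dis) => //.
  by have := mX measurableT A mA; rewrite setTI.
Qed.

Lemma fam_expectM J1 J2 (f g : T -> R) : (forall i, J1 i -> J2 i -> False) ->
  bmeas (f : fam_space J1 -> R) -> bmeas (g : fam_space J2 -> R) ->
  intT P (fun w => f w * g w) =
  intT P f * intT P g.
Proof.
move=> dis bf bg.
have bF : bmeas (fun z : fam_space J1 * fam_space J2 => f z.1 * g z.2).
  apply: bmeasM; [exact: (bmeas_comp (@measurable_fst _ _ _ _) bf)
                 |exact: (bmeas_comp (@measurable_snd _ _ _ _) bg)].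
have [_ /= ->] := @fam_fubini J1 J2 _ _ (id : T -> fam_space J1)
  (fun z => f z.1 * g z.2) dis (@measurable_id _ _ _) bF.
have bf' := fam_bmeas bf; have bg' := fam_bmeas bg.
under eq_Rintegral => w _ do rewrite (RintegralZl_prob P (f w) bg') mulrC.
by rewrite (RintegralZl_prob P _ bf') mulrC.
Qed.

End FamilySigmaAlgebra.

(** * Integrals of functions whose measurability is unknown *)

Section NonMeasurable.
Context {R : realType} {d} {T : measurableType d}.
Import HBNNSimple.

(** The integral of a nonnegative function is a supremum over the simple functions below it, hence
    monotone for arbitrary functions. *)
Lemma ge0_le_integral_nonmeas (mu : {measure set T -> \bar R}) (f g : T -> \bar R) :
  (forall x, 0 <= f x)%E -> (forall x, f x <= g x)%E ->
  (\int[mu]_x f x <= \int[mu]_x g x)%E.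
Proof.
move=> f0 fg; have g0 x : (0 <= g x)%E by exact: le_trans (fg x).
rewrite !ge0_integralTE//; apply: ereal_sup_le => _ [h hf <-].
by exists h => // x; exact: le_trans (fg x).
Qed.

(** A simple function below [f], cut to the conull set [A], keeps its integral and lies below [g]
    everywhere. *)
Lemma conull_le_integral (mu : {measure set T -> \bar R}) (A : set T)
    (f g : T -> \bar R) :
  measurable A -> mu (~` A) = 0%E -> (forall x, 0 <= f x)%E ->
  (forall x, 0 <= g x)%E -> (forall x, A x -> f x <= g x)%E ->
  (\int[mu]_x f x <= \int[mu]_x g x)%E.
Proof.
move=> mA muA f0 g0 fg; rewrite [X in (X <= _)%E]ge0_integralTE//.
apply: ge_ereal_sup => _ [h hf <-]; rewrite -integralT_nnsfun.
have -> : (\int[mu]_x (h x)%:E = \int[mu]_x ((fun x => (h x)%:E) \_ A) x)%E.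
  apply: ae_eq_integral => //.
  - by apply/measurable_EFinP.
  - apply/(measurable_restrictT _ mA); apply/measurable_EFinP.
    exact: measurable_funTS.
  exists (~` A); split => //; first exact: measurableC.
  move=> x /= /not_implyP[_ hx] Ax; apply: hx.
  by rewrite patchE mem_set.
apply: ge0_le_integral_nonmeas => x; rewrite patchE; case: ifPn => // xA.
- by rewrite lee_fin.
- by apply: (le_trans (hf x)); apply: fg; exact: set_mem.
Qed.

Lemma conull_eq_integral (mu : {measure set T -> \bar R}) (A : set T)
    (f g : T -> \bar R) :
  measurable A -> mu (~` A) = 0%E -> (forall x, 0 <= f x)%E ->
  (forall x, 0 <= g x)%E -> (forall x, A x -> f x = g x)%E ->
  (\int[mu]_x f x = \int[mu]_x g x)%E.
Proof.
move=> mA muA f0 g0 fg; apply/eqP; rewrite eq_le; apply/andP.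
by split; apply: (conull_le_integral mA) => // x Ax; rewrite fg.
Qed.

(** Monotonicity is applied to the positive and the negative parts. The bounds keep both integrals
    finite; for an infinite one [fine] would return 0 and break the comparison. *)
Lemma le_Rintegral_nonmeas (P : probability T R) (f g : T -> R) :
  (exists M, forall x, `|f x| <= M) -> (exists M, forall x, `|g x| <= M) ->
  (forall x, f x <= g x) -> intT P f <= intT P g.
Proof.
move=> [M1 fM1] [M2 gM2] fg; rewrite /Rintegral; set M := Num.max M1 M2.
have fM x : `|f x| <= M by rewrite le_max fM1.
have gM x : `|g x| <= M by rewrite le_max gM2 orbT.
have fin (h : T -> \bar R) : (forall x, 0 <= h x)%E -> (forall x, h x <= M%:E)%E ->
    (\int[P]_x h x)%E \is a fin_num.
  move=> h0 hM; rewrite ge0_fin_numE ?integral_ge0//.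
  apply: (@le_lt_trans _ _ (\int[P]_x (cst M%:E x))%E).
    exact: ge0_le_integral_nonmeas.
  by rewrite integral_cst//= probability_setT mule1 ltry.
have pos (h : T -> R) x : (forall x, `|h x| <= M) ->
    ((fun x => (h x)%:E)^\+ x <= M%:E)%E.
  move=> hM; rewrite funeposE -EFin_max lee_fin ge_max (le_trans (ler_norm _) (hM x)).
  by rewrite (le_trans _ (hM x)).
have neg (h : T -> R) x : (forall x, `|h x| <= M) ->
    ((fun x => (h x)%:E)^\- x <= M%:E)%E.
  move=> hM; rewrite funenegE -EFinN -EFin_max lee_fin ge_max.
  by rewrite (le_trans (ler_norm _)) ?normrN//= (le_trans _ (hM x)).
rewrite integralE [X in _ <= fine X]integralE fine_le//.
- by rewrite fin_numB !fin// => x; do [exact: (pos f)|exact: (neg f)].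
- by rewrite fin_numB !fin// => x; do [exact: (pos g)|exact: (neg g)].
apply: leeB; apply: ge0_le_integral_nonmeas => // x.
- by rewrite !funeposE -!EFin_max lee_fin le_max2.
- by rewrite !funenegE -!EFinN -!EFin_max lee_fin le_max2// lerN2.
Qed.

Lemma Rintegral_near_nonmeas (P : probability T R) (Phi S E : T -> R) :
  bmeas S -> bmeas E -> (exists M, forall w, `|Phi w| <= M) ->
  (forall w, `|Phi w - S w| <= E w) -> `|intT P Phi - intT P S| <= intT P E.
Proof.
move=> bS bE PM PS.
have up : intT P Phi <= intT P (fun w => S w + E w).
  apply: le_Rintegral_nonmeas => // [|w]; first exact: (bmeasD bS bE).2.
  by have := PS w; rewrite ler_norml; lra.
have lo : intT P (fun w => S w - E w) <= intT P Phi.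
  apply: le_Rintegral_nonmeas => // [|w]; first exact: (bmeasB bS bE).2.
  by have := PS w; rewrite ler_norml; lra.
by move: up lo; rewrite RintegralD_prob// RintegralB_prob// ler_norml; lra.
Qed.

End NonMeasurable.

(** * Measures with a density, and laws given by their tails *)

Section Density.
Context {R : realType} {d} {T : measurableType d}
  (m : {measure set T -> \bar R}) (h : T -> R).
Hypotheses (h0 : forall x, 0 <= h x) (mh : measT h).

Definition density (A : set T) : \bar R := (\int[m]_(x in A) (h x)%:E)%E.

Let density0 : density set0 = 0%E. Proof. exact: integral_set0. Qed.

Let density_ge0 A : (0 <= density A)%E.
Proof. by apply: integral_ge0 => x _; rewrite lee_fin. Qed.

Let density_sigma_additive : semi_sigma_additive density.
Proof.
move=> F mF tF mUF; rewrite /density ge0_integral_bigcup//.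
- apply: is_cvg_ereal_nneg_natsum_cond => n _ _.
  by apply: integral_ge0 => x _; rewrite lee_fin.
- by apply/measurable_EFinP; exact: measurable_funTS.
- by move=> x _; rewrite lee_fin.
Qed.

HB.instance Definition _ := isMeasure.Build _ _ _ density
  density0 density_ge0 density_sigma_additive.

Definition density_measure : {measure set T -> \bar R} := density.

Import HBNNSimple.

Lemma integral_density (f : T -> \bar R) : (forall x, 0 <= f x)%E ->
  measT f ->
  (\int[density]_x f x = \int[m]_x (f x * (h x)%:E))%E.
Proof.
move=> f0 mf; pose g := nnsfun_approx measurableT mf.
have ndg x : nondecreasing_seq (g^~ x).
  by move=> i j ij; exact/lefP/nd_nnsfun_approx.
have mg n : measT (EFin \o g n).
  by apply/measurable_EFinP; exact/measurable_funP.
have fE x : f x = limn (fun n => (g n x)%:E).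
  by apply/esym/cvg_lim => //; exact: cvg_nnsfun_approx.
have fhE x : (f x * (h x)%:E)%E = limn (fun n => (g n x)%:E * (h x)%:E)%E.
  by apply/esym/cvg_lim => //; apply: cvgeZr => //; exact: cvg_nnsfun_approx.
under [RHS]eq_integral do rewrite fhE.
rewrite [LHS](_ : _ = \int[density]_x limn (fun n => (g n x)%:E))%E; last first.
  by apply: eq_integral => x _; rewrite -fE.
have hE : measT (EFin \o h) by exact/measurable_EFinP.
rewrite monotone_convergence//; first last.
- by move=> x _ i j ij; rewrite lee_fin; exact: ndg.
- by move=> n x _; rewrite lee_fin.
rewrite monotone_convergence//; first last.
- by move=> x _ i j ij; rewrite lee_wpmul2r ?lee_fin//; exact: ndg.
- by move=> n x _; rewrite mule_ge0 ?lee_fin.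
- by move=> n; exact: (emeasurable_funM (mg n) hE).
congr (limn _); apply/funext => n.
have mi y : measT (fun x => (y * \1_(g n @^-1` [set y]) x)%:E).
  by apply/measurable_EFinP; exact: measurable_funM.
transitivity (\int[density]_x
   (\sum_(y \in range (g n)) (y * \1_(g n @^-1` [set y]) x)%:E))%E.
  by apply: eq_integral => t _; rewrite /= fimfunE -fsumEFin.
rewrite ge0_integral_fsum//; last by move=> y x _; exact: nnfun_muleindic_ge0.
transitivity (\int[m]_x (\sum_(y \in range (g n))
    (y * \1_(g n @^-1` [set y]) x)%:E * (h x)%:E))%E; last first.
  apply: eq_integral => x _.
  rewrite -ge0_mule_fsuml => [|y]; last exact: nnfun_muleindic_ge0.
  by rewrite fsumEFin // -(fimfunE _ x).
rewrite ge0_integral_fsum//; first last.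
- by move=> y x _; rewrite mule_ge0 ?lee_fin//; exact: nnfun_muleindic_ge0.
- by move=> y; exact: emeasurable_funM.
apply: eq_fsbigr => y /[!inE] -[x _ yE].
have y0 : 0 <= y by rewrite -yE.
have mA : measurable (g n @^-1` [set y]) by [].
under eq_integral do rewrite EFinM.
rewrite ge0_integralZl//; last by apply/measurable_EFinP.
rewrite integral_indic// setIT.
under [RHS]eq_integral do rewrite EFinM -muleA.
rewrite [RHS]ge0_integralZl//; first last.
- by move=> z _; rewrite mule_ge0 ?lee_fin.
- by apply: emeasurable_funM => //; apply/measurable_EFinP.
congr (_ * _)%E; transitivity (\int[m]_(x in g n @^-1` [set y]) (h x)%:E)%E => //.
rewrite integral_mkcond; apply: eq_integral => z _.
by rewrite patchE indicE; case: ifPn; rewrite ?mul1e ?mul0e.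
Qed.

End Density.

Section LawByTail.
Context {R : realType} {d} {T : measurableType d}.
Local Notation leb := (@lebesgue_measure R).

Lemma FTC2_interval (F F' : R -> R) (a b : R) : a < b ->
  (forall x : R, a <= x <= b -> is_derive x 1 F (F' x)) ->
  (forall x : R, a <= x <= b -> {for x, continuous F'}) ->
  (\int[leb]_(x in `[a, b]) (F' x)%:E = (F b - F a)%:E)%E.
Proof.
move=> ab dF cF'.
have cF (x : R) : a <= x <= b -> {for x, continuous F}.
  by move=> /dF dx; apply/differentiable_continuous/derivable1_diffP; case: dx.
rewrite (@continuous_FTC2 _ F' F)//=.
- by apply: continuous_in_subspaceT => x; rewrite inE /= in_itv /=; exact: cF'.
- split=> [x| |].
  + by rewrite in_itv /= => /andP[ax xb]; case: (dF x); rewrite ?(ltW ax) ?(ltW xb).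
  + by apply: cvg_at_right_filter; apply: cF; rewrite lexx ltW.
  + by apply: cvg_at_left_filter; apply: cF; rewrite lexx ltW.
- move=> x; rewrite in_itv /= => /andP[ax xb]; rewrite derive1E.
  by case: (dF x); rewrite ?(ltW ax) ?(ltW xb).
Qed.

Lemma FTC2_interval_oc (F F' : R -> R) (a b : R) : a < b ->
  (forall x : R, a <= x <= b -> is_derive x 1 F (F' x)) ->
  (forall x : R, a <= x <= b -> {for x, continuous F'}) ->
  (\int[leb]_(x in `]a, b]) (F' x)%:E = (F b - F a)%:E)%E.
Proof.
move=> ab dF cF'; rewrite integral_itv_obnd_cbnd ?(FTC2_interval ab dF cF')//.
apply: (@measurable_funS _ _ _ _ `[a, b]%classic) => //.
  by move=> x; rewrite /= !in_itv /= => /andP[/ltW -> ->].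
apply/measurable_EFinP; apply: subspace_continuous_measurable_fun => //.
by apply: continuous_in_subspaceT => x; rewrite inE /= in_itv /=; exact: cF'.
Qed.

(** The law of [X] restricted to []x0, K]] and the measure with density [h] there agree on rays, by
    the tail formula and the fundamental theorem of calculus, hence on all Borel sets. The tail is
    known only beyond [x0], which is why the statement is confined to an interval. *)
Lemma law_interval (P : probability T R) (X : T -> R) (x0 K : R) (G h f : R -> R) :
  measT X ->
  (forall x : R, x0 <= x -> is_derive x 1 G (- h x)) ->
  (forall x : R, x0 <= x -> {for x, continuous h}) ->
  (forall x, x0 <= x -> 0 <= h x) ->
  (forall x, x0 <= x -> P [set w | x < X w] = (G x)%:E) ->
  bmeas f ->
  leb.-integrable `]x0, K] (EFin \o (fun x => f x * h x)) /\
  intT P (fun w => f (X w) * (x0 < X w <= K)%R%:R) =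
  Rintegral leb `]x0, K] (fun x => f x * h x).
Proof.
move=> mX dG ch h0 PG bf; have [mf [M fM]] := bf.
have M0 : 0 <= M by apply: le_trans (fM 0).
pose I := `]x0, K]%classic : set R.
have mI : measurable I by exact: measurable_itv.
have mhI : measurable_fun I h.
  apply: (@measurable_funS _ _ _ _ `]x0, +oo[%classic) => //.
    by move=> y; rewrite /= !in_itv /= andbT => /andP[].
  apply: open_continuous_measurable_fun; first exact: interval_open.
  by move=> x; rewrite inE /= in_itv /= andbT => /ltW; exact: ch.
have hI x : I x -> 0 <= h x by rewrite /I /= in_itv /= => /andP[/ltW xx _]; exact: h0.
have mXp A : measurable A -> measurable (X @^-1` A).
  by move=> mA; rewrite -[Y in measurable Y]setTI; exact: mX.
pose h' := h \_ I; pose b w : R := \1_(X @^-1` I) w.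
have h'0 x : 0 <= h' x by rewrite /h' patchE; case: ifPn => // /set_mem; exact: hI.
have mh' : measT h' by exact/(measurable_restrictT _ mI).
have b0 w : 0 <= b w by rewrite /b indicE.
have bb : bmeas b by apply: bmeas_indic; exact: mXp.
have mb := bb.1.
have bE w : b w = (x0 < X w <= K)%R%:R.
  by rewrite /b indicE; congr (nat_of_bool _)%:R; apply/idP/idP; rewrite inE /I /= in_itv.
pose m1 : {measure set (measurableTypeR R) -> \bar R} :=
  measure_function_pushforward__canonical__measure_function_Measure
    (density_measure P b0 mb)
    (mX : measT (X : T -> measurableTypeR R)).
pose m2 : {measure set (measurableTypeR R) -> \bar R} := density_measure leb h'0 mh'.
have m1E A : measurable A -> m1 A = P (X @^-1` (A `&` I)).
  move=> mA; rewrite /m1 /= /pushforward /density /b integral_indic//; [|exact: mXp..].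
  by rewrite -preimage_setI setIC.
have m2E A : measurable A -> m2 A = (\int[leb]_(x in A `&` I) (h x)%:E)%E.
  move=> mA; rewrite /m2 /= /density integral_mkcondr; apply: eq_integral => x _.
  by rewrite /h' !patchE; case: ifP.
have ray x : m1 `]x, +oo[%classic = m2 `]x, +oo[%classic.
  rewrite m1E// m2E//; set y := Num.max x x0.
  have -> : `]x, +oo[%classic `&` I = `]y, K]%classic.
    apply/seteqP; split => z; rewrite /I /= !in_itv /= andbT gt_max; first by case=> -> /andP[-> ->].
    by case/andP => /andP[-> ->] ->.
  have x0y : x0 <= y by rewrite le_max lexx orbT.
  have [Ky|yK] := leP K y.
    by rewrite set_itv_ge ?bnd_simp -?leNgt// preimage_set0 measure0 integral_set0.
  have -> : (\int[leb]_(x in `]y, K]) (h x)%:E = (- G K - - G y)%:E)%E.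
    apply: (FTC2_interval_oc yK (F := fun x => - G x)) => z /andP[yz _]; last by apply: ch; exact: le_trans yz.
    have dz := dG z (le_trans x0y yz).
    by rewrite -(opprK (h z)); exact: is_deriveN.
  have : P [set w | y < X w] = (P (X @^-1` `]y, K]) + P [set w | (K < X w)%R])%E.
    have mK : measurable [set w | K < X w].
      rewrite (_ : [set w | _] = X @^-1` `]K, +oo[%classic); first exact: mXp.
      by apply/seteqP; split => w; rewrite /= in_itv /= andbT.
    rewrite -measureU//; [|exact: mXp|]; last first.
      apply/seteqP; split => // w /= []; rewrite in_itv /= => /andP[_ h1] h2.
      by move: h1; rewrite leNgt h2.
    congr (P _); apply/seteqP; split => w /=; rewrite in_itv /=.
      by have [KX|XK] := ltP K (X w) => yX; [right | left; rewrite yX].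
    by case=> [/andP[]|] //; exact: lt_trans.
  rewrite !PG//; last by rewrite (le_trans x0y)// ltW.
  have : P (X @^-1` `]y, K]) \is a fin_num by apply: fin_num_measure; exact: mXp.
  move=> /fineK <-; rewrite -EFinD => -[->].
  by congr EFin; ring.
have m12 : forall A : set R, measurable A -> m1 A = m2 A.
  apply: (@measure_unique _ _ (measurableTypeR R) (@RGenOInfty.G R) (fun n => `](- n%:R), +oo[%classic)) => //.
  - exact: (RGenOInfty.measurableE R).
  - move=> _ _ [x ->] [y ->]; exists (Order.max x y); apply/seteqP; split => z /=.
      by rewrite !in_itv/= !andbT => -[xz yz]; rewrite gt_max xz yz.
    by rewrite !in_itv/= !andbT gt_max => /andP[].
  - by move=> n; exists (- n%:R).
  - apply/seteqP; split => // x _; exists (Num.bound `|x|) => //=.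
    rewrite in_itv/= andbT ltrNl; apply: (le_lt_trans (ler_norm _)); rewrite normrN.
    exact: archi_boundP.
  - by move=> _ [x ->].
  - by move=> n; rewrite m1E//; apply: (le_lt_trans (probability_le1 P _)); [apply: mXp; exact: measurableI | rewrite ltry].
have pos (g : R -> R) : (forall x, 0 <= g x) -> bmeas g ->
    (\int[leb]_(x in I) (g x * h x)%:E)%E = (intT P (fun w => g (X w) * (x0 < X w <= K)%R%:R))%:E.
  move=> g0 [mg [N gN]].
  have bgb : bmeas (fun w => g (X w) * b w).
    by apply: bmeasM; [split; [exact: measurableT_comp | exists N] | exact: bb].
  under [in RHS]eq_Rintegral do rewrite -bE.
  rewrite EFin_Rintegral_prob//; have mEg : measT (EFin \o g) by exact/measurable_EFinP.
  transitivity (\int[m1]_x (EFin \o g) x)%E; last first.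
    rewrite /m1 ge0_integral_pushforward//; last by move=> x _; rewrite /= lee_fin.
    rewrite preimage_setT (@integral_density _ _ _ P b b0 mb ((EFin \o g) \o X))//.
    - by move=> w; rewrite /= lee_fin.
    - exact: measurableT_comp.
  transitivity (\int[m2]_x (EFin \o g) x)%E; last first.
    by apply: eq_measure_integral => A mA _; rewrite m12.
  rewrite (@integral_density _ _ _ leb h' h'0 mh' (EFin \o g))//.
  rewrite [LHS]integral_mkcond; apply: eq_integral => x _.
  by rewrite /h' !patchE; case: ifP => //; rewrite mule0.
have int (g : R -> R) : (forall x, 0 <= g x) -> bmeas g ->
    leb.-integrable I (EFin \o (fun x => g x * h x)).
  move=> g0 bg; apply/integrableP; split.
    by apply/measurable_EFinP; apply: measurable_funM => //; case: bg => mg _; exact: measurable_funS mg.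
  under eq_integral => x xI.
    rewrite /= ger0_norm; last by rewrite mulr_ge0//; apply: hI; rewrite inE in xI.
    over.
  by rewrite pos// ltry.
(* Equality of measures gives the formula for nonnegative integrands; a bounded [f] is the
   difference of the nonnegative functions [f + M] and [M]. *)
have bM : bmeas (fun x => f x + M) by apply: bmeasD => //; exact: bmeas_cst.
have fM0 x : 0 <= f x + M by have := fM x; rewrite ler_norml; lra.
have i1 := int _ fM0 bM; have i2 := int (cst M) (fun=> M0) (bmeas_cst M).
have fE x : f x * h x = (f x + M) * h x - M * h x by ring.
split.
  have := @integrableB _ _ _ leb `]x0, K]%classic (measurable_itv _) _ _ i1 i2.
  by congr (integrable _ _ _); apply/funext => x /=; rewrite fE.
under [RHS]eq_Rintegral do rewrite fE.
rewrite RintegralB// /Rintegral (pos _ fM0 bM) (pos (fun=> M) (fun=> M0) (bmeas_cst M)) /=.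
have bI : bmeas (fun w => (x0 < X w <= K)%R%:R : R).
  by move: bb; congr bmeas; apply/funext => w; rewrite -bE.
rewrite -RintegralB_prob.
- by apply: eq_Rintegral => w _; rewrite -mulrBl addrK.
- by apply: bmeasM => //; exact: bmeas_comp bM.
- by apply: bmeasM => //; exact: bmeas_cst.
Qed.

End LawByTail.

(** * Duhamel integrals and the expansion over the number of jumps *)

Section IntegralComparison.
Context {R : realType}.
Local Notation leb := (@lebesgue_measure R).
Implicit Types (c t : R) (f g h G : R -> R).

Lemma within0_integrable t f : {within `[0, t], continuous f} ->
  leb.-integrable `[0, t]%classic (EFin \o f).
Proof. by move=> cf; apply: continuous_compact_integrable => //; exact: segment_compact. Qed.

(** Variation of constants: the solution at time [t] of g' = c g + f with g(0) = 0. In the jump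
    expansion the walk rests for a time [t - s], and [s] is the time left after the jump. *)
Definition duhamel c f t : R :=
  expR (c * t) * Rintegral leb `[0, t]%classic (fun s => expR (- (c * s)) * f s).

Lemma expRM_continuous c : continuous (fun s : R => expR (c * s)).
Proof.
move=> s; apply: continuous_comp; last exact: continuous_expR.
by apply: cvgM; [exact: cvg_cst | exact: cvg_id].
Qed.

Lemma duhamel_integrable c t f : {within `[0, t], continuous f} ->
  leb.-integrable `[0, t]%classic (EFin \o (fun s => expR (- (c * s)) * f s)).
Proof.
move=> cf; apply: within0_integrable => s.
apply: cvgM; last exact: cf.
apply: (@continuous_subspaceT _ _ _ (fun s => expR (- (c * s)))) => u.
under eq_fun do rewrite -mulNr.
exact: expRM_continuous.
Qed.

Lemma duhamel_ge0 c t f : (forall s, 0 <= s -> 0 <= f s) -> 0 <= duhamel c f t.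
Proof.
move=> f0; rewrite mulr_ge0 ?expR_ge0// Rintegral_ge0// => s /=.
by rewrite in_itv/= => /andP[s0 _]; rewrite mulr_ge0 ?expR_ge0// f0.
Qed.

Lemma duhamel_continuous c T f : {within `[0, T], continuous f} ->
  {within `[0, T], continuous (duhamel c f)}.
Proof.
move=> cf s; have [T0|T0] := leP 0 T; last first.
  apply: (@subspace_eq_continuous _ _ _ (cst 0)) => //; last exact: cst_continuous.
  by move=> x; rewrite inE/= in_itv/= => /andP[x0 /(le_trans x0)]; rewrite leNgt T0.
apply: cvgM; first exact: (continuous_subspaceT (@expRM_continuous c)).
by apply: parameterized_integral_continuous => //; exact: duhamel_integrable.
Qed.

Lemma duhamelD c t f g : {within `[0, t], continuous f} ->
  {within `[0, t], continuous g} ->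
  duhamel c (fun s => f s + g s) t = duhamel c f t + duhamel c g t.
Proof.
move=> cf cg; rewrite /duhamel -mulrDr -RintegralD//; last 2 first.
- exact: duhamel_integrable.
- exact: duhamel_integrable.
by congr (_ * _); apply: eq_Rintegral => s _; rewrite mulrDr.
Qed.

Lemma duhamel_le c t f g : {within `[0, t], continuous f} ->
  {within `[0, t], continuous g} -> (forall s, 0 <= s <= t -> f s <= g s) ->
  duhamel c f t <= duhamel c g t.
Proof.
move=> cf cg fg; rewrite ler_wpM2l ?expR_ge0// le_Rintegral//.
- exact: duhamel_integrable.
- exact: duhamel_integrable.
by move=> s /=; rewrite in_itv/= => st; rewrite ler_wpM2l ?expR_ge0// fg.
Qed.

(** A function is recovered from its defect [G' - c * G]. This turns the differential inequalities
    of explicit profiles into the integral form in which the jump expansion is written. *)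
Lemma duhamel_derive c t G (G' : R -> R) : 0 <= t -> continuous G' ->
  (forall s : R, is_derive s 1 G (G' s)) ->
  duhamel c (fun s => G' s - c * G s) t = G t - expR (c * t) * G 0.
Proof.
move=> t0 cG' dG.
have cG : continuous G.
  by move=> s; apply/differentiable_continuous/derivable1_diffP; case: (dG s).
have eE s : expR (c * s) * expR (- (c * s)) = 1 by rewrite -expRD subrr expR0.
move: t0; rewrite le_eqVlt => /predU1P[<-|t0].
  by rewrite /duhamel set_itv1 Rintegral_set1 !mulr0 expR0 mul1r subrr.
have dF (s : R) : is_derive s 1 (fun s => expR (- (c * s)) * G s)
    (expR (- (c * s)) * (G' s - c * G s)).
  have := dG s => dGs; apply: is_derive_eq.
  rewrite /GRing.scale /=; ring.
have cf : continuous (fun s => expR (- (c * s)) * (G' s - c * G s)).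
  move=> s; apply: cvgM; last by apply: cvgB; [exact: cG' | apply: cvgM; [exact: cvg_cst|exact: cG]].
  under eq_fun do rewrite -mulNr; rewrite -mulNr; exact: expRM_continuous.
have cF : continuous (fun s => expR (- (c * s)) * G s).
  by move=> s; apply/differentiable_continuous/derivable1_diffP; case: (dF s).
rewrite /duhamel /Rintegral (@continuous_FTC2 _ _ (fun s => expR (- (c * s)) * G s))//=.
- rewrite mulr0 oppr0 expR0 mul1r mulrBr mulrA eE mul1r//.
- exact: continuous_subspaceT.
- split=> [s _| |]; first by case: (dF s).
    exact: (cvg_at_right_filter (cF 0)).
  exact: (cvg_at_left_filter (cF t)).
- by move=> s _; rewrite derive1E; case: (dF s).
Qed.

End IntegralComparison.

Section JumpExpansion.
Context {R : realType}.
Implicit Types (B : pred int) (xi : int -> R) (z x : int) (t : R).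

(** Contribution to the Feynman-Kac expectation of the paths from [x] to [z] in time [t] with
    exactly [j] jumps that never leave [B]. The total jump rate 2 appears as [- 2], and each
    neighbour is entered at rate 1. *)
Fixpoint fk B xi z j t x {struct j} : R :=
  if B x then
    if j is j'.+1 then
      duhamel (xi x - 2) (fun s => fk B xi z j' s (x + 1) + fk B xi z j' s (x - 1)) t
    else (x == z)%:R * expR ((xi x - 2) * t)
  else 0.

Variables (B : pred int) (xi : int -> R) (z : int).
Local Notation F := (fk B xi z).

Lemma fk_out j t x : ~~ B x -> F j t x = 0.
Proof. by case: j => [|j] /=; case: (B x). Qed.

Lemma fkS j t x : B x -> F j.+1 t x =
  duhamel (xi x - 2) (fun s => F j s (x + 1) + F j s (x - 1)) t.
Proof. by move=> /= ->. Qed.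

Lemma fk_continuous j x T : {within `[0, T], continuous (F j ^~ x)}.
Proof.
elim: j x => [|j IH] x.
  have [Bx|/negP nBx] := boolP (B x); last first.
    rewrite (_ : F 0 ^~ x = cst 0); first by move=> s; exact: cst_continuous.
    by apply/funext => t; rewrite fk_out//; exact/negP.
  apply: continuous_subspaceT => s /=; rewrite Bx.
  by apply: cvgM; [exact: cvg_cst | exact: expRM_continuous].
have [Bx|nBx] := boolP (B x); last first.
  rewrite (_ : F j.+1 ^~ x = cst 0); first by move=> s; exact: cst_continuous.
  by apply/funext => t; rewrite fk_out.
rewrite (_ : F j.+1 ^~ x = duhamel (xi x - 2) (fun s => F j s (x + 1) + F j s (x - 1))).
  apply: duhamel_continuous => s; apply: cvgD; exact: IH.
by apply/funext => t; rewrite fkS.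
Qed.

Lemma fk_ge0 j t x : 0 <= F j t x.
Proof.
elim: j t x => [|j IH] t x /=; case: ifP => // _.
by apply: duhamel_ge0 => s s0; apply: addr_ge0.
Qed.

Definition fksum J t x : R := \sum_(j < J) F j t x.

Lemma fksum_continuous J x T : {within `[0, T], continuous (fksum J ^~ x)}.
Proof.
move=> s; rewrite /fksum; elim: J => [|J IH].
  rewrite (_ : (fun t => _) = cst 0); first exact: cvg_cst.
  by apply/funext => t; rewrite big_ord0.
rewrite (_ : (fun t => _) = (fun t => \sum_(j < J) F j t x + F J t x)).
  by apply: cvgD => //; exact: fk_continuous.
by apply/funext => t; rewrite big_ord_recr.
Qed.

Lemma fksum_out J t x : ~~ B x -> fksum J t x = 0.
Proof. by move=> Bx; rewrite /fksum big1// => j _; exact: fk_out. Qed.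

Lemma fksumS J t x : B x -> fksum J.+1 t x =
  (x == z)%:R * expR ((xi x - 2) * t) +
  duhamel (xi x - 2) (fun s => fksum J s (x + 1) + fksum J s (x - 1)) t.
Proof.
move=> Bx; elim: J => [|J IH].
  rewrite /fksum big_ord_recl big_ord0 addr0 /= Bx -[LHS]addr0; congr (_ + _).
  rewrite /duhamel (_ : Rintegral _ _ _ = 0) ?mulr0//.
  under eq_Rintegral do rewrite !big_ord0 addr0 mulr0.
  by rewrite Rintegral_cst//= mul0r.
rewrite /fksum big_ord_recr /= -/(fksum J.+1 t x) IH -addrA; congr (_ + _).
rewrite Bx -duhamelD.
- congr (duhamel _ _ t); apply/funext => s; rewrite !big_ord_recr /=.
  by rewrite -!/(fksum _ _ _); ring.
- by move=> s; apply: cvgD; exact: fksum_continuous.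
- by move=> s; apply: cvgD; exact: fk_continuous.
Qed.

(** A comparison principle by induction on the number of jumps: one Duhamel step maps functions
    below [W] to functions below [W], whatever the size of the box. *)
Lemma fksum_supersolution (W W' : R -> int -> R) :
  (forall x (s : R), is_derive s 1 (W ^~ x) (W' s x)) ->
  (forall x, continuous (W' ^~ x)) ->
  (forall x s, B x -> 0 <= s ->
    W s (x + 1) + W s (x - 1) <= W' s x - (xi x - 2) * W s x) ->
  (forall x s, 0 <= s -> 0 <= W s x) -> (forall x, (x == z)%:R <= W 0 x) ->
  forall J t x, 0 <= t -> fksum J t x <= W t x.
Proof.
move=> dW cW' hW W0 Wz; have cW x : continuous (W ^~ x).
  by move=> s; apply/differentiable_continuous/derivable1_diffP; case: (dW x s).
elim=> [|J IH] t x t0; first by rewrite /fksum big_ord0 W0.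
have [Bx|Bx] := boolP (B x); last by rewrite fksum_out// W0.
rewrite fksumS//; apply: (@le_trans _ _ ((x == z)%:R * expR ((xi x - 2) * t) +
    (W t x - expR ((xi x - 2) * t) * W 0 x))).
  rewrite lerD2l -(duhamel_derive _ t0 (cW' x) (dW x)); apply: duhamel_le.
  - by move=> s; apply: cvgD; exact: fksum_continuous.
  - apply: continuous_subspaceT => s.
    by apply: cvgB; [exact: cW' | apply: cvgM; [exact: cvg_cst|exact: cW]].
  - move=> s /andP[s0 _]; apply: le_trans (hW x s Bx s0).
    by apply: lerD; exact: IH.
rewrite mulrC addrCA gerDl subr_le0 ler_wpM2l ?expR_ge0//.
Qed.

(** The total weight of [j] jumps if [xi - 2] were the constant [M]; the 2 counts the two targets of
    each jump. *)
Definition poisson_weight (M : R) j t : R := expR (M * t) * ((2 * t) ^+ j / j`!%:R).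

Lemma poisson_weight_ge0 M j t : 0 <= t -> 0 <= poisson_weight M j t.
Proof. by move=> t0; rewrite mulr_ge0 ?expR_ge0// divr_ge0// exprn_ge0// mulr_ge0. Qed.

Lemma is_derive_poisson M j t : is_derive t 1 (poisson_weight M j.+1)
  (M * poisson_weight M j.+1 t + 2 * poisson_weight M j t).
Proof.
have h1 : (j.+1%:R : R) != 0 by rewrite pnatr_eq0.
have h2 : (j`!%:R : R) != 0 by rewrite pnatr_eq0 -lt0n fact_gt0.
have d1 : is_derive t 1 (fun t : R => expR (M * t)) (M * expR (M * t)).
  by apply: is_derive_eq; rewrite /GRing.scale /=; ring.
have d2 : is_derive t 1 (fun t : R => (2 * t) ^+ j.+1) (2 * j.+1%:R * (2 * t) ^+ j).
  have d0 : is_derive t 1 (fun t : R => 2 * t) 2.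
    by apply: is_derive_eq; rewrite /GRing.scale /= mulr1.
  rewrite (_ : (fun t0 => _) = (fun t : R => 2 * t) ^+ j.+1).
    by move: (is_deriveX j.+1 d0); congr (is_derive _ _ _ _); rewrite /GRing.scale /=; ring.
  by apply/funext => u; rewrite exprfctE.
rewrite /poisson_weight.
rewrite (_ : (fun t0 => _) = (fun t : R => (j.+1)`!%:R^-1 * (expR (M * t) * (2 * t) ^+ j.+1))); last first.
  by apply/funext => u; ring.
apply: is_derive_eq; rewrite /GRing.scale /= factS natrM.
rewrite exprS; move: (j.+1%:R : R) (j`!%:R : R) h1 h2 => a b a0 b0.
by field; rewrite a0 b0.
Qed.

Lemma poisson_weight_continuous M j : continuous (poisson_weight M j).
Proof.
move=> t; apply: cvgM; first exact: expRM_continuous.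
apply: cvgM; last exact: cvg_cst.
apply: (@continuous_comp _ _ _ (fun t => 2 * t) (fun u => u ^+ j)); last exact: exprn_continuous.
by apply: cvgM; [exact: cvg_cst|exact: cvg_id].
Qed.

Lemma duhamel_poisson c M j t : 0 <= t -> c <= M ->
  duhamel c (fun s => 2 * poisson_weight M j s) t <= poisson_weight M j.+1 t.
Proof.
move=> t0 cM; have cP k : continuous (poisson_weight M k) by exact: poisson_weight_continuous.
have cP' : continuous (fun t => M * poisson_weight M j.+1 t + 2 * poisson_weight M j t).
  by move=> s; apply: cvgD; apply: cvgM; [exact: cvg_cst|exact: cP|exact: cvg_cst|exact: cP].
have -> : poisson_weight M j.+1 t =
    poisson_weight M j.+1 t - expR (c * t) * poisson_weight M j.+1 0.
  by rewrite {3}/poisson_weight mulr0 (mulr0 2) expr0n/= mul0r !mulr0 subr0.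
rewrite -(duhamel_derive c t0 cP' (@is_derive_poisson M j)); apply: duhamel_le.
- by apply: continuous_subspaceT => s; apply: cvgM; [exact: cvg_cst|exact: cP].
- apply: continuous_subspaceT => s; apply: cvgB; first exact: cP'.
  by apply: cvgM; [exact: cvg_cst|exact: cP].
move=> s /andP[s0 _]; rewrite addrAC lerDr -mulrBl mulr_ge0 ?subr_ge0//.
exact: poisson_weight_ge0.
Qed.

(** Partial sums miss the paths with more jumps, so from below the comparison carries an error: it
    starts as the crude bound [K * expR (M * s)] and becomes a Poisson term of order [J] after [J]
    steps, which vanishes as [J] grows. *)
Lemma fksum_subsolution (V V' : R -> int -> R) (K M : R) :
  (forall x (s : R), is_derive s 1 (V ^~ x) (V' s x)) ->
  (forall x, continuous (V' ^~ x)) ->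
  (forall x s, B x -> 0 <= s ->
    V' s x - (xi x - 2) * V s x <= V s (x + 1) + V s (x - 1)) ->
  (forall x, V 0 x <= (x == z)%:R) ->
  0 <= K -> (forall x, B x -> xi x - 2 <= M) ->
  (forall x s, 0 <= s -> B x -> V s x <= K * expR (M * s)) ->
  (forall x s, 0 <= s -> ~~ B x -> V s x <= 0) ->
  forall J t x, 0 <= t -> V t x <= fksum J t x + K * poisson_weight M J t.
Proof.
move=> dV cV' hV Vz K0 cM VK Vout; have cV x : continuous (V ^~ x).
  by move=> s; apply/differentiable_continuous/derivable1_diffP; case: (dV x s).
elim=> [|J IH] t x t0.
  rewrite /fksum big_ord0 add0r /poisson_weight expr0 fact0 divr1 mulr1.
  have [Bx|Bx] := boolP (B x); first exact: VK.
  by apply: (le_trans (Vout _ _ t0 Bx)); rewrite mulr_ge0 ?expR_ge0.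
have [Bx|Bx] := boolP (B x); last first.
  apply: (le_trans (Vout _ _ t0 Bx)); rewrite fksum_out// add0r mulr_ge0//.
  exact: poisson_weight_ge0.
have cPK : continuous (fun s => K * (2 * poisson_weight M J s)).
  move=> s; apply: cvgM; first exact: cvg_cst.
  by apply: cvgM; [exact: cvg_cst|exact: poisson_weight_continuous].
set c := xi x - 2.
have h1 : V t x <= (x == z)%:R * expR (c * t) +
    duhamel c (fun s => V s (x + 1) + V s (x - 1)) t.
  rewrite -lerBlDl; apply: (@le_trans _ _ (V t x - expR (c * t) * V 0 x)).
    by rewrite lerD2l lerN2 mulrC ler_wpM2r ?expR_ge0.
  rewrite -(duhamel_derive _ t0 (cV' x) (dV x)); apply: duhamel_le.
  - apply: continuous_subspaceT => s.
    by apply: cvgB; [exact: cV' | apply: cvgM; [exact: cvg_cst|exact: cV]].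
  - by apply: continuous_subspaceT => s; apply: cvgD; exact: cV.
  - by move=> s /andP[s0 _]; exact: hV.
apply: (le_trans h1); rewrite fksumS// -addrA lerD2l.
apply: (@le_trans _ _ (duhamel c (fun s => (fksum J s (x + 1) + fksum J s (x - 1)) +
    K * (2 * poisson_weight M J s)) t)).
  apply: duhamel_le.
  - by apply: continuous_subspaceT => s; apply: cvgD; exact: cV.
  - move=> s; apply: cvgD; last exact: (continuous_subspaceT cPK).
    by apply: cvgD; exact: fksum_continuous.
  - move=> s /andP[s0 _]; have h := IH s (x + 1) s0; have h' := IH s (x - 1) s0.
    apply: (le_trans (lerD h h')); apply: eq_ler; ring.
rewrite duhamelD; last 2 first.
- by move=> s; apply: cvgD; exact: fksum_continuous.
- exact: continuous_subspaceT.
rewrite lerD2l; have -> : duhamel c (fun s => K * (2 * poisson_weight M J s)) t =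
    K * duhamel c (fun s => 2 * poisson_weight M J s) t.
  rewrite /duhamel mulrCA; congr (_ * _); rewrite -RintegralZl//.
    by apply: eq_Rintegral => s _; rewrite mulrCA.
  apply: duhamel_integrable; apply: continuous_subspaceT => s.
  by apply: cvgM; [exact: cvg_cst|exact: poisson_weight_continuous].
by rewrite ler_wpM2l// duhamel_poisson// cM.
Qed.

(** Only sites within distance [j] of the start are visited, so the bound on [xi] is needed there
    only; this matters for an unbounded potential. *)
Lemma fk_crude (M : R) j t x : 0 <= t ->
  (forall y, B y -> (`|y - x| <= j)%N -> xi y - 2 <= M) ->
  F j t x <= poisson_weight M j t.
Proof.
elim: j t x => [|j IH] t x t0 hM.
  rewrite /poisson_weight expr0 fact0 divr1 mulr1 /=; case: ifPn => [Bx|_]; last exact: expR_ge0.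
  apply: (@le_trans _ _ (1 * expR ((xi x - 2) * t))).
    by rewrite ler_wpM2r ?expR_ge0//; case: eqP.
  by rewrite mul1r ler_expR ler_wpM2r// hM// subrr.
have [Bx|Bx] := boolP (B x); last by rewrite fk_out// poisson_weight_ge0.
rewrite fkS//; apply: le_trans (duhamel_poisson j t0 (hM x Bx _)); last by rewrite subrr.
apply: duhamel_le.
- by move=> s; apply: cvgD; exact: fk_continuous.
- apply: continuous_subspaceT => s.
  by apply: cvgM; [exact: cvg_cst|exact: poisson_weight_continuous].
move=> s /andP[s0 _]; rewrite mulr2n mulrDl mul1r; apply: lerD; apply: IH => // y By hy;
  apply: hM => //; lia.
Qed.

End JumpExpansion.

Section JumpExpansionLocality.
Context {R : realType}.
Implicit Types (B : pred int) (xi : int -> R) (z x : int) (t : R).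

Lemma fk_le_box B B' xi z j t x : 0 <= t -> {subset B <= B'} ->
  fk B xi z j t x <= fk B' xi z j t x.
Proof.
move=> t0 BB'; elim: j t x t0 => [|j IH] t x t0 /=.
  case: ifPn => [/BB' B'x|_]; first by rewrite [B' x]B'x.
  by case: ifPn => // _; rewrite mulr_ge0 ?expR_ge0.
case: ifPn => [/BB' B'x|_].
  rewrite [B' x]B'x; apply: duhamel_le.
  - by move=> s; apply: cvgD; exact: fk_continuous.
  - by move=> s; apply: cvgD; exact: fk_continuous.
  - by move=> s /andP[s0 _]; apply: lerD; exact: IH.
by case: ifPn => // _; apply: duhamel_ge0 => s s0; apply: addr_ge0; exact: fk_ge0.
Qed.

Lemma fk_unreachable B xi z j t x : (j < `|x - z|)%N -> fk B xi z j t x = 0.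
Proof.
elim: j t x => [|j IH] t x h /=.
  case: ifP => // _; rewrite (_ : x == z = false) ?mul0r//; apply/negP => /eqP e.
  by move: h; rewrite e subrr.
case: ifP => // _; rewrite /duhamel (_ : Rintegral _ _ _ = 0) ?mulr0//.
have h1 : (j < `|(x + 1 - z)%R|)%N by lia.
have h2 : (j < `|(x - 1 - z)%R|)%N by lia.
under eq_Rintegral => s _ do rewrite (IH _ _ h1) (IH _ _ h2) addr0 mulr0.
by rewrite Rintegral_cst//= mul0r.
Qed.

(* A path from x to z with fewer than dist(x, B^c) + dist(B^c, z) jumps stays in B. *)
Lemma fk_box B xi z j t x :
  (forall y, ~~ B y -> (j < `|y - x| + `|y - z|)%N) ->
  fk B xi z j t x = fk predT xi z j t x.
Proof.
elim: j t x => [|j IH] t x h.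
  case: (boolP (B x)) => Bx /=; first by rewrite Bx.
  rewrite (negbTE Bx) (_ : x == z = false) ?mul0r//; apply/negP => /eqP e.
  by have := h x Bx; rewrite e subrr.
have [Bx|Bx] := boolP (B x).
  rewrite !fkS//; congr (duhamel _ _ t); apply/funext => s.
  by congr (_ + _); apply: IH => y By; have := h y By; lia.
have := h x Bx; rewrite subrr add0n => hx.
by rewrite !fk_unreachable.
Qed.

End JumpExpansionLocality.

(** * Path weights of the walk and the Feynman-Kac formula *)

Section RandomVariableFamily.
Context {R : realType} {d} {T : measurableType d}
  {A B : eqType}.
Variables (X : A -> T -> R) (c : B -> T -> bool).

Definition rv_family (i : A + B) : set (set T) :=
  match i with inl a => sigmaR (X a) | inr b => sigmaB (c b) end.

Hypothesis mX : forall a, measT (X a).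
Hypothesis mc : forall b, measurable [set w | c b w].

Lemma rv_familyT i : rv_family i setT.
Proof.
by case: i => [a|b] /=; exists setT; rewrite preimage_setT.
Qed.

Lemma rv_familyI i : setI_closed (rv_family i).
Proof.
case: i => [a|b] /= U V.
  by move=> [C [mC ->]] [D [mD ->]]; exists (C `&` D); split => //; exact: measurableI.
by move=> [C ->] [D ->]; exists (C `&` D).
Qed.

Lemma measurable_bool_preimage (f : T -> bool) (C : set bool) :
  measurable [set w | f w] -> measurable (f @^-1` C).
Proof.
move=> mf; have mf' : measurable [set w | ~~ f w].
  rewrite (_ : mkset _ = ~` [set w | f w]); first exact: measurableC.
  by apply/seteqP; split => w /= /negP.
rewrite (_ : f @^-1` C = (if true \in C then [set w | f w] else set0) `|`
   (if false \in C then [set w | ~~ f w] else set0)); last first.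
  apply/seteqP; split => w /=.
    by case E : (f w) => h; [left|right]; rewrite mem_set//= E.
  by case=> //; case: ifPn => //; rewrite inE => h /=; case: (f w).
by apply: measurableU; case: ifP.
Qed.

Lemma rv_family_meas i D : rv_family i D -> measurable D.
Proof.
case: i => [a|b] /= [C].
  by move=> [mC ->]; rewrite -[Y in measurable Y]setTI; exact: mX.
by move=> ->; exact: measurable_bool_preimage.
Qed.

Lemma rv_family_fun (J : pred (A + B)) a : J (inl a) ->
  measT (X a : fam_space rv_family J -> R).
Proof.
move=> Ja _ C mC; rewrite setTI; apply: (@fam_gen _ T _ _ J (inl a)) => //=.
by exists C.
Qed.

Lemma rv_family_bool (J : pred (A + B)) b : J (inr b) ->
  measT (c b : fam_space rv_family J -> bool).
Proof.
move=> Jb _ C mC; rewrite setTI; apply: (@fam_gen _ T _ _ J (inr b)) => //=.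
by exists C.
Qed.

End RandomVariableFamily.

Section PathWeights.
Context {R : realType} {d} {T : measurableType d}
  (Q : probability T R).
Variables (tau : nat -> T -> R) (eps : nat -> T -> bool) (xi : int -> R) (z : int).
Local Notation leb := (@lebesgue_measure R).

Definition step (m : nat) (w : T) : int := if eps m w then 1 else -1.

(* Weight of the paths making exactly j jumps in a time span r, when started
   at x with the m-th holding time about to run. *)
Fixpoint path_weight (j m : nat) (r : R) (x : int) (w : T) {struct j} : R :=
  if j is j'.+1 then
    (0 < tau m w <= r)%R%:R * expR (xi x * tau m w) *
    path_weight j' m.+1 (r - tau m w) (x + step m w) w
  else (0 <= r < tau m w)%R%:R * expR (xi x * r) * (x == z)%:R.

Lemma path_weight_ge0 j m r x w : 0 <= path_weight j m r x w.
Proof.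
elim: j m r x => [|j IH] m r x /=; first by rewrite !mulr_ge0 ?expR_ge0.
by rewrite !mulr_ge0 ?expR_ge0.
Qed.

Lemma path_weight_le (M : R) j m r x w : 0 <= M ->
  (forall y, (`|(y - x)%R| <= j)%N -> xi y <= M) -> path_weight j m r x w <= expR (M * r).
Proof.
move=> M0; elim: j m r x => [|j IH] m r x hM /=.
  case: (boolP (0 <= r < tau m w)) => [/andP[r0 _]|_]; last by rewrite !mul0r expR_ge0.
  rewrite mul1r; apply: (@le_trans _ _ (expR (xi x * r) * 1)).
    by rewrite ler_wpM2l ?expR_ge0//; case: eqP.
  by rewrite mulr1 ler_expR ler_wpM2r// hM// subrr.
case: (boolP (0 < tau m w <= r)) => [/andP[t0 tr]|_]; last by rewrite !mul0r expR_ge0.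
have -> : expR (M * r) = expR (M * tau m w) * expR (M * (r - tau m w)).
  by rewrite -expRD; congr expR; ring.
rewrite mul1r; apply: ler_pM; rewrite ?expR_ge0 ?path_weight_ge0//.
  by rewrite ler_expR ler_wpM2r ?hM ?subrr// ltW.
apply: IH => y hy; apply: hM; move: hy; rewrite /step; case: (eps m w); lia.
Qed.

Hypothesis mtau : forall k, measT (tau k).
Hypothesis meps : forall k, measurable [set w | eps k w].
Hypothesis tau_tail : forall k (x : R), 0 <= x ->
  Q [set w | x < tau k w] = (expR (- (2 * x)))%:E.
Hypothesis eps_half : forall k, Q [set w | eps k w] = (1 / 2)%:E.
Hypothesis indep : mutually_indep Q (rv_family tau eps).

(** The future of the walk after [m] jumps: holding times on the left, steps on the right. *)
Definition from (m : nat) (i : nat + nat) : bool :=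
  match i with inl k => (m <= k)%N | inr k => (m <= k)%N end.

Local Notation space J := (fam_space (rv_family tau eps) J).

Lemma from_sub m : measT (id : space (from m) -> space (from m.+1)).
Proof.
apply: (@fam_sub _ T _ (rv_family tau eps) (from m.+1) (from m)).
  by case=> k /= h; apply: ltnW.
exact: measurable_id.
Qed.

Lemma path_weight_measurable j m x : measT
  (fun p : R * space (from m) => path_weight j m p.1 x p.2).
Proof.
elim: j m x => [|j IH] m x.
  have mt : measT (fun p : R * space (from m) => tau m p.2).
    apply: (measurableT_comp (f := (tau m : space (from m) -> R))); last exact: measurable_snd.
    by apply: rv_family_fun => /=.
  apply: measurable_funM; last exact: measurable_cst.
  apply: measurable_funM.
    apply: (measurableT_comp (f := fun b : bool => b%:R : R)); first by [].
    apply: measurable_and; first by apply: measurable_fun_ler => //; exact: measurable_cst.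
    by apply: measurable_fun_ltr => //; exact: measurable_fst.
  apply: measurableT_comp; first exact: measurable_expR.
  by apply: measurable_scale; exact: measurable_fst.
have mt : measT (fun p : R * space (from m) => tau m p.2).
  apply: (measurableT_comp (f := (tau m : space (from m) -> R))); last exact: measurable_snd.
  by apply: rv_family_fun => /=.
have me : measT (fun p : R * space (from m) => eps m p.2).
  apply: (measurableT_comp (f := (eps m : space (from m) -> bool))); last exact: measurable_snd.
  by apply: rv_family_bool => /=.
apply: measurable_funM.
  apply: measurable_funM.
    apply: (measurableT_comp (f := fun b : bool => b%:R : R)); first by [].
    apply: measurable_and; first by apply: measurable_fun_ltr => //; exact: measurable_cst.
    by apply: measurable_fun_ler => //; exact: measurable_fst.
  apply: measurableT_comp; first exact: measurable_expR.
  by apply: measurable_scale; exact: mt.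
pose shift (p : R * space (from m)) : R * space (from m.+1) := (p.1 - tau m p.2, p.2).
have ms : measT shift.
  apply: measurable_fun_pair; first by apply: measurable_funB => //; exact: measurable_fst.
  exact: (measurableT_comp (@from_sub m) (@measurable_snd _ _ _ _)).
rewrite (_ : (fun p => _) = (fun p : R * space (from m) =>
   if eps m p.2 then path_weight j m.+1 (shift p).1 (x + 1) (shift p).2
   else path_weight j m.+1 (shift p).1 (x - 1) (shift p).2)).
  apply: measurable_fun_ifT => //.
    exact: (measurableT_comp (IH m.+1 (x + 1)) ms).
  exact: (measurableT_comp (IH m.+1 (x - 1)) ms).
by apply/funext => p; rewrite /step; case: (eps m p.2).
Qed.

Lemma path_weight_bmeas j m r x :
  bmeas (path_weight j m r x : space (from m) -> R).
Proof.
split.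
  exact: (@measurable_fun_pair2 _ _ _ R (space (from m)) R
    (fun p : R * space (from m) => path_weight j m p.1 x p.2) r (@path_weight_measurable j m x)).
pose M := \sum_(i < (j + j).+1) `|xi (x - j%:Z + (i : nat)%:Z)|.
exists (expR (M * r)) => w; rewrite ger0_norm ?path_weight_ge0//.
apply: path_weight_le => [|y hy]; first by apply: sumr_ge0.
apply: le_trans (ler_norm _) _.
have hy' : (absz (y - x + j%:Z)%R < (j + j).+1)%N by lia.
rewrite /M (bigD1 (Ordinal hy')) //=.
have -> : x - j%:Z + `|(y - x + j%:Z)%R|%N%:Z = y by lia.
by rewrite lerDl; apply: sumr_ge0.
Qed.

Let fT := rv_familyT tau eps.
Let fI := @rv_familyI R _ T _ _ tau eps.
Let fM := @rv_family_meas R _ T _ _ tau eps mtau meps.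

Lemma path_weight_branch j m r x :
  intT Q (fun w => path_weight j m.+1 r (x + step m w) w) =
  2^-1 * (intT Q (path_weight j m.+1 r (x + 1)) +
          intT Q (path_weight j m.+1 r (x - 1))).
Proof.
pose J1 (i : nat + nat) := i == inr m.
have dis i : J1 i -> from m.+1 i -> False.
  by move=> /eqP -> /=; rewrite ltnn.
have be : bmeas ((fun w => (eps m w)%:R) : space J1 -> R).
  by apply: bmeas_bool; apply: rv_family_bool; rewrite /J1 eqxx.
have be' : bmeas ((fun w => 1 - (eps m w)%:R) : space J1 -> R).
  by apply: bmeasB => //; exact: bmeas_cst.
have bp := path_weight_bmeas j m.+1 r.
have em : bmeas ((fun w => (eps m w)%:R) : T -> R) by exact: (fam_bmeas fM be).
have bpT x' : bmeas (path_weight j m.+1 r x' : T -> R) by exact: (fam_bmeas fM (bp x')).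
have E1 : intT Q (fun w => (eps m w)%:R) = 2^-1.
  rewrite -[RHS]mul1r -[RHS]/(fine (1 / 2)%:E) -(eps_half m).
  rewrite -Rintegral_indic_prob//; congr Rintegral; apply/funext => w.
  by rewrite indicE; congr (nat_of_bool _)%:R; apply/idP/idP; rewrite inE.
have E2 : intT Q (fun w => 1 - (eps m w)%:R) = 2^-1.
  rewrite RintegralB_prob//; last exact: bmeas_cst.
  by rewrite Rintegral_prob_cst E1; lra.
transitivity (intT Q (fun w => (eps m w)%:R * path_weight j m.+1 r (x + 1) w +
    (1 - (eps m w)%:R) * path_weight j m.+1 r (x - 1) w)).
  apply: eq_Rintegral => w _; rewrite /step; case: (eps m w) => /=; ring.
rewrite RintegralD_prob; last 2 first.
- exact: bmeasM.
- by apply: bmeasM => //; apply: bmeasB => //; exact: bmeas_cst.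
rewrite (fam_expectM fT fI fM indep dis be (bp _)).
rewrite (fam_expectM fT fI fM indep dis be' (bp _)).
by rewrite E1 E2 mulrDr.
Qed.

(** On the left [s] is the time of the first jump, in [duhamel] it is the time that remains; the
    substitution [r - s] relates the two. *)
Lemma duhamel_convolution (c r : R) (f : R -> R) : 0 <= r ->
  {within `[0, r], continuous f} ->
  (\int[leb]_(s in `[0%R, r]) (expR (c * s) * f (r - s))%:E)%E =
  (duhamel c f r)%:E.
Proof.
move=> r0 cf; pose G s := expR (c * (r - s)) * f s.
have dF (s : R) : is_derive s 1 (fun s : R => r - s) (-1).
  rewrite (_ : (fun _ => _) = (fun s : R => -1 * s + r)); last by apply/funext => u; ring.
  by apply: is_derive_eq; rewrite /GRing.scale /=; ring.
have F' : derive1 (fun s : R => r - s) = cst (-1).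
  by apply/funext => s; rewrite derive1E; case: (dF s).
have := @integration_by_substitution_decreasing R (fun s => r - s) G 0 r r0.
rewrite F' subr0 subrr => sub.
have -> : duhamel c f r = Rintegral leb `[0, r]%classic G.
  rewrite /duhamel -RintegralZl//; last exact: duhamel_integrable.
  apply: eq_Rintegral => s _; rewrite /G mulrA -expRD; congr (expR _ * _); ring.
have cG : {within `[0, r], continuous G}.
  move=> s; apply: cvgM; last exact: cf.
  apply: (continuous_subspaceT (f := fun s => expR (c * (r - s)))) => u.
  apply: continuous_comp; last exact: continuous_expR.
  by apply: cvgM; [exact: cvg_cst | apply: cvgB; [exact: cvg_cst|exact: cvg_id]].
rewrite /Rintegral fineK; last first.
  by apply: integrable_fin_num => //; exact: within0_integrable.
rewrite sub//.
- apply: eq_integral => s _; congr EFin.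
  rewrite [RHS](_ : _ = G (r - s) * - (-1)); last by [].
  by rewrite /G opprK mulr1 subKr.
- by move=> s t _ _; rewrite ltrD2l ltrN2.
- by move=> s _; exact: cvg_cst.
- exact: is_cvg_cst.
- exact: is_cvg_cst.
- split=> [s _| |]; first by case: (dF s).
    apply: cvg_at_right_filter; apply: cvgB; [exact: cvg_cst|exact: cvg_id].
  apply: cvg_at_left_filter; apply: cvgB; [exact: cvg_cst|exact: cvg_id].
Qed.

(** First-jump analysis. The density 2 exp(- 2 s) of the holding time times the probability 1/2 of
    each step gives the jump rate 1 of [fk]. The clock [m] is arbitrary because the recursion
    restarts the walk with the later variables. *)
Lemma path_integral j m r x : 0 <= r ->
  intT Q (path_weight j m r x) = fk predT xi z j r x.
Proof.
elim: j m r x => [|j IH] m r x r0.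
  rewrite (_ : path_weight 0 m r x =
    (fun w => (expR (xi x * r) * (x == z)%:R) * \1_[set w | r < tau m w] w)); last first.
    apply/funext => w /=; rewrite r0 /= indicE.
    have -> : (w \in [set w | r < tau m w]) = (r < tau m w) by apply/idP/idP; rewrite inE.
    ring.
  have mS : measurable [set w | r < tau m w].
    rewrite (_ : mkset _ = tau m @^-1` `]r, +oo[%classic); last first.
      by apply/seteqP; split => w /=; rewrite in_itv/= andbT.
    by rewrite -[Y in measurable Y]setTI; exact: mtau.
  rewrite RintegralZl_prob; last exact: bmeas_indic.
  rewrite Rintegral_indic_prob// tau_tail//= mulrAC -expRD mulrC; congr (_ * expR _); ring.
pose J1 (i : nat + nat) := i == inl m.
(* The holding time [tau m] is frozen; the step [eps m] and all later variables stay random. *)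
pose J2 (i : nat + nat) := from m i && (i != inl m).
have dis i : J1 i -> J2 i -> False by move=> /eqP -> /andP[_ /eqP].
have mid : measT (id : space J2 -> space (from m.+1)).
  apply: (@fam_sub _ T _ (rv_family tau eps) (from m.+1) J2).
    by case=> k; rewrite !unfold_in /J2 /= => h; rewrite ltnW//=; apply/eqP => // -[e]; move: h; rewrite e ltnn.
  exact: measurable_id.
pose Phi (p : R * space J2) : R := (0 < p.1 <= r)%R%:R * expR (xi x * p.1) *
  path_weight j m.+1 (r - p.1) (x + step m p.2) p.2.
have bPhi : bmeas Phi.
  split.
    apply: measurable_funM.
      apply: measurable_funM.
        apply: (measurableT_comp (f := fun b : bool => b%:R : R)); first by [].
        apply: measurable_and; first by apply: measurable_fun_ltr => //; exact: measurable_cst.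
        by apply: measurable_fun_ler => //; exact: measurable_cst.
      apply: measurableT_comp; first exact: measurable_expR.
      by apply: measurable_scale; exact: measurable_fst.
    pose shift (p : R * space J2) : R * space (from m.+1) := (r - p.1, p.2).
    have ms : measT shift.
      apply: measurable_fun_pair; first by apply: measurable_funB => //; exact: measurable_fst.
      exact: (measurableT_comp mid (@measurable_snd _ _ _ _)).
    rewrite (_ : (fun p => _) = (fun p : R * space J2 =>
       if eps m p.2 then path_weight j m.+1 (shift p).1 (x + 1) (shift p).2
       else path_weight j m.+1 (shift p).1 (x - 1) (shift p).2)).
      apply: measurable_fun_ifT => //.
      - apply: (measurableT_comp (f := (eps m : space J2 -> bool))); last exact: measurable_snd.
        by apply: rv_family_bool; rewrite /J2 /= leqnn.
      - exact: (measurableT_comp (@path_weight_measurable j m.+1 (x + 1)) ms).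
      - exact: (measurableT_comp (@path_weight_measurable j m.+1 (x - 1)) ms).
    by apply/funext => p; rewrite /step; case: (eps m p.2).
  pose M := \sum_(i < (j.+1 + j.+1).+1) `|xi (x - j.+1%:Z + (i : nat)%:Z)|.
  have M0 : 0 <= M by apply: sumr_ge0.
  have hM y : (`|(y - x)%R| <= j.+1)%N -> xi y <= M.
    move=> hy; apply: le_trans (ler_norm _) _.
    have hy' : (absz (y - x + j.+1%:Z)%R < (j.+1 + j.+1).+1)%N by lia.
    rewrite /M (bigD1 (Ordinal hy')) //=.
    have -> : x - j.+1%:Z + `|(y - x + j.+1%:Z)%R|%N%:Z = y by lia.
    by rewrite lerDl; apply: sumr_ge0.
  exists (expR (M * r)) => -[s w]; rewrite /Phi /=.
  case: (boolP (0 < s <= r)) => [/andP[s0 sr]|_]; last by rewrite !mul0r normr0 expR_ge0.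
  rewrite mul1r ger0_norm; last by rewrite mulr_ge0 ?expR_ge0 ?path_weight_ge0.
  have -> : expR (M * r) = expR (M * s) * expR (M * (r - s)).
    by rewrite -expRD; congr expR; ring.
  apply: ler_pM; rewrite ?expR_ge0 ?path_weight_ge0//.
    by rewrite ler_expR ler_wpM2r ?hM ?subrr// ltW.
  apply: path_weight_le => // y hy; apply: hM; move: hy; rewrite /step; case: (eps m w); lia.
pose h s := fk predT xi z j s (x + 1) + fk predT xi z j s (x - 1).
pose psi s : R := (0 < s <= r)%R%:R * expR (xi x * s) * (2^-1 * h (r - s)).
have psiE s : intT Q (fun w => Phi (s, w)) = psi s.
  rewrite /Phi /psi /=; case: (boolP (0 < s <= r)) => [/andP[s0 sr]|_]; last first.
    by under eq_Rintegral do rewrite !mul0r; rewrite !mul0r Rintegral_prob_cst.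
  rewrite mul1r RintegralZl_prob; last first.
    have -> : (fun w => path_weight j m.+1 (r - s) (x + step m w) w) =
      (fun w => (eps m w)%:R * path_weight j m.+1 (r - s) (x + 1) w +
        (1 - (eps m w)%:R) * path_weight j m.+1 (r - s) (x - 1) w).
      by apply/funext => w; rewrite /step; case: (eps m w) => /=; ring.
    have be : bmeas ((fun w => (eps m w)%:R) : T -> R).
      apply: bmeas_bool; move=> _ C _; rewrite setTI; exact: measurable_bool_preimage.
    have bp x' : bmeas (path_weight j m.+1 (r - s) x' : T -> R).
      exact: (fam_bmeas fM (path_weight_bmeas j m.+1 (r - s) x')).
    by apply: bmeasD; apply: bmeasM => //; apply: bmeasB => //; exact: bmeas_cst.
  by rewrite path_weight_branch !IH ?subr_ge0.
have mtJ1 : measT (tau m : space J1 -> R).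
  by apply: rv_family_fun; rewrite /J1 eqxx.
have [bpsi E] := fam_fubini fT fI fM indep dis mtJ1 bPhi.
rewrite (_ : intT Q (path_weight j.+1 m r x) =
  intT Q (fun w => Phi (tau m w, w)))// E.
under eq_Rintegral do rewrite psiE.
have {}bpsi : bmeas psi by move: bpsi; congr bmeas; apply/funext => s; exact: psiE.
transitivity (intT Q (fun w => psi (tau m w) * (0 < tau m w <= r)%R%:R)).
  apply: eq_Rintegral => w _; rewrite /psi.
  by case: (0 < tau m w <= r)%R; rewrite ?mulr1 ?mulr0 ?mul0r.
have [|||i ->] := @law_interval R _ _ Q (tau m) 0 r (fun y => expR (- (2 * y))) (fun y => 2 * expR (- (2 * y)))
  psi (mtau m) _ _ _ (tau_tail m) bpsi.
- by move=> y _; apply: is_derive_eq; rewrite /GRing.scale /=; ring.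
- move=> y _; apply: cvgM; first exact: cvg_cst.
  by under eq_fun do rewrite -mulNr; rewrite -mulNr; exact: expRM_continuous.
- by move=> y _; rewrite mulr_ge0 ?expR_ge0.
have eqI : {in `]0, r]%classic, (fun s => psi s * (2 * expR (- (2 * s)))) =1
    (fun s => expR ((xi x - 2) * s) * h (r - s))}.
  move=> s; rewrite inE /= in_itv /= => sr; rewrite /psi sr mul1r.
  have -> : expR ((xi x - 2) * s) = expR (xi x * s) * expR (- (2 * s)).
    by rewrite -expRD; congr expR; ring.
  by field.
transitivity (Rintegral leb `]0, r] (fun s => expR ((xi x - 2) * s) * h (r - s))); first exact: eq_Rintegral.
rewrite fkS// -[RHS]/(fine _%:E) -(duhamel_convolution _ r0); last first.
  by move=> s; apply: cvgD; exact: fk_continuous.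
rewrite /Rintegral integral_itv_obnd_cbnd//.
apply/measurable_EFinP; apply: (@eq_measurable_fun _ _ _ _ _ (fun s => psi s * (2 * expR (- (2 * s)))) _ eqI).
by apply/measurable_EFinP; exact: measurable_int i.
Qed.

End PathWeights.

Section StepFunctionIntegral.
Context {R : realType}.
Local Notation leb := (@lebesgue_measure R).

Lemma Rintegral_step_fun (n : nat) (a : nat -> R) (I : nat -> set R) :
  (forall k, measurable (I k)) -> (forall k, leb (I k) < +oo)%E ->
  intT leb (fun s => \sum_(k < n) a k * \1_(I k) s) =
  \sum_(k < n) a k * fine (leb (I k)).
Proof.
move=> mI fI.
have ind k : (\int[leb]_x (\1_(I k) x)%:E = leb (I k))%E.
  by rewrite integral_indic ?setIT//; exact: mI.
have i1 k : leb.-integrable setT (EFin \o \1_(I k)).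
  apply/integrableP; split; first by apply/measurable_EFinP; apply: measurable_indic; exact: mI.
  under eq_integral => x _ do rewrite /= ger0_norm ?ler0n//.
  by rewrite ind.
have ik k : leb.-integrable setT (EFin \o (fun s => a k * \1_(I k) s)).
  rewrite (_ : _ \o _ = (fun x => (a k)%:E * (EFin \o \1_(I k)) x)%E); last by [].
  exact: integrableZl.
suff h : leb.-integrable setT (EFin \o (fun s => \sum_(k < n) a k * \1_(I k) s)) /\
  intT leb (fun s => \sum_(k < n) a k * \1_(I k) s) =
  \sum_(k < n) a k * fine (leb (I k)) by case: h.
elim: n => [|n [IH1 IH2]].
  rewrite big_ord0 (_ : (fun s => _) = cst 0).
    by split; [exact: integrable0 | rewrite Rintegral_cst//= mul0r].
  by apply/funext => s; rewrite big_ord0.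
rewrite (_ : (fun s => _) = (fun s => \sum_(k < n) a k * \1_(I k) s + a n * \1_(I n) s)); last first.
  by apply/funext => s; rewrite big_ord_recr.
split.
  exact: (integrableD measurableT IH1 (ik n)).
rewrite RintegralD// IH2 big_ord_recr /=; congr (_ + _).
rewrite RintegralZl//; congr (_ * _).
by rewrite /Rintegral ind.
Qed.

End StepFunctionIntegral.

Section FeynmanKac.
Context {R : realType} {d} {T : measurableType d}
  (Q : probability T R).
Variables (tau : nat -> T -> R) (eps : nat -> T -> bool) (xi : int -> R) (z : int).
Local Notation leb := (@lebesgue_measure R).
Local Notation S_ := (jump_time tau).
Local Notation X_ := (jump_chain eps).

Lemma jump_timeS n w : S_ n.+1 w = S_ n w + tau n w.
Proof. by rewrite /jump_time big_ord_recr. Qed.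

Lemma jump_time_le w m n : (forall k, 0 < tau k w) -> (m <= n)%N -> S_ m w <= S_ n w.
Proof.
move=> tau0 /subnKC <-; elim: (n - m)%N => [|k IH]; first by rewrite addn0.
by rewrite addnS jump_timeS; apply: (le_trans IH); rewrite lerDl ltW.
Qed.

Lemma jump_time_inj w s m n : (forall k, 0 < tau k w) ->
  S_ m w <= s < S_ m.+1 w -> S_ n w <= s < S_ n.+1 w -> m = n.
Proof.
move=> tau0 /andP[m1 m2] /andP[n1 n2].
have [mn|nm|//] := ltngtP m n.
  by have := jump_time_le tau0 mn; rewrite leNgt (le_lt_trans n1 m2).
by have := jump_time_le tau0 nm; rewrite leNgt (le_lt_trans m1 n2).
Qed.

Lemma walkE w s n : (forall k, 0 < tau k w) -> S_ n w <= s < S_ n.+1 w ->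
  walk tau eps s w = X_ n w.
Proof.
move=> tau0 h; rewrite /walk; congr (X_ _ w).
by apply: xget_unique => // m hm; exact: jump_time_inj hm h.
Qed.

Lemma jump_time_cover w s : (forall k, 0 < tau k w) -> 0 <= s ->
  (exists i, s < tau i w) -> exists n, S_ n w <= s < S_ n.+1 w.
Proof.
move=> tau0 s0 [i si].
have ex : exists n, s < S_ n.+1 w.
  exists i; rewrite jump_timeS; apply: (lt_le_trans si); rewrite lerDr.
  by have := @jump_time_le w 0 i tau0 isT; rewrite /jump_time big_ord0.
case: (ex_minnP ex) => n sn nmin; exists n; rewrite sn andbT.
case: n sn nmin => [|n] sn nmin; first by rewrite /jump_time big_ord0.
by rewrite leNgt; apply/negP => /nmin; rewrite ltnn.
Qed.

Lemma path_weightE j m r x w (X : nat -> int) : (forall k, 0 < tau k w) ->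
  (forall k, X k = x + \sum_(i < k) step eps (m + i) w) ->
  path_weight tau eps xi z j m r x w =
  (\sum_(i < j) tau (m + i)%N w <= r < \sum_(i < j.+1) tau (m + i)%N w)%R%:R *
  expR (\sum_(i < j) xi (X i) * tau (m + i)%N w +
        xi (X j) * (r - \sum_(i < j) tau (m + i)%N w)) *
  (X j == z)%:R.
Proof.
move=> tau0; elim: j m r x X => [|j IH] m r x X XE /=.
  by rewrite big_ord_recl !big_ord0 XE big_ord0 !(addr0, add0r, subr0, addn0).
have XE' k : X k.+1 = x + step eps m w + \sum_(i < k) step eps (m.+1 + i) w.
  rewrite XE big_ord_recl addn0 addrA; congr (_ + _); apply: eq_bigr => i _.
  by rewrite /= /bump add1n addSnnS.
have SE k : \sum_(i < k.+1) tau (m + i)%N w = tau m w + \sum_(i < k) tau (m.+1 + i)%N w.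
  rewrite big_ord_recl addn0; congr (_ + _); apply: eq_bigr => i _.
  by rewrite /= /bump add1n addSnnS.
rewrite (IH _ _ _ (fun k => X k.+1) XE') !SE.
set S1 := \sum_(i < j) _; set S2 := \sum_(i < j.+1) _.
have S10 : 0 <= S1 by apply: sumr_ge0 => i _; exact: ltW.
have -> : ((tau m w + S1 <= r < tau m w + S2)%R%:R : R) =
    (0 < tau m w <= r)%R%:R * (S1 <= r - tau m w < S2)%R%:R.
  rewrite -natrM mulnb; congr (nat_of_bool _)%:R.
  rewrite tau0 /= lerBrDl ltrBlDl; case: (leP (tau m w + S1) r) => h /=; last by rewrite andbF.
  by rewrite (le_trans _ h) ?lerDl.
have -> : expR (\sum_(i < j.+1) xi (X i) * tau (m + i)%N w + xi (X j.+1) * (r - (tau m w + S1))) =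
  expR (xi x * tau m w) *
  expR (\sum_(i < j) xi (X i.+1) * tau (m.+1 + i)%N w + xi (X j.+1) * (r - tau m w - S1)).
  rewrite -expRD; congr expR; rewrite big_ord_recl addn0 XE big_ord0 addr0 -addrA; congr (_ + _).
  rewrite opprD !addrA; congr (_ + _); apply: eq_bigr => i _.
  by rewrite /= /bump add1n addSnnS.
by ring.
Qed.

Lemma path_action w t n : (forall k, 0 < tau k w) -> 0 <= t ->
  S_ n w <= t < S_ n.+1 w ->
  Rintegral leb `[0, t] (fun s => xi (walk tau eps s w)) =
  \sum_(i < n) xi (X_ i w) * tau i w + xi (X_ n w) * (t - S_ n w).
Proof.
move=> tau0 t0 /andP[tn tn1].
pose I k := [set s | S_ k w <= s < S_ k.+1 w] `&` `[0, t]%classic.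
have S0 k : 0 <= S_ k w.
  by have := @jump_time_le w 0 k tau0 isT; rewrite /jump_time big_ord0.
have Ik k : (k < n)%N -> I k = `[S_ k w, S_ k.+1 w[%classic.
  move=> kn; apply/seteqP; split => s; rewrite /I /= !in_itv/=; first by case.
  move=> /andP[h1 h2]; rewrite h1 h2 (le_trans _ h1)//; split => //=.
  by apply: (le_trans (ltW h2)); apply: le_trans tn; exact: jump_time_le.
have In : I n = `[S_ n w, t]%classic.
  apply/seteqP; split => s; rewrite /I /= !in_itv/=; first by case=> /andP[-> _] /andP[].
  by move=> /andP[h1 h2]; rewrite h1 h2 (le_trans _ h1)// (le_lt_trans h2).
have mI k : measurable (I k).
  apply: measurableI => //; rewrite (_ : mkset _ = `[S_ k w, S_ k.+1 w[%classic)//.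
have fI k : (leb (I k) < +oo)%E.
  apply: (@le_lt_trans _ _ (leb `[0, t]%classic)).
    apply: le_measure; [by rewrite inE; exact: mI | by rewrite inE; exact: measurable_itv | by move=> s []].
  by rewrite lebesgue_measure_itv; case: ifP => _; rewrite /= ?ltry.
rewrite Rintegral_mkcond.
rewrite (_ : _ \_ _ = (fun s => \sum_(k < n.+1) xi (X_ k w) * \1_(I k) s)); last first.
  apply/funext => s; rewrite patchE; case: ifPn => [|/negP st].
    rewrite inE /= in_itv/= => /andP[s0 st].
    have ex : exists k, S_ k w <= s < S_ k.+1 w.
      have ex : exists k, s < S_ k.+1 w by exists n; exact: le_lt_trans tn1.
      case: (ex_minnP ex) => k sk kmin; exists k; rewrite sk andbT.
      case: k sk kmin => [|k] sk kmin; first by rewrite /jump_time big_ord0.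
      by rewrite leNgt; apply/negP => /kmin; rewrite ltnn.
    case: ex => k hk; rewrite (walkE tau0 hk).
    have kn : (k < n.+1)%N.
      rewrite ltnS leqNgt; apply/negP => nk.
      have := jump_time_le tau0 nk; move: hk => /andP[h1 _].
      by rewrite leNgt (le_lt_trans (le_trans h1 st)).
    rewrite (bigD1 (Ordinal kn)) //= indicE mem_set ?mulr1; last first.
      by split => //=; rewrite in_itv/= s0.
    rewrite big1 ?addr0// => i ik; rewrite indicE memNset ?mulr0// => -[/= hi _].
    by move: ik; rewrite -val_eqE /= (jump_time_inj tau0 hi hk) eqxx.
  rewrite big1// => k _; rewrite indicE memNset ?mulr0// => -[_ h].
  by apply: st; rewrite inE.
rewrite (@Rintegral_step_fun _ n.+1 (fun k => xi (X_ k w)) I mI fI) big_ord_recr /= In; congr (_ + _).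
  apply: eq_bigr => i _; rewrite Ik// lebesgue_measure_itv/= lte_fin jump_timeS.
  by rewrite ltrDl tau0 -EFinD /= addrC addKr.
rewrite lebesgue_measure_itv/= lte_fin; case: ifPn => [_|]; first by rewrite -EFinD.
rewrite -leNgt => h; have -> : t = S_ n w by apply/le_anti; rewrite h tn.
by rewrite subrr.
Qed.

Lemma nneseries_single (f : nat -> \bar R) n : (forall k, k != n -> f k = 0%E) ->
  (\sum_(0 <= k <oo) f k = f n)%E.
Proof.
move=> f0; apply/cvg_lim => //; apply: cvg_near_cst; exists n.+1 => // k /= nk.
by rewrite big_mkord (bigD1 (Ordinal nk)) //= big1 ?adde0// => i hi; exact: f0.
Qed.

(** For a given path exactly one term of the series is nonzero, the one whose index is the number of
    jumps made by time [t]. *)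
Lemma path_expansion w t : (forall k, 0 < tau k w) -> 0 <= t ->
  (exists i, t < tau i w) ->
  (expR (Rintegral leb `[0, t] (fun s => xi (walk tau eps s w))) *
     (walk tau eps t w == z)%:R)%:E =
  (\sum_(0 <= j <oo) (path_weight tau eps xi z j 0 t 0 w)%:E)%E.
Proof.
move=> tau0 t0 ex; have [n hn] := jump_time_cover tau0 t0 ex.
have pE j : path_weight tau eps xi z j 0 t 0 w = (S_ j w <= t < S_ j.+1 w)%R%:R *
    expR (\sum_(i < j) xi (X_ i w) * tau i w + xi (X_ j w) * (t - S_ j w)) *
    (X_ j w == z)%:R.
  rewrite (@path_weightE _ _ _ _ _ (X_ ^~ w) tau0)//.
  by move=> k; rewrite add0r.
rewrite (@nneseries_single _ n); last first.
  move=> k kn; rewrite pE; case: (boolP (_ <= t < _)) => [hk|_]; last by rewrite !mul0r.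
  by move: kn; rewrite (jump_time_inj tau0 hk hn) eqxx.
by rewrite pE hn mul1r (path_action tau0 t0 hn) (walkE tau0 hn).
Qed.

Hypothesis mtau : forall k, measT (tau k).
Hypothesis meps : forall k, measurable [set w | eps k w].
Hypothesis tau_tail : forall k (x : R), 0 <= x ->
  Q [set w | x < tau k w] = (expR (- (2 * x)))%:E.
Hypothesis eps_half : forall k, Q [set w | eps k w] = (1 / 2)%:E.
Hypothesis indep : mutually_indep Q (rv_family tau eps).

Let mtau_gt k (x : R) : measurable [set w | x < tau k w].
Proof.
rewrite (_ : mkset _ = tau k @^-1` `]x, +oo[%classic); last first.
  by apply/seteqP; split => w /=; rewrite in_itv/= andbT.
by rewrite -[Y in measurable Y]setTI; exact: mtau.
Qed.

Let tau_pos0 : Q (~` [set w | forall k, 0 < tau k w]) = 0%E.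
Proof.
rewrite (_ : ~` _ = \bigcup_k ~` [set w | 0 < tau k w]); last first.
  apply/seteqP; split => [w /= /existsNP[k hk]|w [k _ /= hk] h]; first by exists k.
  by apply: hk; exact: h.
apply/eqP; rewrite -measure_le0.
apply: (le_trans (generalized_Boole_inequality Q _ _)).
- by move=> k; exact: measurableC.
- by apply: bigcupT_measurable => k; exact: measurableC.
rewrite eseries0// => k _ _.
suff h : Q (~` [set w | 0 < tau k w]) = 0%E by exact: h.
by rewrite (probability_setC Q (mtau_gt k 0)) tau_tail// mulr0 oppr0 expR0 subee.
Qed.

(** This excludes infinitely many jumps before [t]: some single holding time exceeds [t], since the
    first [n] all fail with probability [q ^+ n], where [q < 1]. *)
Let tau_large0 t : 0 <= t -> Q (~` [set w | exists i, t < tau i w]) = 0%E.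
Proof.
move=> t0; set A := ~` _.
have mA : measurable A.
  apply: measurableC; rewrite (_ : mkset _ = \bigcup_i [set w | t < tau i w]).
    exact: bigcupT_measurable.
  by apply/seteqP; split => w [i]; [exists i|move=> _ h; exists i].
pose q := 1 - expR (- (2 * t)).
have q01 : 0 <= q < 1.
  by rewrite subr_ge0 expR_le1 oppr_le0 mulr_ge0//= ltrBlDr ltrDl expR_gt0.
have bound n : (Q A <= (q ^+ n)%:E)%E.
  pose s := [seq inl i | i <- iota 0 n] : seq (nat + nat).
  pose F (i : nat + nat) : set T := match i with inl k => ~` [set w | t < tau k w] | inr k => setT end.
  have -> : (q ^+ n)%:E = Q (\bigcap_(i in [set` s]) F i).
    rewrite (indep (A := F)).
    - rewrite /s big_map (eq_bigr (fun=> q%:E)); last first.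
        by move=> i _; rewrite /= (probability_setC Q (mtau_gt i t)) tau_tail.
      rewrite big_const_seq count_predT size_iota.
      by elim: n {s} => //= k <-; rewrite exprS EFinM.
    - by rewrite map_inj_uniq ?iota_uniq// => i j [].
    - move=> i /mapP[k _ ->] /=; exists (~` `]t, +oo[%classic); split.
        exact: measurableC.
      by apply/seteqP; split => w /=; rewrite in_itv/= andbT.
  apply: le_measure; rewrite ?inE//.
    by apply: (@cylinders_meas _ T _ (rv_family tau eps) (rv_family_meas mtau meps) predT);
      exists s, F; split => //; [by rewrite map_inj_uniq ?iota_uniq// => i j [] | move=> i /mapP[k _ ->] /=;
      exists (~` `]t, +oo[%classic); split; [exact: measurableC |
      by apply/seteqP; split => w /=; rewrite in_itv/= andbT]].
  move=> w /= hw i /mapP[k _ ->] /= hk; apply: hw; by exists k.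
have Qfin : Q A \is a fin_num.
  by rewrite ge0_fin_numE// (le_lt_trans (probability_le1 Q mA)) ?ltry.
have /andP[q0 q1] := q01.
have cq : (fun n => q ^+ n) @ \oo --> (0 : R) by apply: cvg_expr; rewrite ger0_norm.
suff h : (Q A <= 0)%E by apply/eqP; rewrite eq_le h measure_ge0.
rewrite -(fineK Qfin) lee_fin -(cvg_lim _ cq)//.
apply: limr_ge; first by apply/cvg_ex; exists 0.
by apply: nearW => n; rewrite -lee_fin fineK.
Qed.

(** Off a null set the integrand of [pam_u] is the series of path weights, which are measurable and
    nonnegative; monotonicity of the integral for arbitrary functions permits the exchange, after
    which sum and integral commute. *)
Theorem feynman_kac t : 0 <= t ->
  pam_u Q tau eps xi t z = fine (\sum_(0 <= j <oo) (fk predT xi z j t 0)%:E)%E.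
Proof.
move=> t0; rewrite /pam_u; congr fine.
pose A := [set w | forall k, 0 < tau k w] `&` [set w | exists i, t < tau i w].
have mA1 : measurable [set w | forall k, 0 < tau k w].
  rewrite (_ : mkset _ = \bigcap_k [set w | 0 < tau k w]).
    exact: bigcapT_measurable.
  apply/seteqP; split => w h k; [by move=> _; exact: h | exact: (h k Logic.I)].
have mA2 : measurable [set w | exists i, t < tau i w].
  rewrite (_ : mkset _ = \bigcup_i [set w | t < tau i w]).
    exact: bigcupT_measurable.
  by apply/seteqP; split => w [i]; [exists i|move=> _ h; exists i].
have mA : measurable A by exact: measurableI.
have QA : Q (~` A) = 0%E.
  rewrite setCI; apply/eqP; rewrite -measure_le0.
  apply: (le_trans (measureU2 _ _ _)); try exact: measurableC.
  by rewrite [X in (X + _ <= _)%E]tau_pos0 [X in (_ + X <= _)%E]tau_large0// adde0.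
rewrite (@conull_eq_integral _ _ _ Q A _
  (fun w => \sum_(0 <= j <oo) (path_weight tau eps xi z j 0 t 0 w)%:E)%E)//.
- have bp j : bmeas (path_weight tau eps xi z j 0 t 0 : T -> R).
    exact: (fam_bmeas (rv_family_meas mtau meps) (path_weight_bmeas tau eps xi z j 0 t 0)).
  rewrite integral_nneseries//.
  + apply: eq_eseriesr => j _; rewrite -EFin_Rintegral_prob//.
    by rewrite (path_integral _ _ mtau meps).
  + by move=> j; apply/measurable_EFinP; case: (bp j).
  + by move=> j w _; rewrite lee_fin path_weight_ge0.
- by move=> w; apply: nneseries_ge0 => j _ _; rewrite lee_fin path_weight_ge0.
- by move=> w [tau0 ex]; exact: path_expansion.
Qed.

End FeynmanKac.

(** * Continued fractions and explicit profiles on a box around the peak *)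

Section ContinuedFraction.
Context {R : realType}.
Implicit Types (a b : nat -> R).

Fixpoint cfrac a (k i : nat) : R :=
  if k is k'.+1 then (a i - cfrac a k' i.+1)^-1 else 0.

(* [psi a l i] is the ratio v(i) / v(i - 1) of the decaying solution of
   v(i + 1) + v(i - 1) = a(i) v(i) that vanishes at l + 1. *)
Definition psi a l i : R := cfrac a (l.+1 - i) i.

Lemma psi_out a l i : (l < i)%N -> psi a l i = 0.
Proof. by rewrite /psi -subn_eq0 => /eqP ->. Qed.

Lemma psiE a l i : (i <= l)%N -> psi a l i = (a i - psi a l i.+1)^-1.
Proof. by move=> il; rewrite /psi subSn//= subSS. Qed.

Lemma psi_ind (P : nat -> Prop) l : (forall i, (l < i)%N -> P i) ->
  (forall i, (0 < i <= l)%N -> P i.+1 -> P i) -> forall i, (0 < i)%N -> P i.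
Proof.
move=> H0 H1 i; move e : (l.+1 - i)%N => k; elim: k i e => [|k IH] i e i0.
  by apply: H0; rewrite -subn_eq0 e.
by apply: H1; [lia | apply: IH; lia].
Qed.

Variables (G : R) (l : nat).
Hypothesis G4 : 4 <= G.
Let G0 : 0 < G. Proof. by have h := G4; lra. Qed.

Definition gapped a := forall i, (0 < i <= l)%N -> G <= a i.

Lemma gap_half x p : G <= x -> 0 <= p <= 2 / G -> G / 2 <= x - p.
Proof.
have h := G4; have h0 := G0; move=> Gx /andP[_ p2].
have : 2 / G <= G / 2 by rewrite ler_pdivrMr//; nra.
by lra.
Qed.

Lemma psi_bounds a i : gapped a -> (0 < i)%N -> 0 <= psi a l i <= 2 / G.
Proof.
move=> ga; move: i; apply: (@psi_ind _ l) => i h.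
  by rewrite psi_out// lexx divr_ge0// ltW.
move=> IH; rewrite psiE; last by case/andP: h.
have h1 := gap_half (ga i h) IH; have h0 := G0.
have p0 : 0 < a i - psi a l i.+1 by apply: lt_le_trans h1; lra.
rewrite invr_ge0 (ltW p0)/= -[2 / G]invf_div lef_pV2//; by rewrite posrE; lra.
Qed.

Lemma psi_gt0 a i : gapped a -> (0 < i <= l)%N -> 0 < psi a l i.
Proof.
move=> ga h; rewrite psiE; last by case/andP: h.
have h1 := gap_half (ga i h) (psi_bounds (i := i.+1) ga isT); have h0 := G0.
by rewrite invr_gt0; apply: lt_le_trans h1; lra.
Qed.

(** Both denominators are at least [G / 2], so one level of the continued fraction contracts
    differences by [4 / G ^+ 2], which is at most 1/4. The three stability estimates that follow are
    this contraction iterated in the sup norm, over a stretch of agreement, and in the l1 norm. *)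
Lemma psi_diff a b i : gapped a -> gapped b -> (0 < i <= l)%N ->
  `|psi a l i - psi b l i| <=
  4 / G ^+ 2 * (`|a i - b i| + `|psi a l i.+1 - psi b l i.+1|).
Proof.
move=> ga gb h; have h0 := G0; have /andP[_ il] := h.
rewrite (psiE a il) (psiE b il).
have ha := gap_half (ga i h) (psi_bounds (i := i.+1) ga isT).
have hb := gap_half (gb i h) (psi_bounds (i := i.+1) gb isT).
set p := a i - _; set q := b i - _.
have p0 : 0 < p by apply: lt_le_trans ha; lra.
have q0 : 0 < q by apply: lt_le_trans hb; lra.
have -> : p^-1 - q^-1 = (q - p) / (p * q) by field; rewrite !gt_eqF.
rewrite normrM normfV (gtr0_norm (mulr_gt0 p0 q0)) mulrC; apply: ler_pM => //.
- by rewrite invr_ge0 ltW// mulr_gt0.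
- have -> : 4 / G ^+ 2 = (G / 2 * (G / 2))^-1 by field; rewrite gt_eqF.
  by rewrite lef_pV2 ?posrE ?mulr_gt0 ?divr_gt0//; apply: ler_pM => //; lra.
- rewrite (_ : q - p = (b i - a i) + (psi a l i.+1 - psi b l i.+1)); last by rewrite /p /q; ring.
  by apply: (le_trans (ler_normD _ _)); rewrite (distrC (b i)).
Qed.

Lemma contraction_le : 4 / G ^+ 2 <= 1 / 4.
Proof.
have h := G4; have h0 := G0; rewrite ler_pdivrMr ?exprn_gt0//; nra.
Qed.

Lemma psi_lipschitz a b e i : gapped a -> gapped b -> (0 < i)%N ->
  (forall j, (0 < j <= l)%N -> `|a j - b j| <= e) -> 0 <= e ->
  `|psi a l i - psi b l i| <= 8 / G ^+ 2 * e.
Proof.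
move=> ga gb i0 hab e0; move: i i0; have c := contraction_le; have h0 := G0.
have k0 : 0 <= 4 / G ^+ 2 by rewrite divr_ge0// exprn_ge0// ltW.
apply: (@psi_ind _ l) => i h.
  by rewrite !psi_out// subrr normr0 mulr_ge0// divr_ge0// exprn_ge0// ltW.
move=> IH; apply: (le_trans (psi_diff ga gb h)).
have -> : 8 / G ^+ 2 * e = 4 / G ^+ 2 * (e + e) by ring.
apply: ler_wpM2l => //; apply: lerD; first exact: hab.
apply: (le_trans IH); rewrite (_ : 8 / G ^+ 2 = 4 / G ^+ 2 + 4 / G ^+ 2); last by field; rewrite gt_eqF.
by rewrite -[leRHS]mul1r ler_wpM2r//; lra.
Qed.

(** Each site of agreement brings one contraction, and the a priori size [2 / G] ends the recursion.
    It is the source of the locality of the level of a peak. *)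
Lemma psi_local a b k i : gapped a -> gapped b -> (0 < i)%N ->
  (forall j, (i <= j < i + k)%N -> a j = b j) ->
  `|psi a l i - psi b l i| <= (4 / G ^+ 2) ^+ k * (2 / G).
Proof.
move=> ga gb; elim: k i => [|k IH] i i0 hab.
  rewrite expr0 mul1r.
  have /andP[h1 h2] := psi_bounds ga i0; have /andP[h3 h4] := psi_bounds gb i0.
  by rewrite ler_norml; apply/andP; split; lra.
have h0 := G0; have k0 : 0 <= 4 / G ^+ 2 by rewrite divr_ge0// exprn_ge0// ltW.
have [il|il] := leqP i l; last first.
  by rewrite !psi_out// subrr normr0 mulr_ge0 ?exprn_ge0// divr_ge0// ltW.
apply: (le_trans (psi_diff ga gb _)); first by rewrite i0.
rewrite hab; last by lia.
rewrite subrr normr0 add0r [_ ^+ k.+1]exprS -[leRHS]mulrA; apply: ler_wpM2l => //; apply: IH => // j hj; apply: hab; lia.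
Qed.

(** Summing the one-step estimate, the shifted sum on the right is at most the sum on the left
    ([psi] vanishes beyond [l]) and is absorbed as its factor is at most 1/4. The cost is the l1
    distance of the coefficients and not [l] times their sup distance. *)
Lemma psi_diff_sum a b : gapped a -> gapped b ->
  \sum_(1 <= i < l.+1) `|psi a l i.+1 - psi b l i.+1| <=
  8 / G ^+ 2 * \sum_(1 <= i < l.+1) `|a i - b i|.
Proof.
move=> ga gb; have h0 := G0; have c := contraction_le.
have k0 : 0 <= 4 / G ^+ 2 by rewrite divr_ge0// exprn_ge0// ltW.
set D := \sum_(1 <= i < l.+1) `|a i - b i|.
have D0 : 0 <= D by apply: sumr_ge0.
pose s i := `|psi a l i - psi b l i|.
have s0 i : 0 <= s i by exact: normr_ge0.
pose S := \sum_(1 <= i < l.+1) s i.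
have S'S : \sum_(1 <= i < l.+1) s i.+1 <= S.
  have e1 : \sum_(2 <= i < l.+2) s i = \sum_(1 <= i < l.+1) s i.+1 by rewrite big_add1.
  have e2 : \sum_(1 <= i < l.+2) s i = s 1%N + \sum_(2 <= i < l.+2) s i by rewrite big_ltn.
  have e3 : \sum_(1 <= i < l.+2) s i = S + s l.+1 by rewrite big_nat_recr.
  have e4 : s l.+1 = 0 by rewrite /s !psi_out// subrr normr0.
  by have := s0 1%N; lra.
have SD : S <= 4 / G ^+ 2 * (D + \sum_(1 <= i < l.+1) s i.+1).
  rewrite /S /D -big_split mulr_sumr /=; apply: ler_sum_nat => i hi; exact: psi_diff.
apply: (le_trans S'S); have S0 : 0 <= S by apply: sumr_ge0.
rewrite (_ : 8 / G ^+ 2 = 2 * (4 / G ^+ 2)); last by field; rewrite gt_eqF.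
set S2 := \sum_(1 <= i < l.+1) s i.+1 in S'S SD.
move: k0 c SD; set q := 4 / G ^+ 2 => k0 c SD.
have h1 : q * S2 <= q * S by apply: ler_wpM2l.
have h2 : q * S <= S / 4 by nra.
by nra.
Qed.

Lemma psi_anti a b i : gapped a -> (forall j, (0 < j <= l)%N -> a j <= b j) ->
  (0 < i)%N -> psi b l i <= psi a l i.
Proof.
move=> ga hab; have gb : gapped b by move=> j hj; apply: le_trans (ga j hj) (hab j hj).
move: i; apply: (@psi_ind _ l) => i h; first by rewrite !psi_out.
move=> IH; have /andP[_ il] := h; rewrite (psiE a il) (psiE b il).
have h0 := G0.
have ha := gap_half (ga i h) (psi_bounds (i := i.+1) ga isT).
have hb := gap_half (gb i h) (psi_bounds (i := i.+1) gb isT).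
rewrite lef_pV2 ?posrE; [|by lra|by lra].
by apply: lerB => //; exact: hab.
Qed.

Definition arm a (k : nat) : R := \prod_(1 <= i < k.+1) psi a l i.

Lemma arm0 a : arm a 0 = 1. Proof. by rewrite /arm big_geq. Qed.

Lemma armS a k : arm a k.+1 = arm a k * psi a l k.+1.
Proof. by rewrite /arm big_nat_recr. Qed.

Lemma arm_out a k : (l < k)%N -> arm a k = 0.
Proof. by case: k => // k lk; rewrite armS psi_out// mulr0. Qed.

Lemma arm_ge0 a k : gapped a -> 0 <= arm a k.
Proof.
by move=> ga; elim: k => [|k IH]; rewrite ?arm0// armS mulr_ge0//; case/andP: (psi_bounds (i := k.+1) ga isT).
Qed.

Lemma arm_gt0 a k : gapped a -> (k <= l)%N -> 0 < arm a k.
Proof.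
by move=> ga; elim: k => [|k IH] kl; rewrite ?arm0// armS mulr_gt0 ?IH ?psi_gt0// ltnW.
Qed.

Lemma arm_le1 a k : gapped a -> arm a k <= 1.
Proof.
move=> ga; elim: k => [|k IH]; rewrite ?arm0// armS -[leRHS]mulr1.
have /andP[h1 h2] := psi_bounds (i := k.+1) ga isT; apply: ler_pM => //; first exact: arm_ge0.
by apply: (le_trans h2); have h := G4; rewrite ler_pdivrMr//; lra.
Qed.

Lemma arm_eq a k : gapped a -> (0 < k <= l)%N ->
  arm a k.+1 + arm a k.-1 = a k * arm a k.
Proof.
case: k => // k ga h /=; rewrite !armS.
have p0 := psi_gt0 ga h.
have e : psi a l k.+1 * (a k.+1 - psi a l k.+2) = 1.
  by move: p0; rewrite psiE// invr_gt0 => p0; rewrite mulVf// gt_eqF.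
rewrite -{2}[arm a k]mulr1 -e; ring.
Qed.

Lemma arm_anti a b k : gapped a -> (forall j, (0 < j <= l)%N -> a j <= b j) ->
  arm b k <= arm a k.
Proof.
move=> ga hab; have gb : gapped b by move=> j hj; apply: le_trans (ga j hj) (hab j hj).
elim: k => [|k IH]; rewrite ?arm0// !armS; apply: ler_pM => //; first exact: arm_ge0.
  by case/andP: (psi_bounds (i := k.+1) gb isT).
exact: psi_anti.
Qed.

End ContinuedFraction.

Section BoxEigenfunction.
Context {R : realType}.
Variables (xi : int -> R) (z : int) (l m : nat).

Definition box : pred int := fun x => (z - l%:Z <= x <= z + m%:Z).
Definition lcoef (L : R) (i : nat) : R := L - xi (z - i%:Z).
Definition rcoef (L : R) (i : nat) : R := L - xi (z + i%:Z).

(** The solution [v] of v(x + 1) + v(x - 1) = (L - xi x) v(x) off the peak that is 1 at the peak and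
    0 outside the box. At the peak itself the equation holds exactly when [L] solves the level
    equation. *)
Definition profile (L : R) (x : int) : R :=
  if x <= z then arm l (lcoef L) `|(z - x)%R| else arm m (rcoef L) `|(x - z)%R|.

Definition peak_sum (L : R) : R := psi (lcoef L) l 1 + psi (rcoef L) m 1.

Definition gap_level (G L : R) := forall x, box x -> x != z -> G <= L - xi x.

Lemma gap_left G L : gap_level G L -> gapped G l (lcoef L).
Proof. by move=> g i hi; apply: g; rewrite /box; lia. Qed.

Lemma gap_right G L : gap_level G L -> gapped G m (rcoef L).
Proof. by move=> g i hi; apply: g; rewrite /box; lia. Qed.

Lemma profile_peak L : profile L z = 1.
Proof. by rewrite /profile lexx subrr arm0. Qed.

Lemma profile_out L x : ~~ box x -> profile L x = 0.
Proof.
by rewrite /profile /box => h; case: ifP => xz; rewrite arm_out//; lia.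
Qed.

Lemma profile_neighbours L : profile L (z + 1) + profile L (z - 1) = peak_sum L.
Proof.
rewrite /profile /peak_sum addrC.
have -> : (z + 1 <= z) = false by lia.
have -> : z - 1 <= z by lia.
have -> : `|(z - (z - 1))%R|%N = 1%N by lia.
have -> : `|(z + 1 - z)%R|%N = 1%N by lia.
by rewrite !armS !arm0 !mul1r.
Qed.

Variable G : R.
Hypothesis G4 : 4 <= G.

Lemma profile_ge0 L x : gap_level G L -> 0 <= profile L x.
Proof.
by move=> g; rewrite /profile; case: ifP => _;
  [exact: (arm_ge0 G4 _ (gap_left g))|exact: (arm_ge0 G4 _ (gap_right g))].
Qed.

Lemma profile_le1 L x : gap_level G L -> profile L x <= 1.
Proof.
by move=> g; rewrite /profile; case: ifP => _;
  [exact: (arm_le1 G4 _ (gap_left g))|exact: (arm_le1 G4 _ (gap_right g))].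
Qed.

Lemma profile_anti L L' x : gap_level G L -> L <= L' -> profile L' x <= profile L x.
Proof.
move=> g LL'; rewrite /profile; case: ifP => _.
  by apply: (arm_anti G4 _ (gap_left g)) => j _; rewrite lerD2r.
by apply: (arm_anti G4 _ (gap_right g)) => j _; rewrite lerD2r.
Qed.

Lemma profile_eq L x : gap_level G L -> box x -> x != z ->
  profile L (x + 1) + profile L (x - 1) = (L - xi x) * profile L x.
Proof.
move=> g Bx xz; rewrite /profile; have [h|h] := ltrP x z.
  have -> : x + 1 <= z by lia.
  have -> : x - 1 <= z by lia.
  rewrite (ltW h); set k := `|(z - x)%R|%N.
  have -> : `|(z - (x + 1))%R|%N = k.-1 by rewrite /k; lia.
  have -> : `|(z - (x - 1))%R|%N = k.+1 by rewrite /k; lia.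
  rewrite addrC (arm_eq G4 (gap_left g)); last by move: Bx; rewrite /box /k; lia.
  by rewrite /lcoef; congr ((_ - xi _) * _); rewrite /k; lia.
have {}h : z < x by move: xz; lia.
have -> : (x + 1 <= z) = false by lia.
have -> : (x <= z) = false by lia.
set k := `|(x - z)%R|%N.
have e1 : `|(x + 1 - z)%R|%N = k.+1 by rewrite /k; lia.
rewrite e1; have -> : (if x - 1 <= z then arm l (lcoef L) `|(z - (x - 1))%R|
    else arm m (rcoef L) `|(x - 1 - z)%R|) = arm m (rcoef L) k.-1.
  case: ifP => h'.
    have -> : `|(z - (x - 1))%R|%N = 0%N by lia.
    have -> : k.-1 = 0%N by rewrite /k; lia.
    by rewrite !arm0.
  by congr (arm _ _ _); rewrite /k; lia.
rewrite (arm_eq G4 (gap_right g)); last by move: Bx; rewrite /box /k; lia.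
by rewrite /rcoef; congr ((_ - xi _) * _); rewrite /k; lia.
Qed.

Lemma peak_sum_bounds L : gap_level G L -> 0 <= peak_sum L <= 4 / G.
Proof.
move=> g; have /andP[h1 h2] := psi_bounds G4 (i := 1) (gap_left g) isT.
have /andP[h3 h4] := psi_bounds G4 (i := 1) (gap_right g) isT.
rewrite /peak_sum addr_ge0//=; have -> : 4 / G = 2 / G + 2 / G by ring.
exact: lerD.
Qed.

Lemma is_derive_expRM (c k s : R) :
  is_derive s 1 (fun s => k * expR (c * s)) (k * (c * expR (c * s))).
Proof. by apply: is_derive_eq; rewrite /GRing.scale /=; ring. Qed.

(** The profile solves the recurrence off the peak; the additional rate [e] pays for the defect of
    the level equation at the peak, so an approximate level is enough. *)
Lemma box_upper L e J t x : gap_level G L -> 0 <= e -> peak_sum L <= L + e - xi z ->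
  0 <= t -> fksum box xi z J t x <= expR ((L - 2 + e) * t) * profile L x.
Proof.
move=> g e0 hp t0.
apply: (@fksum_supersolution _ _ _ _ (fun s x => expR ((L - 2 + e) * s) * profile L x)
  (fun s x => (L - 2 + e) * expR ((L - 2 + e) * s) * profile L x)) => //.
- move=> y s; have := is_derive_expRM (L - 2 + e) (profile L y) s.
  rewrite (_ : (fun s => _) = (fun s => expR ((L - 2 + e) * s) * profile L y)).
    by congr is_derive; ring.
  by apply/funext => u; rewrite mulrC.
- move=> y s; apply: cvgM; last exact: cvg_cst.
  by apply: cvgM; [exact: cvg_cst|exact: expRM_continuous].
- move=> y s By _; rewrite -mulrDr; set E := expR _.
  have -> : (L - 2 + e) * E * profile L y - (xi y - 2) * (E * profile L y) =
    E * ((L + e - xi y) * profile L y) by ring.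
  rewrite ler_wpM2l ?expR_ge0//; have [->|yz] := eqVneq y z.
    by rewrite profile_neighbours profile_peak mulr1.
  rewrite profile_eq//; apply: ler_wpM2r; first exact: profile_ge0.
  by lra.
- by move=> y s _; rewrite mulr_ge0 ?expR_ge0 ?profile_ge0.
- move=> y; rewrite mulr0 expR0 mul1r; have [->|yz] := eqVneq y z.
    by rewrite profile_peak.
  exact: profile_ge0.
Qed.

End BoxEigenfunction.

Section BoxLowerBound.
Context {R : realType}.
Variables (xi : int -> R) (z : int) (l m : nat) (G : R).
Hypothesis G8 : 8 <= G.
Local Notation Bx := (box z l m).
Local Notation v_ := (profile xi z l m).
Local Notation psum := (peak_sum xi z l m).
Local Notation glevel := (gap_level xi z l m).

Lemma gap_level_half L : glevel G L -> glevel (G / 2) (L - G / 2).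
Proof. by move=> g x Bx xz; have := g x Bx xz; lra. Qed.

Lemma poisson_weight_cvg0 (M t : R) : poisson_weight M ^~ t @ \oo --> (0 : R).
Proof.
rewrite /poisson_weight -(mulr0 (expR (M * t))); apply: cvgM; first exact: cvg_cst.
exact: (cvg_series_cvg_0 (is_cvg_series_exp_coeff (2 * t))).
Qed.

(* The subsolution vanishes outside the box, equals [1] at the peak at time
   [0], and is negative elsewhere at time [0]; the exponentials at rate
   [L - 2 - G / 2] absorb the part of the initial datum that is orthogonal to
   the principal eigenfunction. *)
Lemma box_lower L e t x S : glevel G L -> 0 <= e <= G / 4 ->
  L - e - xi z <= psum L -> 0 <= t -> x != z ->
  (forall J, fksum Bx xi z J t x <= S) ->
  (1 - 32 / G ^+ 2) * (expR ((L - 2 - e) * t) * v_ L x) -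
  expR ((L - 2 - G / 2) * t) * v_ (L - G / 2) x <= S.
Proof.
have z1 : (z + 1 == z) = false by clear; lia.
have z2 : (z - 1 == z) = false by clear; lia.
have zB : Bx z by clear; rewrite /box; lia.
move=> g /andP[e0 eG] hp t0 xz hS; have h8 := G8.
have G4 : 4 <= G by lra. have G4' : 4 <= G / 2 by lra. have G0 : 0 < G by lra.
have g' := gap_level_half g.
(* Chosen so that [c * (G / 4) = 8 / G], which bounds the peak sum at the lowered level [L']; this
   is what the inequality at the peak requires. *)
set c := 32 / G ^+ 2; have c0 : 0 <= c by rewrite divr_ge0// exprn_ge0// ltW.
have c1 : c <= 1 by rewrite /c ler_pdivrMr ?exprn_gt0//; nra.
set L' := L - G / 2; set l1 := L - 2 - e; set l2 := L - 2 - G / 2.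
(* Profiles decrease in the level, so at the lower level [L'] this dominates the profile at [L] off
   the peak and makes the initial value nonpositive there. *)
pose w y := if y == z then 0 else v_ L' y.
pose A y := (1 - c) * v_ L y; pose C y := c * v_ L y - w y.
pose V s y := A y * expR (l1 * s) + C y * expR (l2 * s).
pose V' s y := A y * (l1 * expR (l1 * s)) + C y * (l2 * expR (l2 * s)).
pose M := `|L| + `|xi z|.
have M0 : 0 <= M by rewrite addr_ge0.
have Lle : L <= M by rewrite /M (le_trans (ler_norm L))// lerDl.
have xzle : xi z <= M by rewrite /M (le_trans (ler_norm (xi z)))// lerDr.
have w0 y : 0 <= w y by rewrite /w; case: eqP => // _; exact: (profile_ge0 G4' _ g').
have v0 y : 0 <= v_ L y by exact: (profile_ge0 G4 _ g).
have v1 y : v_ L y <= 1 by exact: (profile_le1 G4 _ g).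
have wle y : w y <= v_ L' y.
  by rewrite /w; case: eqP => // _; exact: (profile_ge0 G4' _ g').
have key J : V t x <= fksum Bx xi z J t x + 1 * poisson_weight M J t.
  apply: (@fksum_subsolution _ _ _ _ V V' 1 M) => //.
  - move=> y s; apply: is_deriveD; exact: is_derive_expRM.
  - move=> y s; apply: cvgD; apply: cvgM; do ?exact: cvg_cst;
      apply: cvgM; do ?exact: cvg_cst; exact: expRM_continuous.
  - move=> y s By _; rewrite /V /V'; set E1 := expR (l1 * s); set E2 := expR (l2 * s).
    have E10 : 0 <= E1 by exact: expR_ge0.
    have E20 : 0 <= E2 by exact: expR_ge0.
    have -> : A y * (l1 * E1) + C y * (l2 * E2) - (xi y - 2) * (A y * E1 + C y * E2) =
      (l1 + 2 - xi y) * A y * E1 + (l2 + 2 - xi y) * C y * E2 by ring.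
    have -> : A (y + 1) * E1 + C (y + 1) * E2 + (A (y - 1) * E1 + C (y - 1) * E2) =
      (A (y + 1) + A (y - 1)) * E1 + (C (y + 1) + C (y - 1)) * E2 by ring.
    have -> : A (y + 1) + A (y - 1) = (1 - c) * (v_ L (y + 1) + v_ L (y - 1)).
      by rewrite /A; ring.
    have -> : C (y + 1) + C (y - 1) =
      c * (v_ L (y + 1) + v_ L (y - 1)) - (w (y + 1) + w (y - 1)).
      by rewrite /C; ring.
    have [->|yz] := eqVneq y z.
      rewrite profile_neighbours /A /C profile_peak /w eqxx !mulr1 subr0.
      rewrite z1 z2 profile_neighbours.
      have /andP[_ ps'] := peak_sum_bounds G4' g'; have /andP[ps0 _] := peak_sum_bounds G4 g.
      have hc : 8 / G <= c * (G / 2 - e).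
        apply: (@le_trans _ _ (c * (G / 4))); last by apply: ler_wpM2l => //; lra.
        by rewrite /c; apply: eq_ler; field; rewrite gt_eqF.
      have ps2 : psum L' <= 8 / G.
        by apply: (le_trans ps'); apply: eq_ler; field; rewrite gt_eqF.
      apply: lerD; apply: ler_wpM2r => //.
        by rewrite mulrC; apply: ler_wpM2l; [lra | rewrite /l1; lra].
      have : (l2 + 2 - xi z) * c <= c * (psum L + e - G / 2).
        by rewrite mulrC; apply: ler_wpM2l => //; rewrite /l2; lra.
      by lra.
    rewrite (profile_eq G4 g By yz) /A /C {1}/w (negbTE yz).
    have hw : w (y + 1) + w (y - 1) <= (L' - xi y) * v_ L' y.
      by rewrite -(profile_eq G4' g' By yz); apply: lerD; exact: wle.
    apply: lerD; apply: ler_wpM2r => //.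
      rewrite mulrCA; apply: ler_wpM2l; first by lra.
      by apply: ler_wpM2r => //; rewrite /l1; lra.
    have : (l2 + 2 - xi y) * (c * v_ L y) <= c * ((L - xi y) * v_ L y).
      rewrite mulrCA; apply: ler_wpM2l => //; apply: ler_wpM2r => //; rewrite /l2; lra.
    have -> : l2 + 2 - xi y = L' - xi y by rewrite /l2 /L'; ring.
    by rewrite mulrBr; lra.
  - move=> y; rewrite /V !mulr0 expR0 !mulr1 /A /C /w; have [->|yz] := eqVneq y z.
      by rewrite profile_peak /=; apply: eq_ler; ring.
    have : v_ L y <= v_ L' y by apply: (profile_anti G4' _ g'); rewrite /L'; lra.
    by rewrite /=; lra.
  - move=> y By; have [->|yz] := eqVneq y z; first by lra.
    by have := g y By yz; lra.
  - move=> y s s0 By; rewrite mul1r /V.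
    have h1 : expR (l1 * s) <= expR (M * s) by rewrite ler_expR ler_wpM2r// /l1; lra.
    have h2 : expR (l2 * s) <= expR (M * s) by rewrite ler_expR ler_wpM2r// /l2; lra.
    have := w0 y; have := v0 y; have := v1 y; have h3 := expR_ge0 (l1 * s); have h4 := expR_ge0 (l2 * s).
    have h5 := expR_ge0 (M * s).
    move=> a1 a2 a3.
    have b1 : A y * expR (l1 * s) <= (1 - c) * expR (M * s).
      apply: ler_pM => //; first by rewrite mulr_ge0//; lra.
      by rewrite /A -[leRHS]mulr1 ler_wpM2l//; lra.
    have b2 : C y * expR (l2 * s) <= c * expR (M * s).
      apply: (@le_trans _ _ (c * expR (l2 * s))); last exact: ler_wpM2l.
      apply: ler_wpM2r => //; rewrite /C.
      have : c * v_ L y <= c * 1 by apply: ler_wpM2l.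
      by lra.
    by lra.
  - move=> y s s0 By; have yz : y != z.
      by apply: contraNneq By => ->.
    by rewrite /V /A /C /w (negbTE yz) !profile_out// !(mulr0, mul0r, subrr, addr0).
apply: (@le_trans _ _ (V t x)).
  rewrite /V /A /C /w (negbTE xz) mulrBl -/c -/L' -/l1 -/l2.
  have : 0 <= c * v_ L x * expR (l2 * t).
    by apply: mulr_ge0; [exact: mulr_ge0 | exact: expR_ge0].
  set a := expR (l1 * t); set b := expR (l2 * t); lra.
(* The Poisson error of the comparison disappears as the number of jumps grows. *)
have cv : (fun J => S + poisson_weight M J t) @ \oo --> S.
  by rewrite -[X in _ --> X]addr0; apply: cvgD; [exact: cvg_cst|exact: poisson_weight_cvg0].
rewrite -(cvg_lim _ cv)//; apply: limr_ge; first by apply/cvg_ex; exists S.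
by apply: nearW => J; apply: (le_trans (key J)); rewrite mul1r lerD2r.
Qed.

End BoxLowerBound.

(** * Size and logarithm of the arms *)

Section ArmEstimates.
Context {R : realType}.
Implicit Types a b : nat -> R.
Variables (G : R) (l : nat).
Hypothesis G8 : 8 <= G.
Let G4 : 4 <= G. Proof. have h := G8; lra. Qed.
Let G0 : 0 < G. Proof. have h := G8; lra. Qed.

(** Lowering the level by half the gap leaves at least a quarter of every denominator, so each ratio
    grows by a factor of at most 4. The resulting [4 ^+ k] will be beaten by the spectral gap over
    time. *)
Lemma arm_lowered a k : gapped G l a -> (k <= l)%N ->
  arm l (fun i => a i - G / 2) k <= 4 ^+ k * arm l a k.
Proof.
move=> ga; have h8 := G8; have h0 := G0; have G4' : 4 <= G / 2 by lra.
have ga' : gapped (G / 2) l (fun i => a i - G / 2).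
  by move=> i hi; have := ga i hi; lra.
elim: k => [|k IH] kl; first by rewrite !arm0 expr0 mulr1.
rewrite !armS exprS.
rewrite (_ : 4 * 4 ^+ k * (arm l a k * psi a l k.+1) = (4 ^+ k * arm l a k) * (4 * psi a l k.+1)); last by ring.
apply: ler_pM.
- exact: (arm_ge0 G4' _ ga').
- by case/andP: (psi_bounds G4' (i := k.+1) ga' isT).
- by apply: IH; exact: ltnW.
rewrite (psiE _ kl) (psiE a kl).
have hk : (0 < k.+1 <= l)%N by rewrite kl.
have /andP[p0 p1] := psi_bounds G4' (i := k.+2) ga' isT.
have q := psi_bounds G4 (i := k.+2) ga isT; have /andP[q0 q1] := q.
have ha := ga _ hk; have hb := gap_half G4 ha q.
have p2 : 2 / (G / 2) <= 1 / 2 by rewrite ler_pdivrMr; lra.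
set p := psi _ l k.+2 in p0 p1 *; set r := psi a l k.+2 in q0 q1 hb *.
rewrite -[4]invrK -invfM lef_pV2 ?posrE; [|by lra|by lra].
by lra.
Qed.

Lemma arm_lower a (C : R) k : gapped G l a -> (k <= l)%N ->
  (forall i, (0 < i <= k)%N -> a i <= C) -> C ^- k <= arm l a k.
Proof.
move=> ga; have h0 := G0; elim: k => [|k IH] kl aC; first by rewrite expr0 invr1 arm0.
rewrite exprS invfM mulrC armS.
have hk : (0 < k.+1 <= l)%N by rewrite kl.
have aC1 : a k.+1 <= C by apply: aC; rewrite leqnn.
have ha := ga _ hk.
have C0 : 0 < C by lra.
apply: ler_pM.
- by rewrite invr_ge0 exprn_ge0// ltW.
- by rewrite invr_ge0 ltW.
- by apply: IH; [exact: ltnW | move=> i hi; apply: aC; lia].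
rewrite (psiE a kl).
have q := psi_bounds G4 (i := k.+2) ga isT; have /andP[q0 q1] := q.
have hb := gap_half G4 ha q.
by rewrite lef_pV2 ?posrE; lra.
Qed.

Lemma ln_arm a k : gapped G l a -> (k <= l)%N ->
  ln (arm l a k) = - \sum_(1 <= i < k.+1) ln (a i - psi a l i.+1).
Proof.
move=> ga; elim: k => [|k IH] kl; first by rewrite arm0 ln1 big_geq ?oppr0.
have hk : (0 < k.+1 <= l)%N by rewrite kl.
have hb := gap_half G4 (ga _ hk) (psi_bounds G4 (i := k.+2) ga isT).
have h0 := G0.
rewrite armS lnM ?posrE; last 2 first.
- exact: (arm_gt0 G4 ga (ltnW kl)).
- exact: (psi_gt0 G4 ga hk).
rewrite IH ?(ltnW kl)// [in RHS]big_nat_recr//= opprD; congr (_ + _).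
by rewrite (psiE a kl) lnV// posrE; lra.
Qed.

Lemma ln_lipschitz (u v : R) : 1 / 2 <= u -> 1 / 2 <= v ->
  `|ln u - ln v| <= 2 * `|u - v|.
Proof.
have one (x y : R) : 1 / 2 <= x -> 1 / 2 <= y -> ln x - ln y <= 2 * `|x - y|.
  move=> hx hy; have x0 : 0 < x by lra. have y0 : 0 < y by lra.
  rewrite -ln_div ?posrE//.
  have xy0 : 0 < x / y by rewrite divr_gt0.
  have := expR_ge1Dx (ln (x / y)); rewrite lnK ?posrE// => h.
  apply: (@le_trans _ _ (x / y - 1)); first by lra.
  rewrite (_ : x / y - 1 = (x - y) / y); last by field; rewrite gt_eqF.
  rewrite ler_pdivrMr// (le_trans (ler_norm _))//.
  by have := normr_ge0 (x - y); nra.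
move=> hu hv; rewrite ler_norml lerNl opprB; apply/andP; split; last exact: one.
by rewrite (distrC u); exact: one.
Qed.

(** After factoring out [A] and [A'], what remains is ln(1 + p'/A') - ln(1 + p/A), which is
    Lipschitz in the quotients: a difference of the [p] gains a factor 1/G, and one of the [A] gains
    1/G^3 because [p] is itself of order 1/G. *)
Lemma ln_shift_diff (A A' p p' : R) : G <= A -> G <= A' ->
  `|p| <= 4 / G -> `|p'| <= 4 / G ->
  `|(ln (A' + p') - ln (A + p)) - (ln A' - ln A)| <=
  2 / G * `|p - p'| + 8 / G ^+ 3 * `|A - A'|.
Proof.
move=> hA hA' hp hp'; have h8 := G8; have h0 := G0.
have A0 : 0 < A by lra. have A'0 : 0 < A' by lra.
have G1 : 4 / G <= 1 / 2 by rewrite ler_pdivrMr//; lra.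
have small (B q : R) : G <= B -> `|q| <= 4 / G -> `|q / B| <= 1 / 2.
  move=> hB hq; have B0 : 0 < B by lra.
  by rewrite normrM normfV (gtr0_norm B0) ler_pdivrMr//; nra.
have fact (B q : R) : G <= B -> `|q| <= 4 / G -> ln (B + q) = ln B + ln (1 + q / B).
  move=> hB hq; have B0 : 0 < B by lra.
  have := small B q hB hq; rewrite ler_norml => /andP[s1 s2].
  rewrite -lnM ?posrE//; last by lra.
  by congr ln; field; rewrite gt_eqF.
rewrite (fact A' p')// (fact A p)//.
rewrite (_ : _ - _ - _ = ln (1 + p' / A') - ln (1 + p / A)); last by ring.
have := small A p hA hp; rewrite ler_norml => /andP[s1 s2].
have := small A' p' hA' hp'; rewrite ler_norml => /andP[s3 s4].
apply: (le_trans (ln_lipschitz _ _)); [by lra|by lra|].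
rewrite (_ : 1 + p' / A' - (1 + p / A) = (p' - p) / A' + p * ((A - A') / (A * A'))); last first.
  by field; rewrite !gt_eqF.
apply: (@le_trans _ _ (2 * (`|p - p'| / G + 4 / G * (`|A - A'| / (G * G))))).
  apply: ler_wpM2l => //; apply: (le_trans (ler_normD _ _)); apply: lerD.
    by rewrite normrM normfV (gtr0_norm A'0) distrC ler_wpM2l// lef_pV2 ?posrE.
  rewrite !normrM normfV (gtr0_norm (mulr_gt0 A0 A'0)); apply: ler_pM => //.
    by rewrite mulr_ge0// invr_ge0 ltW// mulr_gt0.
  apply: ler_wpM2l => //; rewrite lef_pV2 ?posrE ?mulr_gt0//.
  by apply: ler_pM => //; lra.
by apply: eq_ler; field; rewrite gt_eqF.
Qed.

(** Each [psi] is the reciprocal of a coefficient minus the next [psi]. The common shift [h] and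
    these corrections are of order 1/G, and the corrections vary with the coefficients only at order
    1/G^2; so the leading sum is left with an error of order 1/G^3 times the l1 distance, with 24 =
    2 * 8 + 8. *)
Lemma ln_arm_diff (A A' : nat -> R) h k : gapped G l A -> gapped G l A' ->
  0 <= h <= 4 / G -> (k <= l)%N ->
  `|ln (arm l (fun i => A i + h) k) - ln (arm l (fun i => A' i + h) k) -
    \sum_(1 <= i < k.+1) (ln (A' i) - ln (A i))| <=
  24 / G ^+ 3 * \sum_(1 <= i < l.+1) `|A i - A' i|.
Proof.
move=> gA gA' /andP[h0 h1] kl; have h8 := G8; have G00 := G0.
set a := fun i => A i + h; set b := fun i => A' i + h.
have ga : gapped G l a by move=> i hi; have := gA i hi; rewrite /a; lra.
have gb : gapped G l b by move=> i hi; have := gA' i hi; rewrite /b; lra.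
rewrite (_ : _ - _ - _ = \sum_(1 <= i < k.+1) (ln (b i - psi b l i.+1) -
  ln (a i - psi a l i.+1) - (ln (A' i) - ln (A i)))); last first.
  by rewrite !ln_arm// !sumrB; ring.
pose q i := 2 / G * `|psi a l i.+1 - psi b l i.+1| + 8 / G ^+ 3 * `|A i - A' i|.
have q0 i : 0 <= q i.
  by rewrite addr_ge0// mulr_ge0// divr_ge0// ?exprn_ge0// ltW.
apply: (@le_trans _ _ (\sum_(1 <= i < k.+1) q i)).
  apply: (le_trans (ler_norm_sum _ _ _)); apply: ler_sum_nat => i hi.
  have hil : (0 < i <= l)%N by lia.
  have /andP[p0 p1] := psi_bounds G4 (i := i.+1) ga isT.
  have /andP[p0' p1'] := psi_bounds G4 (i := i.+1) gb isT.
  have e2 : 2 / G <= 4 / G by rewrite ler_pM2r ?invr_gt0//; lra.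
  have hp : `|h - psi a l i.+1| <= 4 / G by rewrite ler_norml; apply/andP; split; lra.
  have hp' : `|h - psi b l i.+1| <= 4 / G by rewrite ler_norml; apply/andP; split; lra.
  have := ln_shift_diff (gA i hil) (gA' i hil) hp hp'.
  rewrite (_ : h - psi a l i.+1 - (h - psi b l i.+1) = - (psi a l i.+1 - psi b l i.+1)); last by ring.
  rewrite normrN /q; apply: le_trans.
  by apply: eq_ler; congr (`| _ |); rewrite /a /b !addrA; ring.
apply: (@le_trans _ _ (\sum_(1 <= i < l.+1) q i)).
  rewrite [leRHS](@big_cat_nat _ _ _ k.+1)//= lerDl; exact: sumr_ge0.
rewrite /q big_split -!mulr_sumr /=.
have hs := psi_diff_sum G4 ga gb.
have -> : \sum_(1 <= i < l.+1) `|A i - A' i| = \sum_(1 <= i < l.+1) `|a i - b i|.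
  by apply: eq_bigr => i _; congr (`| _ |); rewrite /a /b; ring.
set D := \sum_(1 <= i < l.+1) `|a i - b i| in hs *.
apply: (@le_trans _ _ (2 / G * (8 / G ^+ 2 * D) + 8 / G ^+ 3 * D)).
  by rewrite lerD2r; apply: ler_wpM2l => //; rewrite divr_ge0// ltW.
by apply: eq_ler; field; rewrite gt_eqF.
Qed.

End ArmEstimates.

(** * Comparison of a peak with its mirror image *)

Section SeriesBounds.
Context {R : realType}.

Lemma sum_geometric_le (tau : R) (N : nat) : 0 <= tau ->
  \sum_(j < N) tau / 2 ^+ j.+1 <= tau.
Proof.
move=> t0; have -> : \sum_(j < N) tau / 2 ^+ j.+1 = tau - tau / 2 ^+ N.
  elim: N => [|N IH]; first by rewrite big_ord0 expr0 divr1 subrr.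
  rewrite big_ord_recr /= IH exprS; field.
  by rewrite expf_neq0.
by rewrite gerBl divr_ge0// exprn_ge0.
Qed.

(** The weights 2^(- j - 1) make the whole tail cost at most [tau]. The bounds also show that the
    series is finite, so that [fine] does not fall back on its default value 0. *)
Lemma nneseries_tail_bounds (f : nat -> R) (J : nat) (S tau : R) :
  (forall j, 0 <= f j) -> 0 <= tau -> \sum_(j < J) f j <= S ->
  (forall j, (J <= j)%N -> f j <= tau / 2 ^+ j.+1) ->
  let U := fine (\sum_(0 <= j <oo) (f j)%:E)%E in
  (forall N, \sum_(j < N) f j <= U) /\ U <= S + tau.
Proof.
move=> f0 t0 fS ftail U.
have bound N : \sum_(j < N) f j <= S + tau.
  apply: (@le_trans _ _ (\sum_(j < J) f j + \sum_(j < N) tau / 2 ^+ j.+1)); last first.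
    by apply: lerD => //; exact: sum_geometric_le.
  rewrite -!(big_mkord xpredT); rewrite -!(big_mkord xpredT (fun j => tau / 2 ^+ j.+1)).
  have [NJ|/ltnW JN] := leqP N J.
    apply: (@le_trans _ _ (\sum_(0 <= j < J) f j)); last first.
      by rewrite lerDl; apply: sumr_ge0 => j _; rewrite divr_ge0// exprn_ge0.
    by rewrite [leRHS](@big_cat_nat _ _ _ N)//= lerDl; exact: sumr_ge0.
  rewrite [leLHS](@big_cat_nat _ _ _ J)//= lerD2l [leRHS](@big_cat_nat _ _ _ J)//=.
  apply: ler_wpDl; first by apply: sumr_ge0 => j _; rewrite divr_ge0// exprn_ge0.
  by apply: ler_sum_nat => j /andP[Jj _]; exact: ftail.
have fE0 j : (0 <= (f j)%:E)%E by rewrite lee_fin.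
have leU : (\sum_(0 <= j <oo) (f j)%:E <= (S + tau)%:E)%E.
  apply: lime_le; first by apply: is_cvg_nneseries => j _ _.
  by apply: nearW => N; rewrite big_mkord sumEFin lee_fin.
have geU N : ((\sum_(j < N) f j)%:E <= \sum_(0 <= j <oo) (f j)%:E)%E.
  rewrite -sumEFin -(big_mkord xpredT (fun j => (f j)%:E)); exact: nneseries_lim_ge.
have Ufin : (\sum_(0 <= j <oo) (f j)%:E)%E \is a fin_num.
  rewrite ge0_fin_numE; first by apply: (le_lt_trans leU); rewrite ltry.
  by apply: nneseries_ge0.
by split=> [N|]; rewrite -lee_fin fineK.
Qed.

End SeriesBounds.

Section Reflection.
Context {R : realType}.

Lemma fk_reflect (B : pred int) (xi : int -> R) z j t x :
  fk B xi (- z) j t (- x) = fk (fun y => B (- y)) (fun y => xi (- y)) z j t x.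
Proof.
elim: j t x => [|j IH] t x /=; first by rewrite (inj_eq oppr_inj).
case: ifP => // _; congr (duhamel _ _ t); apply/funext => s.
rewrite -!IH addrC; congr (_ + _); congr (fk _ _ _ _ _ _); ring.
Qed.

End Reflection.

Section PeakRatio.
Context {R : realType}.
Variables (n m k : nat) (y G t : R).
Hypotheses (n0 : (0 < n)%N) (G8 : 8 <= G) (t0 : 0 <= t).
Let z : int := n%:Z.
(** The box then runs from [- m] to [n + m], with [m] sites beyond both the start 0 and the peak
    [n]. A path from 0 to [n] that leaves it, on either side, makes at least n + 2 m + 2 jumps. *)
Let l := (n + m)%N.
Let G4 : 4 <= G. Proof. by have h := G8; lra. Qed.
Let G0 : 0 < G. Proof. by have h := G8; lra. Qed.
Local Notation Bx := (box z l m).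

Definition peaked (xi : int -> R) :=
  [/\ xi z = y, forall x, Bx x -> x != z -> xi x <= y - G & forall x, 0 <= xi x].

Definition fk_total (xi : int -> R) : R :=
  fine (\sum_(0 <= j <oo) (fk predT xi z j t 0)%:E)%E.

Lemma peaked_gap xi L : peaked xi -> y <= L -> gap_level xi z l m G L.
Proof. by move=> [_ h _] yL x Bx xz; have := h x Bx xz; lra. Qed.

Lemma peak_sum_diff xi xi' L L' : peaked xi -> peaked xi' -> y <= L -> y <= L' ->
  (forall x, Bx x -> x != z -> xi x = xi' x) ->
  `|peak_sum xi z l m L - peak_sum xi' z l m L'| <= 16 / G ^+ 2 * `|L - L'|.
Proof.
move=> p p' yL yL' e; have g := peaked_gap p yL; have g' := peaked_gap p' yL'.
have h0 := G0.
rewrite /peak_sum opprD addrACA; apply: (le_trans (ler_normD _ _)).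
have -> : 16 / G ^+ 2 * `|L - L'| = 8 / G ^+ 2 * `|L - L'| + 8 / G ^+ 2 * `|L - L'|.
  by field; rewrite gt_eqF.
apply: lerD.
  apply: (psi_lipschitz G4 (gap_left g) (gap_left g')) => // j hj.
  rewrite /lcoef e; [|by clear -hj; rewrite /box; lia|by clear -hj; lia].
  by rewrite opprB addrA subrK.
apply: (psi_lipschitz G4 (gap_right g) (gap_right g')) => // j hj.
rewrite /rcoef e; [|by clear -hj; rewrite /box /l; lia|by clear -hj; lia].
by rewrite opprB addrA subrK.
Qed.

(* Picard iteration for the level equation L = y + peak_sum L. *)
Lemma approximate_level xi : peaked xi -> exists L,
  0 <= L - y <= 4 / G /\ `|L - y - peak_sum xi z l m L| <= (16 / G ^+ 2) ^+ k * (4 / G).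
Proof.
move=> p; pose F L := y + peak_sum xi z l m L.
have Fb L : y <= L -> 0 <= F L - y <= 4 / G.
  move=> yL; rewrite /F addrAC subrr add0r; exact: (peak_sum_bounds G4 (peaked_gap p yL)).
have h0 := G0; have c0 : 0 <= 16 / G ^+ 2 by rewrite divr_ge0// exprn_ge0// ltW.
elim: k => [|k' [L [/andP[L0 L1] IH]]].
  exists y; rewrite subrr lexx; split; first by rewrite divr_ge0// ltW.
  rewrite sub0r normrN expr0 mul1r.
  by have /andP[a b] := peak_sum_bounds G4 (peaked_gap p (lexx y)); rewrite ger0_norm.
have yL : y <= L by lra.
exists (F L); split; first exact: Fb.
have yF : y <= F L by have /andP[a _] := Fb L yL; lra.
rewrite (_ : F L - y = peak_sum xi z l m L); last by rewrite /F; ring.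
apply: (le_trans (peak_sum_diff p p yL yF _)) => //.
rewrite [_ ^+ k'.+1]exprS -[leRHS]mulrA; apply: ler_wpM2l => //.
by rewrite /F (_ : L - _ = L - y - peak_sum xi z l m L)//; ring.
Qed.

(** [psi_local] on both sides of the peak; its rate 4 / G^2 is relaxed to 16 / G^2 to match the
    residual of the Picard iteration. *)
Lemma peak_sum_local xi xi' L : peaked xi -> peaked xi' -> y <= L ->
  (forall x, (`|(x - z)%R| <= k)%N -> xi x = xi' x) ->
  `|peak_sum xi z l m L - peak_sum xi' z l m L| <= (16 / G ^+ 2) ^+ k * (4 / G).
Proof.
move=> p p' yL e; have g := peaked_gap p yL; have g' := peaked_gap p' yL.
have h0 := G0.
rewrite /peak_sum opprD addrACA; apply: (le_trans (ler_normD _ _)).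
have le4 : (4 / G ^+ 2) ^+ k * (2 / G) <= (16 / G ^+ 2) ^+ k * (2 / G).
  apply: ler_wpM2r; first by rewrite divr_ge0// ltW.
  apply: lerXn2r; rewrite ?nnegrE ?divr_ge0 ?exprn_ge0 ?ltW//.
  by rewrite ltr_pM2r ?invr_gt0 ?exprn_gt0//; lra.
have -> : (16 / G ^+ 2) ^+ k * (4 / G) =
    (16 / G ^+ 2) ^+ k * (2 / G) + (16 / G ^+ 2) ^+ k * (2 / G) by ring.
apply: lerD; apply: le_trans le4.
  apply: (psi_local G4 (gap_left g) (gap_left g')) => // j hj.
  by rewrite /lcoef e//; clear -hj; lia.
apply: (psi_local G4 (gap_right g) (gap_right g')) => // j hj.
by rewrite /rcoef e//; clear -hj; lia.
Qed.

Variables (delta tau : R).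
Hypotheses (delta0 : 0 <= delta <= 1 / 8) (tau0 : 0 <= tau).
Hypothesis tau_small : tau <= delta * (expR ((y - 2) * t) * (y + 1) ^- n).
Hypothesis G_large : 32 / G ^+ 2 <= delta.
Hypothesis G_time : 4 ^+ n * expR (- (G / 4 * t)) <= delta.
(** Twice the bound for one Picard residual: it covers the residual of the level together with the
    locality error between the two potentials. *)
Let err := (16 / G ^+ 2) ^+ k * (8 / G).

(** Terms with fewer than n + 2 m + 2 jumps do not feel the boundary of the box, so [box_upper]
    bounds them; the later ones are a fraction [delta] of the main term by assumption. Conversely
    all terms dominate those of the box, and [box_lower] applies. *)
Lemma peak_log_bounds xi L : peaked xi -> 0 <= L - y <= 4 / G ->
  `|L - y - peak_sum xi z l m L| <= err -> err <= G / 4 ->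
  (forall j, (n + m + m + 2 <= j)%N -> fk predT xi z j t 0 <= tau / 2 ^+ j.+1) ->
  0 < fk_total xi /\
  `|ln (fk_total xi) - ((L - 2) * t + ln (arm l (lcoef xi z L) n))| <= err * t + 4 * delta.
Proof.
move=> p /andP[L0 L1] hL errG ftail; have h8 := G8; have h0 := G0.
have yL : y <= L by lra.
have g := peaked_gap p yL; have gl := gap_left g.
have nl : (n <= l)%N by clear; rewrite /l; lia.
pose v := arm l (lcoef xi z L) n.
have vE : profile xi z l m L 0 = v.
  rewrite /profile /v (_ : 0 <= z); last by clear; rewrite /z; lia.
  by congr (arm _ _ _); clear; rewrite /z; lia.
have v0 : 0 < v by exact: (arm_gt0 G4 gl nl).
have e0 : 0 <= err by rewrite /err mulr_ge0 ?exprn_ge0 ?divr_ge0 ?exprn_ge0// ltW.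
move: hL; rewrite ler_norml => /andP[hL1 hL2].
have [py pB p0] := p.
have hU := @box_upper _ xi z l m G G4 L err _ t 0 g e0.
have fkb j : (j < n + m + m + 2)%N -> fk Bx xi z j t 0 = fk predT xi z j t 0.
  move=> hj; apply: fk_box => x; clear -hj; rewrite /box /z /l => hx; lia.
pose J := (n + m + m + 2)%N.
have upJ : \sum_(j < J) fk predT xi z j t 0 <= expR ((L - 2 + err) * t) * v.
  rewrite -vE; apply: le_trans (hU J _ t0); last by rewrite py; lra.
  by rewrite /fksum; apply: eq_ler; apply: eq_bigr => j _; rewrite fkb.
have [lowU upU] := nneseries_tail_bounds (fun j => fk_ge0 predT xi z j t 0) tau0 upJ ftail.
rewrite -/(fk_total xi) in lowU upU.
set U := fk_total xi in lowU upU *.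
have zne : (0 : int) != z by clear -n0; rewrite /z; lia.
have G4e : 0 <= err <= G / 4 by rewrite e0.
have low := @box_lower _ xi z l m G G8 L err t 0 U g G4e _ t0 zne.
have {}low : (1 - 32 / G ^+ 2) * (expR ((L - 2 - err) * t) * v) -
   expR ((L - 2 - G / 2) * t) * profile xi z l m (L - G / 2) 0 <= U.
  rewrite -vE; apply: low; first by rewrite py; lra.
  move=> J'; apply: le_trans (lowU J'); apply: ler_sum => j _; exact: fk_le_box.
have v2 : profile xi z l m (L - G / 2) 0 <= 4 ^+ n * v.
  rewrite /profile (_ : 0 <= z); last by clear; rewrite /z; lia.
  rewrite (_ : `|(z - 0)%R|%N = n); last by clear; rewrite /z; lia.
  rewrite (_ : lcoef xi z (L - G / 2) = (fun i => lcoef xi z L i - G / 2)).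
    exact: (arm_lowered G8 gl nl).
  by apply/funext => i; rewrite /lcoef; ring.
set E1 := expR ((L - 2 - err) * t) in low.
have E10 : 0 < E1 by exact: expR_gt0.
(* The correction grows at a rate smaller by at least [G / 4], since [err] is at most [G / 4]; by
   [G_time] this outweighs the factor [4 ^+ n] of the lowered arm. *)
have r2 : expR ((L - 2 - G / 2) * t) * profile xi z l m (L - G / 2) 0 <= delta * (E1 * v).
  apply: (@le_trans _ _ (expR ((L - 2 - G / 2) * t) * (4 ^+ n * v))).
    by apply: ler_wpM2l => //; exact: expR_ge0.
  rewrite !mulrA; apply: ler_wpM2r; first exact: ltW.
  apply: (@le_trans _ _ (E1 * (4 ^+ n * expR (- (G / 4 * t))))); last first.
    by rewrite mulrC; apply: ler_wpM2r => //; exact: ltW.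
  rewrite mulrCA mulrC; apply: ler_wpM2l; first exact: exprn_ge0.
  by rewrite /E1 -expRD ler_expR; have := t0; nra.
have /andP[d0 d1] := delta0.
have Ulow : (1 - 2 * delta) * (E1 * v) <= U.
  apply: le_trans low; have Ev : 0 < E1 * v by exact: mulr_gt0.
  by have := G_large; nra.
(* The arm is at least (y + 1)^(- n): the potential is nonnegative and [L - y] is at most 1/2, so
   all its coefficients are below [y + 1]. *)
have tauv : tau <= delta * (expR ((L - 2 + err) * t) * v).
  apply: (le_trans tau_small); apply: ler_wpM2l => //; apply: ler_pM.
  - exact: expR_ge0.
  - by rewrite invr_ge0 exprn_ge0//; have := p0 z; rewrite py; lra.
  - by rewrite ler_expR; apply: ler_wpM2r => //; lra.
  apply: (arm_lower G8 gl nl) => i _; rewrite /lcoef.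
  have := p0 (z - i%:Z); have : 4 / G <= 1 / 2 by rewrite ler_pdivrMr//; lra.
  by lra.
have Uup : U <= (1 + delta) * (expR ((L - 2 + err) * t) * v).
  by apply: (le_trans upU); rewrite [leRHS]mulrDl mul1r lerD2l.
have U0 : 0 < U by apply: lt_le_trans Ulow; rewrite !mulr_gt0//; lra.
split => //; rewrite ler_norml; apply/andP; split.
  have : ln ((1 - 2 * delta) * (E1 * v)) <= ln U.
    by rewrite ler_ln ?posrE// !mulr_gt0//; lra.
  rewrite lnM ?posrE ?mulr_gt0//; last by lra.
  rewrite lnM ?posrE// /E1 expRK.
  have : - (4 * delta) <= ln (1 - 2 * delta).
    have w0 : 0 < 1 - 2 * delta by lra.
    have := expR_ge1Dx (- ln (1 - 2 * delta)); rewrite expRN lnK ?posrE//.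
    have : (1 - 2 * delta)^-1 <= 1 + 4 * delta.
      by rewrite -[X in X <= _]mul1r ler_pdivrMr//; nra.
    by lra.
  by rewrite -/v; lra.
have : ln U <= ln ((1 + delta) * (expR ((L - 2 + err) * t) * v)).
  by rewrite ler_ln ?posrE// !mulr_gt0 ?expR_gt0//; lra.
rewrite lnM ?posrE ?mulr_gt0 ?expR_gt0//; last by lra.
rewrite lnM ?posrE ?expR_gt0// expRK.
have : ln (1 + delta) <= delta.
  have := expR_ge1Dx (ln (1 + delta)); rewrite lnK ?posrE; lra.
by rewrite -/v; lra.
Qed.

(** One approximate level of [xi] serves both potentials, because their peak sums differ only by the
    locality error. The exponents [(L - 2) * t] then cancel exactly, and what remains is the
    comparison of the two arms from the peak to 0. *)
Theorem log_ratio_bound xi xi' : peaked xi -> peaked xi' ->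
  (forall x, (`|(x - z)%R| <= k)%N -> xi x = xi' x) -> err <= G / 4 ->
  (forall j, (n + m + m + 2 <= j)%N -> fk predT xi z j t 0 <= tau / 2 ^+ j.+1) ->
  (forall j, (n + m + m + 2 <= j)%N -> fk predT xi' z j t 0 <= tau / 2 ^+ j.+1) ->
  [/\ 0 < fk_total xi, 0 < fk_total xi' &
  `|ln (fk_total xi) - ln (fk_total xi') -
    \sum_(1 <= i < n.+1) (ln (y - xi' (z - i%:Z)) - ln (y - xi (z - i%:Z)))| <=
  2 * (err * t) + 8 * delta +
  24 / G ^+ 3 * \sum_(1 <= i < l.+1) `|xi (z - i%:Z) - xi' (z - i%:Z)|].
Proof.
move=> p p' loc errG tl tl'; have h0 := G0.
have [L [Lb LE]] := approximate_level p.
have e0 : 0 <= (16 / G ^+ 2) ^+ k * (4 / G).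
  by rewrite mulr_ge0 ?exprn_ge0 ?divr_ge0 ?exprn_ge0// ltW.
have errE : err = (16 / G ^+ 2) ^+ k * (4 / G) + (16 / G ^+ 2) ^+ k * (4 / G).
  by rewrite /err; ring.
have yL : y <= L by have /andP[a _] := Lb; lra.
have LE1 : `|L - y - peak_sum xi z l m L| <= err by rewrite errE; apply: (le_trans LE); lra.
have LE2 : `|L - y - peak_sum xi' z l m L| <= err.
  rewrite errE (_ : _ - _ - _ = (L - y - peak_sum xi z l m L) +
    (peak_sum xi z l m L - peak_sum xi' z l m L)); last by ring.
  by apply: (le_trans (ler_normD _ _)); apply: lerD => //; exact: peak_sum_local.
have [U0 UE] := peak_log_bounds p Lb LE1 errG tl.
have [U'0 U'E] := peak_log_bounds p' Lb LE2 errG tl'.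
split => //.
have nl : (n <= l)%N by clear; rewrite /l; lia.
pose A i := y - xi (z - i%:Z); pose A' i := y - xi' (z - i%:Z).
have gA (x : int -> R) : peaked x -> gapped G l (fun i => y - x (z - i%:Z)).
  move=> [_ h _] i hi.
  have b1 : Bx (z - i%:Z) by clear -hi; rewrite /box; lia.
  have b2 : z - i%:Z != z by clear -hi; lia.
  by have := h _ b1 b2; lra.
have := ln_arm_diff G8 (gA _ p) (gA _ p') Lb nl.
have aE (x : int -> R) : (fun i => y - x (z - i%:Z) + (L - y)) = lcoef x z L.
  by apply/funext => i; rewrite /lcoef; ring.
rewrite !aE.
have -> : \sum_(1 <= i < l.+1) `|y - xi (z - i%:Z) - (y - xi' (z - i%:Z))| =
   \sum_(1 <= i < l.+1) `|xi (z - i%:Z) - xi' (z - i%:Z)|.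
  by apply: eq_bigr => i _; rewrite -normrN; congr (`| _ |); ring.
move: UE U'E; set X := ln (fk_total xi); set X' := ln (fk_total xi').
set w := ln (arm _ _ _); set w' := ln (arm _ _ _); set Sg := \sum_(1 <= i < n.+1) _.
set D := 24 / _ * _; set a := (L - 2) * t.
by rewrite !ler_norml => /andP[? ?] /andP[? ?] /andP[? ?]; apply/andP; split; lra.
Qed.

End PeakRatio.

(** * Limits of integrals and Lipschitz approximation *)

Section LimitTheorems.
Context {R : realType} {d} {T : measurableType d}.

Lemma Rintegral_dominated_cvg (mu : {measure set T -> \bar R}) (D : set T)
    (f_ : nat -> T -> R) (f g : T -> R) : measurable D ->
  (forall n, measurable_fun D (f_ n)) -> mu.-integrable D (EFin \o g) ->
  (forall n x, D x -> `|f_ n x| <= g x) ->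
  (forall x, D x -> f_ ^~ x @ \oo --> f x) ->
  (fun n => Rintegral mu D (f_ n)) @ \oo --> Rintegral mu D f.
Proof.
move=> mD mf ig fg cf.
have h : (fun n => \int[mu]_(x in D) (f_ n x)%:E)%E @ \oo --> (\int[mu]_(x in D) (f x)%:E)%E.
  apply: (@dominated_cvg _ _ _ mu D mD (fun n x => (f_ n x)%:E) (fun x => (f x)%:E) (EFin \o g)) => //.
  - by move=> n; apply/measurable_EFinP.
  - by move=> x Dx; apply: cvg_EFin; [exact: nearW | exact: cf].
apply: fine_cvg; move: h; congr (_ --> _).
have mfl : measurable_fun D f by apply: (measurable_fun_cvg mf).
rewrite fineK//; apply: integrable_fin_num => //.
apply: (le_integrable mD _ _ ig); first by apply/measurable_EFinP.
move=> x Dx /=; rewrite lee_fin [leRHS]ger0_norm; last by apply: le_trans (fg 0 x Dx).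
have c1 : (fun n => `|f_ n x|) @ \oo --> `|f x| by apply: cvg_norm; exact: cf.
have c2 : (fun=> g x) @ \oo --> g x by exact: cvg_cst.
by apply: (ler_cvg_to c1 c2); apply: nearW => n; exact: fg.
Qed.

Lemma Rintegral_bounded_cvg (P : probability T R) (M : R) (f_ : nat -> T -> R) (f : T -> R) :
  (forall n, measT (f_ n)) -> (forall n x, `|f_ n x| <= M) ->
  (forall x, f_ ^~ x @ \oo --> f x) ->
  (fun n => intT P (f_ n)) @ \oo --> intT P f.
Proof.
move=> mf fM cf; apply: (@Rintegral_dominated_cvg P setT f_ f (cst M)) => //.
exact: (bmeas_integrable P (bmeas_cst M)).
Qed.

Lemma fatou_near (mu : {measure set T -> \bar R}) (f_ : nat -> T -> R) (f : T -> R) (e : R) :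
  0 < e ->
  (forall n, mu.-integrable setT (EFin \o f_ n)) -> mu.-integrable setT (EFin \o f) ->
  (forall n x, 0 <= f_ n x) -> (forall x, f_ ^~ x @ \oo --> f x) ->
  \forall n \near \oo, intT mu f - e <= intT mu (f_ n).
Proof.
move=> e0 if_ if0 f0 cf.
have fin n : (\int[mu]_x (f_ n x)%:E)%E \is a fin_num by exact: integrable_fin_num (if_ n).
have fin0 : (\int[mu]_x (f x)%:E)%E \is a fin_num by exact: integrable_fin_num if0.
pose a n := (\int[mu]_x (f_ n x)%:E)%E.
have h : (\int[mu]_x (f x)%:E <= limn_einf a)%E.
  have := @fatou _ _ _ mu setT measurableT (fun n x => (f_ n x)%:E).
  move=> /(_ _ _)/Wrap[| |].
  - by move=> n; exact: measurable_int (if_ n).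
  - by move=> n x _; rewrite lee_fin.
  apply: le_trans; apply: eq_ler.
  apply: eq_integral => x _; apply/esym.
  have c : (fun n => (f_ n x)%:E) @ \oo --> (f x)%:E.
    by apply: cvg_EFin; [exact: nearW|exact: cf].
  by case: (cvg_limn_einf_sup c).
have : ((intT mu f - e)%:E < limn_einf a)%E.
  apply: lt_le_trans h; rewrite -(fineK fin0) lte_fin -/(intT mu f).
  by rewrite ltrBlDr ltrDl.
rewrite limn_einf_lim (cvg_lim _ (@cvg_einfs_sup _ a))// => /ereal_sup_gt[_ [N _ <-]] hN.
exists N => // n /= Nn; rewrite -lee_fin; apply: (le_trans (ltW hN)).
rewrite /Rintegral fineK//; apply: ereal_inf_lbound; exists n => //.
Qed.

End LimitTheorems.

Section LipschitzMinorant.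
Context {R : realType}.
Variables (F : R -> R) (M : R).
Hypotheses (F0 : forall x, 0 <= F x) (FM : forall x, F x <= M) (cF : continuous F).

(** Inf-convolution of [F] with [j] times the distance (Pasch-Hausdorff envelope): a [j]-Lipschitz
    minorant that tends to [F] pointwise. It reduces bounded continuous test functions to Lipschitz
    ones. *)
Definition lip_minorant (j : nat) (x : R) : R :=
  inf [set F y + j%:R * `|x - y| | y in setT].

Let lb j x : has_lbound [set F y + j%:R * `|x - y| | y in setT].
Proof. by exists 0 => _ [y _ <-]; rewrite addr_ge0// mulr_ge0. Qed.

Let ne j x : [set F y + j%:R * `|x - y| | y in setT] !=set0.
Proof. by exists (F x + j%:R * `|x - x|); exists x. Qed.

Lemma lip_minorant_ge0 j x : 0 <= lip_minorant j x.
Proof. by apply: lb_le_inf => // _ [y _ <-]; rewrite addr_ge0// mulr_ge0. Qed.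

Lemma lip_minorant_le j x : lip_minorant j x <= F x.
Proof.
apply: ge_inf; first exact: lb.
by exists x => //; rewrite subrr normr0 mulr0 addr0.
Qed.

Lemma lip_minorant_lip j x y : lip_minorant j x <= lip_minorant j y + j%:R * `|x - y|.
Proof.
rewrite -lerBlDr; apply: lb_le_inf => // _ [u _ <-]; rewrite lerBlDr.
apply: (@le_trans _ _ (F u + j%:R * `|x - u|)); first by apply: ge_inf; [exact: lb | exists u].
rewrite -addrA lerD2l -mulrDr ler_wpM2l//.
by rewrite (_ : x - u = (y - u) + (x - y)) ?ler_normD//; ring.
Qed.

Lemma lip_minorant_cvg x : lip_minorant ^~ x @ \oo --> F x.
Proof.
apply/cvgrPdist_le => e e0.
have cFx : F y @[y --> x] --> F x by exact: cF.
have /cvgrPdist_le /(_ e e0) [dl /= dl0 hd] := cFx.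
near=> j.
rewrite ger0_norm ?subr_ge0 ?lip_minorant_le// lerBlDr addrC -lerBlDr.
apply: lb_le_inf => // _ [y _ <-].
have [xy|xy] := ltP `|x - y| dl.
  have := hd y xy; rewrite ler_norml => /andP[_ h].
  have : 0 <= j%:R * `|x - y| by rewrite mulr_ge0.
  lra.
have hj : M / dl <= j%:R by near: j; exact: nbhs_infty_ger.
have : M <= j%:R * `|x - y|.
  by rewrite ler_pdivrMr// in hj; apply: (le_trans hj); rewrite ler_wpM2l.
by have := F0 y; have := FM x; lra.
Unshelve. all: by end_near. Qed.

Lemma lip_minorant_continuous j : continuous (lip_minorant j).
Proof.
move=> x; apply/cvgrPdist_le => e e0.
exists (e / j.+1%:R) => /=; first by rewrite divr_gt0.
move=> y /= xy; have h1 := lip_minorant_lip j x y; have h2 := lip_minorant_lip j y x.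
have h3 : j%:R * `|x - y| <= e.
  apply: (@le_trans _ _ (j.+1%:R * `|x - y|)); first by rewrite ler_wpM2r// ler_nat.
  by rewrite mulrC -ler_pdivlMr// ltW.
rewrite (distrC y) in h2.
by rewrite ler_norml; apply/andP; split; lra.
Qed.

End LipschitzMinorant.

(** * The Fourier transform of the normal law *)

Section NormalFourier.
Context {R : realType}.
Local Notation leb := (@lebesgue_measure R).
Local Notation g := (@gauss_pdf R).

Lemma gauss_pdfE : g = normal_pdf 0 1.
Proof.
apply/funext => x; rewrite normal_pdfE ?oner_eq0// /normal_peak /normal_fun /gauss_pdf.
rewrite mulrC expr1n !mul1r subr0; congr (_^-1 * expR (- (_ ^+ 2) / _)).
by congr Num.sqrt; rewrite mulr_natl.
Qed.

Definition std_normal : probability (measurableTypeR R) R := normal_prob 0 1.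

Lemma gauss_ge0 x : 0 <= g x.
Proof. by rewrite gauss_pdfE normal_pdf_ge0. Qed.

Lemma gauss_continuous : continuous g.
Proof. by rewrite gauss_pdfE; apply: continuous_normal_pdf; exact: oner_neq0. Qed.

Lemma gauss_integrable : leb.-integrable setT (EFin \o g).
Proof. by rewrite gauss_pdfE; exact: integrable_normal_pdf. Qed.

Lemma gauss_mul_integrable (h : R -> R) (M : R) : measT h ->
  (forall x, `|h x| <= M) -> leb.-integrable setT (EFin \o (fun x => h x * g x)).
Proof.
move=> mh hM.
apply: (@le_integrable _ _ _ leb setT measurableT _ (fun x => M%:E * (EFin \o g) x)%E).
- apply/measurable_EFinP; apply: measurable_funM => //.
  exact: continuous_measurable_fun gauss_continuous.
- move=> x _ /=; rewrite lee_fin normrM (ger0_norm (gauss_ge0 x)).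
  by rewrite [leRHS]ger0_norm ?mulr_ge0 ?gauss_ge0 ?ler_wpM2r ?gauss_ge0// (le_trans _ (hM x)).
- exact: integrableZl gauss_integrable.
Qed.

Lemma std_normalE (h : R -> R) : bmeas h ->
  intT std_normal h = intT leb (fun x => h x * g x).
Proof.
move=> bh; have [mh [M hM]] := bh.
have M0 : 0 <= M by apply: le_trans (hM 0).
have mg : measT g by exact: continuous_measurable_fun gauss_continuous.
have pos (f : R -> R) : (forall x, 0 <= f x) -> bmeas f ->
    intT std_normal f = intT leb (fun x => f x * g x).
  move=> f0 [mf _]; rewrite /Rintegral; congr fine.
  transitivity (\int[density_measure leb gauss_ge0 mg]_x (f x)%:E)%E.
    apply: eq_measure_integral => A mA _.
    by rewrite /std_normal /= /normal_prob /= /density gauss_pdfE.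
  rewrite (@integral_density _ _ _ leb g gauss_ge0 mg (EFin \o f))//.
  exact/measurable_EFinP.
have bM : bmeas (fun x => h x + M) by apply: bmeasD => //; exact: bmeas_cst.
have e1 : intT std_normal h = intT std_normal (fun x => h x + M) - M.
  by rewrite RintegralD_prob//; [rewrite Rintegral_prob_cst addrK|exact: bmeas_cst].
rewrite e1 pos//; last by move=> x; have := hM x; rewrite ler_norml => /andP[]; lra.
under eq_Rintegral do rewrite mulrDl.
rewrite RintegralD//; last 2 first.
- exact: gauss_mul_integrable hM.
- by apply: (@gauss_mul_integrable (cst M) `|M|) => //; exact: measurable_cst.
rewrite -(pos (cst M))//; last exact: bmeas_cst.
by rewrite Rintegral_prob_cst addrK.
Qed.

End NormalFourier.

Section NormalMoments.
Context {R : realType}.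
Local Notation leb := (@lebesgue_measure R).

(** With w the distance in units of [s], w <= 1 + w^2 / 4 <= exp(w^2 / 4): the linear factor is
    traded for a doubled standard deviation. First moments thereby become masses of normal
    densities. *)
Lemma normal_pdf_mulabs (x s u : R) : 0 < s ->
  `|u - x| * normal_pdf x s u <= 2 * s * normal_pdf x (2 * s) u.
Proof.
move=> s0; have s20 : 0 < 2 * s by rewrite mulr_gt0.
rewrite !normal_pdfE ?gt_eqF//.
have pE : normal_peak s = 2 * normal_peak (2 * s).
  rewrite /normal_peak (_ : (2 * s) ^+ 2 * pi *+ 2 = 2 ^+ 2 * (s ^+ 2 * pi *+ 2)); last by ring.
  rewrite sqrtrM ?sqr_ge0// sqrtr_sqr ger0_norm// invfM mulrA mulfV ?mul1r//.
rewrite pE /normal_fun; set K := normal_peak (2 * s).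
have K0 : 0 <= K by exact: normal_peak_ge0.
set v := u - x.
have h : `|v| <= s * expR ((v ^+ 2) / (s ^+ 2 *+ 2) * (1/2)).
  rewrite mulrC -ler_pdivrMr//.
  set w := `|v| / s; have wE : v ^+ 2 / (s ^+ 2 *+ 2) * (1/2) = w ^+ 2 / 4.
    rewrite /w expr_div_n real_normK ?num_real//; field; lra.
  rewrite wE; apply: le_trans (expR_ge1Dx _).
  have := sqr_ge0 (w - 2); lra.
rewrite [leLHS](_ : _ = 2 * K * (`|v| * expR (- v ^+ 2 / (s ^+ 2 *+ 2)))); last by ring.
rewrite [leRHS](_ : _ = 2 * K * (s * expR (- v ^+ 2 / ((2 * s) ^+ 2 *+ 2)))); last by ring.
rewrite ler_wpM2l ?mulr_ge0//.
apply: (le_trans (ler_wpM2r (expR_ge0 _) h)).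
rewrite -(mulrA s) -expRD ler_wpM2l ?(ltW s0)// ler_expR.
set q := v ^+ 2 / s ^+ 2.
have q0 : 0 <= q by rewrite divr_ge0 ?sqr_ge0.
have -> : v ^+ 2 / (s ^+ 2 *+ 2) * (1/2) + - v ^+ 2 / (s ^+ 2 *+ 2) = - q / 4.
  by rewrite /q; field; lra.
have -> : - v ^+ 2 / ((2 * s) ^+ 2 *+ 2) = - q / 8 by rewrite /q; field; lra.
lra.
Qed.

Lemma measurable_normal_pdf2 {d} {T : measurableType d} (s : R) (X Y : T -> R) : 0 < s ->
  measT X -> measT Y ->
  measT (fun w => normal_pdf (X w) s (Y w)).
Proof.
move=> s0 mX mY.
rewrite (_ : (fun w => _) = (fun w => normal_peak s * expR (- (Y w - X w) ^+ 2 / (s ^+ 2 *+ 2)))).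
  apply: measurable_scale.
  apply: measurableT_comp => //; apply: measurable_funM; last exact: measurable_cst.
  apply: measurableT_comp => //; apply: measurable_funX; exact: measurable_funB.
by apply/funext => w; rewrite normal_pdfE ?gt_eqF.
Qed.

Lemma gauss_mulabs_integrable (h : R -> R) : measT h ->
  (forall x, `|h x| <= `|x|) -> leb.-integrable setT (EFin \o (fun x => h x * gauss_pdf x)).
Proof.
move=> mh hM.
apply: (@le_integrable _ _ _ leb setT measurableT _ (fun x => 2%:E * (normal_pdf 0 2 x)%:E)%E).
- apply/measurable_EFinP; apply: measurable_funM => //.
  exact: continuous_measurable_fun gauss_continuous.
- move=> x _ /=; rewrite lee_fin normrM (ger0_norm (gauss_ge0 x)) gauss_pdfE.
  rewrite [leRHS]ger0_norm ?mulr_ge0 ?normal_pdf_ge0//.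
  apply: (@le_trans _ _ (`|x - 0| * normal_pdf 0 1 x)).
    by rewrite subr0 ler_wpM2r// normal_pdf_ge0.
  have := @normal_pdf_mulabs 0 1 x ltr01; rewrite !mulr1//.
- by apply: integrableZl => //; apply: integrable_normal_pdf.
Qed.

Lemma gauss_derive (x : R) : is_derive x 1 (@gauss_pdf R) (- x * gauss_pdf x).
Proof.
rewrite /gauss_pdf; apply: is_derive_eq.
by rewrite /GRing.scale /=; field; rewrite sqrtr_eq0 -ltNge mulr_gt0// pi_gt0.
Qed.

(** The derivative of [sin (a * x) * gauss_pdf x] is integrated over growing intervals; the boundary
    terms decay like 1 / n. *)
Lemma gauss_sin_ibp (a : R) :
  intT leb (fun x => x * sin (a * x) * gauss_pdf x) =
  a * intT leb (fun x => cos (a * x) * gauss_pdf x).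
Proof.
have cS : continuous (fun x : R => sin (a * x)).
  by move=> x; apply: continuous_comp; [apply: mulrl_continuous | exact: continuous_sin].
have cC : continuous (fun x : R => cos (a * x)).
  by move=> x; apply: continuous_comp; [apply: mulrl_continuous | exact: continuous_cos].
have mS := continuous_measurable_fun cS; have mC := continuous_measurable_fun cC.
have i1 : leb.-integrable setT (EFin \o (fun x => x * sin (a * x) * gauss_pdf x)).
  apply: gauss_mulabs_integrable; first exact: measurable_funM.
  by move=> x; rewrite normrM ler_piMr// ler_norml sin_le1 sin_geN1.
have i2 : leb.-integrable setT (EFin \o (fun x => cos (a * x) * gauss_pdf x)).
  by apply: (@gauss_mul_integrable _ _ 1) => // x; rewrite ler_norml cos_le1 cos_geN1.
have i3 : leb.-integrable setT (EFin \o (fun x => a * (cos (a * x) * gauss_pdf x))).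
  exact: (@integrableZl _ _ _ leb setT measurableT a _ i2).
pose F x : R := sin (a * x) * gauss_pdf x.
pose F' x : R := a * (cos (a * x) * gauss_pdf x) - x * sin (a * x) * gauss_pdf x.
have iF' : leb.-integrable setT (EFin \o F').
  have := @integrableB _ _ _ leb setT measurableT _ _ i3 i1.
  by congr (integrable _ _ _); apply/funext => x.
apply/eqP; rewrite eq_sym -subr_eq0 -RintegralZl// -RintegralB//; apply/eqP.
have dF (x : R) : is_derive x 1 F (F' x).
  rewrite /F /F'; have d1 := gauss_derive x.
  have d2 : is_derive (a * x) 1 (@sin R) (cos (a * x)) by exact: is_derive_sin.
  have d3 : is_derive x 1 (fun x : R => a * x) a.
    by apply: is_derive_eq; rewrite /GRing.scale /= mulr1.
  have d4 := @is_derive1_comp _ (@sin R) (fun x => a * x) x _ _ d2 d3.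
  by apply: is_derive_eq; rewrite /GRing.scale /=; ring.
have cF' : continuous F'.
  move=> x; apply: cvgB.
    apply: cvgM; first exact: cvg_cst.
    by apply: cvgM; [exact: cC | exact: gauss_continuous].
  apply: cvgM; last exact: gauss_continuous.
  by apply: cvgM; [exact: cvg_id | exact: cS].
have c1 : (fun n : nat => intT leb (fun x => F' x * \1_`[- n.+1%:R, n.+1%:R] x))
    @ \oo --> intT leb F'.
  apply: (@Rintegral_dominated_cvg _ _ _ leb setT _ _ (fun x => `|F' x|)) => //.
  - move=> n; apply: measurable_funM; last exact: measurable_indic.
    exact: continuous_measurable_fun.
  - exact: integrable_norm.
  - move=> n x _; rewrite normrM ler_piMr//.
    by rewrite indicE; case: (_ \in _) => /=; rewrite ?normr1 ?normr0.
  - move=> x _; rewrite -[X in _ --> X]mulr1; apply: cvgM; first exact: cvg_cst.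
    apply: cvg_near_cst; near=> n; rewrite indicE mem_set//= in_itv /=.
    have hx : `|x| <= n%:R by near: n; exact: nbhs_infty_ger.
    rewrite -ler_norml (le_trans hx)// ler_nat//.
have c2 : (fun n : nat => intT leb (fun x => F' x * \1_`[- n.+1%:R, n.+1%:R] x))
    @ \oo --> (0 : R).
  set C := 8 * normal_peak (2 * 1) : R.
  have gC (x : R) : gauss_pdf x <= C / 4 / `|x| \/ x = 0.
    have [->|x0] := eqVneq x 0; [by right | left].
    rewrite ler_pdivlMr ?normr_gt0//.
    have := @normal_pdf_mulabs 0 1 x ltr01; rewrite subr0 -gauss_pdfE => h.
    have h2 := @normal_pdf_ub R 0 (2 * 1) x _.
    have /h2 h3 : 2 * 1 != 0 :> R by rewrite mulr1.
    rewrite /C; lra.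
  have hC : C * @harmonic R n @[n --> \oo] --> (0 : R).
    by rewrite -[X in _ --> X](mulr0 C); apply: cvgM; [exact: cvg_cst|exact: cvg_harmonic].
  have hC' : - (C * @harmonic R n) @[n --> \oo] --> (0 : R).
    by rewrite -[X in _ --> X]oppr0; exact: cvgN.
  apply: (squeeze_cvgr _ hC' hC); apply: nearW => n; rewrite -ler_norml.
  have -> : intT leb (fun x => F' x * \1_`[- n.+1%:R, n.+1%:R] x) = F n.+1%:R - F (- n.+1%:R).
    have nn : - n.+1%:R < n.+1%:R :> R by rewrite (@lt_trans _ _ 0)// oppr_lt0.
    rewrite -[RHS](congr1 fine (@FTC2_interval R F F' _ _ nn (fun x _ => dF x) (fun x _ => cF' x))).
    rewrite -[RHS]/(Rintegral _ _ _) [RHS]Rintegral_mkcond; apply: eq_Rintegral => x _.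
    by rewrite patchE indicE; case: ifPn => _; rewrite ?mulr1 ?mulr0.
  have hF (x : R) : `|F x| <= gauss_pdf x.
    by rewrite normrM (ger0_norm (gauss_ge0 x)) ler_piMl ?gauss_ge0// ler_norml sin_le1 sin_geN1.
  apply: (le_trans (ler_normB _ _)).
  have := hF n.+1%:R; have := hF (- n.+1%:R).
  case: (gC n.+1%:R) => [|/eqP]; last by rewrite pnatr_eq0.
  case: (gC (- n.+1%:R)) => [|/eqP]; last by rewrite oppr_eq0 pnatr_eq0.
  rewrite normrN normr_nat /harmonic /=.
  have : 0 <= C / n.+1%:R.
    by rewrite divr_ge0// /C mulr_ge0// normal_peak_ge0.
  rewrite ![C / 4 * _]mulrAC; set z := n.+1%:R^-1; lra.
exact: (cvg_unique _ c1 c2).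
Unshelve. all: by end_near. Qed.

(** The transform [C] satisfies C'(t) = - t C(t), by differentiation under the integral and
    [gauss_sin_ibp]; hence C(t) exp(t^2 / 2) is constant, and it is 1 at 0. *)
Lemma normal_fourier (a : R) :
  intT leb (fun x => cos (a * x) * gauss_pdf x) = expR (- a ^+ 2 / 2).
Proof.
pose C (t : R) := intT leb (fun x => cos (t * x) * gauss_pdf x).
have cC t : continuous (fun x : R => cos (t * x)).
  by move=> x; apply: continuous_comp; [apply: mulrl_continuous | exact: continuous_cos].
have i2 t : leb.-integrable setT (EFin \o (fun x => cos (t * x) * gauss_pdf x)).
  apply: (@gauss_mul_integrable _ _ 1); first exact: continuous_measurable_fun.
  by move=> x; rewrite ler_norml cos_le1 cos_geN1.
pose f (t x : R) := cos (t * x) * gauss_pdf x.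
have df (t x : R) : is_derive t 1 (f ^~ x) (- (x * sin (t * x) * gauss_pdf x)).
  have d2 : is_derive (t * x) 1 (@cos R) (- sin (t * x)) by exact: is_derive_cos.
  have d3 : is_derive t 1 (fun t : R => t * x) x.
    by apply: is_derive_eq; rewrite /GRing.scale /= mulr1 mulr0 add0r.
  have d4 := @is_derive1_comp _ (@cos R) (fun t => t * x) t _ _ d2 d3.
  rewrite /f; apply: is_derive_eq.
  by rewrite /GRing.scale /=; ring.
have [dC CE] : (forall t : R, derivable C t 1) /\
    (forall t : R, derive1 C t = - (t * C t)).
  have G0 (y : R) : 0 <= `|y| * gauss_pdf y by rewrite mulr_ge0// gauss_ge0.
  have iG : leb.-integrable setT (EFin \o (fun y => `|y| * gauss_pdf y)).
    by apply: gauss_mulabs_integrable => // x; rewrite normr_id.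
  have b (t x : R) : `|partial1of2 f t x| <= `|x| * gauss_pdf x.
    rewrite /partial1of2 derive1E (@derive_val _ _ _ _ _ _ _ (df t x)) normrN normrM normrM.
    rewrite (ger0_norm (gauss_ge0 x)) ler_wpM2r ?gauss_ge0// ler_piMr// ler_norml.
    by rewrite sin_le1 sin_geN1.
  have mem (t : R) : `]t - 1, t + 1[%classic t.
    by rewrite /= in_itv /= ltrBlDr ltrDl ltr01.
  split=> t.
    apply: (@derivable_under_integral _ _ _ leb f setT measurableT t _ _ (mem t) _ _ _ G0 iG).
    - by move=> x _; exact: i2.
    - by move=> x y _ _; case: (df x y).
    - by move=> x y _ _; exact: b.
  rewrite (@differentiation_under_integral _ _ _ leb f setT measurableT t _ _ (mem t) _ _ _ G0 iG).
  - rewrite /C -gauss_sin_ibp -mulN1r -RintegralZl//.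
      apply: eq_Rintegral => x _; rewrite /partial1of2 derive1E (@derive_val _ _ _ _ _ _ _ (df t x)).
      by rewrite mulN1r.
    apply: gauss_mulabs_integrable.
      apply: measurable_funM => //; apply: continuous_measurable_fun => x.
      by apply: continuous_comp; [apply: mulrl_continuous | exact: continuous_sin].
    by move=> x; rewrite normrM ler_piMr// ler_norml sin_le1 sin_geN1.
  - by move=> x _; exact: i2.
  - by move=> x y _ _; case: (df x y).
  - by move=> x y _ _; exact: b.
have dC' (t : R) : is_derive t 1 C (- (t * C t)).
  by rewrite -CE derive1E; apply/derivableP; exact: dC.
have d0 (t : R) : is_derive t 1 (fun t => C t * expR (t ^+ 2 / 2)) 0.
  have := dC' t => d; apply: is_derive_eq.
  by rewrite /GRing.scale /=; field.
have h := is_derive_0_is_cst a 0 d0.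
have C0 : C 0 = 1.
  transitivity (intT std_normal (cst 1 : R -> R)).
    rewrite std_normalE; last exact: bmeas_cst.
    by apply: eq_Rintegral => x _; rewrite mul0r cos0.
  by rewrite Rintegral_prob_cst.
move: h; rewrite C0 expr0n /= mul0r expR0 mulr1 => h.
apply: (@mulIf _ (expR (a ^+ 2 / 2))); first by rewrite gt_eqF// expR_gt0.
by rewrite -expRD -mulrDl addNr mul0r expR0.
Qed.

End NormalMoments.

(** * Levy's continuity theorem by Gaussian smoothing, and a Slutsky lemma *)

Section Characteristic.
Context {R : realType} {d} {T : measurableType d}.

Lemma bmeas_cos (Y : T -> R) : measT Y -> bmeas (fun x => cos (Y x)).
Proof.
move=> mY; split; last by exists 1 => x; rewrite ler_norml cos_le1 cos_geN1.
by apply: measurableT_comp => //; apply: continuous_measurable_fun; exact: continuous_cos.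
Qed.

Lemma bmeas_sin (Y : T -> R) : measT Y -> bmeas (fun x => sin (Y x)).
Proof.
move=> mY; split; last by exists 1 => x; rewrite ler_norml sin_le1 sin_geN1.
by apply: measurableT_comp => //; apply: continuous_measurable_fun; exact: continuous_sin.
Qed.

End Characteristic.

Section MeanKernel.
Context {R : realType} {d} {T : measurableType d}.
Variables (s : R) (P : probability T R) (X : T -> R).
Hypotheses (s0 : 0 < s) (mX : measT X).

(** The density at [u] of X + s N, with N a standard normal independent of [X]. *)
Definition mean_kernel (u : R) : R := intT P (fun w => normal_pdf (X w) s u).

Lemma mean_kernel_bmeas u : bmeas (fun w => normal_pdf (X w) s u).
Proof.
split; first by apply: measurable_normal_pdf2 => //; exact: measurable_cst.
exists (normal_peak s) => w; rewrite ger0_norm ?normal_pdf_ge0// normal_pdf_ub//.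
by rewrite gt_eqF.
Qed.

Lemma mean_kernel_ge0 u : 0 <= mean_kernel u.
Proof. by apply: Rintegral_ge0 => w _; exact: normal_pdf_ge0. Qed.

Definition cosfn (a : R) : R := intT P (fun w => cos (a * X w)).
Definition sinfn (a : R) : R := intT P (fun w => sin (a * X w)).

(** The normal density is a multiple of the cosine transform of the standard normal law. Exchanging
    integrals expresses the smoothed density through the characteristic function of [X], so
    pointwise convergence passes from the latter to the former by bounded convergence. *)
Lemma mean_kernel_fourier u : mean_kernel u = normal_peak s *
  intT (@std_normal R)
    (fun t => cos (t * u / s) * cosfn (t / s) + sin (t * u / s) * sinfn (t / s)).
Proof.
have mA t : measT (fun w => t / s * X w) by apply: measurable_funM => //; exact: measurable_cst.
pose f (z : T * measurableTypeR R) : R := cos (((u - X z.1) / s) * z.2).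
have bf : bmeas f.
  apply: bmeas_cos; apply: measurable_funM; last exact: measurable_snd.
  apply: measurable_funM; last exact: measurable_cst.
  by apply: measurable_funB; [exact: measurable_cst | exact: measurableT_comp mX measurable_fst].
have [b1 b2 e0 e] := prob_fubini P (@std_normal R) bf; rewrite e0 in e.
transitivity (intT P (fun w => normal_peak s *
    intT (@std_normal R) (fun t => f (w, t)))).
  apply: eq_Rintegral => w _; rewrite normal_pdfE ?gt_eqF//; congr (_ * _).
  have bw : bmeas (fun t : measurableTypeR R => f (w, t)).
    rewrite /f /=; apply: bmeas_cos.
    by apply: (@measurable_funM _ _ _ _ (cst ((u - X w) / s)) id); [exact: measurable_cst | exact: measurable_id].
  rewrite (@std_normalE R (fun t => f (w, t)) bw) /f /= normal_fourier /normal_fun; congr expR.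
  by field; rewrite gt_eqF.
rewrite RintegralZl_prob// e; congr (_ * _); apply: eq_Rintegral => t _.
rewrite /cosfn /sinfn -!RintegralZl_prob; [|by apply: bmeas_sin|by apply: bmeas_cos].
rewrite -RintegralD_prob; last 2 first.
- by apply: bmeasM; [exact: bmeas_cst | exact: bmeas_cos].
- by apply: bmeasM; [exact: bmeas_cst | exact: bmeas_sin].
apply: eq_Rintegral => w _; rewrite /f /=.
by rewrite (_ : (u - X w) / s * t = t * u / s - t / s * X w) ?cosB//; ring.
Qed.

End MeanKernel.

Section GaussianSmoothing.
Context {R : realType}.
Local Notation leb := (@lebesgue_measure R).
Variables (F : R -> R) (j M s : R).
Hypotheses (F0 : forall x, 0 <= F x) (FM : forall x, F x <= M) (cF : continuous F).
Hypothesis Flip : forall x y, F x <= F y + j * `|x - y|.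
Hypothesis s0 : 0 < s.

Definition gauss_smooth (x : R) : R := intT leb (fun u => F u * normal_pdf x s u).

Let M0 : 0 <= M. Proof. exact: le_trans (F0 0) (FM 0). Qed.

Let j0 : 0 <= j.
Proof.
have := Flip 0 1; have := Flip 1 0; rewrite subr0 sub0r normrN normr1 mulr1; lra.
Qed.

Let mF : measT F := continuous_measurable_fun cF.

Let pdf_integrable (h : R -> R) (K : R) x s' : measT h ->
  (forall u, `|h u| <= K) -> leb.-integrable setT (EFin \o (fun u => h u * normal_pdf x s' u)).
Proof.
move=> mh hK.
apply: (@le_integrable _ _ _ leb setT measurableT _ (fun u => K%:E * (normal_pdf x s' u)%:E)%E).
- by apply/measurable_EFinP; apply: measurable_funM => //; exact: measurable_normal_pdf.
- move=> u _ /=; rewrite lee_fin normrM (ger0_norm (normal_pdf_ge0 _ _ _)).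
  rewrite [leRHS]ger0_norm ?mulr_ge0 ?normal_pdf_ge0 ?ler_wpM2r ?normal_pdf_ge0//.
  exact: le_trans (hK u).
- by apply: integrableZl => //; exact: integrable_normal_pdf.
Qed.

Let mass (k x s' : R) : intT leb (fun u => k * normal_pdf x s' u) = k.
Proof.
rewrite RintegralZl//; last exact: integrable_normal_pdf.
by rewrite /Rintegral integral_normal_pdf /= mulr1.
Qed.

Lemma gauss_smooth_dist x : `|gauss_smooth x - F x| <= 2 * (j * s).
Proof.
have iF : leb.-integrable setT (EFin \o (fun u => F u * normal_pdf x s u)).
  by apply: (pdf_integrable _ _ mF) => u; rewrite ger0_norm.
have iC k s' : leb.-integrable setT (EFin \o (fun u => k * normal_pdf x s' u)).
  by apply: (@pdf_integrable (cst k) `|k|) => //; exact: measurable_cst.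
rewrite -[X in _ - X](mass (F x) x s) -RintegralB//.
have -> : 2 * (j * s) = intT leb (fun u => 2 * (j * s) * normal_pdf x (2 * s) u).
  by rewrite mass.
have iD : leb.-integrable setT (EFin \o (fun u => F u * normal_pdf x s u - F x * normal_pdf x s u)).
  have := @integrableB _ _ _ leb setT measurableT _ _ iF (iC (F x) s).
  by congr (integrable _ _ _); apply/funext => u.
apply: (le_trans (le_normr_Rintegral measurableT iD)).
apply: le_Rintegral => //; first by have := integrable_norm iD.
move=> u _; rewrite -mulrBl normrM (ger0_norm (normal_pdf_ge0 _ _ _)).
apply: (@le_trans _ _ (j * (`|u - x| * normal_pdf x s u))).
  rewrite mulrA ler_wpM2r ?normal_pdf_ge0// ler_norml.
  by have := Flip x u; have := Flip u x; rewrite (distrC x); lra.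
have h := @normal_pdf_mulabs R x s u s0.
by apply: (le_trans (ler_wpM2l j0 h)); apply: eq_ler; ring.
Qed.

Section Law.
Context {d} {T : measurableType d} (P : probability T R).
Variable X : T -> R.
Hypothesis mX : measT X.

Let K (z : T * measurableTypeR R) : \bar R := (F z.2 * normal_pdf (X z.1) s z.2)%:E.

Let mK : measT K.
Proof.
apply/measurable_EFinP; apply: measurable_funM.
  exact: (measurableT_comp mF measurable_snd).
by apply: measurable_normal_pdf2 => //; exact: measurableT_comp mX measurable_fst.
Qed.

Let K0 z : (0 <= K z)%E.
Proof. by rewrite lee_fin mulr_ge0// normal_pdf_ge0. Qed.

Let inner1 w : (\int[leb]_u K (w, u) = (gauss_smooth (X w))%:E)%E.
Proof.
rewrite /gauss_smooth /Rintegral fineK//; apply: integrable_fin_num => //.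
by apply: (pdf_integrable _ _ mF) => u; rewrite ger0_norm.
Qed.

Let inner2 u : (\int[P]_w K (w, u) = (F u * mean_kernel s P X u)%:E)%E.
Proof.
rewrite /mean_kernel EFinM EFin_Rintegral_prob; last exact: mean_kernel_bmeas.
rewrite -ge0_integralZl_EFin//.
- by move=> w _; rewrite lee_fin normal_pdf_ge0.
- by apply/measurable_EFinP; exact: (mean_kernel_bmeas s0 mX u).1.
Qed.

Lemma gauss_smooth_mean :
  [/\ bmeas (fun w => gauss_smooth (X w)),
      leb.-integrable setT (EFin \o (fun u => F u * mean_kernel s P X u)) &
  intT P (fun w => gauss_smooth (X w)) =
  intT leb (fun u => F u * mean_kernel s P X u)].
Proof.
have bS : bmeas (fun w => gauss_smooth (X w)).
  split.
    apply/measurable_EFinP.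
    have := @measurable_fun_fubini_tonelli_F _ _ _ _ _ leb K mK K0.
    by congr measurable_fun; apply/funext => w; rewrite /fubini_F inner1.
  exists (M + 2 * (j * s)) => w; have := gauss_smooth_dist (X w).
  by have := F0 (X w); have := FM (X w); rewrite !ler_norml; lra.
have e : (\int[leb]_u (F u * mean_kernel s P X u)%:E = (intT P (fun w => gauss_smooth (X w)))%:E)%E.
  rewrite EFin_Rintegral_prob//.
  have := @fubini_tonelli _ _ _ _ _ P leb K mK K0.
  under eq_integral do rewrite inner1.
  by move=> ->; apply: eq_integral => u _; rewrite inner2.
split => //.
  apply/integrableP; split.
    apply/measurable_EFinP; apply: measurable_funM => //.
    apply/measurable_EFinP.
    have mk : measT (fun z : T * measurableTypeR R => (normal_pdf (X z.1) s z.2)%:E).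
      by apply/measurable_EFinP; apply: measurable_normal_pdf2 => //; exact: measurableT_comp mX measurable_fst.
    have := @measurable_fun_fubini_tonelli_G _ _ _ _ _ P _ mk.
    move=> /(_ _)/Wrap[|]; first by move=> z; rewrite lee_fin normal_pdf_ge0.
    by congr measurable_fun; apply/funext => u; rewrite /fubini_G /= /mean_kernel EFin_Rintegral_prob//; exact: mean_kernel_bmeas.
  under eq_integral do rewrite /= ger0_norm ?mulr_ge0 ?mean_kernel_ge0//.
  by rewrite e ltry.
by rewrite /Rintegral e.
Qed.

End Law.

End GaussianSmoothing.

(** Smoothing at a width [s] with [2 * (j * s) <= e / 4] costs [e / 4] on each side; the smoothed
    densities converge pointwise, and Fatou's lemma loses another [e / 4]. Fatou takes the place of
    tightness, at the price of a one-sided bound; the other side will come from [M - f]. *)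
Lemma levy_liminf {R : realType} {d d'} {T : measurableType d} {T' : measurableType d'}
    (P : probability T R) (Q : probability T' R) (G : nat -> T -> R) (H : T' -> R) (F : R -> R) (j M e : R) :
  (forall m, measT (G m)) -> measT H ->
  (forall a, (fun m => cosfn P (G m) a) @ \oo --> cosfn Q H a) ->
  (forall a, (fun m => sinfn P (G m) a) @ \oo --> sinfn Q H a) ->
  (forall x, 0 <= F x) -> (forall x, F x <= M) -> continuous F ->
  (forall x y, F x <= F y + j * `|x - y|) -> 0 < e ->
  \forall m \near \oo, intT Q (fun w => F (H w)) - e <=
    intT P (fun w => F (G m w)).
Proof.
move=> mG mH cc cs F0 FM cF Flip e0.
have j0 : 0 <= j.
  by have := Flip 0 1; have := Flip 1 0; rewrite subr0 sub0r normrN normr1 mulr1; lra.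
pose s := e / (8 * (j + 1)).
have s0 : 0 < s by rewrite /s divr_gt0// mulr_gt0//; lra.
have js : 2 * (j * s) <= e / 4.
  rewrite /s (_ : 2 * (j * (e / (8 * (j + 1)))) = j / (j + 1) * (e / 4)); last by field; lra.
  by rewrite ler_piMl// ?divr_ge0 ?(ltW e0)// ler_pdivrMr ?mul1r; lra.
pose k m u := mean_kernel s P (G m) u; pose k0 u := mean_kernel s Q H u.
have ck u : (fun m => k m u) @ \oo --> k0 u.
  rewrite /k0 mean_kernel_fourier//.
  under eq_fun do rewrite /k mean_kernel_fourier//.
  apply: cvgM; first exact: cvg_cst.
  have bt d1 (T1 : measurableType d1) (P1 : probability T1 R) (X : T1 -> R) : measT X ->
      bmeas (fun t : measurableTypeR R => cos (t * u / s) * cosfn P1 X (t / s) + sin (t * u / s) * sinfn P1 X (t / s)).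
    move=> mX.
    have mz : measT (fun z : T1 * measurableTypeR R => z.2 / s * X z.1).
      apply: measurable_funM; last exact: measurableT_comp mX measurable_fst.
      by apply: measurable_funM; [exact: measurable_snd | exact: measurable_cst].
    have mt : measT (fun t : measurableTypeR R => t * u / s).
      by do 2 (apply: measurable_funM; last exact: measurable_cst).
    have bc := bmeas_cos mz; have bs := bmeas_sin mz.
    have [_ b1 _ _] := prob_fubini P1 (@std_normal R) bc.
    have [_ b2 _ _] := prob_fubini P1 (@std_normal R) bs.
    by apply: bmeasD; apply: bmeasM => //; [exact: bmeas_cos | exact: bmeas_sin].
  apply: (@Rintegral_bounded_cvg R _ _ (@std_normal R) 2).
  - by move=> m; case: (bt _ _ P (G m) (mG m)).
  - have ab := normr_Rintegral_prob.
    have c1 (x : R) : `|cos x| <= 1 by rewrite ler_norml cos_le1 cos_geN1.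
    have s1 (x : R) : `|sin x| <= 1 by rewrite ler_norml sin_le1 sin_geN1.
    move=> m t; apply: (le_trans (ler_normD _ _)); rewrite (_ : 2 = 1 + 1)//.
    have mt : measT (fun w => t / s * G m w) by apply: measurable_funM => //; exact: measurable_cst.
    by apply: lerD; rewrite normrM -[leRHS]mulr1; apply: ler_pM => //; apply: ab => //;
      [exact: bmeas_cos | exact: bmeas_sin].
  - by move=> t; apply: cvgD; apply: cvgM; (try exact: cvg_cst); [exact: cc | exact: cs].
have [bS iS eS] := gauss_smooth_mean F0 FM cF Flip s0 Q mH.
have h m := gauss_smooth_mean F0 FM cF Flip s0 P (mG m).
have e4 : 0 < e / 4 by lra.
have hn := @fatou_near R _ _ (@lebesgue_measure R) (fun m u => F u * k m u) (fun u => F u * k0 u) _ e4 _ iS _ _.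
have bF d1 (T1 : measurableType d1) (X : T1 -> R) : measT X -> bmeas (fun w => F (X w)).
  move=> mX; split; first by apply: measurableT_comp => //; exact: continuous_measurable_fun.
  by exists M => w; rewrite ger0_norm.
have dist x := gauss_smooth_dist F0 FM cF Flip s0 x.
have low : intT Q (fun w => F (H w)) - 2 * (j * s) <= intT Q (fun w => gauss_smooth F s (H w)).
  rewrite -{1}(Rintegral_prob_cst Q (2 * (j * s))) -RintegralB_prob; [|exact: bF|exact: bmeas_cst].
  apply: le_Rintegral_prob => //; first by apply: bmeasB; [exact: bF | exact: bmeas_cst].
  by move=> w; have := dist (H w); rewrite ler_norml; lra.
near=> m.
have up : intT P (fun w => gauss_smooth F s (G m w)) - 2 * (j * s) <= intT P (fun w => F (G m w)).
  have [b _ _] := h m.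
  rewrite -{1}(Rintegral_prob_cst P (2 * (j * s))) -RintegralB_prob//; last exact: bmeas_cst.
  apply: le_Rintegral_prob => //; [by apply: bmeasB => //; exact: bmeas_cst | exact: bF |].
  by move=> w; have := dist (G m w); rewrite ler_norml; lra.
have mid : intT lebesgue_measure (fun u => F u * k0 u) - e / 4 <= intT lebesgue_measure (fun u => F u * k m u).
  near: m; apply: hn.
  - by move=> m; have [] := h m.
  - by move=> m u; rewrite mulr_ge0// mean_kernel_ge0.
  - by move=> u; apply: cvgM; [exact: cvg_cst | exact: ck].
have [_ _ eG] := h m; rewrite eG in up; rewrite eS in low; rewrite -/(k m) in up.
pose A := intT lebesgue_measure (fun u => F u * k0 u).
pose B := intT lebesgue_measure (fun u => F u * k m u).
have {}up : B - 2 * (j * s) <= intT P (fun w => F (G m w)) := up.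
have {}low : intT Q (fun w => F (H w)) - 2 * (j * s) <= A := low.
have {}mid : A - e / 4 <= B := mid.
move: A B up low mid => A B.
move: (intT P (fun w => F (G m w))) (intT Q (fun w => F (H w))) => C D.
by move: js e0; clear; lra.
Unshelve. all: by end_near. Qed.

(** On [A] the functional [Phi m] is the value of [f] at a point close to the measurable [G m]; a
    Lipschitz minorant along [G m], lowered by [j] times the distance and cut to [A], is therefore a
    measurable function below it. The argument is run for [f + M] and for [M - f], which gives both
    bounds. *)
Lemma slutsky_nonmeas {R : realType} {d d'} {T : measurableType d} {T' : measurableType d'}
    (P : probability T R) (Q : probability T' R) (G : nat -> T -> R) (H : T' -> R)
    (f : R -> R) (M : R) (Phi : nat -> T -> R) :
  (forall m, measT (G m)) -> measT H ->
  (forall a, (fun m => cosfn P (G m) a) @ \oo --> cosfn Q H a) ->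
  (forall a, (fun m => sinfn P (G m) a) @ \oo --> sinfn Q H a) ->
  continuous f -> (forall x, `|f x| <= M) ->
  (forall m w, `|Phi m w| <= M) ->
  (forall e, 0 < e -> \forall m \near \oo, exists A : set T,
     [/\ measurable A, ((1 - e)%:E <= P A)%E &
      forall w, A w -> exists2 y, Phi m w = f y & `|y - G m w| <= e]) ->
  (fun m => intT P (Phi m)) @ \oo --> intT Q (fun w => f (H w)).
Proof.
move=> mG mH cc cs cf fM PM hA.
have M0 : 0 <= M by apply: le_trans (fM 0).
have mf := continuous_measurable_fun cf.
have bfH : bmeas (fun w => f (H w)).
  by split; [exact: measurableT_comp | exists M].
have low (F : R -> R) (Psi : nat -> T -> R) : continuous F -> (forall x, 0 <= F x) ->
    (forall x, F x <= 2 * M) -> (forall m w, 0 <= Psi m w) ->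
    (forall m w y, Phi m w = f y -> Psi m w = F y) ->
    forall e, 0 < e -> \forall m \near \oo, exists2 g : T -> R, bmeas g &
      (forall w, g w <= Psi m w) /\
      intT Q (fun w => F (H w)) - e <= intT P g.
  move=> cF F0 FM Psi0 PsiE e e0.
  have mF := continuous_measurable_fun cF.
  have L0 := lip_minorant_ge0 F0; have Lle := lip_minorant_le F0.
  have Lc j := lip_minorant_continuous F0 (j := j).
  have LM j x : lip_minorant F j x <= 2 * M by apply: le_trans (FM x).
  have cvgL : (fun j => intT Q (fun w => lip_minorant F j (H w))) @ \oo -->
      intT Q (fun w => F (H w)).
    apply: (@Rintegral_bounded_cvg _ _ _ Q (2 * M)).
    - by move=> j; apply: measurableT_comp => //; exact: continuous_measurable_fun.
    - by move=> j w; rewrite ger0_norm.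
    - by move=> w; exact: (lip_minorant_cvg F0 FM).
  have e4 : 0 < e / 4 by lra.
  have /cvgrPdist_le /(_ _ e4) [j _ /(_ j (leqnn j))] := cvgL.
  rewrite ler_norml => /andP[_ hj].
  pose e' := e / (4 * (j%:R + 2 * M + 1)).
  have j0 : 0 <= j%:R :> R by [].
  have D0 : 0 < 4 * (j%:R + 2 * M + 1) by lra.
  have e'0 : 0 < e' by rewrite divr_gt0.
  have je' : (j%:R + 2 * M) * e' <= e / 4.
    rewrite /e' (_ : _ * _ = (j%:R + 2 * M) / (j%:R + 2 * M + 1) * (e / 4)); last by field; lra.
    by rewrite ler_piMl ?(ltW e4)// ler_pdivrMr; lra.
  have hL := levy_liminf mG mH cc cs (L0 j) (LM j) (Lc j) (lip_minorant_lip F0 j) e4.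
  near=> m.
  have hLm : intT Q (fun w => lip_minorant F j (H w)) - e / 4 <=
      intT P (fun w => lip_minorant F j (G m w)) by near: m; exact: hL.
  have [A [mA PA HA]] : exists A : set T,
     [/\ measurable A, ((1 - e')%:E <= P A)%E &
      forall w, A w -> exists2 y, Phi m w = f y & `|y - G m w| <= e'].
    by near: m; exact: hA.
  have bL : bmeas (fun w => lip_minorant F j (G m w)).
    split; first by apply: measurableT_comp => //; exact: continuous_measurable_fun.
    by exists (2 * M) => w; rewrite ger0_norm.
  have bA : bmeas (\1_A : T -> R) by exact: bmeas_indic.
  exists (fun w => (lip_minorant F j (G m w) - j%:R * e') * \1_A w).
    by apply: bmeasM => //; apply: bmeasB => //; exact: bmeas_cst.
  split=> [w|].
    rewrite indicE; case: (boolP (w \in A)) => [|_]; rewrite ?mulr1 ?mulr0//.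
    rewrite inE => /HA[y /PsiE -> hy]; rewrite lerBlDr.
    apply: (le_trans (lip_minorant_lip F0 j _ y)).
    by apply: lerD => //; rewrite ler_wpM2l// distrC.
  have : intT P (fun w => lip_minorant F j (G m w) - (j%:R * e' + 2 * M * (1 - \1_A w))) <=
      intT P (fun w => (lip_minorant F j (G m w) - j%:R * e') * \1_A w).
    have b1 : bmeas (fun w => 2 * M * (1 - \1_A w) : R).
      apply: bmeasM; first exact: bmeas_cst.
      by apply: bmeasB => //; exact: bmeas_cst.
    apply: le_Rintegral_prob.
    - by apply: bmeasB => //; apply: bmeasD => //; exact: bmeas_cst.
    - by apply: bmeasM => //; apply: bmeasB => //; exact: bmeas_cst.
    move=> w; have := LM j (G m w); have : 0 <= j%:R * e' by rewrite mulr_ge0// ltW.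
    by rewrite indicE; case: (w \in A); rewrite ?mulr1 ?mulr0 ?subrr ?subr0 ?mulr0 ?mulr1; lra.
  have b2 : bmeas (fun w => 1 - \1_A w : R) by apply: bmeasB => //; exact: bmeas_cst.
  have b3 : bmeas (fun w => 2 * M * (1 - \1_A w) : R) by apply: bmeasM => //; exact: bmeas_cst.
  rewrite RintegralB_prob//; last by apply: bmeasD => //; exact: bmeas_cst.
  rewrite RintegralD_prob//; last exact: bmeas_cst.
  rewrite Rintegral_prob_cst RintegralZl_prob// RintegralB_prob//; last exact: bmeas_cst.
  rewrite Rintegral_prob_cst Rintegral_indic_prob//.
  have PA' : 1 - e' <= fine (P A) by rewrite -lee_fin fineK// fin_num_measure.
  have : 2 * M * (1 - fine (P A)) <= 2 * M * e' by rewrite ler_wpM2l//; lra.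
  by move: hLm hj je' e0; clear; lra.
have up0 := low (fun x => f x + M) (fun m w => Phi m w + M).
have lo0 := low (fun x => M - f x) (fun m w => M - Phi m w).
apply/cvgrPdist_le => e e0.
have bnd x : - M <= f x <= M by rewrite -ler_norml.
have bndP m w : - M <= Phi m w <= M by rewrite -ler_norml.
have up : \forall m \near \oo, intT Q (fun w => f (H w)) - e <= intT P (Phi m).
  have : \forall m \near \oo, exists2 g : T -> R, bmeas g &
      (forall w, g w <= Phi m w + M) /\
      intT Q (fun w => f (H w) + M) - e <= intT P g.
    apply: up0 => //.
    - by move=> x; apply: cvgD; [exact: cf | exact: cvg_cst].
    - by move=> x; have := bnd x; lra.
    - by move=> x; have := bnd x; lra.
    - by move=> m w; have := bndP m w; lra.
    - by move=> m w y ->.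
  apply: filterS => m [g bg [gP hg]].
  have le : intT P (fun w => g w - M) <= intT P (Phi m).
    apply: le_Rintegral_nonmeas => [||w]; [exact: (bmeasB bg (bmeas_cst M)).2 | by exists M |].
    by have := gP w; lra.
  move: hg le; rewrite RintegralD_prob//; last exact: bmeas_cst.
  rewrite RintegralB_prob//; last exact: bmeas_cst.
  by rewrite !Rintegral_prob_cst; lra.
have lo : \forall m \near \oo, intT P (Phi m) <= intT Q (fun w => f (H w)) + e.
  have : \forall m \near \oo, exists2 g : T -> R, bmeas g &
      (forall w, g w <= M - Phi m w) /\
      intT Q (fun w => M - f (H w)) - e <= intT P g.
    apply: lo0 => //.
    - by move=> x; apply: cvgB; [exact: cvg_cst | exact: cf].
    - by move=> x; have := bnd x; lra.
    - by move=> x; have := bnd x; lra.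
    - by move=> m w; have := bndP m w; lra.
    - by move=> m w y ->.
  apply: filterS => m [g bg [gP hg]].
  have le : intT P (Phi m) <= intT P (fun w => M - g w).
    apply: le_Rintegral_nonmeas => [||w]; [by exists M | exact: (bmeasB (bmeas_cst M) bg).2 |].
    by have := gP w; lra.
  move: hg le; rewrite RintegralB_prob//; last exact: bmeas_cst.
  rewrite RintegralB_prob//; last exact: bmeas_cst.
  by rewrite !Rintegral_prob_cst; lra.
near=> m.
have h1 : intT Q (fun w => f (H w)) - e <= intT P (Phi m) by near: m; exact: up.
have h2 : intT P (Phi m) <= intT Q (fun w => f (H w)) + e by near: m; exact: lo.
by rewrite ler_norml; lra.
Unshelve. all: by end_near. Qed.

Lemma is_derive_powR_affine {R : realType} (c k e x : R) : 0 < c + k * x ->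
  is_derive x 1 (fun x => (c + k * x) `^ e) (e * k * (c + k * x) `^ (e - 1)).
Proof.
move=> h.
have d3 : is_derive x 1 (fun x : R => c + k * x) k.
  by apply: is_derive_eq; rewrite /GRing.scale /=; ring.
have d4 := @is_derive1_comp _ ((@powR R) ^~ e) (fun x => c + k * x) x _ _ (is_derive1_powR e h) d3.
by apply: is_derive_eq; ring.
Qed.

Lemma powR_affine_continuous {R : realType} (c k e x : R) : 0 < c + k * x ->
  {for x, continuous (fun x => (c + k * x) `^ e)}.
Proof.
move=> h; apply/differentiable_continuous/derivable1_diffP.
by case: (is_derive_powR_affine e h).
Qed.

Lemma powR_neg_cvg {R : realType} (e : R) : 0 < e -> x `^ (- e) @[x --> +oo] --> (0 : R).
Proof.
move=> e0.
have -> : (fun x : R => x `^ (- e)) = (fun x => (x `^ e)^-1).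
  by apply/funext => x; rewrite powRN.
have : (fun x : R => x `^ e) x @[x --> +oo] --> +oo; last first.
  by move=> c; apply/(gtr0_cvgV0 _); [near=> x; rewrite powR_gt0//; near: x; exact: nbhs_pinfty_gt | exact: c].
apply/cvgryPge => A; near=> x.
have hx : (Num.max A 0) `^ e^-1 <= x by near: x; exact: nbhs_pinfty_ge.
apply: (@le_trans _ _ (((Num.max A 0) `^ e^-1) `^ e)).
  by rewrite -powRrM mulVf ?gt_eqF// powRr1 ?le_max ?lexx ?orbT.
by apply: ge0_ler_powR => //; rewrite ?nnegrE ?powR_ge0 ?(le_trans _ hx) ?powR_ge0// ltW.
Unshelve. all: by end_near. Qed.

Lemma eq_Rintegral_prob1 {R : realType} {d} {T : measurableType d} (P : probability T R)
    (A : set T) (f g : T -> R) : measurable A -> P A = 1%E -> bmeas f -> bmeas g ->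
  (forall w, A w -> f w = g w) -> intT P f = intT P g.
Proof.
move=> mA PA bf bg fg; have [mf [M fM]] := bf; have [mg [M' gM]] := bg.
have bA : bmeas (\1_A : T -> R) by exact: bmeas_indic.
apply/eqP; rewrite -subr_eq0 -RintegralB_prob//; apply/eqP.
have bAc : bmeas (fun w => (M + M') * (1 - \1_A w) : R).
  by apply: bmeasM; [exact: bmeas_cst | apply: bmeasB => //; exact: bmeas_cst].
have z : intT P (fun w => (M + M') * (1 - \1_A w)) = 0.
  rewrite RintegralZl_prob; last by apply: bmeasB => //; exact: bmeas_cst.
  rewrite RintegralB_prob//; last exact: bmeas_cst.
  by rewrite Rintegral_prob_cst Rintegral_indic_prob// PA /= subrr mulr0.
have key w : `|f w - g w| <= (M + M') * (1 - \1_A w).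
  rewrite indicE; have [|nA] := boolP (w \in A).
    by rewrite inE => /fg ->; rewrite !subrr mulr0 normr0.
  by rewrite subr0 mulr1; apply: (le_trans (ler_normB _ _)); exact: lerD.
have bfg := bmeasB bf bg.
apply: le_anti; apply/andP; split.
  rewrite -z; apply: le_Rintegral_prob => // w; exact: le_trans (ler_norm _) (key w).
rewrite -oppr0 -z lerNl.
have -> : - intT P (fun w => f w - g w) = intT P (fun w => -1 * (f w - g w)).
  by rewrite RintegralZl_prob// mulN1r.
apply: le_Rintegral_prob => //; first by apply: bmeasM => //; exact: bmeas_cst.
by move=> w; rewrite mulN1r; apply: le_trans (key w); rewrite -normrN; exact: ler_norm.
Qed.

(** * The Pareto field: phases of mirror pairs given the height of the peak *)

Section ProductOfCosines.
Context {R : realType} {d} {T : measurableType d}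
  (P : probability T R) (I : eqType) (E : I -> set (set T)).
Hypothesis E_T : forall i, E i setT.
Hypothesis E_I : forall i, setI_closed (E i).
Hypothesis E_meas : forall i A, E i A -> measurable A.
Hypothesis E_indep : mutually_indep P E.

(** Multiplicativity of characteristic functions in real form: as every single sine mean vanishes,
    the addition formulas leave the product of the cosine means, and a vanishing sine mean for the
    sum. *)
Lemma expect_prod_cos (J : nat -> pred I) (F S : nat -> T -> R) (s : seq nat) :
  uniq s ->
  (forall i j x, i != j -> J i x -> J j x -> False) ->
  (forall i, i \in s -> bmeas (F i : fam_space E (J i) -> R)) ->
  (forall i, i \in s -> measT (S i : fam_space E (J i) -> R)) ->
  (forall i, i \in s -> intT P (fun w => F i w * sin (S i w)) = 0) ->
  intT P (fun w => (\prod_(i <- s) F i w) * cos (\sum_(i <- s) S i w)) =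
  \prod_(i <- s) intT P (fun w => F i w * cos (S i w)) /\
  intT P (fun w => (\prod_(i <- s) F i w) * sin (\sum_(i <- s) S i w)) = 0.
Proof.
move=> us dis.
elim: s us => [_ _ _ _|i s IH /= /andP[ins us] bF mS z].
  rewrite big_nil.
  under eq_Rintegral do rewrite !big_nil cos0 mulr1.
  rewrite Rintegral_prob_cst; split=> //.
  under eq_Rintegral do rewrite !big_nil sin0 mulr0.
  by rewrite Rintegral_prob_cst.
have bF' j : j \in s -> bmeas (F j : fam_space E (J j) -> R).
  by move=> js; apply: bF; rewrite inE js orbT.
have mS' j : j \in s -> measT (S j : fam_space E (J j) -> R).
  by move=> js; apply: mS; rewrite inE js orbT.
have z' j : j \in s -> intT P (fun w => F j w * sin (S j w)) = 0.
  by move=> js; apply: z; rewrite inE js orbT.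
have [IHc IHs] := IH us bF' mS' z'.
have is_ : i \in i :: s by rewrite inE eqxx.
pose Js : pred I := fun x => has (fun j => J j x) s.
have disJ x : J i x -> Js x -> False.
  move=> Jx /hasP[j js Jjx]; apply: (dis i j x) => //.
  by apply: contra ins => /eqP ->.
have bFi : bmeas (F i : fam_space E (J i) -> R) by exact: bF.
have mSi : measT (S i : fam_space E (J i) -> R) by exact: mS.
have sub j : j \in s -> {subset J j <= Js}.
  by move=> js x Jx; apply/hasP; exists j.
have bprod : bmeas ((fun w => \prod_(j <- s) F j w) : fam_space E Js -> R).
  rewrite (_ : (fun w => _) = (fun w => \prod_(j <- s | j \in s) F j w)); last first.
    by apply/funext => w; rewrite [LHS]big_seq.
  apply: bmeas_prod => j js; have [mf hf] := bF' j js; split => //.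
  exact: (fam_sub (sub j js) mf).
have msum : measT ((fun w => \sum_(j <- s) S j w) : fam_space E Js -> R).
  rewrite (_ : (fun w => _) = (fun w => \sum_(j <- s) (if j \in s then S j w else 0))); last first.
    by apply/funext => w; rewrite [LHS]big_seq [RHS]big_seq; apply: eq_bigr => j ->.
  have mm j : measT ((fun w => if j \in s then S j w else 0) : fam_space E Js -> R).
    case: (boolP (j \in s)) => js; last exact: measurable_cst.
    exact: (fam_sub (sub j js) (mS' j js)).
  exact: (measurable_sum s mm).
have ex := fam_expectM E_T E_I E_meas E_indep disJ.
have bc1 : bmeas ((fun w => F i w * cos (S i w)) : fam_space E (J i) -> R).
  by apply: bmeasM => //; exact: bmeas_cos.
have bs1 : bmeas ((fun w => F i w * sin (S i w)) : fam_space E (J i) -> R).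
  by apply: bmeasM => //; exact: bmeas_sin.
have bc2 : bmeas ((fun w => (\prod_(j <- s) F j w) * cos (\sum_(j <- s) S j w)) : fam_space E Js -> R).
  by apply: bmeasM => //; exact: bmeas_cos.
have bs2 : bmeas ((fun w => (\prod_(j <- s) F j w) * sin (\sum_(j <- s) S j w)) : fam_space E Js -> R).
  by apply: bmeasM => //; exact: bmeas_sin.
have up J0 (f : T -> R) : bmeas (f : fam_space E J0 -> R) -> bmeas f by exact: fam_bmeas.
have uM (f g : T -> R) : bmeas (f : fam_space E (J i) -> R) -> bmeas (g : fam_space E Js -> R) ->
    bmeas (fun w => f w * g w).
  by move=> bf bg; apply: bmeasM; [exact: up bf | exact: up bg].
split.
  rewrite big_cons -IHc -(ex _ _ bc1 bc2).
  have -> : intT P (fun w => (F i w * cos (S i w)) *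
      ((\prod_(j <- s) F j w) * cos (\sum_(j <- s) S j w))) =
    intT P (fun w => (F i w * cos (S i w)) *
      ((\prod_(j <- s) F j w) * cos (\sum_(j <- s) S j w))) -
    intT P (fun w => (F i w * sin (S i w)) *
      ((\prod_(j <- s) F j w) * sin (\sum_(j <- s) S j w))).
    by rewrite (ex _ _ bs1 bs2) IHs mulr0 subr0.
  rewrite -RintegralB_prob; [|exact: uM|exact: uM].
  by apply: eq_Rintegral => w _; rewrite !big_cons cosD; ring.
transitivity (intT P (fun w => (F i w * sin (S i w)) *
      ((\prod_(j <- s) F j w) * cos (\sum_(j <- s) S j w))) +
    intT P (fun w => (F i w * cos (S i w)) *
      ((\prod_(j <- s) F j w) * sin (\sum_(j <- s) S j w)))).
  rewrite -RintegralD_prob; [|exact: uM|exact: uM].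
  by apply: eq_Rintegral => w _; rewrite !big_cons sinD; ring.
by rewrite (ex _ _ bs1 bc2) (ex _ _ bc1 bs2) IHs z// mul0r mulr0 addr0.
Qed.

End ProductOfCosines.

Record pareto_field {R : realType} (alpha : R) (p : nat -> R) {d} {T : measurableType d}
    (P : probability T R) (xi0 : int -> T -> R) (c : nat -> T -> bool) : Prop := ParetoField {
  field_alpha : 2 <= alpha;
  field_p : forall n, 0 <= p n <= 1;
  field_meas : forall z, measT (xi0 z);
  field_tail : forall z (x : R), 1 <= x -> P [set w | x < xi0 z w] = (x `^ (- alpha))%:E;
  field_coin_meas : forall n, measurable [set w | c n w];
  field_coin : forall n, (0 < n)%N -> P [set w | c n w] = (p n)%:E;
  field_indep : mutually_indep P (rv_family xi0 (fun n => c n.+1)) }.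

Section ParetoField.
Context {R : realType} {alpha : R} {p : nat -> R} {d} {T : measurableType d}
  {P : probability T R} {xi0 : int -> T -> R} {c : nat -> T -> bool}.
Hypothesis fld : pareto_field alpha p P xi0 c.
Local Notation leb := (@lebesgue_measure R).
Local Notation E := (rv_family xi0 (fun n => c n.+1)).
Local Notation space J := (fam_space E J).

Let fT := rv_familyT xi0 (fun n => c n.+1).
Let fI := @rv_familyI R _ T _ _ xi0 (fun n => c n.+1).
Let fM := @rv_family_meas R _ T _ _ xi0 (fun n => c n.+1) (field_meas fld)
  (fun n => field_coin_meas fld n.+1).
Let indep := field_indep fld.
Let mxi := field_meas fld.

Let alpha0 : 0 < alpha. Proof. have := field_alpha fld; lra. Qed.

Lemma pareto_law z (K : R) (f : R -> R) : bmeas f ->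
  intT P (fun w => f (xi0 z w) * (1 < xi0 z w <= K)%R%:R) =
  Rintegral leb `]1, K] (fun x => f x * (alpha * x `^ (- alpha - 1))).
Proof.
move=> bf.
have pos (x : R) : 1 <= x -> 0 < 0 + 1 * x by move=> x1; lra.
have := @law_interval R d T P (xi0 z) 1 K (fun x => x `^ (- alpha))
  (fun x => alpha * x `^ (- alpha - 1)) f (mxi z).
move=> /(_ _ _ _ _ bf)/Wrap[| | | |[]//].
- move=> x x1; have := @is_derive1_powR _ (- alpha) x.
  move=> /(_ _)/Wrap[|dx]; first by lra.
  by apply: is_derive_eq; rewrite mulNr.
- move=> x x1; apply: cvgM; first exact: cvg_cst.
  have := @powR_affine_continuous R 0 1 (- alpha - 1) x (pos x x1).
  by under [X in {for _, continuous X}]eq_fun do rewrite add0r mul1r.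
- by move=> x _; rewrite mulr_ge0 ?powR_ge0// ltW.
- by move=> x x1; exact: (field_tail fld).
Qed.

Lemma pareto_gt1 z : P [set w | 1 < xi0 z w] = 1%E.
Proof. by rewrite (field_tail fld)// powR1. Qed.

Lemma measurable_gt z (x : R) : measurable [set w | x < xi0 z w].
Proof.
rewrite (_ : [set w | _] = xi0 z @^-1` `]x, +oo[%classic).
  by rewrite -[X in measurable X]setTI; exact: mxi.
by apply/seteqP; split => w /=; rewrite in_itv /= andbT.
Qed.

Lemma bmeas_site z (f : R -> R) : bmeas f -> bmeas (fun w => f (xi0 z w)).
Proof. by move=> [mf [M hM]]; split; [exact: (measurableT_comp mf (mxi z)) | exists M]. Qed.

Lemma same_law z z' (f : R -> R) : bmeas f ->
  intT P (fun w => f (xi0 z w)) = intT P (fun w => f (xi0 z' w)).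
Proof.
move=> bf; have [mf [M hM]] := bf.
have bI y (n : nat) : bmeas (fun w => f (xi0 y w) * (1 < xi0 y w <= n%:R)%R%:R).
  apply: bmeasM; first exact: bmeas_site.
  have : measurable ([set w | 1 < xi0 y w] `&` ~` [set w | n%:R < xi0 y w]).
    by apply: measurableI; [|apply: measurableC]; exact: measurable_gt.
  move=> /(@bmeas_indic R d T); congr bmeas; apply/funext => w; rewrite indicE; congr (nat_of_bool _)%:R.
  apply/idP/idP; rewrite inE /=; first by case=> -> /negP; rewrite -leNgt.
  by move=> /andP[-> h]; split => //; apply/negP; rewrite -leNgt.
have bG y : bmeas (fun w => f (xi0 y w) * (1 < xi0 y w)%R%:R).
  apply: bmeasM; first exact: bmeas_site.
  have := @bmeas_indic R d T _ (measurable_gt y 1).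
  by congr bmeas; apply/funext => w; rewrite indicE; congr (nat_of_bool _)%:R; apply/idP/idP; rewrite inE.
have lim y : (fun n : nat => intT P (fun w => f (xi0 y w) * (1 < xi0 y w <= n%:R)%R%:R))
    @ \oo --> intT P (fun w => f (xi0 y w)).
  rewrite (_ : intT P (fun w => f (xi0 y w)) =
      intT P (fun w => f (xi0 y w) * (1 < xi0 y w)%R%:R)); last first.
    apply: (eq_Rintegral_prob1 (measurable_gt y 1) (pareto_gt1 y) (bmeas_site y bf) (bG y)).
    by move=> w /= ->; rewrite mulr1.
  apply: (@Rintegral_bounded_cvg _ _ _ P M) => [n|n w|w].
  - by case: (bI y n).
  - rewrite normrM; case: (1 < xi0 y w <= n%:R)%R; rewrite ?normr1 ?normr0 ?mulr1 ?mulr0//.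
    exact: le_trans (hM 0).
  - apply: cvg_near_cst; near=> n.
    have -> : (xi0 y w <= n%:R)%R by near: n; exact: nbhs_infty_ger.
    by rewrite andbT.
have l2 : (fun n : nat => intT P (fun w => f (xi0 z w) * (1 < xi0 z w <= n%:R)%R%:R))
    @ \oo --> intT P (fun w => f (xi0 z' w)).
  by under eq_fun do rewrite (pareto_law z _ bf) -(pareto_law z' _ bf); exact: lim.
exact: (cvg_unique _ (lim z) l2).
Unshelve. all: by end_near. Qed.

(** The mean of [h] over two independent Pareto variables, realised by two copies of the site 0;
    [pair_law] identifies it with the mean over any two distinct sites. *)
Definition pair_mean (h : R * R -> R) : R :=
  intT P (fun w => intT P (fun w' => h (xi0 0 w, xi0 0 w'))).

Lemma pair_law z z' (h : R * R -> R) : z != z' -> bmeas h ->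
  intT P (fun w => h (xi0 z w, xi0 z' w)) = pair_mean h.
Proof.
move=> zz bh; have [mh [M hM]] := bh.
pose J1 : pred (int + nat) := pred1 (inl z); pose J2 : pred (int + nat) := pred1 (inl z').
have dis i : J1 i -> J2 i -> False.
  by rewrite /J1 /J2 /= => /eqP -> /eqP[] /eqP; rewrite (negbTE zz).
have m1 : measT (xi0 z : space J1 -> R) by apply: rv_family_fun; rewrite /J1 /= eqxx.
have m2 : measT (xi0 z' : space J2 -> R) by apply: rv_family_fun; rewrite /J2 /= eqxx.
have bf : bmeas (fun u : R * space J2 => h (u.1, xi0 z' u.2)).
  split; last by exists M => u.
  apply: (measurableT_comp mh); apply/measurable_fun_pairP; split.
    exact: measurable_fst.
  exact: measurableT_comp m2 measurable_snd.
have [b1 ->] := fam_fubini fT fI fM indep dis m1 bf.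
rewrite /= (@same_law z 0 (fun x => intT P (fun w => h (x, xi0 z' w))))//.
apply: eq_Rintegral => w _; rewrite (@same_law z' 0 (fun y => h (xi0 0 w, y)))//.
by split; [exact: measurable_fun_pair2 | exists M].
Qed.

Lemma bmeas_pair (h : R * R -> R) : bmeas h -> bmeas (fun u : T * T => h (xi0 0 u.1, xi0 0 u.2)).
Proof.
move=> [mh [M hM]]; split; last by exists M.
apply: (measurableT_comp mh); apply/measurable_fun_pairP; split.
  exact: measurableT_comp (mxi 0) measurable_fst.
exact: measurableT_comp (mxi 0) measurable_snd.
Qed.

Lemma pair_mean_swap (h : R * R -> R) : bmeas h ->
  pair_mean (fun u => h (u.2, u.1)) = pair_mean h.
Proof.
by move=> bh; have e := Rintegral_exchange P P (bmeas_pair bh); rewrite /pair_mean -[RHS]/(Rintegral _ _ _) e.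
Qed.

Lemma pair_mean_antisym (h : R * R -> R) : bmeas h ->
  (forall x y, h (y, x) = - h (x, y)) -> pair_mean h = 0.
Proof.
move=> bh hN; have := pair_mean_swap bh.
have bp := bmeas_pair bh.
have -> : pair_mean (fun u => h (u.2, u.1)) = - pair_mean h.
  have [b1 _ _ _] := prob_fubini P P bp.
  rewrite /pair_mean -mulN1r -RintegralZl_prob//; apply: eq_Rintegral => w _.
  rewrite -RintegralZl_prob; last by case: bp => m [M hM]; split; [exact: (measurable_fun_pair2 w m) | exists M => v; exact: (hM (w, v))].
  by apply: eq_Rintegral => w' _; rewrite /= hN mulN1r.
by lra.
Qed.

End ParetoField.

(** Contribution of one mirror pair, with [u.1] the value at i and [u.2] that at - i, to the
    logarithm of the ratio when the peak has height [y]. Pairs with a value above [b] are dropped;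
    in a typical environment there is none among the separately drawn pairs in range. *)
Definition pair_phase {R : realType} (b y : R) (u : R * R) : R :=
  ((u.1 <= b) && (u.2 <= b))%:R * (ln (y - u.2) - ln (y - u.1)).

Definition site_phase {R : realType} {T : Type} (xi0 : int -> T -> R) (c : nat -> T -> bool)
    (b y : R) (i : nat) (w : T) : R :=
  (~~ c i w)%:R * pair_phase b y (xi0 i%:Z w, xi0 (- i%:Z) w).

(** One minus the characteristic function, at [th], of the phase of a separately drawn pair; by
    symmetry that function is real. *)
Definition phase_defect {R : realType} {d} {T : measurableType d} (P : probability T R)
    (xi0 : int -> T -> R) (th b y : R) : R :=
  @pair_mean R d T P xi0 (fun u => 1 - cos (th * pair_phase b y u)).

Lemma measurable_pair_phase {R : realType} {d} {T : measurableType d} (b : R) (Y U V : T -> R) :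
  measT Y -> measT U -> measT V ->
  measT (fun w => pair_phase b (Y w) (U w, V w)).
Proof.
move=> mY mU mV; apply: measurable_funM.
  have [] // : bmeas (fun w => ((U w <= b) && (V w <= b))%:R : R).
  by apply: bmeas_bool; apply: measurable_and; apply: measurable_fun_ler => //; exact: measurable_cst.
by apply: measurable_funB; apply: measurableT_comp => //; exact: measurable_funB.
Qed.

Section PeakExpectation.
Context {R : realType} {alpha : R} {p : nat -> R} {d} {T : measurableType d}
  {P : probability T R} {xi0 : int -> T -> R} {c : nat -> T -> bool}.
Hypothesis fld : pareto_field alpha p P xi0 c.
Local Notation E := (rv_family xi0 (fun n => c n.+1)).
Local Notation space J := (fam_space E J).
Local Notation phase := (site_phase xi0 c).
Local Notation defect := (phase_defect P xi0).

Let fT := rv_familyT xi0 (fun n => c n.+1).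
Let fI := @rv_familyI R _ T _ _ xi0 (fun n => c n.+1).
Let fM := @rv_family_meas R _ T _ _ xi0 (fun n => c n.+1) (field_meas fld)
  (fun n => field_coin_meas fld n.+1).
Let indep := field_indep fld.
Let mxi := field_meas fld.

(** All the randomness attached to the mirror pair of i: both values and the coin. These groups are
    disjoint for distinct [i]; the index [k] stands for the coin [c k.+1]. *)
Definition site (i : nat) : pred (int + nat) := fun x =>
  match x with inl z => `|z|%N == i | inr k => k.+1 == i end.

Let site_fun i z : `|z|%N = i -> measT (xi0 z : space (site i) -> R).
Proof. by move=> zi; apply: rv_family_fun; rewrite /= zi. Qed.

Let site_coin i : (0 < i)%N -> measT (c i : space (site i) -> bool).
Proof. by case: i => // i _; apply: (@rv_family_bool _ _ _ _ _ xi0 (fun n => c n.+1) _ i) => /=. Qed.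

Let coinN (J : pred (int + nat)) i : measT (c i : space J -> bool) ->
  measT ((fun w => ~~ c i w) : space J -> bool).
Proof. by move=> mc; exact: measurable_neg. Qed.

Let coin_mean i : (0 < i)%N -> intT P (fun w => (~~ c i w)%:R) = 1 - p i.
Proof.
move=> i0.
have bc : bmeas (fun w => (c i w)%:R : R).
  have := @bmeas_indic R d T _ (field_coin_meas fld i).
  by congr bmeas; apply/funext => w; rewrite indicE; congr (nat_of_bool _)%:R; apply/idP/idP; rewrite inE.
transitivity (intT P (fun w => 1 - (c i w)%:R)).
  by apply: eq_Rintegral => w _; case: (c i w); rewrite ?subrr ?subr0.
rewrite RintegralB_prob//; last exact: bmeas_cst.
rewrite Rintegral_prob_cst; congr (_ - _).
transitivity (intT P (\1_[set w | c i w] : T -> R)).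
  apply: eq_Rintegral => w _; congr (nat_of_bool _)%:R.
  by apply/idP/idP; rewrite inE.
by rewrite Rintegral_indic_prob ?(field_coin fld)//; exact: (field_coin_meas fld).
Qed.

Let ipN (i : nat) : (0 < i)%N -> i%:Z != - i%:Z.
Proof. by clear; lia. Qed.

Let nondup_mean i (h : R * R -> R) : (0 < i)%N -> bmeas h ->
  intT P (fun w => (~~ c i w)%:R * h (xi0 i%:Z w, xi0 (- i%:Z) w)) =
  (1 - p i) * @pair_mean R d T P xi0 h.
Proof.
move=> i0 bh; have [mh [M hM]] := bh.
pose J1 : pred (int + nat) := pred1 (inr i.-1).
pose J2 : pred (int + nat) := fun x => if x is inl _ then true else false.
have dis x : J1 x -> J2 x -> False by rewrite /J1 /J2 /= => /eqP ->.
have b1 : bmeas ((fun w => (~~ c i w)%:R) : space J1 -> R).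
  apply: bmeas_bool; apply: coinN; case: i i0 @J1 dis => // i _ J1 _.
  by apply: (@rv_family_bool _ _ _ _ _ xi0 (fun n => c n.+1) _ i); rewrite /J1 /= eqxx.
have b2 : bmeas ((fun w => h (xi0 i%:Z w, xi0 (- i%:Z) w)) : space J2 -> R).
  split; last by exists M => w.
  apply: (measurableT_comp mh); apply/measurable_fun_pairP.
  by split; apply: rv_family_fun.
by rewrite (fam_expectM fT fI fM indep dis b1 b2) coin_mean// (pair_law fld (ipN i0) bh).
Qed.

Let bdef th b y : bmeas (fun u : R * R => 1 - cos (th * pair_phase b y u)).
Proof.
apply: bmeasB; first exact: bmeas_cst.
apply: bmeas_cos; apply: measurable_scale.
have := @measurable_pair_phase R _ (R * R)%type b (cst y) fst snd.
move=> /(_ _ _ _)/Wrap[| | |]; [exact: measurable_cst|exact: measurable_fst|exact: measurable_snd|].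
by congr measurable_fun; apply/funext => -[].
Qed.

(** As [b <= A], a site above the barrier [A] has phase 0. The barrier event and the phase thus
    never interact: the integrand is 1 minus the indicator of exceeding [A] minus the defect on a
    failed coin. *)
Lemma site_cos i (A th b y : R) : (0 < i)%N -> 1 <= A -> b <= A ->
  intT P (fun w => (xi0 i%:Z w <= A)%R%:R * cos (th * phase b y i w)) =
  1 - A `^ (- alpha) - (1 - p i) * defect th b y.
Proof.
move=> i0 A1 bA.
have bA' : bmeas (\1_[set w | A < xi0 i%:Z w] : T -> R) by apply: bmeas_indic; exact: (measurable_gt fld).
have bD : bmeas (fun w => (~~ c i w)%:R * (1 - cos (th * pair_phase b y (xi0 i%:Z w, xi0 (- i%:Z) w)))).
  apply: bmeasM.
    apply: bmeas_bool; apply: measurable_neg.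
    by apply: (@fam_meas_fun _ _ _ E _ (site i)) (site_coin i0).
  have [m [M hM]] := bdef th b y; split; last by exists M => w.
  by apply: (measurableT_comp m); apply/measurable_fun_pairP; split; exact: mxi.
transitivity (intT P (fun w => 1 - \1_[set w | A < xi0 i%:Z w] w -
   (~~ c i w)%:R * (1 - cos (th * pair_phase b y (xi0 i%:Z w, xi0 (- i%:Z) w))))).
  apply: eq_Rintegral => w _; rewrite indicE /site_phase.
  have -> : (w \in [set w | A < xi0 i%:Z w]) = ~~ (xi0 i%:Z w <= A).
    by rewrite -ltNge; apply/idP/idP; rewrite inE.
  have [xA|xA] := leP (xi0 i%:Z w) A.
    by case: (c i w); rewrite /= ?mul0r ?mul1r ?mulr0 ?cos0; ring.
  have -> : pair_phase b y (xi0 i%:Z w, xi0 (- i%:Z) w) = 0.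
    by rewrite /pair_phase /= leNgt (le_lt_trans bA xA) /= mul0r.
  by rewrite /= !mulr0 cos0; ring.
rewrite RintegralB_prob//; last by apply: bmeasB => //; exact: bmeas_cst.
rewrite RintegralB_prob//; last exact: bmeas_cst.
rewrite Rintegral_prob_cst Rintegral_indic_prob; last exact: (measurable_gt fld).
by rewrite (field_tail fld)// (nondup_mean i0 (bdef th b y)).
Qed.

Lemma site_sin i (A th b y : R) : (0 < i)%N -> b <= A ->
  intT P (fun w => (xi0 i%:Z w <= A)%R%:R * sin (th * phase b y i w)) = 0.
Proof.
move=> i0 bA.
have bS : bmeas (fun u : R * R => sin (th * pair_phase b y u)).
  apply: bmeas_sin; apply: measurable_scale.
  have := @measurable_pair_phase R _ (R * R)%type b (cst y) fst snd.
  move=> /(_ _ _ _)/Wrap[| | |]; [exact: measurable_cst|exact: measurable_fst|exact: measurable_snd|].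
  by congr measurable_fun; apply/funext => -[].
transitivity (intT P (fun w =>
   (~~ c i w)%:R * sin (th * pair_phase b y (xi0 i%:Z w, xi0 (- i%:Z) w)))).
  apply: eq_Rintegral => w _; rewrite /site_phase.
  have [xA|xA] := leP (xi0 i%:Z w) A.
    by case: (c i w); rewrite /= ?mul0r ?mul1r ?mulr0 ?sin0.
  have -> : pair_phase b y (xi0 i%:Z w, xi0 (- i%:Z) w) = 0.
    by rewrite /pair_phase /= leNgt (le_lt_trans bA xA) /= mul0r.
  by rewrite /= !(mul0r, mulr0) sin0 mulr0.
rewrite (nondup_mean i0 bS) (pair_mean_antisym fld bS) ?mulr0// => x y'.
by rewrite /pair_phase /= andbC -sinN -mulrN -mulrN opprB.
Qed.

Lemma site_mean z (A : R) : 1 <= A ->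
  intT P (fun w => (xi0 z w <= A)%R%:R) = 1 - A `^ (- alpha).
Proof.
move=> A1.
have bA' : bmeas (\1_[set w | A < xi0 z w] : T -> R) by apply: bmeas_indic; exact: (measurable_gt fld).
transitivity (intT P (fun w => 1 - \1_[set w | A < xi0 z w] w)).
  apply: eq_Rintegral => w _; rewrite indicE.
  have -> : (w \in [set w | A < xi0 z w]) = ~~ (xi0 z w <= A).
    by rewrite -ltNge; apply/idP/idP; rewrite inE.
  by case: (_ <= _); rewrite ?subrr ?subr0.
rewrite RintegralB_prob//; last exact: bmeas_cst.
rewrite Rintegral_prob_cst Rintegral_indic_prob; last exact: (measurable_gt fld).
by rewrite (field_tail fld).
Qed.

Definition cut_phase n b y i w : R := (0 < i < n)%N%:R * phase b y i w.

Definition site_factor (A th b y : R) n i : R :=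
  1 - A `^ (- alpha) - (0 < i < n)%N%:R * ((1 - p i) * defect th b y).

Lemma cut_site_cos n i (A th b y : R) : 1 <= A -> b <= A ->
  intT P (fun w => (xi0 i%:Z w <= A)%R%:R * cos (th * cut_phase n b y i w)) =
  site_factor A th b y n i.
Proof.
move=> A1 bA; rewrite /site_factor /cut_phase.
case: (boolP (0 < i < n)%N) => [/andP[i0 _]|_].
  by under eq_Rintegral do rewrite mul1r; rewrite site_cos// mul1r.
by under eq_Rintegral do rewrite mul0r mulr0 cos0 mulr1; rewrite site_mean// mul0r subr0.
Qed.

Lemma cut_site_sin n i (A th b y : R) : b <= A ->
  intT P (fun w => (xi0 i%:Z w <= A)%R%:R * sin (th * cut_phase n b y i w)) = 0.
Proof.
move=> bA; rewrite /cut_phase.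
case: (boolP (0 < i < n)%N) => [/andP[i0 _]|_].
  by under eq_Rintegral do rewrite mul1r; exact: site_sin.
by under eq_Rintegral do rewrite mul0r mulr0 sin0 mulr0; rewrite Rintegral_prob_cst.
Qed.

Let coin_site J i : (0 < i)%N -> {subset site i <= J} ->
  measT ((fun w => ~~ c i w) : space J -> bool).
Proof. by move=> i0 h; apply: coinN; exact: (fam_sub h (site_coin i0)). Qed.

Let meas_cut (J : pred (int + nat)) n b i {d'} {T' : measurableType d'} (Y : T' -> R) (W : T' -> space J) :
  {subset site i <= J} -> measT Y -> measT W ->
  measT (fun u => cut_phase n b (Y u) i (W u)).
Proof.
move=> h mY mW; rewrite /cut_phase.
case: (boolP (0 < i < n)%N) => [/andP[i0 _]|_]; last first.
  by rewrite (_ : (fun u => _) = cst 0); [exact: measurable_cst | apply/funext => u; rewrite mul0r].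
apply: measurable_scale.
apply: measurable_funM.
  have [m _] : bmeas ((fun w => (~~ c i w)%:R : R) : space J -> R).
    by apply: bmeas_bool; exact: coin_site.
  exact: measurableT_comp m mW.
apply: measurable_pair_phase => //.
  apply: measurableT_comp mW; apply: rv_family_fun; apply: h.
  by rewrite unfold_in /= ?absz_nat ?eqxx.
apply: measurableT_comp mW; apply: rv_family_fun; apply: h.
by rewrite unfold_in /= abszN absz_nat.
Qed.

Let meas_ind (J : pred (int + nat)) i {d'} {T' : measurableType d'} (A : T' -> R) (W : T' -> space J) :
  {subset site i <= J} -> measT A -> measT W ->
  bmeas (fun u => (xi0 i%:Z (W u) <= A u)%R%:R : R).
Proof.
move=> h mA mW; apply: bmeas_bool; apply: measurable_fun_ler => //.
by apply: measurableT_comp mW; apply: rv_family_fun; apply: h; rewrite unfold_in /= ?absz_nat ?eqxx.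
Qed.

(** The height of site [n] is frozen; given it, the other mirror pairs are independent, each with
    its own barrier and phase. The condition on the support of [g] keeps every barrier above 1 and
    above [b], where the one-site formula is valid. *)
Lemma peak_expectation (n N : nat) (th b : R) (A : nat -> R -> R) (g : R -> R) : bmeas g ->
  (forall i, measT (A i)) ->
  (forall y i, g y != 0 -> 1 <= A i y /\ b <= A i y) ->
  let prodI w := \prod_(i <- iota 0 N.+1 | i != n) (xi0 i%:Z w <= A i (xi0 n%:Z w))%R%:R in
  let S w := \sum_(i <- iota 0 N.+1 | i != n) cut_phase n b (xi0 n%:Z w) i w in
  intT P (fun w => g (xi0 n%:Z w) * (prodI w * cos (th * S w))) =
  intT P (fun w => g (xi0 n%:Z w) *
    \prod_(i <- iota 0 N.+1 | i != n) site_factor (A i (xi0 n%:Z w)) th b (xi0 n%:Z w) n i) /\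
  intT P (fun w => g (xi0 n%:Z w) * (prodI w * sin (th * S w))) = 0.
Proof.
move=> bg mA gA prodI S; have [mg [M gM]] := bg.
pose J1 : pred (int + nat) := pred1 (inl n%:Z).
pose J2 : pred (int + nat) := [pred x | ~~ site n x].
have dis x : J1 x -> J2 x -> False.
  by rewrite /J1 /J2 /= => /eqP -> /=; rewrite ?absz_nat eqxx.
have m1 : measT (xi0 n%:Z : space J1 -> R).
  by apply: rv_family_fun; rewrite /J1 /= eqxx.
have sJ2 i : i != n -> {subset site i <= J2}.
  move=> ni x; rewrite /J2 !inE; case: x => [z|k] /= /eqP ->; exact: ni.
pose G (u : R * space J2) := g u.1.
have bG : bmeas G by exact: (@bmeas_comp _ _ _ _ _ g fst measurable_fst bg).
pose PI (u : R * space J2) := \prod_(i <- iota 0 N.+1 | i != n) ((xi0 i%:Z u.2 <= A i u.1)%R%:R : R).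
have bPI : bmeas PI.
  apply: bmeas_prod => i ni.
  apply: (@meas_ind J2 i _ _ (fun u : R * space J2 => A i u.1) snd (sJ2 i ni)).
    exact: measurableT_comp (mA i) measurable_fst.
  exact: measurable_snd.
pose SS (u : R * space J2) := \sum_(i <- iota 0 N.+1 | i != n) cut_phase n b u.1 i u.2.
have mSS : measT (fun u => th * SS u).
  apply: measurable_scale.
  have mm i : measT (fun u : R * space J2 => if i != n then cut_phase n b u.1 i u.2 else 0).
    case: (boolP (i != n)) => ni; last exact: measurable_cst.
    apply: (@meas_cut J2 n b i _ _ (fst : R * space J2 -> R) snd (sJ2 i ni)).
      exact: measurable_fst.
    exact: measurable_snd.
  have := measurable_sum (iota 0 N.+1) mm; congr measurable_fun.
  by apply/funext => u; rewrite /SS [RHS]big_mkcond.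
have inner y : g y != 0 ->
    intT P (fun w => PI (y, w) * cos (th * SS (y, w))) =
    \prod_(i <- iota 0 N.+1 | i != n) site_factor (A i y) th b y n i /\
    intT P (fun w => PI (y, w) * sin (th * SS (y, w))) = 0.
  move=> gy.
  have disS i j x : i != j -> site i x -> site j x -> False.
    by move=> /eqP ij; case: x => [z|k] /= /eqP hi /eqP hj; apply: ij; rewrite -hi -hj.
  have := @expect_prod_cos R d T P _ E fT fI fM indep site
    (fun i w => (xi0 i%:Z w <= A i y)%R%:R) (fun i w => th * cut_phase n b y i w)
    [seq i <- iota 0 N.+1 | i != n] (filter_uniq _ (iota_uniq _ _)) disS.
  move=> /(_ _ _ _)/Wrap[| | |[]].
  - move=> i _; apply: (@meas_ind (site i) i _ _ (cst (A i y)) id) => //; exact: measurable_cst.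
  - move=> i _; apply: measurable_scale.
    by apply: (@meas_cut (site i) n b i _ _ (cst y) id) => //; exact: measurable_cst.
  - by move=> i _; apply: cut_site_sin; case: (gA y i gy).
  rewrite !big_filter => e1 e2; split.
    transitivity (\prod_(i <- iota 0 N.+1 | i != n)
       intT P (fun w => (xi0 i%:Z w <= A i y)%R%:R * cos (th * cut_phase n b y i w))).
      rewrite -e1; apply: eq_Rintegral => w _.
      by rewrite !big_filter /PI /SS /= mulr_sumr.
    by apply: eq_bigr => i _; apply: cut_site_cos; case: (gA y i gy).
  rewrite -[RHS]e2; apply: eq_Rintegral => w _.
  by rewrite !big_filter /PI /SS /= mulr_sumr.
have bx (y : R) (h : R * space J2 -> R) : bmeas h -> bmeas (fun w : T => h (y, w) : R).
  move=> [mh [M' hM]]; split; last by exists M' => w.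
  by apply: (@fam_meas_fun _ _ _ E fM J2); exact: measurable_fun_pair2.
have bC : bmeas (fun u => PI u * cos (th * SS u)) by apply: bmeasM => //; exact: bmeas_cos.
have bS : bmeas (fun u => PI u * sin (th * SS u)) by apply: bmeasM => //; exact: bmeas_sin.
split.
  have [_ ->] := fam_fubini fT fI fM indep dis m1 (bmeasM bG bC).
  apply: eq_Rintegral => w _; rewrite /G /=.
  rewrite RintegralZl_prob; last exact: (bx _ _ bC).
  have [->|gy] := eqVneq (g (xi0 n%:Z w)) 0; first by rewrite !mul0r.
  by have [-> _] := inner _ gy.
have [_ ->] := fam_fubini fT fI fM indep dis m1 (bmeasM bG bS).
rewrite -[RHS](Rintegral_prob_cst P 0); apply: eq_Rintegral => w _; rewrite /G /=.
rewrite RintegralZl_prob; last exact: (bx _ _ bS).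
have [->|gy] := eqVneq (g (xi0 n%:Z w)) 0; first by rewrite !mul0r.
by have [_ ->] := inner _ gy; rewrite mulr0.
Qed.

End PeakExpectation.

(** * Elementary asymptotics *)

Section ElementaryAsymptotics.
Context {R : realType}.

Lemma one_sub_ge_expR (v dl : R) : 0 <= v <= dl -> dl <= 1 / 2 ->
  expR (- ((1 + 2 * dl) * v)) <= 1 - v.
Proof.
move=> /andP[v0 vd] d2.
have v1 : 0 < 1 - v by lra.
rewrite expRN -[leRHS]invrK lef_pV2 ?posrE ?invr_gt0 ?expR_gt0//.
apply: (@le_trans _ _ (1 + v / (1 - v))).
  by apply: eq_ler; field; lra.
apply: (le_trans (expR_ge1Dx _)); rewrite ler_expR ler_pdivrMr//.
by nra.
Qed.

Lemma prod_one_sub (I : Type) (s : seq I) (Q : pred I) (v : I -> R) (dl : R) :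
  (forall i, Q i -> 0 <= v i <= dl) -> 0 <= dl <= 1 / 2 ->
  expR (- ((1 + 2 * dl) * \sum_(i <- s | Q i) v i)) <= \prod_(i <- s | Q i) (1 - v i) <=
  expR (- \sum_(i <- s | Q i) v i).
Proof.
move=> hv /andP[d0 d2].
have pE k : expR (- (k * \sum_(i <- s | Q i) v i)) = \prod_(i <- s | Q i) expR (- (k * v i)).
  by rewrite mulr_sumr -sumrN; apply: (big_morph _ (@expRD R) (@expR0 R)).
rewrite pE -[X in _ <= _ <= expR (- X)]mul1r pE; apply/andP; split.
  apply: ler_prod => i Qi; rewrite expR_ge0 /=; exact: one_sub_ge_expR (hv i Qi) d2.
apply: ler_prod => i Qi; have /andP[v0 vd] := hv i Qi.
rewrite mul1r; apply/andP; split; first lra.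
exact: expR_ge1Dx.
Qed.

Lemma prod_one_sub_cvg (I : Type) (s : nat -> seq I) (Q : nat -> pred I) (v : nat -> I -> R)
    (dl : nat -> R) (V : R) :
  (\forall m \near \oo, forall i, Q m i -> 0 <= v m i <= dl m) ->
  dl @ \oo --> (0 : R) ->
  (fun m => \sum_(i <- s m | Q m i) v m i) @ \oo --> V ->
  (fun m => \prod_(i <- s m | Q m i) (1 - v m i)) @ \oo --> expR (- V).
Proof.
move=> hv d0 hV.
have cE (u : nat -> R) l : u @ \oo --> l -> (fun m => expR (- u m)) @ \oo --> expR (- l).
  move=> cu; apply: continuous_cvg; first exact: continuous_expR.
  exact: cvgN.
have up := cE _ _ hV.
have lo : (fun m => expR (- ((1 + 2 * `|dl m|) * \sum_(i <- s m | Q m i) v m i))) @ \oo --> expR (- V).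
  apply: cE; rewrite -[X in _ --> X]mul1r; apply: cvgM => //.
  rewrite -[X in _ --> X]addr0; apply: cvgD; first exact: cvg_cst.
  rewrite -[X in _ --> X](mulr0 2); apply: cvgM; first exact: cvg_cst.
  by rewrite -(normr0 R); apply: cvg_norm.
apply: (squeeze_cvgr _ lo up); near=> m.
apply: prod_one_sub.
  move=> i Qi; have /andP[-> h] /= : 0 <= v m i <= dl m by move: i Qi; near: m.
  exact: le_trans h (ler_norm _).
rewrite normr_ge0 /=; near: m.
by apply: (@cvgr0_norm_le _ _ _ \oo _ dl d0); lra.
Unshelve. all: by end_near. Qed.

Lemma powR_affine_slope (c k al x y : R) : 0 < c -> 0 < k -> 1 < al -> 0 <= x -> x < y ->
  k * (al - 1) * (c + k * y) `^ (- al) * (y - x) <=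
    (c + k * x) `^ (1 - al) - (c + k * y) `^ (1 - al) <=
  k * (al - 1) * (c + k * x) `^ (- al) * (y - x).
Proof.
move=> c0 k0 al1 x0 xy.
have pos (z : R) : 0 <= z -> 0 < c + k * z.
  by move=> z0; rewrite ltr_pwDl// mulr_ge0// ltW.
have d (z : R) : z \in `]x, y[%R -> is_derive z 1 (fun z => - (c + k * z) `^ (1 - al))
    (k * (al - 1) * (c + k * z) `^ (- al)).
  rewrite in_itv /= => /andP[xz _].
  have p := pos z (ltW (le_lt_trans x0 xz)).
  have dd := @is_derive_powR_affine R c k (1 - al) z p.
  apply: is_derive_eq; rewrite (_ : 1 - al - 1 = - al); last by ring.
  ring.
have cc : {within `[x, y], continuous (fun z => - (c + k * z) `^ (1 - al))}.
  apply: continuous_in_subspaceT => z; rewrite inE /= in_itv /= => /andP[xz _].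
  apply: cvgN; apply: powR_affine_continuous; apply: pos; exact: le_trans x0 xz.
have [z] := MVT xy d cc; rewrite in_itv /= => /andP[xz zy] e.
have -> : (c + k * x) `^ (1 - al) - (c + k * y) `^ (1 - al) =
   k * (al - 1) * (c + k * z) `^ (- al) * (y - x) by rewrite -e; ring.
have z0 : 0 <= z by exact: ltW (le_lt_trans x0 xz).
have mono (u v : R) : 0 <= u -> u <= v -> (c + k * v) `^ (- al) <= (c + k * u) `^ (- al).
  move=> u0 uv; rewrite !powRN lef_pV2 ?posrE ?powR_gt0 ?pos ?(le_trans u0)//.
  apply: ge0_ler_powR; rewrite ?nnegrE; [lra| | |].
  - exact/ltW/pos.
  - by apply/ltW/pos; exact: le_trans uv.
  - by rewrite lerD2l ler_pM2l.
have h : 0 <= k * (al - 1) by rewrite mulr_ge0//; lra.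
by apply/andP; split; rewrite ler_wpM2r ?subr_ge0 ?(ltW xy)// ler_wpM2l// mono// ltW.
Qed.

(** The normalisation [k * (al - 1) = 1] makes (s + k x)^(1 - al) an antiderivative of the summand
    up to sign, so the monotone sum is compared with a telescoping one; the last term of the upper
    bound is the summand at [i = 0]. *)
Lemma powR_riemann_sum (s k al r : R) (N : nat) : 0 < s -> 0 < k -> 1 < al -> 0 < r -> k * (al - 1) = 1 ->
  s `^ (1 - al) - (s + k * (N.+1%:R / r)) `^ (1 - al) <=
    \sum_(i <- iota 0 N.+1) r^-1 * (s + k * (i%:R / r)) `^ (- al) <=
  s `^ (1 - al) + r^-1 * s `^ (- al).
Proof.
move=> s0 k0 al1 r0 kal.
have F (i : nat) : let x := i%:R / r in let y := i.+1%:R / r in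
    r^-1 * (s + k * y) `^ (- al) <= (s + k * x) `^ (1 - al) - (s + k * y) `^ (1 - al) <=
    r^-1 * (s + k * x) `^ (- al).
  move=> x y; have xy : y - x = r^-1.
    by rewrite /x /y -mulrBl -natrB// subSnn mul1r.
  have x0 : 0 <= x by rewrite divr_ge0// ltW.
  have lxy : x < y by rewrite -subr_gt0 xy invr_gt0.
  have := powR_affine_slope s0 k0 al1 x0 lxy.
  by rewrite kal !mul1r xy ![_ * r^-1]mulrC.
have tele (n : nat) : \sum_(i <- iota 0 n) ((s + k * (i%:R / r)) `^ (1 - al) - (s + k * (i.+1%:R / r)) `^ (1 - al))
    = s `^ (1 - al) - (s + k * (n%:R / r)) `^ (1 - al).
  elim: n => [|n IH]; first by rewrite big_nil mul0r mulr0 addr0 subrr.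
  by rewrite -addn1 iotaD big_cat /= big_seq1 IH add0n addn1; ring.
apply/andP; split.
  by rewrite -tele; apply: ler_sum => i _; case/andP: (F i).
rewrite /= big_cons mul0r mulr0 addr0 addrC lerD2r.
rewrite (iotaDl 1 0 N) big_map.
apply: (@le_trans _ _ (\sum_(i <- iota 0 N) ((s + k * (i%:R / r)) `^ (1 - al) - (s + k * (i.+1%:R / r)) `^ (1 - al)))).
  by apply: ler_sum => i _; case/andP: (F i).
by rewrite tele lerBlDr lerDl powR_ge0.
Qed.

Lemma sin_normle (v : R) : `|sin v| <= `|v|.
Proof.
wlog v0 : v / 0 <= v.
  move=> h; have [/h//|v0] := leP 0 v.
  by have := h (- v); rewrite sinN !normrN; apply; rewrite oppr_ge0 ltW.
move: v0; rewrite le_eqVlt => /predU1P[<-|v0]; first by rewrite sin0.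
have [z] := @MVT R (@sin R) (@cos R) 0 v v0 (fun z _ => is_derive_sin z) (continuous_subspaceT (@continuous_sin R)).
move=> _; rewrite sin0 !subr0 => ->; rewrite normrM ler_piMl//.
by rewrite ler_norml cos_le1 cos_geN1.
Qed.

Lemma one_sub_cos (u : R) : 1 - cos u = 2 * sin (u / 2) ^+ 2.
Proof.
have -> : cos u = cos (u / 2 + u / 2) by congr cos; lra.
by rewrite cosD -!expr2 cos2sin2; ring.
Qed.

Lemma one_sub_cos_le (u : R) : 0 <= 1 - cos u <= u ^+ 2 / 2.
Proof.
rewrite one_sub_cos mulr_ge0 ?sqr_ge0//=.
have := sin_normle (u / 2); rewrite -(@ler_pXn2r _ 2)// ?nnegrE// !real_normK ?num_real//.
by rewrite expr_div_n; lra.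
Qed.

Lemma one_sub_cos_ge (e : R) : 0 < e ->
  exists2 dl, 0 < dl & forall u : R, `|u| < dl -> (1 - e) * (u ^+ 2 / 2) <= 1 - cos u.
Proof.
move=> e0.
have : sin h / h @[h --> 0^'] --> (1 : R).
  have [/cvg_ex[/= l hl] dE] := is_derive_sin (0 : R).
  have hl' : h^-1 *: ((sin \o shift 0) (h *: (1 : R)) - sin (0 : R)) @[h --> 0^'] --> (1 : R).
    have := hl; rewrite (_ : l = 1)//.
    by have := dE; rewrite /derive (cvg_lim _ hl)// cos0.
  rewrite (_ : (fun h => sin h / h) =
    (fun h : R => h^-1 *: ((sin \o shift 0) (h *: (1 : R)) - sin (0 : R))))//.
  apply/funext => h /=; by rewrite sin0 subr0 addr0 /GRing.scale /= mulr1 mulrC.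
move=> /cvgrPdist_le /(_ (e / 2)) /(_ _)/Wrap[|]; first by lra.
move=> [dl /= dl0 hd].
exists dl => // u ud.
have [->|u0] := eqVneq u 0; first by rewrite expr0n /= mul0r mulr0 cos0 subrr.
rewrite one_sub_cos.
have v0 : u / 2 != 0 by rewrite mulf_neq0.
have vd : `|0 - u / 2| < dl.
  by rewrite sub0r normrN normrM normfV normr_nat; apply: le_lt_trans ud; rewrite ler_pdivrMr// ler_peMr//; lra.
have := hd _ vd v0; rewrite ler_norml => /andP[_ h].
set q := sin (u / 2) / (u / 2) in h.
have -> : sin (u / 2) = q * (u / 2) by rewrite /q divfK.
rewrite exprMn.
have -> : (u / 2) ^+ 2 = u ^+ 2 / 4 by field.
have q1 : 1 - e / 2 <= q by lra.
have : (1 - e) <= q ^+ 2.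
  have [e2|e2] := leP 1 (1 - e / 2); first by lra.
  have [e1|e1] := leP 1 e; first by apply: (@le_trans _ _ 0); [lra | exact: sqr_ge0].
  by nra.
have : 0 <= u ^+ 2 by exact: sqr_ge0.
by move: (q ^+ 2) (u ^+ 2) => a b; nra.
Qed.

End ElementaryAsymptotics.

Lemma prob1_setI {R : realType} {d} {T : measurableType d} (P : probability T R) (A B : set T) :
  measurable A -> measurable B -> P A = 1%E -> P B = 1%E -> P (A `&` B) = 1%E.
Proof.
move=> mA mB PA PB; rewrite -PA (measureDI P mA mB).
rewrite -[LHS]add0e; congr (_ + _)%E; apply/esym/eqP; rewrite eq_le measure_ge0 andbT.
apply: (@le_trans _ _ (P (~` B))).
  by apply: le_measure; rewrite ?inE; [exact: measurableD | exact: measurableC | move=> w []].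
by rewrite probability_setC// PB subee.
Qed.

Lemma ln_diff_bounds {R : realType} (A B m M : R) : 0 < m -> m <= A <= M -> m <= B <= M ->
  `|A - B| / M <= `|ln A - ln B| <= `|A - B| / m.
Proof.
move=> m0; wlog AB : A B / B <= A.
  move=> h hA hB; have [/h|/ltW /h h'] := leP B A; first exact.
  by rewrite (distrC A B) (distrC (ln A)); exact: h' hB hA.
move=> /andP[mA AM] /andP[mB BM].
have A0 : 0 < A by lra. have B0 : 0 < B by lra.
have key (x y : R) : 0 < x -> 0 < y -> ln x - ln y <= (x - y) / y.
  move=> x0 y0; rewrite -ln_div ?posrE//.
  have -> : x / y = 1 + (x - y) / y by field; lra.
  apply: le_ln1Dx; rewrite ltr_pdivlMr//; lra.
have lnAB : 0 <= ln A - ln B by rewrite subr_ge0 ler_ln ?posrE.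
rewrite (ger0_norm lnAB) (@ger0_norm _ (A - B)); last by rewrite subr_ge0.
apply/andP; split.
  have := key B A B0 A0; rewrite -(opprB A B) mulNr lerNr opprB => h.
  apply: (le_trans _ (le_trans _ h)); last by [].
  by rewrite ler_wpM2l ?subr_ge0// lef_pV2 ?posrE//; lra.
apply: (le_trans (key A B A0 B0)).
by rewrite ler_wpM2l ?subr_ge0// lef_pV2 ?posrE.
Qed.

(** * Truncated moments and the origin of the constant sigma *)

Section TruncatedMoments.
Context {R : realType} {alpha : R} {p : nat -> R} {d} {T : measurableType d}
  {P : probability T R} {xi0 : int -> T -> R} {c : nat -> T -> bool}.
Hypothesis fld : pareto_field alpha p P xi0 c.
Local Notation leb := (@lebesgue_measure R).
Local Notation defect := (phase_defect P xi0).
Local Notation pmean := (@pair_mean R d T P xi0).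
Let mxi := field_meas fld.
Let alpha2 := field_alpha fld.

Lemma powR_int (k e b : R) : 1 < b -> e != 0 ->
  Rintegral leb `]1, b] (fun x => k * x `^ (e - 1)) = k / e * (b `^ e - 1).
Proof.
move=> b1 e0; have pos (x : R) : 1 <= x <= b -> 0 < x by move=> /andP[? _]; lra.
have h := @FTC2_interval_oc R (fun x => k / e * x `^ e) (fun x => k * x `^ (e - 1)) 1 b b1.
  apply: (etrans (congr1 fine (h _ _))); last by rewrite /= powR1; ring.
  - move=> x /pos x0; have dx := @is_derive1_powR _ e x x0.
    apply: is_derive_eq; rewrite /GRing.scale /=; field; exact: e0.
  - move=> x /pos x0; apply: cvgM; first exact: cvg_cst.
    have := @powR_affine_continuous R 0 1 (e - 1) x; rewrite add0r mul1r => /(_ x0).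
    by under [X in {for _, continuous X}]eq_fun do rewrite add0r mul1r.
Qed.

Lemma inv_int (k b : R) : 1 < b -> Rintegral leb `]1, b] (fun x => k * x `^ (- 1)) = k * ln b.
Proof.
move=> b1; have pos (x : R) : 1 <= x <= b -> 0 < x by move=> /andP[? _]; lra.
have h := @FTC2_interval_oc R (fun x => k * ln x) (fun x => k * x `^ (- 1)) 1 b b1.
  apply: (etrans (congr1 fine (h _ _))); last by rewrite /= ln1; ring.
  - move=> x /pos x0; have dx := is_derive1_ln x0.
    by apply: is_derive_eq; rewrite powR_inv1 ?ltW// /GRing.scale /=; ring.
  - move=> x /pos x0; apply: cvgM; first exact: cvg_cst.
    have := @powR_affine_continuous R 0 1 (- 1) x; rewrite add0r mul1r => /(_ x0).
    by under [X in {for _, continuous X}]eq_fun do rewrite add0r mul1r.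
Qed.

Definition trunc_moment (k : nat) (b : R) : R :=
  intT P (fun w => xi0 0 w ^+ k * (1 < xi0 0 w <= b)%R%:R).

Let bind (b : R) : bmeas (fun x : R => (1 < x <= b)%R%:R : R).
Proof.
apply: bmeas_bool; apply: measurable_and; [apply: measurable_fun_ltr|apply: measurable_fun_ler] => //;
  exact: measurable_cst.
Qed.

Let bpow k b : bmeas (fun x : R => x ^+ k * (1 < x <= b)%R%:R : R).
Proof.
split; first by apply: measurable_funM; [apply: measurable_funX | case: (bind b)].
exists (`|b| ^+ k) => x; rewrite normrM.
have [/andP[x1 xb]|_] := boolP (1 < x <= b)%R; rewrite ?normr1 ?normr0 ?mulr1 ?mulr0 ?exprn_ge0//.
rewrite normrX lerXn2r ?nnegrE// !ger0_norm//; lra.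
Qed.

Lemma trunc_momentE k b : 1 < b ->
  trunc_moment k b = Rintegral leb `]1, b] (fun x => alpha * x `^ (k%:R - alpha - 1)).
Proof.
move=> b1; rewrite /trunc_moment.
transitivity (intT P (fun w => (xi0 0 w ^+ k * (1 < xi0 0 w <= b)%R%:R) * (1 < xi0 0 w <= b)%R%:R)).
  by apply: eq_Rintegral => w _; case: (_ <= b); rewrite ?andbF ?mulr0// andbT; case: (_ < _); rewrite ?mulr1 ?mulr0.
rewrite (pareto_law fld 0 b (bpow k b)); apply: eq_Rintegral => x.
rewrite inE /= in_itv /= => /andP[x1 ->]; rewrite x1 mulr1 mulrCA; congr (_ * _).
rewrite -powR_mulrn; last by lra.
by rewrite -powRD; [congr (_ `^ _); ring | apply/implyP => _; rewrite gt_eqF//; lra].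
Qed.

Lemma trunc_moment0 b : 1 < b -> trunc_moment 0 b = 1 - b `^ (- alpha).
Proof.
have a2 := alpha2; move=> b1; rewrite trunc_momentE// (_ : 0%:R - alpha - 1 = - alpha - 1); last by ring.
by rewrite powR_int//; [field|]; lra.
Qed.

Lemma trunc_moment1 b : 1 < b -> trunc_moment 1 b = alpha / (alpha - 1) * (1 - b `^ (1 - alpha)).
Proof.
have a2 := alpha2; move=> b1; rewrite trunc_momentE//.
by rewrite powR_int//; [field|]; lra.
Qed.

Lemma trunc_moment2 b : 1 < b ->
  trunc_moment 2 b = if 2 < alpha then alpha / (alpha - 2) * (1 - b `^ (2 - alpha)) else 2 * ln b.
Proof.
have a2 := alpha2; move=> b1; rewrite trunc_momentE//; case: ltP => a2'.
  by rewrite powR_int//; [field|]; lra.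
have -> : alpha = 2 by lra.
by rewrite subrr sub0r inv_int.
Qed.

(** The mean of (X - X')^2 over two independent Pareto variables, on the event that both are at most
    [b]. For alpha > 2 it tends to twice the Pareto variance, which is [sigmaPAM alpha ^+ 2]. *)
Definition trunc_var (b : R) : R :=
  2 * (trunc_moment 0 b * trunc_moment 2 b - trunc_moment 1 b ^+ 2).

Lemma pair_mean_prod (f g : R -> R) : bmeas f -> bmeas g ->
  pmean (fun u => f u.1 * g u.2) =
  intT P (fun w => f (xi0 0 w)) * intT P (fun w => g (xi0 0 w)).
Proof.
move=> bf bg; rewrite /pair_mean /=.
have bf' := bmeas_site fld 0 bf; have bg' := bmeas_site fld 0 bg.
transitivity (intT P (fun w => intT P (fun w' => g (xi0 0 w')) * f (xi0 0 w))).
  apply: eq_Rintegral => w _; rewrite (RintegralZl_prob P (f (xi0 0 w)) bg'); exact: mulrC.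
by rewrite (RintegralZl_prob P _ bf'); exact: mulrC.
Qed.

Let z01 : (0 : int) != 1. Proof. by []. Qed.

Let site2 (h : R * R -> R) : bmeas h -> bmeas (fun w => h (xi0 0 w, xi0 1 w)).
Proof.
move=> [mh [M hM]]; split; last by exists M.
by apply: (measurableT_comp mh); apply/measurable_fun_pairP; split; exact: mxi.
Qed.

Lemma pair_mean_le (h h' : R * R -> R) : bmeas h -> bmeas h' ->
  (forall u, h u <= h' u) -> pmean h <= pmean h'.
Proof.
move=> bh bh' hh; rewrite -(pair_law fld z01 bh) -(pair_law fld z01 bh').
by apply: le_Rintegral_prob; [exact: site2|exact: site2|move=> w; exact: hh].
Qed.

Lemma pair_meanZ (k : R) (h : R * R -> R) : bmeas h -> pmean (fun u => k * h u) = k * pmean h.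
Proof.
move=> bh; have bk : bmeas (fun u => k * h u) by apply: bmeasM => //; exact: bmeas_cst.
rewrite -(pair_law fld z01 bh) -(pair_law fld z01 bk) RintegralZl_prob//; exact: site2.
Qed.

Lemma pair_mean_ae (h h' : R * R -> R) : bmeas h -> bmeas h' ->
  (forall x y, 1 < x -> 1 < y -> h (x, y) = h' (x, y)) -> pmean h = pmean h'.
Proof.
move=> bh bh' hh; rewrite -(pair_law fld z01 bh) -(pair_law fld z01 bh').
have mA z := measurable_gt fld z 1.
have P1 : P ([set w | 1 < xi0 0 w] `&` [set w | 1 < xi0 1 w]) = 1%E.
  by apply: prob1_setI; [exact: mA|exact: mA|exact: (pareto_gt1 fld)|exact: (pareto_gt1 fld)].
apply: (eq_Rintegral_prob1 (measurableI _ _ (mA 0) (mA 1)) P1 (site2 bh) (site2 bh')).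
by move=> w /= [? ?]; exact: hh.
Qed.

Definition trunc_sqdiff (b : R) (u : R * R) : R :=
  (1 < u.1 <= b)%R%:R * (1 < u.2 <= b)%R%:R * (u.1 - u.2) ^+ 2.

Let mfst := @measurable_fst _ _ R R.
Let msnd := @measurable_snd _ _ R R.

Let b2 b (f g : nat) : bmeas (fun u : R * R => (u.1 ^+ f * (1 < u.1 <= b)%R%:R) * (u.2 ^+ g * (1 < u.2 <= b)%R%:R) : R).
Proof.
by apply: bmeasM; [exact: (bmeas_comp mfst (bpow f b)) | exact: (bmeas_comp msnd (bpow g b))].
Qed.

Let sqE b u : trunc_sqdiff b u = (u.1 ^+ 2 * (1 < u.1 <= b)%R%:R) * (u.2 ^+ 0 * (1 < u.2 <= b)%R%:R)
    - 2 * ((u.1 ^+ 1 * (1 < u.1 <= b)%R%:R) * (u.2 ^+ 1 * (1 < u.2 <= b)%R%:R))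
    + (u.1 ^+ 0 * (1 < u.1 <= b)%R%:R) * (u.2 ^+ 2 * (1 < u.2 <= b)%R%:R).
Proof. by rewrite /trunc_sqdiff; move: (_%:R) (_%:R) => x y; ring. Qed.

Let bsq b : bmeas (trunc_sqdiff b).
Proof.
rewrite (funext (sqE b)); apply: bmeasD => //; apply: bmeasB => //.
by apply: bmeasM => //; exact: bmeas_cst.
Qed.

Lemma pair_mean_sqdiff b : pmean (trunc_sqdiff b) = trunc_var b.
Proof.
rewrite -(pair_law fld z01 (bsq b)).
under eq_Rintegral do rewrite sqE.
have bb f g := site2 (b2 b f g).
rewrite RintegralD_prob//; last by apply: bmeasB => //; apply: bmeasM => //; exact: bmeas_cst.
rewrite RintegralB_prob//; last by apply: bmeasM => //; exact: bmeas_cst.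
rewrite RintegralZl_prob//.
have e f g : intT P (fun w => (xi0 0 w ^+ f * (1 < xi0 0 w <= b)%R%:R) *
   (xi0 1 w ^+ g * (1 < xi0 1 w <= b)%R%:R)) = trunc_moment f b * trunc_moment g b.
  by rewrite (pair_law fld z01 (b2 b f g)) (pair_mean_prod (bpow f b) (bpow g b)).
by rewrite /= !e /trunc_var; ring.
Qed.

Let bdef th b y : bmeas (fun u : R * R => 1 - cos (th * pair_phase b y u)).
Proof.
apply: bmeasB; first exact: bmeas_cst.
apply: bmeas_cos; apply: measurable_scale.
have := @measurable_pair_phase R _ (R * R)%type b (cst y) fst snd.
move=> /(_ _ _ _)/Wrap[| | |]; [exact: measurable_cst|exact: measurable_fst|exact: measurable_snd|].
by congr measurable_fun; apply/funext => -[].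
Qed.

(** In absolute value the phase of a pair lies between its difference divided by [y] and divided by
    [y - b], and 1 - cos v is close to v^2 / 2 for small v. The smallness condition is uniform over
    the pairs below [b], so [dl] depends on [e] only. *)
Lemma defect_bounds (e : R) : 0 < e -> exists2 dl, 0 < dl &
  forall th b y : R, 0 < b < y -> `|th| * (b / (y - b)) < dl ->
  (1 - e) * (th ^+ 2 / (2 * y ^+ 2) * trunc_var b) <= defect th b y <=
    th ^+ 2 / (2 * (y - b) ^+ 2) * trunc_var b.
Proof.
move=> e0; have [dl dl0 hd] := one_sub_cos_ge e0.
exists dl => // th b y /andP[b0 by_] hth.
pose k (u : R * R) : R := (1 < u.1 <= b)%R%:R * (1 < u.2 <= b)%R%:R.
have bk : bmeas k.
  by apply: bmeasM; [exact: (bmeas_comp mfst (bind b)) | exact: (bmeas_comp msnd (bind b))].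
have bh := bmeasM bk (bdef th b y).
have -> : defect th b y = pmean (fun u => k u * (1 - cos (th * pair_phase b y u))).
  apply: pair_mean_ae => // x1 x2 h1 h2; rewrite /k /pair_phase /= h1 h2 /=.
  by case: (x1 <= b); case: (x2 <= b); rewrite /= ?mul0r ?mul1r ?mulr0 ?cos0 ?subrr// ?mulr0.
have key u : k u * ((1 - e) * (th ^+ 2 / (2 * y ^+ 2) * (u.1 - u.2) ^+ 2)) <=
     k u * (1 - cos (th * pair_phase b y u)) <= k u * (th ^+ 2 / (2 * (y - b) ^+ 2) * (u.1 - u.2) ^+ 2).
  rewrite /k; have [/andP[u1 u1b]|_] := boolP (1 < u.1 <= b)%R; last by rewrite !mul0r lexx.
  have [/andP[u2 u2b]|_] := boolP (1 < u.2 <= b)%R; last by rewrite mulr0 !mul0r lexx.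
  rewrite !mul1r /pair_phase u1b u2b /= mul1r; set ph := ln _ - ln _.
  have /andP[l1 l2] : `|(y - u.2) - (y - u.1)| / y <= `|ph| <= `|(y - u.2) - (y - u.1)| / (y - b).
    by apply: ln_diff_bounds; lra.
  have E1 : (y - u.2) - (y - u.1) = u.1 - u.2 by ring.
  rewrite E1 in l1 l2.
  have sq (A B : R) : 0 <= A -> A <= B -> A ^+ 2 <= B ^+ 2 by move=> h0 h1; rewrite lerXn2r// nnegrE// (le_trans h0).
  have s1 : (u.1 - u.2) ^+ 2 / y ^+ 2 <= ph ^+ 2.
    have := sq _ _ _ l1; rewrite divr_ge0//; last lra.
    by move=> /(_ isT); rewrite real_normK ?num_real// expr_div_n real_normK ?num_real.
  have s2 : ph ^+ 2 <= (u.1 - u.2) ^+ 2 / (y - b) ^+ 2.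
    have := sq _ _ (normr_ge0 _) l2.
    by rewrite real_normK ?num_real// expr_div_n real_normK ?num_real.
  have hsm : `|th * ph| < dl.
    rewrite normrM; apply: le_lt_trans hth; rewrite ler_wpM2l//.
    apply: (le_trans l2); rewrite ler_wpM2r ?invr_ge0; [by []|lra|].
    by rewrite ler_norml; lra.
  have th2 : 0 <= th ^+ 2 by exact: sqr_ge0.
  apply/andP; split.
    have [e1|e1] := leP 1 e.
      apply: (@le_trans _ _ 0); last by case/andP: (one_sub_cos_le (th * ph)).
      rewrite mulr_le0_ge0; [by []|lra|].
      by rewrite mulr_ge0 ?sqr_ge0// divr_ge0// mulr_ge0// sqr_ge0.
    apply: le_trans (hd _ hsm); rewrite ler_wpM2l; [by []|lra|].
    rewrite exprMn [leLHS](_ : _ = th ^+ 2 * ((u.1 - u.2) ^+ 2 / y ^+ 2) / 2); last by field; lra.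
    by rewrite ler_wpM2r// ler_wpM2l.
  case/andP: (one_sub_cos_le (th * ph)) => _ h; apply: (le_trans h).
  rewrite exprMn [leRHS](_ : _ = th ^+ 2 * ((u.1 - u.2) ^+ 2 / (y - b) ^+ 2) / 2); last by field; lra.
  by rewrite ler_wpM2r// ler_wpM2l.
have kE (K : R) u : k u * (K * (u.1 - u.2) ^+ 2) = K * trunc_sqdiff b u by rewrite /k /trunc_sqdiff; ring.
have kE' (K : R) u : k u * ((1 - e) * (K * (u.1 - u.2) ^+ 2)) = (1 - e) * K * trunc_sqdiff b u.
  by rewrite /k /trunc_sqdiff; ring.
have bK (K : R) : bmeas (fun u => K * trunc_sqdiff b u) by apply: bmeasM => //; exact: bmeas_cst.
rewrite mulrA -!pair_mean_sqdiff -!pair_meanZ//; apply/andP; split; apply: pair_mean_le => // u.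
  by rewrite -kE'; case/andP: (key u).
by rewrite -kE; case/andP: (key u).
Qed.

End TruncatedMoments.

Section SequenceLimits.
Context {R : realType}.
Implicit Types u v : nat -> R.

Lemma seq_cvg_eq u v (l : R) : (\forall m \near \oo, u m = v m) -> u @ \oo --> l -> v @ \oo --> l.
Proof.
move=> uv ul; apply/cvgrPdist_le => e e0; move/cvgrPdist_le : ul => /(_ e e0) h.
by near=> m; rewrite -(_ : u m = v m); near: m.
Unshelve. all: by end_near. Qed.

Lemma seq_powR_cvg u (l e : R) : 0 < l -> u @ \oo --> l -> (fun m => u m `^ e) @ \oo --> l `^ e.
Proof.
move=> l0 ul; have := @powR_affine_continuous R 0 1 e l; rewrite add0r mul1r => /(_ l0).
under [X in {for _, continuous X}]eq_fun do rewrite add0r mul1r.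
by move=> c; apply: (@cvg_comp _ _ _ u (fun x => x `^ e) \oo (nbhs l)); [exact: ul | exact: c].
Qed.

Lemma seq_ln_cvg u (l : R) : 0 < l -> u @ \oo --> l -> (fun m => ln (u m)) @ \oo --> ln l.
Proof. by move=> l0 ul; apply: continuous_cvg => //; exact: continuous_ln. Qed.

Lemma seq_powRN_cvg0 u (e : R) : 0 < e -> u @ \oo --> +oo -> (fun m => u m `^ (- e)) @ \oo --> (0 : R).
Proof. by move=> e0 uy; exact: (cvg_comp _ _ uy (powR_neg_cvg e0)). Qed.

Lemma seq_ln_cvgy u : u @ \oo --> +oo -> (fun m => ln (u m)) @ \oo --> +oo.
Proof.
move=> /cvgryPge h; apply/cvgryPge => A; near=> m.
have uA : expR A <= u m by near: m; exact: h.
by rewrite -[leLHS]expRK ler_ln ?posrE ?expR_gt0// (lt_le_trans _ uA) ?expR_gt0.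
Unshelve. all: by end_near. Qed.

Lemma seq_invy u : u @ \oo --> +oo -> (fun m => (u m)^-1) @ \oo --> (0 : R).
Proof.
move=> uy; apply/(gtr0_cvgV0 _) => //.
by move/cvgryPgt : uy; exact.
Qed.

Lemma seq_divy u v (l : R) : u @ \oo --> l -> v @ \oo --> +oo -> (fun m => u m / v m) @ \oo --> (0 : R).
Proof. by move=> ul vy; rewrite -(mulr0 l); apply: cvgM => //; exact: seq_invy. Qed.

Lemma seq_near_gt0 u (l : R) : 0 < l -> u @ \oo --> l -> \forall m \near \oo, 0 < u m.
Proof. by move=> l0 ul; apply: cvgr_gt ul _ l0. Qed.

Lemma seq_near_gty u (A : R) : u @ \oo --> +oo -> \forall m \near \oo, A < u m.
Proof. by move/cvgryPgt; exact. Qed.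

Lemma seq_near_gey u (A : R) : u @ \oo --> +oo -> \forall m \near \oo, A <= u m.
Proof. by move/cvgryPge; exact. Qed.

Lemma seq_powR_cvgy u (e : R) : 0 < e -> u @ \oo --> +oo -> (fun m => u m `^ e) @ \oo --> +oo.
Proof.
move=> e0 uy; apply/(gtr0_cvgV0 _).
  near=> m; rewrite powR_gt0//; near: m; exact: seq_near_gty.
apply: seq_cvg_eq (seq_powRN_cvg0 e0 uy); near=> m; rewrite powRN//.
Unshelve. all: by end_near. Qed.

End SequenceLimits.

Section DefectAsymptotics.
Context {R : realType} {alpha : R} {p : nat -> R} {d} {T : measurableType d}
  {P : probability T R} {xi0 : int -> T -> R} {c : nat -> T -> bool}.
Hypothesis fld : pareto_field alpha p P xi0 c.
Local Notation defect := (phase_defect P xi0).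
Local Notation V := (@trunc_var R d T P xi0).
Local Notation mom := (@trunc_moment R d T P xi0).
Let alpha2 := field_alpha fld.
Local Notation sg2 := (sigmaPAM alpha ^+ 2).

Variables (a b : nat -> R).
Hypotheses (ay : a @ \oo --> +oo) (by_ : b @ \oo --> +oo).
Hypothesis ba : (fun m => b m / a m) @ \oo --> (0 : R).
Hypothesis lnba : (fun m => ln (b m) / ln (a m)) @ \oo --> (1 : R).

Let b1 : \forall m \near \oo, 1 < b m. Proof. exact: seq_near_gty. Qed.

Let c0 : (fun m => mom 0 (b m)) @ \oo --> (1 : R).
Proof.
have a2 := alpha2; apply: (@seq_cvg_eq _ (fun m => 1 - b m `^ (- alpha))).
  by near=> m; rewrite (trunc_moment0 fld)//; near: m.
rewrite -[X in _ --> X]subr0; apply: cvgB; first exact: cvg_cst.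
by apply: seq_powRN_cvg0 => //; lra.
Unshelve. all: by end_near. Qed.

Let c1 : (fun m => mom 1 (b m)) @ \oo --> alpha / (alpha - 1).
Proof.
have a2 := alpha2; apply: (@seq_cvg_eq _ (fun m => alpha / (alpha - 1) * (1 - b m `^ (- (alpha - 1))))).
  by near=> m; rewrite (trunc_moment1 fld) ?opprB//; near: m.
rewrite -[X in _ --> X]mulr1; apply: cvgM; first exact: cvg_cst.
rewrite -[X in _ --> X]subr0; apply: cvgB; first exact: cvg_cst.
by apply: seq_powRN_cvg0 => //; lra.
Unshelve. all: by end_near. Qed.

Lemma trunc_var_cvg : 2 < alpha -> (fun m => V (b m)) @ \oo --> 2 * sg2.
Proof.
move=> a2.
have c2 : (fun m => mom 2 (b m)) @ \oo --> alpha / (alpha - 2).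
  apply: (@seq_cvg_eq _ (fun m => alpha / (alpha - 2) * (1 - b m `^ (- (alpha - 2))))).
    by near=> m; rewrite (trunc_moment2 fld) ?a2 ?opprB//; near: m.
  rewrite -[X in _ --> X]mulr1; apply: cvgM; first exact: cvg_cst.
  rewrite -[X in _ --> X]subr0; apply: cvgB; first exact: cvg_cst.
  by apply: seq_powRN_cvg0 => //; lra.
have -> : 2 * sg2 = 2 * (1 * (alpha / (alpha - 2)) - (alpha / (alpha - 1)) ^+ 2).
  rewrite /sigmaPAM a2 sqr_sqrtr; last by rewrite divr_ge0 ?mulr_ge0 ?sqr_ge0//; lra.
  by field; rewrite !gt_eqF//; lra.
apply: cvgM; first exact: cvg_cst.
by apply: cvgB; [exact: cvgM | rewrite expr2; under eq_fun do rewrite expr2; exact: cvgM].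
Unshelve. all: by end_near. Qed.

Lemma trunc_var_cvg2 : alpha = 2 -> (fun m => V (b m) / ln (b m)) @ \oo --> (4 : R).
Proof.
move=> a2.
have lny := seq_ln_cvgy by_.
apply: (@seq_cvg_eq _ (fun m => 2 * (mom 0 (b m) * 2 - mom 1 (b m) ^+ 2 / ln (b m)))).
  near=> m; rewrite /trunc_var (trunc_moment2 fld) ?a2 ?ltxx; last by near: m.
  have : 0 < ln (b m) by near: m; exact: seq_near_gty.
  by move=> l0; field; rewrite gt_eqF.
rewrite (_ : 4 = 2 * (1 * 2 - 0)); last by ring.
apply: cvgM; first exact: cvg_cst; apply: cvgB.
  by apply: cvgM => //; exact: cvg_cst.
apply: (seq_divy (l := alpha / (alpha - 1) * (alpha / (alpha - 1)))) lny.
by under eq_fun do rewrite expr2; exact: cvgM.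
Unshelve. all: by end_near. Qed.

(** At alpha = 2 this is where sigma = 1 comes from: [n] is about x a^2 and kappa(n) about x a^2 /
    (2 ln a), while the truncated variance is about 4 ln b with ln b equivalent to ln a, so the
    limit is 2 x. *)
Lemma kappa_trunc_var (n : nat -> nat) (x : R) : 0 < x ->
  (fun m => (n m)%:R / a m `^ alpha) @ \oo --> x ->
  (fun m => kappa alpha (n m) * V (b m) / a m ^+ 2) @ \oo --> 2 * sg2 * x `^ (2 / alpha).
Proof.
move=> x0 nx; have a2 := alpha2.
have a0 : \forall m \near \oo, 1 < a m by exact: seq_near_gty.
have [a2'|a2'] := ltP 2 alpha.
  apply: (@seq_cvg_eq _ (fun m => V (b m) * ((n m)%:R / a m `^ alpha) `^ (2 / alpha))).
    near=> m; rewrite /kappa a2'; have am : 1 < a m by near: m.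
    rewrite powRM ?invr_ge0 ?powR_ge0// -powRN -powRrM.
    rewrite (_ : - alpha * (2 / alpha) = - 2%:R); last by field; lra.
    rewrite powRN powR_mulrn; last by lra.
    by ring.
  by apply: cvgM; [exact: trunc_var_cvg | exact: seq_powR_cvg].
have ae : alpha = 2 by lra.
have lnay := seq_ln_cvgy ay; have lnby := seq_ln_cvgy by_.
have h1 : (fun m => ln (n m)%:R / ln (a m)) @ \oo --> (2 : R).
  apply: (@seq_cvg_eq _ (fun m => ln ((n m)%:R / a m `^ alpha) / ln (a m) + 2)).
    near=> m; have am : 1 < a m by near: m.
    have nm : 0 < (n m)%:R / a m `^ alpha by near: m; exact: seq_near_gt0 nx.
    have r0 : 0 < a m `^ alpha by rewrite powR_gt0; lra.
    have n0 : 0 < (n m)%:R :> R by move: nm; rewrite pmulr_lgt0 ?invr_gt0.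
    have l0 : 0 < ln (a m) by rewrite ln_gt0.
    by rewrite ln_div ?posrE// ln_powR ae; field; rewrite gt_eqF.
  rewrite -[X in _ --> X]add0r; apply: cvgD; last exact: cvg_cst.
  by apply: (seq_divy (l := ln x)) lnay; exact: seq_ln_cvg.
apply: (@seq_cvg_eq _ (fun m => ((n m)%:R / a m `^ alpha) * (V (b m) / ln (b m)) *
    (ln (b m) / ln (a m) * (ln (n m)%:R / ln (a m))^-1))).
  near=> m; rewrite /kappa ae ltxx; have am : 1 < a m by near: m.
  have lb : 0 < ln (b m) by near: m; exact: seq_near_gty.
  have la : 0 < ln (a m) by near: m; exact: seq_near_gty.
  have h : 0 < ln (n m)%:R / ln (a m) by near: m; apply: seq_near_gt0 h1.
  have ln0 : 0 < ln ((n m)%:R : R) by move: h; rewrite pmulr_lgt0 ?invr_gt0.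
  rewrite (_ : a m `^ 2 = a m ^+ 2); last by rewrite -powR_mulrn//; lra.
  by field; rewrite !gt_eqF//; lra.
have -> : 2 * sg2 * x `^ (2 / alpha) = x * 4 * (1 * 2^-1).
  by rewrite /sigmaPAM ae ltxx divff// powRr1 ?(ltW x0)//; field.
apply: cvgM; first by apply: cvgM => //; exact: trunc_var_cvg2.
by apply: cvgM => //; apply: cvgV.
Unshelve. all: by end_near. Qed.

Lemma trunc_var_small : (fun m => V (b m) / a m ^+ 2) @ \oo --> (0 : R).
Proof.
have a2 := alpha2; have [a2'|a2'] := ltP 2 alpha.
  apply: (@seq_cvg_eq _ (fun m => V (b m) / a m `^ 2)).
    near=> m; rewrite (_ : a m `^ 2 = a m ^+ 2)//.
    rewrite -powR_mulrn//; near: m; exact: seq_near_gey.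
  by apply: seq_divy (trunc_var_cvg a2') _; exact: seq_powR_cvgy.
have ae : alpha = 2 by lra.
have h : (fun m => ln (a m) / a m ^+ 2) @ \oo --> (0 : R).
  apply: (@squeeze_cvgr _ _ _ _ (cst 0) (fun m => (a m)^-1)); last exact: seq_invy.
    near=> m; have am : 1 < a m by near: m; exact: seq_near_gty.
    rewrite divr_ge0 ?sqr_ge0 ?ln_ge0 ?(ltW am)//= expr2 invfM mulrA ler_piMl ?invr_ge0//; first lra.
    rewrite ler_pdivrMr ?mul1r; last lra.
    have := @le_ln1Dx R (a m - 1); rewrite (addrC 1) subrK; lra.
  exact: cvg_cst.
apply: (@seq_cvg_eq _ (fun m => (V (b m) / ln (b m)) * (ln (b m) / ln (a m)) * (ln (a m) / a m ^+ 2))).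
  near=> m.
  have lb : 0 < ln (b m) by near: m; exact: seq_near_gty (seq_ln_cvgy by_).
  have la : 0 < ln (a m) by near: m; exact: seq_near_gty (seq_ln_cvgy ay).
  have am : 1 < a m by near: m; exact: seq_near_gty.
  by field; rewrite !gt_eqF//; lra.
rewrite -[X in _ --> X](mulr0 (4 * 1)); apply: cvgM => //.
by apply: cvgM => //; exact: trunc_var_cvg2.
Unshelve. all: by end_near. Qed.

Section Height.
Variables (th Y : R) (y : nat -> R).
Hypotheses (Y0 : 0 < Y) (yY : (fun m => y m / a m) @ \oo --> Y).

Let a1 : \forall m \near \oo, 1 < a m. Proof. exact: seq_near_gty. Qed.

Let by_lt : \forall m \near \oo, 0 < b m < y m.
Proof.
have h : (fun m => y m / a m - b m / a m) @ \oo --> Y by rewrite -[X in _ --> X]subr0; exact: cvgB.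
near=> m; have am : 1 < a m by near: m.
have bm : 1 < b m by near: m.
have : 0 < y m / a m - b m / a m by near: m; exact: seq_near_gt0 h.
rewrite -mulrBl pmulr_lgt0 ?invr_gt0; last lra.
by move=> ?; apply/andP; split; lra.
Unshelve. all: by end_near. Qed.

Let ratio0 : (fun m => `|th| * (b m / (y m - b m))) @ \oo --> (0 : R).
Proof.
rewrite -[X in _ --> X](mulr0 `|th|); apply: cvgM; first exact: cvg_cst.
apply: (@seq_cvg_eq _ (fun m => (b m / a m) * (y m / a m - b m / a m)^-1)).
  near=> m; have am : 1 < a m by near: m.
  have /andP[b0 hy] : 0 < b m < y m by near: m.
  rewrite -mulrBl; field; rewrite !gt_eqF//; lra.
rewrite -[X in _ --> X](mul0r (Y - 0)^-1); apply: cvgM => //.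
by apply: cvgV; [rewrite subr0 gt_eqF | exact: cvgB].
Unshelve. all: by end_near. Qed.

Lemma defect_cvg0 : (fun m => defect th (b m) (y m)) @ \oo --> (0 : R).
Proof.
have [dl dl0 hd] := defect_bounds fld (ltr01).
apply: (@squeeze_cvgr _ _ _ _ (cst 0)
  (fun m => th ^+ 2 / (2 * (y m / a m - b m / a m) ^+ 2) * (V (b m) / a m ^+ 2))).
- near=> m; have am : 1 < a m by near: m.
  have hb : 0 < b m < y m by near: m.
  have hs : `|th| * (b m / (y m - b m)) < dl by near: m; apply: cvgr_lt ratio0 _ dl0.
  have /andP[l u] := hd _ _ _ hb hs.
  rewrite subrr mul0r in l; rewrite l /=; apply: (le_trans u).
  apply: eq_ler; rewrite -mulrBl; field.
  by case/andP: hb => b0 hy; rewrite !gt_eqF//; lra.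
- exact: cvg_cst.
rewrite -[X in _ --> X](mulr0 (th ^+ 2 / (2 * (Y - 0) ^+ 2))); apply: cvgM; last exact: trunc_var_small.
apply: cvgM; first exact: cvg_cst; apply: cvgV.
  by rewrite subr0 gt_eqF// mulr_gt0// exprn_gt0.
apply: cvgM; first exact: cvg_cst.
by under eq_fun do rewrite expr2; rewrite expr2; apply: cvgM; exact: cvgB.
Unshelve. all: by end_near. Qed.

(** The two bounds of [defect_bounds] have the same limit because [b / a] tends to 0. The quotient
    under the square is the limit of n^(1/alpha) / y, the future [B]. *)
Lemma kappa_defect (n : nat -> nat) (x : R) : 0 < x ->
  (fun m => (n m)%:R / a m `^ alpha) @ \oo --> x ->
  (fun m => kappa alpha (n m) * defect th (b m) (y m)) @ \oo -->
    sg2 * th ^+ 2 * (x `^ (1 / alpha) / Y) ^+ 2.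
Proof.
move=> x0 nx; have a2 := alpha2.
set L := (X in _ --> X).
pose W m := kappa alpha (n m) * V (b m) / a m ^+ 2.
have Wc : W @ \oo --> 2 * sg2 * x `^ (2 / alpha) by exact: kappa_trunc_var.
have K0 : \forall m \near \oo, 0 <= kappa alpha (n m).
  near=> m; rewrite /kappa; case: ifP => _; rewrite ?powR_ge0// divr_ge0//.
  case: (n m) => [|k]; first by rewrite ln0.
  by rewrite ln_ge0// ler1n.
have up : (fun m => th ^+ 2 / (2 * (y m / a m - b m / a m) ^+ 2) * W m) @ \oo --> L.
  have -> : L = th ^+ 2 / (2 * (Y - 0) ^+ 2) * (2 * sg2 * x `^ (2 / alpha)).
    rewrite /L subr0 (_ : 2 / alpha = 1 / alpha * 2%:R); last by rewrite mulrAC mul1r.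
    rewrite (powRrM x (1 / alpha) 2%:R) powR_mulrn ?powR_ge0//.
    by field; rewrite gt_eqF.
  apply: cvgM => //; apply: cvgM; first exact: cvg_cst; apply: cvgV.
    by rewrite subr0 gt_eqF// mulr_gt0// exprn_gt0.
  apply: cvgM; first exact: cvg_cst.
  by under eq_fun do rewrite expr2; rewrite expr2; apply: cvgM; exact: cvgB.
have lo : (fun m => th ^+ 2 / (2 * (y m / a m) ^+ 2) * W m) @ \oo --> L.
  have -> : L = th ^+ 2 / (2 * Y ^+ 2) * (2 * sg2 * x `^ (2 / alpha)).
    rewrite /L (_ : 2 / alpha = 1 / alpha * 2%:R); last by rewrite mulrAC mul1r.
    rewrite (powRrM x (1 / alpha) 2%:R) powR_mulrn ?powR_ge0//.
    by field; rewrite gt_eqF.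
  apply: cvgM => //; apply: cvgM; first exact: cvg_cst; apply: cvgV.
    by rewrite gt_eqF// mulr_gt0// exprn_gt0.
  apply: cvgM; first exact: cvg_cst.
  by under eq_fun do rewrite expr2; rewrite expr2; exact: cvgM.
have L0 : 0 <= L by rewrite /L mulr_ge0 ?sqr_ge0// mulr_ge0 ?sqr_ge0.
apply/cvgrPdist_le => e e0.
pose e' := e / (2 * (L + 1)).
have e'0 : 0 < e' by rewrite divr_gt0//; lra.
have [dl dl0 hd] := defect_bounds fld e'0.
have e2 : 0 < e / 4 by lra.
near=> m.
have am : 1 < a m by near: m.
have hb : 0 < b m < y m by near: m.
have hs : `|th| * (b m / (y m - b m)) < dl by near: m; apply: cvgr_lt ratio0 _ dl0.
have k0 : 0 <= kappa alpha (n m) by near: m.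
have /andP[l u] := hd _ _ _ hb hs.
have hu : `|L - th ^+ 2 / (2 * (y m / a m - b m / a m) ^+ 2) * W m| <= e / 4.
  by near: m; move/cvgrPdist_le : up; exact.
have hl : `|L - th ^+ 2 / (2 * (y m / a m) ^+ 2) * W m| <= e / 4.
  by near: m; move/cvgrPdist_le : lo; exact.
have hl1 : `|L - th ^+ 2 / (2 * (y m / a m) ^+ 2) * W m| <= 1.
  by near: m; move/cvgrPdist_le : lo; exact.
have y0 : 0 < y m by lra.
set Lm := th ^+ 2 / (2 * (y m / a m) ^+ 2) * W m in hl hl1.
set Um := th ^+ 2 / (2 * (y m / a m - b m / a m) ^+ 2) * W m in hu.
have u' : kappa alpha (n m) * defect th (b m) (y m) <= Um.
  apply: (le_trans (ler_wpM2l k0 u)); apply: eq_ler.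
  rewrite /Um /W -mulrBl; field.
  by case/andP: hb => b0 hy; rewrite !gt_eqF//; lra.
have l' : (1 - e') * Lm <= kappa alpha (n m) * defect th (b m) (y m).
  apply: le_trans (ler_wpM2l k0 l); apply: eq_ler.
  by rewrite /Lm /W; field; rewrite !gt_eqF//; lra.
have eL : e' * Lm <= e / 2.
  apply: (@le_trans _ _ (e' * (L + 1))).
    by rewrite ler_wpM2l ?(ltW e'0)//; move: hl1; rewrite ler_norml; lra.
  by rewrite /e'; apply: eq_ler; field; lra.
move: hu hl u' l' eL; rewrite !ler_norml.
clear hl1; move: (kappa _ _ * _) Lm Um => D A B; rewrite mulrBl mul1r; lra.
Unshelve. all: by end_near. Qed.

Lemma eta_defect (beta : R) (n : nat -> nat) (x : R) : 0 < x -> 0 < beta ->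
  (fun n => etaPAM p n / (beta * kappa alpha n)) @ \oo --> (1 : R) ->
  (fun m => (n m)%:R / a m `^ alpha) @ \oo --> x ->
  (fun m => etaPAM p (n m) * defect th (b m) (y m)) @ \oo -->
    beta * sg2 * th ^+ 2 * (x `^ (1 / alpha) / Y) ^+ 2.
Proof.
move=> x0 b0 he nx; have a2 := alpha2.
have ry : (fun m => a m `^ alpha) @ \oo --> +oo by apply: seq_powR_cvgy => //; lra.
have ny : n @ \oo --> \oo.
  apply/(@cvgrnyP R)/cvgryPge => A; near=> m.
  have r0 : 0 < a m `^ alpha by near: m; exact: seq_near_gty.
  have h1 : x / 2 < (n m)%:R / a m `^ alpha by near: m; apply: cvgr_gt nx _ _; lra.
  have h2 : 2 * A / x <= a m `^ alpha by near: m; exact: seq_near_gey.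
  move: h1 h2; rewrite ltr_pdivlMr// ler_pdivrMr// => h1 h2.
  have -> : A = (2 * A) / 2 by field.
  by move: h1 h2; move: (a m `^ alpha) => r; nra.
have hc := cvg_comp _ _ ny he.
have -> : beta * sg2 * th ^+ 2 * (x `^ (1 / alpha) / Y) ^+ 2 =
   1 * (beta * (sg2 * th ^+ 2 * (x `^ (1 / alpha) / Y) ^+ 2)) by ring.
apply: (@seq_cvg_eq _ (fun m => etaPAM p (n m) / (beta * kappa alpha (n m)) *
    (beta * (kappa alpha (n m) * defect th (b m) (y m))))); last first.
  by apply: cvgM => //; apply: cvgM; [exact: cvg_cst | exact: kappa_defect].
near=> m.
have n2 : (1 < n m)%N by near: m; move/cvgnyPgt : ny; exact.
have k0 : 0 < kappa alpha (n m).
  rewrite /kappa; case: ifP => _; first by rewrite powR_gt0// ltr0n (ltn_trans _ n2).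
  by rewrite divr_gt0 ?ltr0n ?(ltn_trans _ n2)// ln_gt0// ltr1n.
by field; rewrite !gt_eqF.
Unshelve. all: by end_near. Qed.

End Height.

End DefectAsymptotics.

Lemma dominated_cvg_near {R : realType} {d} {T : measurableType d} (mu : {measure set T -> \bar R})
    (D : set T) (f_ : nat -> T -> R) (f g : T -> R) : measurable D ->
  (forall n, measurable_fun D (f_ n)) -> mu.-integrable D (EFin \o g) ->
  (\forall n \near \oo, forall x, D x -> `|f_ n x| <= g x) ->
  (forall x, D x -> f_ ^~ x @ \oo --> f x) ->
  (fun n => Rintegral mu D (f_ n)) @ \oo --> Rintegral mu D f.
Proof.
move=> mD mf ig [N _ hN] cf.
have h : (fun n => Rintegral mu D (f_ (n + N)%N)) @ \oo --> Rintegral mu D f.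
  apply: (Rintegral_dominated_cvg mD (fun n => mf (n + N)%N) ig).
    by move=> n x Dx; apply: hN => //=; exact: leq_addl.
  by move=> x Dx; have := cf x Dx; rewrite -(cvg_shiftn N).
by rewrite -(cvg_shiftn N).
Qed.

(** * Riemann sums over the position of the peak *)

Section PeakIntegral.
Context {R : realType} {alpha : R} {p : nat -> R} {d} {T : measurableType d}
  {P : probability T R} {xi0 : int -> T -> R} {c : nat -> T -> bool}.
Hypothesis fld : pareto_field alpha p P xi0 c.
Local Notation leb := (@lebesgue_measure R).
Local Notation defect := (phase_defect P xi0).
Local Notation factor := (@site_factor R alpha p d T P xi0).
Let alpha2 := field_alpha fld.
Let mxi := field_meas fld.

Lemma measurable_defect th b {d'} {T' : measurableType d'} (Y : T' -> R) :
  measT Y -> measT (fun s => defect th b (Y s)).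
Proof.
move=> mY.
have m0 : measT (defect th b).
  pose f (z : measurableTypeR R * T) := 1 - cos (th * pair_phase b z.1 (xi0 0 z.2, xi0 1 z.2)).
  have bf : bmeas f.
    apply: bmeasB; first exact: bmeas_cst.
    apply: bmeas_cos; apply: measurable_scale.
    by apply: measurable_pair_phase; [exact: measurable_fst|exact: measurableT_comp (mxi _) measurable_snd..].
  have [[m _] _ _ _] := prob_fubini (@std_normal R) P bf.
  move: m; congr measurable_fun; apply/funext => y; rewrite /phase_defect.
  rewrite -(@pair_law _ _ _ _ _ _ _ _ fld 0 1)//.
  apply: bmeasB; first exact: bmeas_cst.
  apply: bmeas_cos; apply: measurable_scale.
  have := @measurable_pair_phase R _ (R * R)%type b (cst y) fst snd.
  move=> /(_ _ _ _)/Wrap[| | |]; [exact: measurable_cst|exact: measurable_fst|exact: measurable_snd|].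
  by congr measurable_fun; apply/funext => -[].
exact: measurableT_comp m0 mY.
Qed.

Lemma defect_ge0 th b y : 0 <= defect th b y.
Proof.
apply: Rintegral_ge0 => w _; apply: Rintegral_ge0 => w' _.
by case/andP: (one_sub_cos_le (th * pair_phase b y (xi0 0 w, xi0 0 w'))).
Qed.

Lemma factor_norm_le1 (A th b y : R) n i : 1 <= A -> b <= A -> `|factor A th b y n i| <= 1.
Proof.
move=> A1 bA; rewrite -(cut_site_cos fld)//.
have bf : bmeas (fun w => (xi0 i%:Z w <= A)%R%:R * cos (th * @cut_phase R d T xi0 c n b y i w) : R).
  apply: bmeasM.
    by apply: bmeas_bool; apply: measurable_fun_ler; [exact: mxi | exact: measurable_cst].
  apply: bmeas_cos; apply: measurable_scale.
  rewrite /cut_phase; apply: measurable_scale.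
  rewrite /site_phase; apply: measurable_funM.
    have [m _] : bmeas (fun w => (~~ c i w)%:R : R).
      have := @bmeas_indic R d T _ (measurableC (field_coin_meas fld i)).
      congr bmeas; apply/funext => w; rewrite indicE; congr (nat_of_bool _)%:R.
      by apply/idP/idP; rewrite inE => /negP.
    exact: m.
  by apply: measurable_pair_phase; [exact: measurable_cst|exact: mxi..].
have b1 w : `|(xi0 i%:Z w <= A)%R%:R * cos (th * @cut_phase R d T xi0 c n b y i w)| <= 1 :> R.
  rewrite normrM -[leRHS]mulr1; apply: ler_pM => //.
    by case: (xi0 i%:Z w <= A)%R; rewrite ?normr1 ?normr0.
  by rewrite ler_norml cos_le1 cos_geN1.
exact: normr_Rintegral_prob.
Qed.

Variables (a r rho e K : R).
Hypotheses (a0 : 0 < a) (rE : r = a `^ alpha) (rho0 : 0 < rho) (e0 : 0 < e) (ae : 1 <= a * e).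

(** The excess [s] is the rescaled value of [Psi]: at such a height ln xi is about rho ln t, and
    with a / r = ln t / t the travel cost of [n] is about a rho n / r, which leaves [Psi] about a s.
    [barrier] is the same line lowered by the margin [e]. *)
Definition height (n : nat) (s : R) : R := a * (s + rho * (n%:R / r)).
Definition barrier (s : R) (i : nat) : R := a * (s - e + rho * (i%:R / r)).
Definition excess (n : nat) (w : T) : R := xi0 n%:Z w / a - rho * (n%:R / r).
Definition below_barrier (N n : nat) (w : T) : R :=
  \prod_(i <- iota 0 N.+1 | i != n) (xi0 i%:Z w <= barrier (excess n w) i)%R%:R.
Definition total_phase (b : R) (N n : nat) (w : T) : R :=
  \sum_(i <- iota 0 N.+1 | i != n) @cut_phase R d T xi0 c n b (xi0 n%:Z w) i w.
Definition factor_prod (th b : R) (N n : nat) (s : R) : R :=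
  \prod_(i <- iota 0 N.+1 | i != n) factor (barrier s i) th b (height n s) n i.

Let r0 : 0 < r. Proof. by rewrite rE powR_gt0. Qed.

Let nr0 (n : nat) : 0 <= n%:R / r. Proof. by rewrite divr_ge0// ltW. Qed.

Lemma barrier_ge (s : R) i : 2 * e < s -> a * e <= barrier s i.
Proof.
move=> se; rewrite /barrier ler_pM2l//.
have := nr0 i; move: (i%:R / r) => x x0; have : 0 <= rho * x by rewrite mulr_ge0// ltW.
lra.
Qed.

Lemma height_excess n w : height n (excess n w) = xi0 n%:Z w.
Proof. by rewrite /height /excess subrK mulrC divfK// gt_eqF. Qed.

Lemma factor_prod_le1 (th b : R) (N n : nat) (s : R) : b <= a * e -> 2 * e < s ->
  `|factor_prod th b N n s| <= 1.
Proof.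
move=> be se; rewrite /factor_prod normr_prod; apply: (@le_trans _ _ (\prod_(i <- iota 0 N.+1 | i != n) 1)).
  apply: ler_prod => i _; rewrite normr_ge0 /= factor_norm_le1//.
    by apply: (le_trans ae); exact: barrier_ge.
  by apply: (le_trans be); exact: barrier_ge.
by rewrite big1_eq.
Qed.

Lemma measurable_factor_prod (th b : R) (N n : nat) : measT (factor_prod th b N n).
Proof.
have ms : measT (fun s : R => s) by exact: measurable_id.
have mm i : measT (fun s => if i != n then factor (barrier s i) th b (height n s) n i else 1).
  case: (boolP (i != n)) => _; last exact: measurable_cst.
  apply: measurable_funB.
    apply: measurable_funB; first exact: measurable_cst.
    apply: (measurableT_comp (@measurable_powR R (- alpha))).
    apply: measurable_scale.
    by apply: measurable_funD; [apply: measurable_funB => //|]; exact: measurable_cst.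
  apply: measurable_scale.
  apply: measurable_scale.
  apply: measurable_defect; apply: measurable_scale.
  by apply: measurable_funD => //; exact: measurable_cst.
have := measurable_prod (s := iota 0 N.+1) (fun i _ => mm i); congr measurable_fun.
by apply/funext => s; rewrite /factor_prod [RHS]big_mkcond.
Qed.

Lemma excess_law n (f : R -> R) : 2 * e < K -> bmeas f ->
  leb.-integrable `]2 * e, K] (EFin \o (fun s => f s * (r^-1 * alpha * (s + rho * (n%:R / r)) `^ (- alpha - 1)))) /\
  intT P (fun w => f (excess n w) * (2 * e < excess n w <= K)%R%:R) =
  Rintegral leb `]2 * e, K] (fun s => f s * (r^-1 * alpha * (s + rho * (n%:R / r)) `^ (- alpha - 1))).
Proof.
move=> eK bf; have a2 := alpha2; have he := e0.
set q := rho * (n%:R / r); have q0 : 0 <= q by rewrite mulr_ge0 ?nr0// ltW.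
have pos (x : R) : 2 * e <= x -> 0 < q + 1 * x by lra.
have cE (x : R) : q + 1 * x = x + q by ring.
have mX : measT (excess n).
  apply: measurable_funB; last exact: measurable_cst.
  by apply: measurable_funM; [exact: mxi | exact: measurable_cst].
apply: (@law_interval R d T P (excess n) (2 * e) K (fun x => r^-1 * (x + q) `^ (- alpha))) => //.
- move=> x x1; have dd := @is_derive_powR_affine R q 1 (- alpha) x (pos x x1).
  under eq_fun do rewrite -cE.
  by apply: is_derive_eq; rewrite -cE /GRing.scale /=; ring.
- move=> x x1; apply: cvgM; first exact: cvg_cst.
  have := @powR_affine_continuous R q 1 (- alpha - 1) x (pos x x1).
  by under [X in {for _, continuous X}]eq_fun do rewrite cE.
- by move=> x _; rewrite mulr_ge0 ?powR_ge0// mulr_ge0// ?invr_ge0 ?ltW//; lra.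
- move=> x x1.
  rewrite (_ : [set w | x < excess n w] = [set w | a * (x + q) < xi0 n%:Z w]); last first.
    by apply/seteqP; split => w /=; rewrite /excess -/q ltrBrDr ltr_pdivlMr// mulrC.
  have xq : e <= x + q by lra.
  rewrite (field_tail fld); last by apply: (le_trans ae); rewrite ler_pM2l.
  by rewrite powRM ?(ltW a0)//; [rewrite powRN rE powRN|lra].
Unshelve. all: by end_near. Qed.

Definition peak_density (th b : R) (N : nat) (g : R -> R) (n : nat) (s : R) : R :=
  alpha * (s + rho * (n%:R / r)) `^ (- alpha - 1) * g (height n s) * factor_prod th b N n s.

Lemma peak_integral (th b : R) (N n : nat) (g : R -> R) : 2 * e < K -> bmeas g -> b <= a * e ->
  intT P (fun w => (2 * e < excess n w <= K)%R%:R * g (xi0 n%:Z w) *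
     (below_barrier N n w * cos (th * total_phase b N n w))) =
  Rintegral leb `]2 * e, K] (fun s => r^-1 * peak_density th b N g n s) /\
  leb.-integrable `]2 * e, K] (EFin \o (fun s => r^-1 * peak_density th b N g n s)) /\
  intT P (fun w => (2 * e < excess n w <= K)%R%:R * g (xi0 n%:Z w) *
     (below_barrier N n w * sin (th * total_phase b N n w))) = 0.
Proof.
move=> eK bg be; have [mg [M gM]] := bg.
have M0 : 0 <= M by apply: le_trans (gM 0).
pose q := rho * (n%:R / r).
pose G (y : R) : R := (2 * e < y / a - q <= K)%R%:R * g y.
have mq : measT (fun y : R => y / a - q).
  by apply: measurable_funB; [apply: measurable_funM => //|]; exact: measurable_cst.
have bG : bmeas G.
  apply: bmeasM => //; apply: bmeas_bool; apply: measurable_and.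
    by apply: measurable_fun_ltr => //; exact: measurable_cst.
  by apply: measurable_fun_ler => //; exact: measurable_cst.
pose A i (y : R) := barrier (y / a - q) i.
have mA i : measT (A i).
  apply: measurable_scale.
  apply: measurable_funD; last exact: measurable_cst.
  by apply: measurable_funB => //; exact: measurable_cst.
have GA y i : G y != 0 -> 1 <= A i y /\ b <= A i y.
  rewrite /G; have [/andP[h1 _] _|_] := boolP (2 * e < y / a - q <= K)%R; last by rewrite mul0r eqxx.
  have := barrier_ge i h1; rewrite /A => h; split; first exact: le_trans ae h.
  exact: le_trans be h.
have [ec es] := peak_expectation fld n N th bG mA GA.
pose F (s : R) := (2 * e < s <= K)%R%:R * (g (height n s) * factor_prod th b N n s).
have bF : bmeas F.
  have ms : measT (fun s : R => s) by exact: measurable_id.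
  split.
    apply: measurable_funM.
      have [] // : bmeas (fun s : R => (2 * e < s <= K)%R%:R : R).
      by apply: bmeas_bool; apply: measurable_and; [apply: measurable_fun_ltr|apply: measurable_fun_ler] => //;
        exact: measurable_cst.
    apply: measurable_funM; last exact: measurable_factor_prod.
    apply: (measurableT_comp mg); apply: measurable_scale.
    by apply: measurable_funD => //; exact: measurable_cst.
  exists M => s; rewrite /F; have [/andP[h1 _]|_] := boolP (2 * e < s <= K)%R; last by rewrite mul0r normr0.
  rewrite mul1r normrM -[leRHS]mulr1; apply: ler_pM => //; exact: factor_prod_le1.
have [iF law] := excess_law n eK bF.
have eqF s : s \in `]2 * e, K]%classic -> F s * (r^-1 * alpha * (s + rho * (n%:R / r)) `^ (- alpha - 1)) =
    r^-1 * peak_density th b N g n s.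
  by rewrite inE /= in_itv /= => /andP[h1 h2]; rewrite /F h1 h2 /= /peak_density mul1r; ring.
split; last split; last by rewrite -[RHS]es.
  transitivity (intT P (fun w => G (xi0 n%:Z w) *
    \prod_(i <- iota 0 N.+1 | i != n) factor (A i (xi0 n%:Z w)) th b (xi0 n%:Z w) n i)).
    by rewrite -ec.
  transitivity (intT P (fun w => F (excess n w) * (2 * e < excess n w <= K)%R%:R)).
    apply: eq_Rintegral => w _; rewrite /F /G /factor_prod height_excess -/q.
    rewrite -/(excess n w) /A -/(excess n w).
    by case: (2 * e < excess n w <= K)%R; rewrite ?mul0r ?mul1r ?mulr1.
  by rewrite law; apply: eq_Rintegral => s sI; exact: eqF.
by apply: eq_integrable iF => // s sI; rewrite /= eqF.
Qed.

End PeakIntegral.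

Section FactorLimit.
Context {R : realType} {alpha : R} {p : nat -> R} {d} {T : measurableType d}
  {P : probability T R} {xi0 : int -> T -> R} {c : nat -> T -> bool}.
Hypothesis fld : pareto_field alpha p P xi0 c.
Let alpha2 := field_alpha fld.
Variables (rho e th beta : R) (a b : nat -> R) (N : nat -> nat).
Hypotheses (rho0 : 0 < rho) (rhoE : rho * (alpha - 1) = 1) (e0 : 0 < e) (beta0 : 0 < beta).
Hypothesis etah : (fun n => etaPAM p n / (beta * kappa alpha n)) @ \oo --> (1 : R).
Hypotheses (ay : a @ \oo --> +oo) (by_ : b @ \oo --> +oo).
Hypothesis ba : (fun m => b m / a m) @ \oo --> (0 : R).
Hypothesis lnba : (fun m => ln (b m) / ln (a m)) @ \oo --> (1 : R).
Local Notation r m := (a m `^ alpha).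
Hypothesis Ny : (fun m => (N m)%:R / r m) @ \oo --> +oo.
Local Notation fprod m n s :=
  (@factor_prod R alpha p d T P xi0 (a m) (r m) rho e th (b m) (N m) n s).
Local Notation defect := (phase_defect P xi0 th).

Let ry : (fun m => r m) @ \oo --> +oo.
Proof. by have a2 := alpha2; apply: seq_powR_cvgy => //; lra. Qed.

(** The first term in the exponent is the void probability of the other sites, the limiting expected
    number of sites above the barrier; the second is the conditional characteristic function of the
    phase at [th]. *)
Definition limit_factor (s x : R) : R :=
  expR (- ((s - e) `^ (1 - alpha) +
    beta * sigmaPAM alpha ^+ 2 * th ^+ 2 * (x `^ (1 / alpha) / (s + rho * x)) ^+ 2)).

Lemma sum_cut_eta (n N' : nat) (D : R) : (0 < n <= N')%N ->
  \sum_(i <- iota 0 N'.+1 | i != n) (0 < i < n)%N%:R * ((1 - p i) * D) = etaPAM p n.-1 * D.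
Proof.
move=> /andP[n0 nN]; rewrite /etaPAM prednK// mulr_suml.
have -> : iota 0 N'.+1 = index_iota 0 N'.+1 by rewrite /index_iota subn0.
rewrite (@big_nat_widen _ _ _ 1 n N'.+1); last exact: leqW.
rewrite big_mkcond big_ltn// (_ : (if _ then _ else _) = 0); last by rewrite /= mul0r; case: ifP.
apply: etrans (add0r _) _; rewrite [RHS]big_mkcond [LHS]big_nat [RHS]big_nat.
apply: eq_bigr => i /andP[i0 _]; rewrite i0 /=.
by case: ltngtP => //= _; rewrite ?mul1r// ?mul0r.
Qed.

(** Each factor is 1 minus a small number. The barrier parts form a Riemann sum over the half-line,
    complete because N / r tends to infinity; the failed coins before the peak add up to [etaPAM]
    times the defect of one pair. *)
Lemma factor_prod_cvg (n : nat -> nat) (x s : R) : 0 < x -> 2 * e < s ->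
  (fun m => (n m)%:R / r m) @ \oo --> x ->
  (fun m => fprod m (n m) s) @ \oo --> limit_factor s x.
Proof.
move=> x0 se nx; have a2 := alpha2; have he := e0; have rh := rhoE; have rp := rho0.
pose y m := height (a m) (r m) rho (n m) s.
pose D m := defect (b m) (y m).
have a1 : \forall m \near \oo, 1 < a m by exact: seq_near_gty.
have r1 : \forall m \near \oo, 1 < r m by exact: seq_near_gty.
pose Y := s + rho * x.
have Y0 : 0 < Y by rewrite /Y; have := mulr_gt0 rho0 x0; lra.
have yY : (fun m => y m / a m) @ \oo --> Y.
  apply: (@seq_cvg_eq _ (fun m => s + rho * ((n m)%:R / r m))).
    near=> m; have am : 1 < a m by near: m.
    by rewrite /y /height [RHS]mulrC mulKf// gt_eqF//; lra.
  by apply: cvgD; [exact: cvg_cst | apply: cvgM => //; exact: cvg_cst].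
have nx' : (fun m => (n m).-1%:R / r m) @ \oo --> x.
  apply: (@seq_cvg_eq _ (fun m => (n m)%:R / r m - (r m)^-1)).
    near=> m; have n0 : 0 < (n m)%:R / r m by near: m; exact: seq_near_gt0 nx.
    have rm : 1 < r m by near: m.
    have n0' : (0 < n m)%N.
      by move: n0; rewrite pmulr_lgt0 ?invr_gt0 ?ltr0n//; lra.
    by rewrite -{1}(prednK n0') -natr1; ring.
  by rewrite -[X in _ --> X]subr0; apply: cvgB => //; exact: seq_invy.
have D0 : D @ \oo --> (0 : R) by exact: (defect_cvg0 fld ay by_ ba lnba th Y0 yY).
have eD : (fun m => etaPAM p (n m).-1 * D m) @ \oo -->
    beta * sigmaPAM alpha ^+ 2 * th ^+ 2 * (x `^ (1 / alpha) / Y) ^+ 2.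
  exact: (eta_defect fld ay by_ ba lnba Y0 yY x0 beta0 etah nx').
have nN : \forall m \near \oo, (0 < n m <= N m)%N.
  near=> m; have rm : 1 < r m by near: m.
  have n0 : 0 < (n m)%:R / r m by near: m; exact: seq_near_gt0 nx.
  have n1 : (n m)%:R / r m < x + 1 by near: m; apply: cvgr_lt nx _ _; lra.
  have N1 : x + 1 <= (N m)%:R / r m by near: m; exact: seq_near_gey.
  have r0 : 0 < r m by lra.
  apply/andP; split; first by move: n0; rewrite pmulr_lgt0 ?invr_gt0 ?ltr0n.
  have := lt_le_trans n1 N1; rewrite ltr_pM2r ?invr_gt0// ltr_nat; exact: ltnW.
pose se' := s - e; have se0 : 0 < se' by rewrite /se'; lra.
pose w m (i : nat) := (r m)^-1 * (se' + rho * (i%:R / r m)) `^ (- alpha).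
pose v m i := w m i + (0 < i < n m)%N%:R * ((1 - p i) * D m).
have wle m i : 0 < r m -> 0 <= w m i <= (r m)^-1 * se' `^ (- alpha).
  move=> r0; rewrite mulr_ge0 ?powR_ge0 ?invr_ge0 ?(ltW r0)//= ler_wpM2l ?invr_ge0 ?(ltW r0)//.
  have h : se' <= se' + rho * (i%:R / r m).
    by rewrite lerDl mulr_ge0 ?divr_ge0 ?(ltW r0) ?(ltW rp).
  rewrite !powRN lef_pV2 ?posrE ?powR_gt0//; last exact: lt_le_trans h.
  by apply: ge0_ler_powR => //; rewrite ?nnegrE; lra.
have fE : \forall m \near \oo, \prod_(i <- iota 0 (N m).+1 | i != n m) (1 - v m i) = fprod m (n m) s.
  near=> m; have am : 1 < a m by near: m.
  have rm : 1 < r m by near: m.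
  apply: eq_bigr => i _; rewrite /site_factor /v -/(y m) -/(D m) opprD addrA; congr (1 - _ - _).
  have h : 0 < se' + rho * (i%:R / r m).
    by rewrite ltr_pwDl// mulr_ge0 ?(ltW rp)// divr_ge0//; lra.
  rewrite /w /barrier -/se' powRM ?powRN ?(ltW h)//; lra.
have rc : (fun m => (r m)^-1 * se' `^ (- alpha)) @ \oo --> (0 : R).
  by rewrite -(mul0r (se' `^ (- alpha))); apply: cvgM; [exact: seq_invy | exact: cvg_cst].
apply: (seq_cvg_eq fE); rewrite /limit_factor.
apply: (@prod_one_sub_cvg _ _ _ _ _ (fun m => (r m)^-1 * se' `^ (- alpha) + D m)).
- near=> m => i _; rewrite /v.
  have rm : 1 < r m by near: m.
  have r0 : 0 < r m by lra.
  have /andP[w0 w1] := wle m i r0.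
  have d0 : 0 <= D m by exact: (defect_ge0).
  have /andP[p0 p1] := field_p fld i.
  have q0 : 0 <= (1 - p i) * D m <= D m.
    by rewrite mulr_ge0//=; [rewrite ler_piMl//; lra | lra].
  case: (0 < i < n m)%N; rewrite ?mul1r ?mul0r; move: q0 => /andP[q0 q1]; apply/andP; split; lra.
- by rewrite -[X in _ --> X]addr0; exact: cvgD.
- have cw : (fun m => \sum_(i <- iota 0 (N m).+1) w m i) @ \oo --> se' `^ (1 - alpha).
    apply: (@squeeze_cvgr _ _ _ _
      (fun m => se' `^ (1 - alpha) - (se' + rho * ((N m).+1%:R / r m)) `^ (1 - alpha))
      (fun m => se' `^ (1 - alpha) + (r m)^-1 * se' `^ (- alpha))).
    + near=> m; have rm : 1 < r m by near: m.
      by apply: powR_riemann_sum => //; lra.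
    + rewrite -[X in _ --> X]subr0; apply: cvgB; first exact: cvg_cst.
      rewrite (_ : 1 - alpha = - (alpha - 1)); last by ring.
      apply: seq_powRN_cvg0; first lra.
      apply/cvgryPge => A; near=> m; have rm : 1 < r m by near: m.
      have h : A / rho <= (N m)%:R / r m by near: m; exact: seq_near_gey.
      have h2 : (N m)%:R / r m <= (N m).+1%:R / r m.
        by rewrite ler_pM2r ?invr_gt0 ?ler_nat//; lra.
      have := le_trans h h2; rewrite ler_pdivrMr// mulrC => h3.
      by apply: (le_trans h3); rewrite lerDr ltW.
    + by rewrite -[X in _ --> X]addr0; apply: cvgD => //; exact: cvg_cst.
  have cwn : (fun m => w m (n m)) @ \oo --> (0 : R).
    apply: (@squeeze_cvgr _ _ _ _ (cst 0) (fun m => (r m)^-1 * se' `^ (- alpha))).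
    + near=> m; have rm : 1 < r m by near: m.
      by apply: wle; lra.
    + exact: cvg_cst.
    + by [].
  apply: (@seq_cvg_eq _ (fun m => (\sum_(i <- iota 0 (N m).+1) w m i - w m (n m)) + etaPAM p (n m).-1 * D m)).
    near=> m; have nm : (0 < n m <= N m)%N by near: m.
    rewrite /v big_split /= sum_cut_eta//; congr (_ + _).
    have ni : n m \in iota 0 (N m).+1 by rewrite mem_iota add0n ltnS /=; case/andP: nm.
    have -> : \sum_(i <- iota 0 (N m).+1) w m i = w m (n m) + \sum_(i <- iota 0 (N m).+1 | i != n m) w m i.
      exact: (bigD1_seq (n m) ni (iota_uniq _ _)).
    by rewrite addrC addKr.
  by apply: cvgD => //; rewrite -[X in _ --> X]subr0; exact: cvgB.
Unshelve. all: by end_near. Qed.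

End FactorLimit.

Section StepFunctions.
Context {R : realType}.
Local Notation leb := (@lebesgue_measure R).

(** The sum over sites written as the integral of a step function in the rescaled position, so that
    dominated convergence can replace an estimate of Riemann sums. *)
Definition step_sum (h : nat -> R) (r : R) (N : nat) (x : R) : R :=
  \sum_(k < N.+1) h k * \1_`[k%:R / r, k.+1%:R / r[%classic x.

Lemma step_sumE (h : nat -> R) (r : R) (N : nat) (x : R) : 0 < r ->
  step_sum h r N x =
  if (0 <= x) && (Num.truncn (x * r) <= N)%N then h (Num.truncn (x * r)) else 0.
Proof.
move=> r0; set k := Num.truncn (x * r).
have mem (i : nat) : (x \in `[i%:R / r, i.+1%:R / r[%classic) = (0 <= x) && (i == k).
  apply/idP/idP.
    rewrite inE /= in_itv /= ler_pdivrMr// ltr_pdivlMr// => /andP[h1 h2].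
    have xr0 : 0 <= x * r by apply: le_trans h1.
    rewrite -(pmulr_lge0 x r0) xr0 /= eq_sym /k truncn_eq// h1 h2//.
  move=> /andP[x0 /eqP ->]; rewrite inE /= in_itv /= ler_pdivrMr// ltr_pdivlMr//.
  have xr0 : 0 <= x * r by rewrite mulr_ge0// ltW.
  by rewrite truncn_le xr0 /= truncnS_gt.
rewrite /step_sum; case: ifPn => [/andP[x0 kN]|hn].
  have kN' : (k < N.+1)%N by [].
  rewrite (bigD1 (Ordinal kN'))//= big1 ?addr0; last first.
    move=> i ik; rewrite indicE mem x0 /=.
    have -> : (i == k :> nat) = false by apply/negbTE; apply: contra ik => /eqP ik; apply/eqP/val_inj.
    by rewrite mulr0.
  by rewrite indicE mem x0 eqxx mulr1.
rewrite big1// => i _; rewrite indicE mem.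
case: (boolP (0 <= x)) hn => //= x0 hn.
  case: eqP => [ik|_]; last by rewrite mulr0.
  by case/negP: hn; rewrite -ik -ltnS.
by rewrite mulr0.
Qed.

Lemma measurable_step_sum h (r : R) N : measT (step_sum h r N).
Proof.
rewrite /step_sum; apply: (@measurable_sum _ _ _ _ _ (index_enum _) (fun (k : 'I_N.+1) x => h k * \1_`[k%:R / r, k.+1%:R / r[%classic x)) => k.
by apply: measurable_scale; exact: measurable_indic.
Qed.

Lemma Rintegral_step_sum h (r : R) N : 0 < r ->
  intT leb (step_sum h r N) = \sum_(k <- iota 0 N.+1) r^-1 * h k.
Proof.
move=> r0.
have lE (k : nat) : leb `[k%:R / r, k.+1%:R / r[%classic = (r^-1)%:E.
  rewrite lebesgue_measure_itv /= lte_fin ltr_pM2r ?invr_gt0// ltr_nat ltnSn.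
  by rewrite -EFinD -mulrBl -natrB// subSnn mul1r.
rewrite (@Rintegral_step_fun R N.+1 h (fun k => `[k%:R / r, k.+1%:R / r[%classic)).
- rewrite -(big_mkord xpredT (fun k => h k * fine (leb `[k%:R / r, k.+1%:R / r[%classic))).
  by rewrite /index_iota subn0; apply: eq_bigr => k _; rewrite lE mulrC.
- by move=> k; exact: measurable_itv.
- by move=> k; rewrite lE ltry.
Qed.

Lemma truncn_scaled (x : R) (r : nat -> R) : 0 <= x -> r @ \oo --> +oo ->
  (fun m => (Num.truncn (x * r m))%:R / r m) @ \oo --> x.
Proof.
move=> x0 ry; apply: (@squeeze_cvgr _ _ _ _ (fun m => x - (r m)^-1) (cst x)).
- near=> m; have r0 : 0 < r m by near: m; exact: seq_near_gty.
  have xr0 : 0 <= x * r m by rewrite mulr_ge0// ltW.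
  rewrite /= ler_pdivrMr// ler_pdivlMr// mulrBl mulVf ?gt_eqF//.
  rewrite truncn_le xr0 andbT lerBlDr natr1 ltW// truncnS_gt//.
- by rewrite -[X in _ --> X]subr0; apply: cvgB; [exact: cvg_cst | exact: seq_invy].
- exact: cvg_cst.
Unshelve. all: by end_near. Qed.

End StepFunctions.

Section PeakSum.
Context {R : realType} {alpha : R} {p : nat -> R} {d} {T : measurableType d}
  {P : probability T R} {xi0 : int -> T -> R} {c : nat -> T -> bool}.
Hypothesis fld : pareto_field alpha p P xi0 c.
Local Notation leb := (@lebesgue_measure R).
Let alpha2 := field_alpha fld.
Let mxi := field_meas fld.
Variables (rho e K th beta : R) (a b : nat -> R) (N : nat -> nat).
Hypotheses (rho0 : 0 < rho) (rhoE : rho * (alpha - 1) = 1) (e0 : 0 < e) (beta0 : 0 < beta).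
Hypothesis eK : 2 * e < K.
Hypothesis etah : (fun n => etaPAM p n / (beta * kappa alpha n)) @ \oo --> (1 : R).
Hypotheses (ay : a @ \oo --> +oo) (by_ : b @ \oo --> +oo).
Hypothesis ba : (fun m => b m / a m) @ \oo --> (0 : R).
Hypothesis lnba : (fun m => ln (b m) / ln (a m)) @ \oo --> (1 : R).
Local Notation r m := (a m `^ alpha).
Hypothesis Ny : (fun m => (N m)%:R / r m) @ \oo --> +oo.
Variables (g : R -> R) (M : R).
Hypotheses (cg : continuous g) (gM : forall x, `|g x| <= M).

Let ry : (fun m => r m) @ \oo --> +oo.
Proof. by have a2 := alpha2; apply: seq_powR_cvgy => //; lra. Qed.

(** The test function at the site [n], on the event that [n] beats all other sites by the margin
    [e]. Confining both rescaled coordinates to bounded intervals away from 0 is what provides a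
    dominating function. *)
Definition peak_weight (m n : nat) (w : T) : R :=
  (e < n%:R / r m <= K)%R%:R * ((2 * e < @excess R d T xi0 (a m) (r m) rho n w <= K)%R%:R *
    g (n%:R `^ (1 / alpha) * (xi0 n%:Z w) `^ (- 1)) *
    @below_barrier R d T xi0 (a m) (r m) rho e (N m) n w).

Definition cos_sum m w : R := \sum_(n <- iota 0 (N m).+1)
  peak_weight m n w * cos (th * @total_phase R d T xi0 c (b m) (N m) n w).
Definition sin_sum m w : R := \sum_(n <- iota 0 (N m).+1)
  peak_weight m n w * sin (th * @total_phase R d T xi0 c (b m) (N m) n w).

Definition limit_density (s x : R) : R :=
  alpha * (s + rho * x) `^ (- alpha - 1) * g (x `^ (1 / alpha) / (s + rho * x)) *
  @limit_factor R alpha rho e th beta s x.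

Let G (n : nat) (y : R) : R := g (n%:R `^ (1 / alpha) * y `^ (- 1)).

Let bG n : bmeas (G n).
Proof.
split; last by exists M => y; exact: gM.
apply: measurableT_comp; first exact: continuous_measurable_fun.
by apply: measurable_scale; exact: measurable_powR.
Qed.

Let dens m n s : R := @peak_density R alpha p d T P xi0 (a m) (r m) rho e th (b m) (N m) (G n) n s.
Let hk m s (n : nat) : R := (e < n%:R / r m <= K)%R%:R * dens m n s.

Let good m := [/\ 1 < a m, 1 <= a m * e, b m <= a m * e & 1 <= r m].

Let good_near : \forall m \near \oo, good m.
Proof.
near=> m; split.
- by near: m; exact: seq_near_gty.
- rewrite -ler_pdivrMr//; near: m; exact: seq_near_gey.
- have am : 0 < a m by near: m; exact: seq_near_gty.
  by rewrite mulrC -ler_pdivrMr// ltW//; near: m; apply: cvgr_lt ba _ e0.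
- by near: m; exact: seq_near_gey.
Unshelve. all: by end_near. Qed.

Let bW m n : bmeas (fun w => (2 * e < @excess R d T xi0 (a m) (r m) rho n w <= K)%R%:R *
    g (n%:R `^ (1 / alpha) * (xi0 n%:Z w) `^ (- 1)) *
    @below_barrier R d T xi0 (a m) (r m) rho e (N m) n w).
Proof.
have mex k : measT (@excess R d T xi0 (a m) (r m) rho k).
  apply: measurable_funB; last exact: measurable_cst.
  by apply: measurable_funM; [exact: mxi | exact: measurable_cst].
apply: bmeasM.
  apply: bmeasM; last exact: (bmeas_site fld n%:Z (bG n)).
  by apply: bmeas_bool; apply: measurable_and; [apply: measurable_fun_ltr|apply: measurable_fun_ler] => //;
    exact: measurable_cst.
apply: bmeas_prod => i _; apply: bmeas_bool; apply: measurable_fun_ler; first exact: mxi.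
apply: measurable_scale.
apply: measurable_funD; last exact: measurable_cst.
by apply: measurable_funB => //; exact: measurable_cst.
Qed.

Lemma peak_weight_bmeas m n : bmeas (peak_weight m n).
Proof. by apply: bmeasM => //; exact: bmeas_cst. Qed.

Lemma measurable_total_phase m n : measT (@total_phase R d T xi0 c (b m) (N m) n).
Proof.
have mm i : measT (fun w => if i != n then @cut_phase R d T xi0 c n (b m) (xi0 n%:Z w) i w else 0).
  case: (boolP (i != n)) => _; last exact: measurable_cst.
  apply: measurable_scale.
  apply: measurable_funM.
    have [mc _] : bmeas (fun w => (~~ c i w)%:R : R).
      have := @bmeas_indic R d T _ (measurableC (field_coin_meas fld i)).
      congr bmeas; apply/funext => w; rewrite indicE; congr (nat_of_bool _)%:R.
      by apply/idP/idP; rewrite inE => /negP.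
    exact: mc.
  by apply: measurable_pair_phase; exact: mxi.
have := measurable_sum (iota 0 (N m).+1) mm; congr measurable_fun.
by apply/funext => w; rewrite /total_phase [RHS]big_mkcond.
Qed.

Let mth m n : measT (fun w => th * @total_phase R d T xi0 c (b m) (N m) n w).
Proof. by apply: measurable_scale; exact: measurable_total_phase. Qed.

Let bcosn m n : bmeas (fun w => peak_weight m n w * cos (th * @total_phase R d T xi0 c (b m) (N m) n w)).
Proof.
apply: bmeasM; first exact: peak_weight_bmeas.
by apply: bmeas_cos; exact: mth.
Qed.

Let bsinn m n : bmeas (fun w => peak_weight m n w * sin (th * @total_phase R d T xi0 c (b m) (N m) n w)).
Proof.
apply: bmeasM; first exact: peak_weight_bmeas.
by apply: bmeas_sin; exact: mth.
Qed.

Let iD m n : good m -> leb.-integrable `]2 * e, K] (EFin \o (fun s => (r m)^-1 * hk m s n)).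
Proof.
move=> [a1 ae be _]; have a0 : 0 < a m by lra.
have [_ [i _]] := peak_integral fld a0 erefl rho0 e0 ae th (N m) n eK (bG n) be.
have := @integrableZl _ _ _ leb _ (measurable_itv _) (e < n%:R / r m <= K)%R%:R _ i.
by congr (integrable _ _ _); apply/funext => s /=; rewrite -EFinM mulrCA.
Qed.

Lemma cos_sum_mean m : good m -> intT P (cos_sum m) =
  Rintegral leb `]2 * e, K] (fun s => intT leb (step_sum (hk m s) (r m) (N m))).
Proof.
move=> gm; have [a1 ae be r1] := gm; have a0 : 0 < a m by lra.
have r0 : 0 < r m by rewrite powR_gt0.
rewrite /cos_sum (Rintegral_sum_prob P (iota 0 (N m).+1) (bcosn m)).
under [RHS]eq_Rintegral do rewrite Rintegral_step_sum//.
have sumE : Rintegral leb `]2 * e, K] (fun s => \sum_(k <- iota 0 (N m).+1) (r m)^-1 * hk m s k) =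
   \sum_(k <- iota 0 (N m).+1) Rintegral leb `]2 * e, K] (fun s => (r m)^-1 * hk m s k).
  elim: (iota 0 (N m).+1) => [|k l IH].
    by rewrite big_nil; under eq_Rintegral do rewrite big_nil; rewrite Rintegral_cst ?mul0r.
  rewrite big_cons -IH -RintegralD//; [|exact: iD|].
    by apply: eq_Rintegral => s _; rewrite big_cons.
  have := @integrable_sum _ _ _ leb _ (measurable_itv _) _ l xpredT _ (fun k _ => iD k gm).
  by congr (integrable _ _ _); apply/funext => s /=; rewrite sumEFin.
rewrite sumE; apply: eq_bigr => n _.
have [e1 [i _]] := peak_integral fld a0 erefl rho0 e0 ae th (N m) n eK (bG n) be.
transitivity ((e < n%:R / r m <= K)%R%:R * Rintegral leb `]2 * e, K] (fun s => (r m)^-1 * dens m n s)).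
  rewrite -e1 -RintegralZl_prob.
    by apply: eq_Rintegral => w _; rewrite /peak_weight -!mulrA.
  have := bmeasM (bW m n) (bmeas_cos (mth m n)).
  by congr bmeas; apply/funext => w; rewrite -!mulrA.
by rewrite -RintegralZl//; apply: eq_Rintegral => s _; rewrite /hk mulrCA.
Qed.

Lemma sin_sum_mean m : good m -> intT P (sin_sum m) = 0.
Proof.
move=> [a1 ae be r1]; have a0 : 0 < a m by lra.
rewrite /sin_sum (Rintegral_sum_prob P (iota 0 (N m).+1) (bsinn m)) big1// => n _.
have [_ [_ e1]] := peak_integral fld a0 erefl rho0 e0 ae th (N m) n eK (bG n) be.
rewrite -[RHS](mulr0 (e < n%:R / r m <= K)%R%:R) -e1 -RintegralZl_prob.
  by apply: eq_Rintegral => w _; rewrite /peak_weight -!mulrA.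
have := bmeasM (bW m n) (bmeas_sin (mth m n)).
by congr bmeas; apply/funext => w; rewrite -!mulrA.
Qed.

Let M0 : 0 <= M. Proof. exact: le_trans (gM 0). Qed.

Let C : R := alpha * (2 * e) `^ (- alpha - 1) * M.

Let C0 : 0 <= C.
Proof. by have a2 := alpha2; rewrite /C !mulr_ge0 ?powR_ge0//; lra. Qed.

Let hkC m s k : good m -> 2 * e < s -> `|hk m s k| <= (k%:R / r m <= K)%R%:R * C.
Proof.
move=> [a1 ae be r1] se; have a2 := alpha2; have he := e0; have a0 : 0 < a m by lra.
have [kK|kK] := leP (k%:R / r m) K; last first.
  by rewrite /hk (leNgt _ K) kK andbF !mul0r normr0.
rewrite mul1r /hk kK andbT.
case: (e < k%:R / r m)%R; last by rewrite mul0r normr0.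
rewrite mul1r.
rewrite /dens /peak_density /C !normrM.
have q0 : 0 <= rho * (k%:R / r m).
  by rewrite mulr_ge0 ?(ltW rho0)// divr_ge0//; lra.
apply: (@le_trans _ _ (alpha * (2 * e) `^ (- alpha - 1) * M * 1)); last by rewrite mulr1.
apply: ler_pM => //; last first.
  exact: (factor_prod_le1 fld a0 erefl rho0 ae th (N m) k be se).
apply: ler_pM => //; last exact: gM.
rewrite (ger0_norm (powR_ge0 _ _)) ger0_norm; last by lra.
rewrite ler_wpM2l; [by []|lra|].
rewrite (_ : - alpha - 1 = - (alpha + 1)); last by ring.
rewrite !powRN lef_pV2 ?posrE ?powR_gt0//; [|lra..].
by apply: ge0_ler_powR; rewrite ?nnegrE; lra.
Qed.

Let stepC m s x : good m -> 2 * e < s ->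
  `|step_sum (hk m s) (r m) (N m) x| <= C * \1_`[0, K + 1]%classic x.
Proof.
move=> gm se; have [a1 ae be r1] := gm.
have r0 : 0 < r m by lra.
rewrite step_sumE//; set k := Num.truncn (x * r m).
rewrite indicE; have [|nx] := boolP (x \in `[0, K + 1]%classic).
  move=> _; rewrite mulr1; case: ifP => _; last by rewrite normr0.
  apply: (le_trans (hkC k gm se)); rewrite ler_piMl//.
  by case: (k%:R / r m <= K).
rewrite mulr0; case: ifP => [/andP[x0 _]|_]; last by rewrite normr0.
have xK : K + 1 < x.
  by rewrite ltNge; apply: contra nx => xK; rewrite inE /= in_itv /= x0 xK.
apply: (le_trans (hkC k gm se)).
suff -> : (k%:R / r m <= K) = false by rewrite mul0r.
apply/negbTE; rewrite -ltNge ltr_pdivlMr//.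
have h := @truncnS_gt R (x * r m); rewrite -/k -natr1 in h.
have : (K + 1) * r m < x * r m by rewrite ltr_pM2r.
lra.
Qed.

Let iC : leb.-integrable setT (EFin \o (fun x => C * \1_`[0, K + 1]%classic x)).
Proof. exact: (@integrableZl _ _ _ leb setT measurableT C _ (@integrable_indic_itv R 0 (K + 1) true false)). Qed.

Lemma inner_cvg s : 2 * e < s <= K ->
  (fun m => intT leb (step_sum (hk m s) (r m) (N m))) @ \oo -->
  Rintegral leb `]e, K] (limit_density s).
Proof.
move=> /andP[se sK]; have a2 := alpha2; have he := e0.
rewrite [X in _ --> X]Rintegral_mkcond.
apply: (@dominated_cvg_near _ _ _ leb setT _ _ (fun x => C * \1_`[0, K + 1]%classic x)) => //.
- by move=> m; exact: measurable_step_sum.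
- by near=> m => x _; apply: stepC => //; near: m.
- move=> x _; rewrite patchE.
  have [xI|xI] := boolP (x \in `]e, K]%classic).
    move: xI; rewrite inE /= in_itv /= => /andP[ex xK].
    have x0 : 0 < x by lra.
    pose k m := Num.truncn (x * r m).
    have kx : (fun m => (k m)%:R / r m) @ \oo --> x by exact: truncn_scaled (ltW x0) ry.
    apply: (@seq_cvg_eq _ (fun m => dens m (k m) s)).
      near=> m; have gm : good m by near: m.
      have [a1 ae be r1] := gm; have r0 : 0 < r m by lra.
      rewrite step_sumE// (ltW x0) /= -/(k m).
      have kle : (k m)%:R <= x * r m by rewrite truncn_le mulr_ge0// ltW.
      have kN : (k m <= N m)%N.
        have : x <= (N m)%:R / r m by near: m; exact: seq_near_gey.
        by rewrite ler_pdivlMr// => h; rewrite -(ler_nat R); exact: le_trans h.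
      have ek : e < (k m)%:R / r m by near: m; apply: cvgr_gt kx _ ex.
      by rewrite kN /hk ek /= ler_pdivrMr// (le_trans kle) ?ler_pM2r// mul1r.
    rewrite /dens /peak_density /limit_density.
    have cs : (fun m => s + rho * ((k m)%:R / r m)) @ \oo --> s + rho * x.
      by apply: cvgD; [exact: cvg_cst | apply: cvgM => //; exact: cvg_cst].
    have Y0 : 0 < s + rho * x by have := mulr_gt0 rho0 x0; lra.
    have fc := (@factor_prod_cvg R alpha p d T P xi0 c fld rho e th beta a b N rho0 rhoE e0 beta0 etah ay by_ ba lnba Ny k x s x0 se kx).
    apply: cvgM; last exact: fc.
    apply: cvgM; first by apply: cvgM; [exact: cvg_cst | exact: seq_powR_cvg].
    apply: (@cvg_comp _ _ _ (fun m => (k m)%:R `^ (1 / alpha) * (height (a m) (r m) rho (k m) s) `^ (- 1)) g _ (nbhs (x `^ (1 / alpha) / (s + rho * x)))); last exact: cg.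
    apply: (@seq_cvg_eq _ (fun m => ((k m)%:R / r m) `^ (1 / alpha) / (s + rho * ((k m)%:R / r m)))).
      near=> m; have [a1 ae be r1] : good m by near: m.
      have am : 0 < a m by lra. have r0 : 0 < r m by lra.
      have h0 : 0 < s + rho * ((k m)%:R / r m) by near: m; exact: seq_near_gt0 cs.
      rewrite /height powR_inv1 ?mulr_ge0 ?ltW//.
      have e1 : (r m)^-1 `^ (1 / alpha) = (a m)^-1.
        rewrite -powRN -powRrM (_ : - alpha * (1 / alpha) = - 1); last by field; lra.
        by rewrite powR_inv1 ?ltW.
      rewrite powRM ?invr_ge0 ?(ltW r0)// e1.
      move: h0; move: (s + rho * _) => q h0.
      by rewrite invfM mulrA.
    by apply: cvgM; [exact: seq_powR_cvg | apply: cvgV => //; rewrite gt_eqF].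
  (* The truncated position never exceeds [x], so for [x <= e] it always fails the lower bound; for
     [x > K] it converges to [x] and eventually fails the upper one. *)
  have kK : \forall m \near \oo, K < x -> K < (Num.truncn (x * r m))%:R / r m.
    have [Kx|Kx] := ltP K x; last by apply: nearW.
    have x0 : 0 <= x by have := eK; lra.
    have : \forall m \near \oo, K < (Num.truncn (x * r m))%:R / r m by apply: cvgr_gt (truncn_scaled x0 ry) _ Kx.
    by move=> h; near=> m => _; near: m; exact: h.
  apply: cvg_near_cst; near=> m; have gm : good m by near: m.
  have [a1 ae be r1] := gm; have r0 : 0 < r m by lra.
  rewrite step_sumE//; case: ifP => // /andP[x0 _].
  rewrite /hk; have [ex|ex] := leP x e.
    have kle : (Num.truncn (x * r m))%:R <= x * r m by rewrite truncn_le mulr_ge0// ltW.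
    suff -> : (e < (Num.truncn (x * r m))%:R / r m) = false by rewrite mul0r.
    apply/negbTE; rewrite -leNgt ler_pdivrMr//; apply: (le_trans kle).
    by rewrite ler_pM2r.
  have Kx : K < x.
    by rewrite ltNge; apply: contra xI => xK; rewrite inE /= in_itv /= ex xK.
  have : K < (Num.truncn (x * r m))%:R / r m by move: Kx; near: m; exact: kK.
  by move=> h; rewrite leNgt h andbF mul0r.
Unshelve. all: by end_near. Qed.

Lemma cos_sum_cvg : (fun m => intT P (cos_sum m)) @ \oo -->
  Rintegral leb `]2 * e, K] (fun s => Rintegral leb `]e, K] (limit_density s)).
Proof.
have a2 := alpha2; have he := e0.
(* Measurability in [s] is required for every [m], but is available for good ones; the others,
   finitely many, are replaced by 0. *)
pose J m s := if `[< good m >] then intT leb (step_sum (hk m s) (r m) (N m)) else 0.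
apply: (@seq_cvg_eq _ (fun m => Rintegral leb `]2 * e, K] (J m))).
  near=> m; have gm : good m by near: m.
  by rewrite cos_sum_mean//; apply: eq_Rintegral => s _; rewrite /J; case: asboolP.
apply: (@dominated_cvg_near _ _ _ leb _ _ _ (fun=> C * (K + 1))) => //.
- move=> m; rewrite /J; case: asboolP => gm; last exact: measurable_cst.
  have [a1 ae be r1] := gm.
  have := @integrable_sum _ _ _ leb _ (measurable_itv _) _ (iota 0 (N m).+1) xpredT _ (fun k _ => iD k gm).
  move=> /measurable_int mi; apply/measurable_EFinP; move: mi.
  congr measurable_fun; apply/funext => s /=; rewrite sumEFin Rintegral_step_sum//; lra.
- have i : leb.-integrable `[2 * e, K] (EFin \o (cst (C * (K + 1)) : R -> R)).
    apply: continuous_compact_integrable; first exact: segment_compact.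
    by apply: continuous_subspaceT; exact: cst_continuous.
  by apply: integrableS i => // x; rewrite /= !in_itv /= => /andP[/ltW -> ->].
- near=> m => s; rewrite /= in_itv /= => /andP[se sK].
  have gm : good m by near: m.
  rewrite /J; case: asboolP => // _.
  have [a1 ae be r1] := gm.
  have iS : leb.-integrable setT (EFin \o step_sum (hk m s) (r m) (N m)).
    apply: (le_integrable measurableT _ _ iC); first by apply/measurable_EFinP; exact: measurable_step_sum.
    move=> x _ /=; rewrite lee_fin [leRHS]ger0_norm; first exact: stepC.
    by rewrite mulr_ge0// indicE.
  apply: (le_trans (le_normr_Rintegral measurableT iS)).
  have -> : C * (K + 1) = intT leb (fun x => C * \1_`[0, K + 1]%classic x).
    rewrite RintegralZl//; last exact: (@integrable_indic_itv R 0 (K + 1) true false).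
    congr (_ * _); rewrite /Rintegral integral_indic//= setIT.
    have -> : leb `[0, K + 1]%classic = (K + 1)%:E; last by [].
    rewrite lebesgue_measure_itv /= lte_fin ifT; first by rewrite sube0.
    by have := eK; lra.
  apply: le_Rintegral => //; first exact: (integrable_norm iS).
  by move=> x _; exact: stepC.
move=> s; rewrite /= in_itv /= => sI.
apply: seq_cvg_eq (inner_cvg sI); near=> m; have gm : good m by near: m.
by rewrite /J; case: asboolP.
Unshelve. all: by end_near. Qed.

End PeakSum.

Lemma prob_eq_ae {R : realType} {d} {T : measurableType d} (P : probability T R) (A B C : set T) :
  measurable A -> measurable B -> measurable C -> P C = 1%E ->
  (forall w, C w -> A w = B w) -> P A = P B.
Proof.
move=> mA mB mC PC AB.
have e (D : set T) : measurable D -> P D = (intT P (\1_D : T -> R))%:E.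
  by move=> mD; rewrite Rintegral_indic_prob// fineK// fin_num_measure.
rewrite !e//; congr _%:E; apply: (eq_Rintegral_prob1 mC PC); try exact: bmeas_indic.
by move=> w /AB h; rewrite !indicE; congr (nat_of_bool _)%:R; apply/idP/idP; rewrite !inE h.
Qed.

(** * The limit law of the rescaled peak *)

Section LimitLaw.
Context {R : realType} {alpha : R} {p : nat -> R} {d} {T : measurableType d}
  {P : probability T R} {xi0 : int -> T -> R} {c : nat -> T -> bool}.
Hypothesis fld : pareto_field alpha p P xi0 c.
Local Notation leb := (@lebesgue_measure R).
Let alpha2 := field_alpha fld.
Let mxi := field_meas fld.
Variable rho : R.
Hypotheses (rho0 : 0 < rho) (rhoE : rho * (alpha - 1) = 1).

(* The limit of (excess, n / r) has density alpha (s + rho x)^(-alpha-1) exp(-s^(1-alpha)):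
   the first coordinate S satisfies P(S > s) = 1 - exp(-s^(1-alpha)), and given S = s the
   second one is s (V - 1) / rho with V Pareto. *)
Definition limit_excess (u : R) : R := (- ln (1 - u `^ (- alpha))) `^ (- rho).
Definition limit_position (s v : R) : R := s * (v - 1) / rho.
Definition limit_ratio (s v : R) : R := limit_position s v `^ (1 / alpha) * (s * v) `^ (- 1).

(** The sites 0 and 1 serve as two independent Pareto variables from which the limit law is built;
    only the law of [limit_B] has a meaning. *)
Definition limit_B (w : T) : R := limit_ratio (limit_excess (xi0 1 w)) (xi0 0 w).

Lemma limit_excess_gt0 u : 1 < u -> 0 < limit_excess u.
Proof.
move=> u1; have a2 := alpha2; rewrite /limit_excess powR_gt0// oppr_gt0.
have h : 0 < u `^ (- alpha) by rewrite powR_gt0; lra.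
have h1 : u `^ (- alpha) < 1.
  rewrite powRN invf_lt1 ?powR_gt0; [|lra..].
  have lu : 0 < ln u by rewrite ln_gt0.
  by rewrite -ltr_ln ?posrE ?powR_gt0//; [rewrite ln1 ln_powR mulr_gt0//; lra|lra].
by apply: ln_lt0; lra.
Qed.

(** For a Pareto variable the power - alpha is uniform, and [limit_excess] is the corresponding
    quantile transform; solved for [u], the event is read off from the Pareto tail. *)
Lemma limit_excess_gt (s u : R) : 0 < s -> 1 < u ->
  (s < limit_excess u) = ((1 - expR (- s `^ (1 - alpha))) `^ (- (1 / alpha)) < u).
Proof.
move=> s0 u1; have a2 := alpha2; have rp := rho0.
set v := u `^ (- alpha); set q := s `^ (1 - alpha); set z := 1 - expR (- q).
have q0 : 0 < q by rewrite powR_gt0.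
have v0 : 0 < v by rewrite powR_gt0; lra.
have lnu : 0 < ln u by rewrite ln_gt0.
have v1 : v < 1.
  by rewrite -ltr_ln ?posrE// ln1 /v ln_powR; nra.
have z0 : 0 < z by rewrite /z subr_gt0 -[X in _ < X]expR0 ltr_expR; lra.
have t0 : 0 < - ln (1 - v) by rewrite oppr_gt0; apply: ln_lt0; lra.
have e1 : (s < limit_excess u) = (- ln (1 - v) < q).
  rewrite /limit_excess -/v -ltr_ln ?posrE ?powR_gt0// ln_powR.
  rewrite -[RHS]ltr_ln ?posrE// /q ln_powR.
  set A := ln s; set Bt := ln (- ln (1 - v)).
  have rE := rhoE.
  apply/idP/idP => h.
    have : (alpha - 1) * A < (alpha - 1) * (- rho * Bt) by rewrite ltr_pM2l//; lra.
    rewrite (_ : (alpha - 1) * (- rho * Bt) = - (rho * (alpha - 1)) * Bt); last by ring.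
    by rewrite rE; lra.
  have : rho * Bt < rho * ((1 - alpha) * A) by rewrite ltr_pM2l.
  rewrite (_ : rho * ((1 - alpha) * A) = - (rho * (alpha - 1)) * A); last by ring.
  by rewrite rE; lra.
have e2 : (- ln (1 - v) < q) = (v < z).
  rewrite ltrNl -{1}(expRK (- q)) ltr_ln ?posrE ?expR_gt0//; last lra.
  by rewrite /z; apply/idP/idP => h; lra.
rewrite e1 e2 -ltr_ln ?posrE// -[RHS]ltr_ln ?posrE ?powR_gt0//; last lra.
rewrite /v !ln_powR; set A := ln u; set Bz := ln z.
have -> : - (1 / alpha) * Bz = - Bz / alpha by field; lra.
rewrite ltr_pdivrMr; last by lra.
by apply/idP/idP => h; lra.
Qed.

Lemma measurable_limit_excess : measT limit_excess.
Proof.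
apply: (measurableT_comp (@measurable_powR R (- rho))).
apply: measurableT_comp => //; apply: (measurableT_comp (@measurable_ln R)).
by apply: measurable_funB; [exact: measurable_cst | exact: measurable_powR].
Qed.

Lemma measurable_limit_ratio {d'} {T' : measurableType d'} (X Y : T' -> R) :
  measT X -> measT Y ->
  measT (fun w => limit_ratio (X w) (Y w)).
Proof.
move=> mX mY; apply: measurable_funM.
  apply: (measurableT_comp (@measurable_powR R (1 / alpha))).
  apply: measurable_funM; last exact: measurable_cst.
  by apply: measurable_funM => //; apply: measurable_funB => //; exact: measurable_cst.
by apply: (measurableT_comp (@measurable_powR R (- 1))); exact: measurable_funM.
Qed.

Lemma measurable_limit_B : measT limit_B.
Proof.
by apply: measurable_limit_ratio; [exact: (measurableT_comp measurable_limit_excess) | exact: mxi].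
Qed.

Let both1 : P ([set w | 1 < xi0 0 w] `&` [set w | 1 < xi0 1 w]) = 1%E.
Proof. by apply: prob1_setI; try exact: (measurable_gt fld); exact: (pareto_gt1 fld). Qed.

Let mboth : measurable ([set w | 1 < xi0 0 w] `&` [set w | 1 < xi0 1 w]).
Proof. by apply: measurableI; exact: (measurable_gt fld). Qed.

Lemma limit_B_gt0 w : 1 < xi0 0 w -> 1 < xi0 1 w -> 0 < limit_B w.
Proof.
move=> h0 h1; have s0 := limit_excess_gt0 h1.
rewrite /limit_B /limit_ratio mulr_gt0// powR_gt0//.
  by rewrite /limit_position divr_gt0// mulr_gt0//; lra.
by rewrite mulr_gt0//; lra.
Qed.

(** The box of the Riemann sums times the price of the margin: other sites must stay [e] below the
    peak, which turns exp(- s^(1 - alpha)) into exp(- (s - e)^(1 - alpha)). On the box the power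
    decreases and [Num.max] changes nothing; it makes the bound by 1 immediate for all arguments. *)
Definition box_weight (e K s v : R) : R :=
  (2 * e < s <= K)%R%:R * (e < limit_position s v <= K)%R%:R *
  expR (- Num.max 0 ((s - e) `^ (1 - alpha) - s `^ (1 - alpha))).

Lemma box_weight_bounds e K s v : 0 <= box_weight e K s v <= 1.
Proof.
rewrite /box_weight; apply/andP; split; first by rewrite !mulr_ge0// expR_ge0.
rewrite -[leRHS]mulr1; apply: ler_pM; [by rewrite mulr_ge0|exact: expR_ge0| |].
  by case: (2 * e < s <= K)%R; case: (e < _ <= K)%R; rewrite ?(mul0r, mulr0, mul1r).
by rewrite -[leRHS]expR0 ler_expR oppr_le0 le_max lexx.
Qed.

Lemma measurable_box_weight e K {d'} {T' : measurableType d'} (X Y : T' -> R) :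
  measT X -> measT Y ->
  bmeas (fun w => box_weight e K (X w) (Y w)).
Proof.
move=> mX mY.
have ind (Z : T' -> R) (u : R) : measT Z -> bmeas (fun w => (u < Z w <= K)%R%:R : R).
  by move=> mZ; apply: bmeas_bool; apply: measurable_and; [apply: measurable_fun_ltr|apply: measurable_fun_ler] => //;
    exact: measurable_cst.
split; last by exists 1 => w; have /andP[h0 h1] := box_weight_bounds e K (X w) (Y w); rewrite ger0_norm.
apply: measurable_funM.
  apply: measurable_funM; first by case: (ind X (2 * e) mX).
  have [] // := ind (fun w => limit_position (X w) (Y w)) e.
  apply: measurable_funM; last exact: measurable_cst.
  by apply: measurable_funM => //; apply: measurable_funB => //; exact: measurable_cst.
apply: measurableT_comp => //; apply: measurableT_comp => //.
apply: measurable_maxr; first exact: measurable_cst.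
apply: measurable_funB; apply: (measurableT_comp (@measurable_powR R (1 - alpha))) => //.
by apply: measurable_funB => //; exact: measurable_cst.
Qed.

Lemma position_law (s e K : R) (f : R -> R) : 0 < s -> 0 < e -> bmeas f ->
  leb.-integrable `]e, K] (EFin \o (fun x => f x * (alpha * (rho / s) * (1 + rho / s * x) `^ (- alpha - 1)))) /\
  intT P (fun w => f (limit_position s (xi0 0 w)) * (e < limit_position s (xi0 0 w) <= K)%R%:R) =
  Rintegral leb `]e, K] (fun x => f x * (alpha * (rho / s) * (1 + rho / s * x) `^ (- alpha - 1))).
Proof.
move=> s0 e0 bf; have a2 := alpha2; have rp := rho0.
have k0 : 0 < rho / s by rewrite divr_gt0.
have pos (x : R) : e <= x -> 0 < 1 + rho / s * x.
  by move=> ex; rewrite ltr_pwDl// mulr_ge0 ?(ltW k0)//; lra.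
have mX : measT (fun w => limit_position s (xi0 0 w)).
  apply: measurable_funM; last exact: measurable_cst.
  apply: measurable_scale.
  by apply: measurable_funB; [exact: mxi | exact: measurable_cst].
have := @law_interval R d T P _ e K (fun x => (1 + rho / s * x) `^ (- alpha))
  (fun x => alpha * (rho / s) * (1 + rho / s * x) `^ (- alpha - 1)) f mX.
move=> /(_ _ _ _ _ bf)/Wrap[| | | |//].
- move=> x ex; have dd := @is_derive_powR_affine R 1 (rho / s) (- alpha) x (pos x ex).
  by apply: is_derive_eq; ring.
- move=> x ex; apply: cvgM; first exact: cvg_cst.
  exact: (@powR_affine_continuous R 1 (rho / s) (- alpha - 1) x (pos x ex)).
- by move=> x _; rewrite mulr_ge0 ?powR_ge0// mulr_ge0 ?(ltW k0)//; lra.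
- move=> x ex; have px := pos x ex.
  rewrite (_ : [set w | x < limit_position s (xi0 0 w)] = [set w | 1 + rho / s * x < xi0 0 w]).
    by rewrite (field_tail fld)// lerDl mulr_ge0 ?(ltW k0)//; lra.
  apply/seteqP; split => w /=; rewrite /limit_position.
    rewrite ltr_pdivlMr// => h.
    have -> : rho / s * x = (x * rho) / s by ring.
    have : x * rho / s < xi0 0 w - 1 by rewrite ltr_pdivrMr// [_ * s]mulrC.
    by move=> h'; rewrite -ltrBrDl.
  move=> h; rewrite ltr_pdivlMr//.
  have : rho / s * x < xi0 0 w - 1 by lra.
  by rewrite -(ltr_pM2l s0) (_ : s * (rho / s * x) = x * rho)//; field; lra.
Unshelve. all: by end_near. Qed.

Lemma excess_limit_law (e K : R) (f : R -> R) : 0 < e -> bmeas f ->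
  intT P (fun w => f (limit_excess (xi0 1 w)) * (2 * e < limit_excess (xi0 1 w) <= K)%R%:R) =
  Rintegral leb `]2 * e, K] (fun s => f s * ((alpha - 1) * s `^ (- alpha) * expR (- s `^ (1 - alpha)))).
Proof.
move=> e0 bf; have a2 := alpha2.
have pos (x : R) : 2 * e <= x -> 0 < x by lra.
have pd (x : R) : 2 * e <= x -> 0 < 0 + 1 * x by move=> /pos; lra.
have mX : measT (fun w => limit_excess (xi0 1 w)).
  exact: (measurableT_comp measurable_limit_excess (mxi 1)).
have cp (t : R) (x : R) : 2 * e <= x -> {for x, continuous (fun x => x `^ t)}.
  move=> /pd h; have := @powR_affine_continuous R 0 1 t x h.
  by under [X in {for _, continuous X}]eq_fun do rewrite add0r mul1r.
have := @law_interval R d T P _ (2 * e) K (fun s => 1 - expR (- s `^ (1 - alpha)))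
  (fun s => (alpha - 1) * s `^ (- alpha) * expR (- s `^ (1 - alpha))) f mX.
move=> /(_ _ _ _ _ bf)/Wrap[| | | |[]//].
- move=> x ex; have dd := @is_derive1_powR _ (1 - alpha) x (pos x ex).
  apply: is_derive_eq; rewrite /GRing.scale /= (_ : 1 - alpha - 1 = - alpha); last by ring.
  ring.
- move=> x ex; apply: cvgM.
    by apply: cvgM; [exact: cvg_cst | exact: cp].
  apply: continuous_cvg; first exact: continuous_expR.
  by apply: cvgN; exact: cp.
- by move=> x _; rewrite !mulr_ge0 ?powR_ge0 ?expR_ge0//; lra.
- move=> x ex; have x0 := pos x ex.
  set z := 1 - expR (- x `^ (1 - alpha)).
  have q0 : 0 < x `^ (1 - alpha) by rewrite powR_gt0.
  have z0 : 0 < z by rewrite /z subr_gt0 -[X in _ < X]expR0 ltr_expR; lra.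
  have z1 : z <= 1 by rewrite /z gerBl expR_ge0.
  have c1 : 1 <= z `^ (- (1 / alpha)).
    rewrite -ler_ln ?posrE ?powR_gt0// ln1 ln_powR mulr_le0 ?ln_le0// oppr_le0 divr_ge0//.
    by lra.
  transitivity (P [set w | z `^ (- (1 / alpha)) < xi0 1 w]); last first.
    rewrite (field_tail fld)// -powRrM (_ : - (1 / alpha) * - alpha = 1); last by field; lra.
    by rewrite powRr1 ?ltW.
  have mS : measurable [set w | x < limit_excess (xi0 1 w)].
    rewrite (_ : [set w | _] = (fun w => limit_excess (xi0 1 w)) @^-1` `]x, +oo[%classic).
      by rewrite -[X in measurable X]setTI; exact: mX.
    by apply/seteqP; split => w /=; rewrite in_itv /= andbT.
  have mZ := measurable_gt fld 1 (z `^ (- (1 / alpha))).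
  apply: (prob_eq_ae mS mZ (measurable_gt fld 1 1) (pareto_gt1 fld 1)) => w /= w1.
  by rewrite limit_excess_gt.
Unshelve. all: by end_near. Qed.

Section Box.
Variables (e K M : R) (F : R -> R).
Hypotheses (e0 : 0 < e) (mF : measT F) (FM : forall x, `|F x| <= M).

Let bH : bmeas (fun u : R * R => box_weight e K u.1 u.2 * F (limit_ratio u.1 u.2)).
Proof.
apply: bmeasM; first by apply: measurable_box_weight; [exact: measurable_fst | exact: measurable_snd].
split; last by exists M => u.
apply: (measurableT_comp mF); apply: measurable_limit_ratio; [exact: measurable_fst | exact: measurable_snd].
Qed.

(** The densities of the two coordinates, multiplied with the price of the margin and simplified by
    [rho * (alpha - 1) = 1], reproduce the integrand to which the Riemann sums converge. *)
Lemma limit_law_box :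
  intT P (fun w => box_weight e K (limit_excess (xi0 1 w)) (xi0 0 w) * F (limit_B w)) =
  Rintegral leb `]2 * e, K] (fun s => Rintegral leb `]e, K] (fun x =>
    alpha * (s + rho * x) `^ (- alpha - 1) * F (x `^ (1 / alpha) / (s + rho * x)) *
    expR (- (s - e) `^ (1 - alpha)))).
Proof.
have a2 := alpha2; have rp := rho0; have he := e0.
pose H (u : R * R) := box_weight e K u.1 u.2 * F (limit_ratio u.1 u.2).
pose h (u : R * R) := H (limit_excess u.1, u.2).
have bh : bmeas h.
  apply: (@bmeas_comp _ _ _ _ _ H (fun u : R * R => (limit_excess u.1, u.2)) _ bH).
  apply/measurable_fun_pairP; split; last exact: measurable_snd.
  exact: (measurableT_comp measurable_limit_excess measurable_fst).
transitivity (intT P (fun w => h (xi0 1 w, xi0 0 w))) => //.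
rewrite (pair_law fld _ bh)//.
pose psi s := intT P (fun w => H (s, xi0 0 w)).
have bpsi : bmeas psi.
  have bb : bmeas (fun z : measurableTypeR R * T => H (z.1, xi0 0 z.2)).
    apply: (@bmeas_comp _ _ _ _ _ H (fun z : measurableTypeR R * T => (z.1, xi0 0 z.2)) _ bH).
    apply/measurable_fun_pairP; split; first exact: measurable_fst.
    exact: measurableT_comp (mxi 0) measurable_snd.
  by have [] := prob_fubini (@std_normal R) P bb.
transitivity (intT P (fun w => psi (limit_excess (xi0 1 w)))).
  exact: (same_law fld 0 1 (bmeas_comp measurable_limit_excess bpsi)).
transitivity (intT P (fun w => psi (limit_excess (xi0 1 w)) * (2 * e < limit_excess (xi0 1 w) <= K)%R%:R)).
  apply: eq_Rintegral => w _.
  have [_|hn] := boolP (2 * e < limit_excess (xi0 1 w) <= K)%R; first by rewrite mulr1.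
  rewrite mulr0 /psi /H /box_weight /= (negbTE hn) -[RHS](Rintegral_prob_cst P 0).
  by apply: eq_Rintegral => w' _; rewrite !mul0r.
rewrite excess_limit_law//; apply: eq_Rintegral => s; rewrite inE /= in_itv /= => /andP[se sK].
have s0 : 0 < s by lra.
have se0 : 0 < s - e by lra.
have mono : s `^ (1 - alpha) <= (s - e) `^ (1 - alpha).
  rewrite (_ : 1 - alpha = - (alpha - 1)); last by ring.
  rewrite !powRN lef_pV2 ?posrE ?powR_gt0//.
  by apply: ge0_ler_powR; rewrite ?nnegrE; lra.
pose f (x : R) := expR (s `^ (1 - alpha) - (s - e) `^ (1 - alpha)) * F (x `^ (1 / alpha) * (s + rho * x) `^ (- 1)).
have bf : bmeas f.
  apply: bmeasM; first exact: bmeas_cst.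
  split; last by exists M => x.
  apply: (measurableT_comp mF); apply: measurable_funM; first exact: measurable_powR.
  apply: (measurableT_comp (@measurable_powR R (- 1))); apply: measurable_funD; first exact: measurable_cst.
  by apply: measurable_scale; exact: measurable_id.
have -> : psi s = intT P (fun w => f (limit_position s (xi0 0 w)) * (e < limit_position s (xi0 0 w) <= K)%R%:R).
  apply: eq_Rintegral => w _; rewrite /H /box_weight /= se sK /= mul1r /f /limit_ratio.
  have -> : s + rho * limit_position s (xi0 0 w) = s * xi0 0 w.
    by rewrite /limit_position; field; lra.
  rewrite max_r; last by rewrite subr_ge0.
  by rewrite opprB -mulrA mulrC.
have [ip ->] := position_law K s0 e0 bf.
rewrite mulrC -RintegralZl//.
apply: eq_Rintegral => x; rewrite inE /= in_itv /= => /andP[ex xK].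
have q0 : 0 < s + rho * x by rewrite ltr_pwDl// mulr_ge0//; lra.
rewrite /f powR_inv1 ?(ltW q0)//.
have e1 : (1 + rho / s * x) `^ (- alpha - 1) = (s + rho * x) `^ (- alpha - 1) * s `^ (alpha + 1).
  rewrite (_ : 1 + rho / s * x = (s + rho * x) * s^-1); last by field; lra.
  rewrite powRM ?(ltW q0) ?invr_ge0 ?(ltW s0)//; congr (_ * _).
  rewrite -powR_inv1 ?(ltW s0)// -powRrM; congr (_ `^ _); ring.
have e2 : s `^ (- alpha) * s `^ (alpha + 1) = s.
  rewrite -powRD; last by apply/implyP => _; rewrite gt_eqF.
  by rewrite addrA addNr add0r powRr1 ?ltW.
have e3 : expR (s `^ (1 - alpha) - (s - e) `^ (1 - alpha)) * expR (- s `^ (1 - alpha)) =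
    expR (- (s - e) `^ (1 - alpha)).
  by rewrite -expRD; congr expR; ring.
rewrite -e3 e1.
set E1 := expR _; set E2 := expR _; set A := s `^ (- alpha) in e2 *; set Bq := s `^ (alpha + 1) in e2 *.
set q := (_ + _) `^ _; set FF := F _.
have -> : (alpha - 1) * A * E1 * (E2 * FF * (alpha * (rho / s) * (q * Bq))) =
   (rho * (alpha - 1)) * (A * Bq / s) * (alpha * q * FF * (E2 * E1)) by field; lra.
by rewrite e2 rhoE divff ?mul1r// gt_eqF.
Qed.

End Box.

(** Almost every point ends up in the boxes, and the price of the margin tends to 1. The values 1 /
    (j + 2) and j + 2 satisfy [2 * e < K] from [j = 0] on. *)
Lemma box_mass_cvg (F : R -> R) (M : R) : measT F -> (forall x, `|F x| <= M) ->
  (fun j : nat => intT P (fun w =>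
     box_weight (j.+2%:R)^-1 j.+2%:R (limit_excess (xi0 1 w)) (xi0 0 w) * F (limit_B w))) @ \oo -->
  intT P (fun w => F (limit_B w)).
Proof.
move=> mF FM; have a2 := alpha2; have rp := rho0.
have bF : bmeas (fun w => F (limit_B w)).
  by split; [exact: (measurableT_comp mF measurable_limit_B) | exists M].
have bA : bmeas (\1_([set w | 1 < xi0 0 w] `&` [set w | 1 < xi0 1 w]) : T -> R) by exact: bmeas_indic.
have bW (e K : R) : bmeas (fun w => box_weight e K (limit_excess (xi0 1 w)) (xi0 0 w) * F (limit_B w)).
  apply: bmeasM => //; apply: measurable_box_weight; last exact: mxi.
  exact: (measurableT_comp measurable_limit_excess (mxi 1)).
rewrite (eq_Rintegral_prob1 mboth both1 bF (bmeasM bA bF)); last first.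
  by move=> w hw; rewrite indicE mem_set// mul1r.
pose f j w := box_weight (j.+2%:R)^-1 j.+2%:R (limit_excess (xi0 1 w)) (xi0 0 w) * F (limit_B w).
have eW (j : nat) : intT P (fun w => \1_([set w | 1 < xi0 0 w] `&` [set w | 1 < xi0 1 w]) w * f j w) =
    intT P (f j).
  apply/esym; apply: (eq_Rintegral_prob1 mboth both1 (bW _ _) (bmeasM bA (bW _ _))).
  by move=> w hw; rewrite indicE mem_set// mul1r.
rewrite -(funext eW) /f.
apply: (@Rintegral_bounded_cvg _ _ _ P M) => [j|j w|w].
- by case: (bmeasM bA (bW (j.+2%:R)^-1 j.+2%:R)).
- rewrite mulrA normrM -[leRHS]mul1r; apply: ler_pM => //.
  have /andP[h0 h1] := box_weight_bounds (j.+2%:R)^-1 j.+2%:R (limit_excess (xi0 1 w)) (xi0 0 w).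
  rewrite normrM indicE; case: (w \in _); rewrite ?normr0 ?mul0r// normr1 mul1r ger0_norm//.
rewrite indicE; have [|_] := boolP (w \in _); last first.
  by under eq_fun do rewrite mul0r; rewrite mul0r; exact: cvg_cst.
rewrite inE /= => -[w0 w1]; under eq_fun do rewrite mul1r.
apply: cvgM; last exact: cvg_cst.
set s := limit_excess (xi0 1 w); have s0 : 0 < s by exact: limit_excess_gt0.
set x := limit_position s (xi0 0 w).
have x0 : 0 < x by rewrite /x /limit_position divr_gt0// mulr_gt0//; lra.
have ry : (fun j : nat => j.+2%:R : R) @ \oo --> +oo.
  apply/cvgryPge => A; near=> j; apply: (@le_trans _ _ j%:R); last by rewrite ler_nat (leq_trans (leqnSn _)).
  by near: j; exact: nbhs_infty_ger.
have i0 := seq_invy ry.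
apply: (@seq_cvg_eq _ (fun j : nat => expR (- Num.max 0 ((s - (j.+2%:R)^-1) `^ (1 - alpha) - s `^ (1 - alpha))))).
  near=> j; rewrite /box_weight.
  have h1 : (j.+2%:R)^-1 < x by near: j; apply: cvgr_lt i0 _ x0.
  have h2 : (j.+2%:R)^-1 < s / 2 by near: j; apply: cvgr_lt i0 _ _; rewrite divr_gt0.
  have h3 : s <= j.+2%:R by near: j; exact: seq_near_gey.
  have h4 : x <= j.+2%:R by near: j; exact: seq_near_gey.
  have h5 : 2 * (j.+2%:R)^-1 < s by rewrite mulrC -ltr_pdivlMr.
  by rewrite h5 h3 -/x h1 h4 /= !mul1r.
have cs : (fun j : nat => (s - (j.+2%:R)^-1) `^ (1 - alpha)) @ \oo --> s `^ (1 - alpha).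
  apply: seq_powR_cvg => //; rewrite -[X in _ --> X]subr0.
  by apply: cvgB => //; exact: cvg_cst.
rewrite -[X in _ --> X]expR0; apply: continuous_cvg; first exact: continuous_expR.
rewrite -[X in _ --> X]oppr0; apply: cvgN.
have c0 : (fun j : nat => (s - (j.+2%:R)^-1) `^ (1 - alpha) - s `^ (1 - alpha)) @ \oo --> (0 : R).
  by rewrite -(subrr (s `^ (1 - alpha))); apply: cvgB => //; exact: cvg_cst.
have c1 : (fun j : nat => `|(s - (j.+2%:R)^-1) `^ (1 - alpha) - s `^ (1 - alpha)|) @ \oo --> (0 : R).
  by rewrite -(normr0 R); apply: cvg_norm.
apply: (squeeze_cvgr _ (cvg_cst 0) c1); near=> j.
by rewrite le_max lexx /= ge_max normr_ge0 /= ler_norm.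
Unshelve. all: by end_near. Qed.

End LimitLaw.

(** * From sums over deterministic sites to the random peak *)

Section PeakTransfer.
Context {R : realType} {alpha : R} {p : nat -> R} {d} {T : measurableType d}
  {P : probability T R} {xi0 : int -> T -> R} {c : nat -> T -> bool}.
Hypothesis fld : pareto_field alpha p P xi0 c.
Let alpha2 := field_alpha fld.
Variables (rho beta : R) (a b : nat -> R) (N : nat -> nat).
Hypotheses (rho0 : 0 < rho) (rhoE : rho * (alpha - 1) = 1) (beta0 : 0 < beta).
Hypothesis etah : (fun n => etaPAM p n / (beta * kappa alpha n)) @ \oo --> (1 : R).
Hypotheses (ay : a @ \oo --> +oo) (by_ : b @ \oo --> +oo).
Hypothesis ba : (fun m => b m / a m) @ \oo --> (0 : R).
Hypothesis lnba : (fun m => ln (b m) / ln (a m)) @ \oo --> (1 : R).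
Local Notation r m := (a m `^ alpha).
Hypothesis Ny : (fun m => (N m)%:R / r m) @ \oo --> +oo.

Local Notation phase m n w := (@total_phase R d T xi0 c (b m) (N m) n w).
Local Notation exc m n w := (@excess R d T xi0 (a m) (r m) rho n w).
Local Notation weight e K := (@peak_weight R alpha d T xi0 rho e K a N).
Local Notation ratio n w := (n%:R `^ (1 / alpha) * (xi0 n%:Z w) `^ (- 1)).

Definition peak_event (e K : R) (m n : nat) (w : T) : bool :=
  [&& (e < n%:R / r m <= K)%R, (2 * e < exc m n w <= K)%R &
    all (fun i => (i != n) ==> (xi0 i%:Z w <= barrier (a m) (r m) rho e (exc m n w) i)%R)
      (iota 0 (N m).+1)].

Let prod_all (Q B : pred nat) (l : seq nat) :
  \prod_(i <- l | Q i) ((B i)%:R : R) = (all (fun i => Q i ==> B i) l)%:R.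
Proof.
elim: l => [|i l IH]; first by rewrite big_nil.
by rewrite big_cons /=; case: (Q i) => /=; rewrite IH //; case: (B i); rewrite /= ?mul1r ?mul0r.
Qed.

Lemma peak_weightE g e K m n w :
  weight e K g m n w =
  (peak_event e K m n w)%:R * g (ratio n w).
Proof.
rewrite /peak_weight /below_barrier /peak_event prod_all.
case: (_ < _ <= _)%R => /=; last by rewrite !mul0r.
case: (_ < _ <= _)%R => /=; last by rewrite !mul0r mulr0.
by rewrite !mul1r mulrC.
Qed.

(** Two peaks would each have an excess smaller than that of the other by at least [e]. *)
Lemma peak_event_uniq e K m n n' w : 0 < e -> 0 < a m -> (n <= N m)%N -> (n' <= N m)%N ->
  peak_event e K m n w -> peak_event e K m n' w -> n = n'.
Proof.
move=> e0 a0 nN nN' /and3P[_ _ /allP h] /and3P[_ _ /allP h'].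
apply/eqP; apply/negPn/negP => nn.
have := h n'; rewrite mem_iota add0n ltnS nN' eq_sym nn /= => /(_ isT).
have := h' n; rewrite mem_iota add0n ltnS nN nn /= => /(_ isT).
rewrite -{1}(@height_excess R d T xi0 (a m) (r m) rho a0 n w).
rewrite -{1}(@height_excess R d T xi0 (a m) (r m) rho a0 n' w).
rewrite /height /barrier !ler_pM2l//.
move: (@excess _ _ _ _ _ _ _ n w) (@excess _ _ _ _ _ _ _ n' w) => s s'.
move: (rho * _) (rho * _) => x x'; lra.
Qed.

Definition trig_sum (tr : R -> R) (th : R) (g : R -> R) e K m w : R :=
  \sum_(n <- iota 0 (N m).+1) weight e K g m n w *
    tr (th * phase m n w).

Lemma trig_sumE tr th g e K m w : 0 < e -> 0 < a m ->
  (exists n, [/\ (n <= N m)%N, peak_event e K m n w &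
     trig_sum tr th g e K m w = g (ratio n w) *
       tr (th * phase m n w)]) \/
  ((forall n, (n <= N m)%N -> ~~ peak_event e K m n w) /\ trig_sum tr th g e K m w = 0).
Proof.
move=> e0 a0; have [/hasP[n nI pn]|/hasPn hn] := boolP (has (fun n => peak_event e K m n w) (iota 0 (N m).+1)).
  left; exists n; have nN : (n <= N m)%N by move: nI; rewrite mem_iota add0n ltnS.
  split => //; rewrite /trig_sum.
  pose G n' := weight e K g m n' w *
    tr (th * phase m n' w).
  rewrite -[LHS]/(\sum_(i <- iota 0 (N m).+1) G i).
  have -> : \sum_(i <- iota 0 (N m).+1) G i = G n + \sum_(i <- iota 0 (N m).+1 | i != n) G i.
    exact: (bigD1_seq n nI (iota_uniq _ _)).
  have -> : \sum_(i <- iota 0 (N m).+1 | i != n) G i = 0; last first.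
    by rewrite addr0 /G peak_weightE pn (mul1r (g _)).
  rewrite big_seq_cond big1// => i /andP[iI ni]; rewrite /G.
  rewrite peak_weightE; case: (boolP (peak_event e K m i w)) => [pi|_]; last by rewrite !mul0r.
  have iN : (i <= N m)%N by move: iI; rewrite mem_iota add0n ltnS.
  by move: ni; rewrite (peak_event_uniq e0 a0 iN nN pi pn) eqxx.
right; split=> [n nN|]; first by apply: hn; rewrite mem_iota add0n ltnS.
rewrite /trig_sum big_seq big1// => i iI; rewrite peak_weightE.
by rewrite (negbTE (hn i iI)) !mul0r.
Qed.

Let F (th : R) (g : R -> R) (x : R) := g x * expR (- (beta * sigmaPAM alpha ^+ 2 * th ^+ 2 * x ^+ 2)).

Local Notation Bv := (@limit_B R alpha d T xi0 rho).
Local Notation box e K w := (@box_weight R alpha rho e K (@limit_excess R alpha rho (xi0 1 w)) (xi0 0 w)).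

Let mF th g : continuous g -> measT (F th g).
Proof.
move=> cg; apply: measurable_funM; first exact: continuous_measurable_fun.
apply: measurableT_comp => //; apply: measurableT_comp => //.
by apply: measurable_scale; exact: measurable_funX.
Qed.

Let FM th g M : (forall x, `|g x| <= M) -> forall x, `|F th g x| <= M.
Proof.
move=> gM x; have M0 : 0 <= M by exact: le_trans (gM 0).
rewrite /F normrM -[leRHS]mulr1; apply: ler_pM => //.
rewrite ger0_norm ?expR_ge0// -[leRHS]expR0 ler_expR oppr_le0.
by rewrite mulr_ge0 ?sqr_ge0// mulr_ge0 ?sqr_ge0// mulr_ge0 ?sqr_ge0// ltW.
Qed.

Lemma trig_cos_cvg g M th e K : continuous g -> (forall x, `|g x| <= M) -> 0 < e -> 2 * e < K ->
  (fun m => intT P (trig_sum (@cos R) th g e K m)) @ \oo -->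
  intT P (fun w => box e K w * F th g (Bv w)).
Proof.
move=> cg gM e0 eK; rewrite (limit_law_box fld rho0 rhoE K e0 (mF th cg) (FM th gM)).
have h := @cos_sum_cvg R alpha p d T P xi0 c fld rho e K th beta a b N rho0 rhoE e0 beta0 eK etah
  ay by_ ba lnba Ny g M cg gM.
set RR := (X in _ --> X) in h; set L := (X in _ --> X).
have -> : L = RR; last exact: h.
apply: eq_Rintegral => s _; apply: eq_Rintegral => x _.
rewrite /limit_density /limit_factor /F opprD expRD.
set q := _ `^ (- alpha - 1); set gg := g _; set e1 := expR _; set e2 := expR _.
by ring.
Qed.

(** [Phi] is approximated by the sum over sites, which has at most one nonzero term. The error
    consists of the mass without a peak event, given by the same limit theorem, and of the
    exceptional set of the transfer. *)
Lemma peak_limit_gen (tr : R -> R) th g (M l : R) (Phi : nat -> T -> R) e K : 0 < e -> 2 * e < K ->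
  (forall m n, measT (fun w => tr (th * phase m n w))) ->
  (forall x, `|tr x| <= 1) ->
  continuous g -> (forall x, `|g x| <= M) -> (forall m w, `|Phi m w| <= M) ->
  (fun m => intT P (trig_sum tr th g e K m)) @ \oo --> l ->
  (forall eta, 0 < eta -> \forall m \near \oo, exists A : set T,
    [/\ measurable A, ((1 - eta)%:E <= P A)%E & forall w n, A w -> (n <= N m)%N ->
      peak_event e K m n w -> Phi m w = g (ratio n w) *
        tr (th * phase m n w)]) ->
  forall eta, 0 < eta -> \forall m \near \oo,
    `|intT P (Phi m) - l| <= M * (1 - intT P (fun w => box e K w)) + eta.
Proof.
move=> e0 eK mtr tr1 cg gM PM cl hA eta eta0.
have M0 : 0 <= M by apply: le_trans (gM 0).
have c1 : continuous (cst 1 : R -> R) by exact: cst_continuous.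
have n1 x : `|(cst 1 : R -> R) x| <= 1 by rewrite normr1.
(* With [th = 0] and the constant test function the sum is the indicator that a peak event occurs,
   so its mean is the probability of one. *)
have cmass : (fun m => intT P (trig_sum (@cos R) 0 (cst 1) e K m)) @ \oo -->
    intT P (fun w => box e K w).
  have := trig_cos_cvg c1 n1 (th:=0) e0 eK; congr (_ --> _); apply: eq_Rintegral => w _.
  by rewrite /F expr0n /= mulr0 mul0r oppr0 expR0 !mulr1.
pose e' := eta / (4 * (M + 1)).
have e'0 : 0 < e' by rewrite divr_gt0//; lra.
have Me' : M * e' <= eta / 4.
  rewrite /e' (_ : M * _ = M / (M + 1) * (eta / 4)); last by field; lra.
  by rewrite ler_piMl ?ler_pdivrMr; lra.
have eta4 : 0 < eta / 4 by lra.
near=> m.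
have a0 : 0 < a m by near: m; exact: seq_near_gty.
have [A [mA PA HA]] : exists A : set T,
    [/\ measurable A, ((1 - e')%:E <= P A)%E & forall w n, A w -> (n <= N m)%N ->
      peak_event e K m n w -> Phi m w = g (ratio n w) *
        tr (th * phase m n w)].
  by near: m; exact: hA.
have hl : `|l - intT P (trig_sum tr th g e K m)| <= eta / 4.
  by near: m; move/cvgrPdist_le : cl; exact.
have hm : `|intT P (fun w => box e K w) - intT P (trig_sum (@cos R) 0 (cst 1) e K m)| <= e'.
  by near: m; move/cvgrPdist_le : cmass; exact.
set mass := trig_sum (@cos R) 0 (cst 1) e K m in hm.
set S := trig_sum tr th g e K m in hl.
(* Without a peak event the sum is 0 and [Phi] is charged to [1 - mass]; with one, the two agree on
   [A]. *)
have key w : `|Phi m w - S w| <= M * (1 - mass w) + 2 * M * (1 - \1_A w).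
  have := trig_sumE (@cos R) 0 (cst 1) K w e0 a0; rewrite -/mass.
  have := trig_sumE tr th g K w e0 a0; rewrite -/S.
  have pA : 0 <= 2 * M * (1 - \1_A w).
    by rewrite indicE; case: (w \in A); rewrite ?subrr ?mulr0// subr0 mulr1; lra.
  case=> [[n [nN pn ->]]|[hn ->]].
    case=> [[n' [nN' pn' ->]]|[hn' _]]; last by have := hn' n nN; rewrite pn.
    rewrite mul0r cos0 mulr1 subrr mulr0 add0r.
    have b1 : `|g (ratio n w) *
        tr (th * phase m n w)| <= M.
      by rewrite normrM -[leRHS]mulr1; apply: ler_pM.
    rewrite indicE; have [|_] := boolP (w \in A).
      by rewrite inE => Aw; rewrite (HA w n Aw nN pn) !subrr normr0 mulr0.
    rewrite subr0 mulr1; apply: (le_trans (ler_normB _ _)).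
    by have := PM m w; lra.
  case=> [[n' [nN' pn' _]]|[hn' ->]]; first by have := hn n' nN'; rewrite pn'.
  rewrite !subr0 mulr1.
  by have := PM m w; lra.
have bpw g' M' : continuous g' -> (forall x, `|g' x| <= M') -> forall n,
   bmeas (weight e K g' m n).
  by move=> cg' gM' n; exact: (peak_weight_bmeas fld rho e K a N cg' gM' m n).
have bmass : bmeas mass.
  apply: bmeas_sum => n _; apply: bmeasM; first exact: (bpw _ 1).
  apply: bmeas_cos; under eq_fun do rewrite mul0r; exact: measurable_cst.
have bS : bmeas S.
  apply: bmeas_sum => n _; apply: bmeasM; first exact: (bpw _ M).
  by split; [exact: mtr | exists 1 => w].
have bA : bmeas (\1_A : T -> R) by exact: bmeas_indic.
have bc (k : R) : bmeas (cst k : T -> R) by exact: bmeas_cst.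
have b1m : bmeas (fun w => 1 - mass w) by exact: (bmeasB (bc 1)).
have b1A : bmeas (fun w => 1 - \1_A w : R) by exact: (bmeasB (bc 1)).
pose E w := M * (1 - mass w) + 2 * M * (1 - \1_A w).
have bE : bmeas E.
  by apply: bmeasD; [exact: (bmeasM (bc M) b1m) | exact: (bmeasM (bc (2 * M)) b1A)].
have EE : intT P E = M * (1 - intT P mass) + 2 * M * (1 - fine (P A)).
  rewrite /E RintegralD_prob; [|exact: (bmeasM (bc M) b1m)|exact: (bmeasM (bc (2 * M)) b1A)].
  rewrite !RintegralZl_prob// !(RintegralB_prob _ (bc 1))//.
  by rewrite !Rintegral_prob_cst Rintegral_indic_prob.
have near_mean : `|intT P (Phi m) - intT P S| <= intT P E.
  by apply: Rintegral_near_nonmeas => //; exists M.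
have PA' : 1 - e' <= fine (P A) by rewrite -lee_fin fineK// fin_num_measure.
have hE : intT P E <= M * (1 - intT P (fun w => box e K w)) + 3 * (eta / 4).
  rewrite EE; set x := intT P mass in hm *; set y := intT P (fun w => box e K w) in hm *.
  have h1 : M * (1 - x) <= M * (1 - y + e') by rewrite ler_wpM2l//; move: hm; rewrite ler_norml; lra.
  have h2 : M * (1 - fine (P A)) <= M * e' by rewrite ler_wpM2l//; lra.
  by move: h1; rewrite mulrDr; lra.
move: near_mean hl hE; rewrite !ler_norml.
move: (intT P S) (intT P E) (intT P (Phi m)) (M * _) => s1 s2 s3 s4.
by lra.
Unshelve. all: by end_near. Qed.

(** The interface between probability and analysis: on a measurable set of large probability, a peak
    event determines [Phi]. Only the set has to be measurable. *)
Definition good_transfer (tr : R -> R) (th : R) (g : R -> R) (Phi : nat -> T -> R) : Prop :=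
  forall e K eta, 0 < e -> 2 * e < K -> 0 < eta -> \forall m \near \oo, exists A : set T,
    [/\ measurable A, ((1 - eta)%:E <= P A)%E & forall w n, A w -> (n <= N m)%N ->
      peak_event e K m n w -> Phi m w = g (ratio n w) *
        tr (th * phase m n w)].

Let mass_cvg : (fun j : nat => intT P (fun w => box (j.+2%:R)^-1 j.+2%:R w)) @ \oo --> (1 : R).
Proof.
have n1 (x : R) : `|(cst 1 : R -> R) x| <= 1 by rewrite normr1.
have := box_mass_cvg fld rho0 (@measurable_cst _ _ _ _ setT (1 : R)) n1.
have -> : intT P (fun w => (cst 1 : R -> R) (Bv w)) = 1 by exact: Rintegral_prob_cst.
have -> // : (fun j : nat => intT P (fun w => box (j.+2%:R)^-1 j.+2%:R w * (cst 1 : R -> R) (Bv w))) =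
  (fun j : nat => intT P (fun w => box (j.+2%:R)^-1 j.+2%:R w)).
by apply/funext => j; apply: eq_Rintegral => w _; rewrite mulr1.
Qed.

Let eK_of j : 0 < (j.+2%:R)^-1 :> R /\ 2 * (j.+2%:R)^-1 < j.+2%:R :> R.
Proof.
have h : 0 < j.+2%:R :> R by rewrite ltr0n.
split; first by rewrite invr_gt0.
by rewrite ltr_pdivrMr// -natrM ltr_nat; nia.
Qed.

Let peak_limit (tr : R -> R) th (g : R -> R) (M : R) (h : R -> R) (Phi : nat -> T -> R) :
  (forall m n, measT (fun w => tr (th * phase m n w))) ->
  (forall x, `|tr x| <= 1) -> measT h -> (forall x, `|h x| <= M) ->
  (forall e K, 0 < e -> 2 * e < K -> (fun m => intT P (trig_sum tr th g e K m)) @ \oo -->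
    intT P (fun w => box e K w * h (Bv w))) ->
  continuous g -> (forall x, `|g x| <= M) -> (forall m w, `|Phi m w| <= M) ->
  good_transfer tr th g Phi ->
  (fun m => intT P (Phi m)) @ \oo --> intT P (fun w => h (Bv w)).
Proof.
move=> mtr tr1 mh hM ch cg gM PM hA.
have M0 : 0 <= M by apply: le_trans (gM 0).
apply/cvgrPdist_le => eta eta0.
have eta4 : 0 < eta / 4 by lra.
have h1 := box_mass_cvg fld rho0 mh hM.
have : \forall j \near \oo, M * (1 - intT P (fun w => box (j.+2%:R)^-1 j.+2%:R w)) <= eta / 4 /\
  `|intT P (fun w => h (Bv w)) - intT P (fun w => box (j.+2%:R)^-1 j.+2%:R w * h (Bv w))| <= eta / 4.
  pose e' := eta / (4 * (M + 1)).
  have e'0 : 0 < e' by rewrite divr_gt0//; lra.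
  have Me' : M * e' <= eta / 4.
    rewrite /e' (_ : M * _ = M / (M + 1) * (eta / 4)); last by field; lra.
    by rewrite ler_piMl ?ler_pdivrMr; lra.
  near=> j; split; last by near: j; move/cvgrPdist_le : h1; exact.
  apply: le_trans Me'; rewrite ler_wpM2l//.
  apply: le_trans (ler_norm _) _; near: j.
  by have /cvgrPdist_le := mass_cvg; apply.
case=> j _ /(_ j (leqnn j)) [hj1 hj2].
have [ej eK] := eK_of j.
have h2 := peak_limit_gen ej eK mtr tr1 cg gM PM (ch _ _ ej eK) (fun eta eta0 => hA _ _ eta ej eK eta0) eta4.
apply: filterS h2 => m; move: hj1 hj2; rewrite !ler_norml; lra.
Unshelve. all: by end_near. Qed.

Lemma peak_limit_cos th g M (Phi : nat -> T -> R) :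
  continuous g -> (forall x, `|g x| <= M) -> (forall m w, `|Phi m w| <= M) ->
  good_transfer (@cos R) th g Phi ->
  (fun m => intT P (Phi m)) @ \oo --> intT P (fun w => F th g (Bv w)).
Proof.
move=> cg gM; apply: peak_limit => //; [|exact: cos_max|exact: mF|exact: FM|].
  by move=> m n; exact: (bmeas_cos (measurable_scale th (measurable_total_phase fld b N m n))).1.
by move=> e K e0 eK; exact: trig_cos_cvg.
Qed.

Lemma peak_limit_sin th g M (Phi : nat -> T -> R) :
  continuous g -> (forall x, `|g x| <= M) -> (forall m w, `|Phi m w| <= M) ->
  good_transfer (@sin R) th g Phi ->
  (fun m => intT P (Phi m)) @ \oo --> (0 : R).
Proof.
move=> cg gM PM hA; rewrite -(Rintegral_prob_cst P 0).
apply: (@peak_limit (@sin R) th g M (cst 0)) PM hA => //; [|exact: sin_max| |].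
- by move=> m n; exact: (bmeas_sin (measurable_scale th (measurable_total_phase fld b N m n))).1.
- by move=> x; rewrite normr0; exact: le_trans (gM 0).
move=> e K e0 eK; under [X in _ --> X]eq_Rintegral do rewrite mulr0.
rewrite Rintegral_prob_cst; apply/cvgrPdist_le => z z0; near=> m.
rewrite (_ : Rintegral _ _ _ = 0) ?subrr ?normr0 ?ltW//.
apply: (sin_sum_mean fld th N rho0 e0 eK cg gM); split.
- by near: m; exact: seq_near_gty.
- rewrite -ler_pdivrMr//; near: m; exact: seq_near_gey.
- have a0 : 0 < a m by near: m; exact: seq_near_gty.
  rewrite mulrC -ler_pdivrMr// -[leLHS]ger0_norm; last first.
    by rewrite divr_ge0 ?ltW//; near: m; exact: seq_near_gty.
  rewrite -[_ / _]subr0 -normrN opprB; near: m; move/cvgrPdist_le : ba; exact.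
- have a1 : 1 <= a m by near: m; exact: seq_near_gey.
  rewrite -[leLHS](congr1 (@^~ alpha) (powR1 R)); apply: ge0_ler_powR => //; rewrite ?nnegrE ?ler01 ?(le_trans ler01 a1)//.
  by have := alpha2; lra.
Unshelve. all: by end_near. Qed.

Lemma peak_event_prob eta : 0 < eta -> exists e K, [/\ 0 < e, 2 * e < K & \forall m \near \oo,
  exists A : set T, [/\ measurable A, ((1 - eta)%:E <= P A)%E &
    forall w, A w -> exists2 n, (n <= N m)%N & peak_event e K m n w]].
Proof.
move=> eta0; have eta2 : 0 < eta / 2 by lra.
have /cvgrPdist_le/(_ _ eta2)[j _ /(_ j (leqnn j)) hj] := mass_cvg.
have [ej eK] := eK_of j.
set e : R := _^-1 in hj ej eK; set K : R := _%:R in hj eK.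
exists e, K; split => //.
have c1 : continuous (cst 1 : R -> R) by exact: cst_continuous.
have n1 x : `|(cst 1 : R -> R) x| <= 1 by rewrite normr1.
have cmass : (fun m => intT P (trig_sum (@cos R) 0 (cst 1) e K m)) @ \oo -->
    intT P (fun w => box e K w).
  have := trig_cos_cvg c1 n1 (th:=0) ej eK; congr (_ --> _); apply: eq_Rintegral => w _.
  by rewrite /F expr0n /= mulr0 mul0r oppr0 expR0 !mulr1.
near=> m.
have a0 : 0 < a m by near: m; exact: seq_near_gty.
have hm : `|intT P (fun w => box e K w) - intT P (trig_sum (@cos R) 0 (cst 1) e K m)| <= eta / 2.
  by near: m; move/cvgrPdist_le : cmass; exact.
set mass := trig_sum (@cos R) 0 (cst 1) e K m in hm.
have bmass : bmeas mass.
  apply: bmeas_sum => n _; apply: bmeasM; first exact: (peak_weight_bmeas fld rho e K a N c1 n1 m n).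
  apply: bmeas_cos; under eq_fun do rewrite mul0r; exact: measurable_cst.
have mA : measurable [set w | mass w = 1].
  by rewrite -[X in measurable X]setTI; apply: (bmass.1 measurableT _ (@measurable_set1 _ (1 : R))).
have massE w : mass w = \1_[set w | mass w = 1] w.
  have := trig_sumE (@cos R) 0 (cst 1) K w ej a0; rewrite -/mass indicE.
  case=> [[n [_ _]]|[_]]; rewrite ?mul0r ?cos0 ?mulr1 => h.
    by rewrite mem_set.
  by rewrite memNset// /mkset h => /esym/eqP; rewrite oner_eq0.
exists [set w | mass w = 1]; split => //.
  have -> : P [set w | mass w = 1] = (intT P mass)%:E.
    have -> : intT P mass = intT P (\1_[set w | mass w = 1] : T -> R).
      by apply: eq_Rintegral => w _; exact: massE.
    by rewrite Rintegral_indic_prob// fineK// fin_num_measure.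
  by rewrite lee_fin; move: hm hj; rewrite !ler_norml; lra.
move=> w mw; have := trig_sumE (@cos R) 0 (cst 1) K w ej a0; rewrite -/mass.
case=> [[n [nN pn _]]|[_]]; first by exists n.
by move: mw => /= -> /eqP; rewrite oner_eq0.
Unshelve. all: by end_near. Qed.

End PeakTransfer.

(** * The scales in time *)

Section Scales.
Context {R : realType} (alpha rho : R).

(* With L = ln t these are a = (t / L)^rho, r = a^alpha, omega = L^(1/4), b = a / omega and
   N > r omega; for rho = 1 / (alpha - 1) one has a / r = L / t. *)
Definition peak_height (t : R) : R := (t / ln t) `^ rho.
Definition peak_radius (t : R) : R := peak_height t `^ alpha.
Definition cut_ratio (t : R) : R := ln t `^ (1 / 4).
Definition cut_level (t : R) : R := peak_height t / cut_ratio t.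
Definition cut_radius (t : R) : nat := (Num.truncn (peak_radius t * cut_ratio t)).+1.

Hypotheses (alpha2 : 2 <= alpha) (rho0 : 0 < rho) (rhoE : rho * (alpha - 1) = 1).

Record scale_facts (t : R) : Prop := ScaleFacts {
  scale_ln : 1 < ln t;
  scale_cut : 1 < cut_ratio t;
  scale_ln_cut : ln t = cut_ratio t ^+ 4;
  scale_ln_ln : ln (ln t) = 4 * ln (cut_ratio t);
  scale_height : 0 < peak_height t;
  scale_ln_height : ln (peak_height t) = rho * (ln t - ln (ln t));
  scale_radius : 0 < peak_radius t;
  scale_rate : peak_radius t * ln t = peak_height t * t;
  scale_radius_lb : peak_radius t * cut_ratio t <= (cut_radius t)%:R;
  scale_radius_ub : (cut_radius t)%:R <= peak_radius t * cut_ratio t + 1 }.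

Lemma scale_factsP t : expR 1 < t -> scale_facts t.
Proof.
move=> t1; have e1 : 0 < expR (1 : R) by exact: expR_gt0.
have t0 : 0 < t by lra.
have L1 : 1 < ln t by rewrite -[ltLHS]expRK ltr_ln ?posrE.
have L0 : 0 < ln t by lra.
have c1 : 1 < cut_ratio t.
  rewrite /cut_ratio /powR gt_eqF// -[ltLHS]expR0 ltr_expR mulr_gt0 ?ln_gt0//; lra.
have c4 : ln t = cut_ratio t ^+ 4.
  rewrite /cut_ratio -powR_mulrn ?powR_ge0// -powRrM (_ : 1 / 4 * 4%:R = 1) ?powRr1 ?ltW//.
  by field.
have tL : 0 < t / ln t by rewrite divr_gt0.
have a0 : 0 < peak_height t by rewrite powR_gt0.
have r0 : 0 < peak_radius t by rewrite powR_gt0.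
have rc0 : 0 <= peak_radius t * cut_ratio t by rewrite mulr_ge0 ?ltW//; lra.
split => //.
- by rewrite {1}c4 lnXn ?mulr_natl//; lra.
- by rewrite /peak_height ln_powR ln_div ?posrE.
- rewrite /peak_radius -[in LHS](subrK 1 alpha) powRD ?powRr1 ?ltW//; last first.
    by apply/implyP => _; rewrite gt_eqF.
  rewrite /peak_height -powRrM rhoE powRr1 ?ltW//; field; lra.
- by rewrite ltW// truncnS_gt.
- by rewrite -natr1 lerD2r truncn_le.
Qed.

Variable t : nat -> R.
Hypothesis ty : t @ \oo --> +oo.
Local Notation a m := (peak_height (t m)).
Local Notation r m := (peak_radius (t m)).
Local Notation om m := (cut_ratio (t m)).
Local Notation b m := (cut_level (t m)).
Local Notation N m := (cut_radius (t m)).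
Local Notation L m := (ln (t m)).

Lemma scale_near : \forall m \near \oo, scale_facts (t m).
Proof. by near=> m; apply: scale_factsP; near: m; exact: seq_near_gty. Unshelve. all: by end_near. Qed.

Lemma log_cvgy : (fun m => L m) @ \oo --> +oo.
Proof. exact: seq_ln_cvgy. Qed.

Lemma cut_ratio_cvgy : (fun m => om m) @ \oo --> +oo.
Proof. by apply: seq_powR_cvgy; [lra | exact: log_cvgy]. Qed.

Lemma cut_ln_cvg0 : (fun m => om m * ln (L m) / L m) @ \oo --> (0 : R).
Proof.
apply: (@squeeze_cvgr _ _ _ _ (cst 0) (fun m => 4 * (om m)^-1 * (om m)^-1)).
- near=> m; have f : scale_facts (t m) by near: m; exact: scale_near.
  have c1 := scale_cut f; have c0 : 0 < om m by lra.
  have cl : 0 <= ln (om m) by rewrite ln_ge0 ?ltW.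
  have cu : ln (om m) < om m by exact: ln_sublinear.
  rewrite (scale_ln_ln f) {1 2}(scale_ln_cut f); apply/andP; split.
    by rewrite divr_ge0 ?exprn_ge0 ?mulr_ge0//; lra.
  rewrite (_ : 4 * _ * _ = om m * (4 * om m) / om m ^+ 4); last by field; lra.
  by rewrite ler_pM2r ?invr_gt0 ?exprn_gt0// ler_pM2l//; lra.
- exact: cvg_cst.
- rewrite -(mulr0 (4 * 0)); have h := seq_invy cut_ratio_cvgy.
  by apply: cvgM => //; apply: cvgM => //; exact: cvg_cst.
Unshelve. all: by end_near. Qed.

Lemma ln_ln_small (e : R) : 0 < e -> \forall m \near \oo, om m * ln (L m) <= e * L m.
Proof.
move=> e0; near=> m; have f : scale_facts (t m) by near: m; exact: scale_near.
have L1 := scale_ln f; have L0 : 0 < L m by lra.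
rewrite -ler_pdivrMr//; apply: le_trans (ler_norm _) _.
rewrite -[X in `|X|]subr0 -normrN opprB; near: m.
by have /cvgrPdist_le := cut_ln_cvg0; apply.
Unshelve. all: by end_near. Qed.

(** ln a is about rho ln t, whereas ln omega is of order ln ln t: any positive power of the height
    beats any power of the cut ratio. *)
Lemma scale_exponent_cvgy (x y : R) : 0 < x ->
  (fun m => x * ln (a m) - y * ln (om m)) @ \oo --> +oo.
Proof.
move=> x0; apply/cvgryPge => A.
have xr : 0 < x * rho by rewrite mulr_gt0.
pose e := x * rho / (2 * (x * rho + `|y|)).
have yn : 0 <= `|y| by [].
have e0 : 0 < e by rewrite divr_gt0//; lra.
near=> m; have f : scale_facts (t m) by near: m; exact: scale_near.
have L1 := scale_ln f; have c1 := scale_cut f.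
have hl : om m * ln (L m) <= e * L m by near: m; exact: ln_ln_small.
have l0 : 0 <= ln (om m) by rewrite ln_ge0 ?ltW.
have hl2 : ln (L m) <= e * L m.
  by apply: le_trans hl; apply: ler_peMl (ltW c1); rewrite (scale_ln_ln f); lra.
have LA : A <= (x * rho / 2) * L m.
  rewrite mulrC -ler_pdivrMr ?divr_gt0//; near: m; exact: seq_near_gey log_cvgy.
apply: (le_trans LA); rewrite (scale_ln_height f).
have yl : y * ln (om m) <= `|y| * ln (L m).
  apply: le_trans (ler_wpM2r l0 (ler_norm y)) _.
  by rewrite ler_wpM2l// (scale_ln_ln f); lra.
have : (x * rho + `|y|) * ln (L m) <= x * rho / 2 * L m.
  apply: le_trans (_ : (x * rho + `|y|) * (e * L m) <= _); first by rewrite ler_wpM2l//; lra.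
  by rewrite /e; apply: eq_ler; field; lra.
move: yl; rewrite mulrA; nra.
Unshelve. all: by end_near. Qed.

Lemma scale_power_cvg0 (x y : R) : 0 < x ->
  (fun m => a m `^ (- x) * om m `^ y) @ \oo --> (0 : R).
Proof.
move=> x0; have h := scale_exponent_cvgy y x0.
apply: (@seq_cvg_eq _ (fun m => expR (- (x * ln (a m) - y * ln (om m))))).
  near=> m; have f : scale_facts (t m) by near: m; exact: scale_near.
  have a0 := scale_height f; have c1 := scale_cut f.
  rewrite /powR !gt_eqF//; last by lra.
  by rewrite -expRD; congr expR; ring.
apply: (@squeeze_cvgr _ _ _ _ (cst 0) (fun m => (x * ln (a m) - y * ln (om m))^-1)).
- near=> m; rewrite expR_ge0 /= expRN lef_pV2 ?posrE ?expR_gt0//.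
    by apply: le_trans (expR_ge1Dx _); lra.
  by near: m; exact: seq_near_gty h.
- exact: cvg_cst.
- exact: seq_invy.
Unshelve. all: by end_near. Qed.

Lemma peak_height_cvgy : (fun m => a m) @ \oo --> +oo.
Proof.
have := scale_exponent_cvgy 0 ltr01.
under eq_fun do rewrite mul1r mul0r subr0.
move=> h; apply/cvgryPge => A; near=> m; have f : scale_facts (t m) by near: m; exact: scale_near.
apply: le_trans (ltW (ln_sublinear (scale_height f))).
by near: m; exact: seq_near_gey h.
Unshelve. all: by end_near. Qed.

Lemma peak_radius_cvgy : (fun m => r m) @ \oo --> +oo.
Proof. by apply: seq_powR_cvgy peak_height_cvgy; have := alpha2; lra. Qed.

Lemma cut_level_cvgy : (fun m => b m) @ \oo --> +oo.
Proof.
have := scale_exponent_cvgy 1 ltr01.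
under eq_fun do rewrite !mul1r.
move=> h; apply/cvgryPge => A; near=> m; have f : scale_facts (t m) by near: m; exact: scale_near.
have a0 := scale_height f; have c1 := scale_cut f.
apply: le_trans (ltW (ln_sublinear _)); last by rewrite divr_gt0//; lra.
rewrite ln_div ?posrE//; last by lra.
by near: m; exact: seq_near_gey h.
Unshelve. all: by end_near. Qed.

Lemma cut_level_ratio : (fun m => b m / a m) @ \oo --> (0 : R).
Proof.
apply: seq_cvg_eq (seq_invy cut_ratio_cvgy).
near=> m; have f : scale_facts (t m) by near: m; exact: scale_near.
have a0 := scale_height f; have c1 := scale_cut f.
by rewrite /cut_level; field; lra.
Unshelve. all: by end_near. Qed.

Lemma cut_level_ln : (fun m => ln (b m) / ln (a m)) @ \oo --> (1 : R).
Proof.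
have la : (fun m => ln (a m)) @ \oo --> +oo by exact: seq_ln_cvgy peak_height_cvgy.
apply/cvgrPdist_le => e e0.
have h := scale_exponent_cvgy 1 e0.
near=> m; have f : scale_facts (t m) by near: m; exact: scale_near.
have a0 := scale_height f; have c1 := scale_cut f.
have la0 : 0 < ln (a m) by near: m; exact: seq_near_gty la.
have l0 : 0 <= ln (om m) by rewrite ln_ge0 ?ltW.
rewrite ln_div ?posrE//; last by lra.
rewrite (_ : 1 - _ = ln (om m) / ln (a m)); last by field; lra.
rewrite ger0_norm; last by rewrite divr_ge0// ltW.
rewrite ler_pdivrMr// -subr_ge0 -[X in _ - X]mul1r; near: m; exact: seq_near_gey h.
Unshelve. all: by end_near. Qed.

Lemma cut_radius_ratio : (fun m => (N m)%:R / r m) @ \oo --> +oo.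
Proof.
apply/cvgryPge => A; near=> m; have f : scale_facts (t m) by near: m; exact: scale_near.
have r0 := scale_radius f.
rewrite ler_pdivlMr//; apply: le_trans (scale_radius_lb f).
rewrite mulrC ler_pM2l//; near: m; exact: seq_near_gey cut_ratio_cvgy.
Unshelve. all: by end_near. Qed.

Lemma cut_radius_cvgy : (fun m => (N m)%:R : R) @ \oo --> +oo.
Proof.
apply/cvgryPge => A; near=> m; have f : scale_facts (t m) by near: m; exact: scale_near.
have r0 := scale_radius f; have c1 := scale_cut f.
apply: le_trans (scale_radius_lb f).
have rA : A <= r m by near: m; exact: seq_near_gey peak_radius_cvgy.
by apply: (le_trans rA); rewrite ler_peMr ?ltW.
Unshelve. all: by end_near. Qed.

(** The exponent condition gives a^k at least (t / ln t)^2, so the quotient is at most (ln t)^2 / t.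
    It decides how many symmetric sites around the peak are required. *)
Lemma time_height_cvg0 (k : nat) : 2 <= rho * k%:R -> (fun m => t m / a m ^+ k) @ \oo --> (0 : R).
Proof.
move=> hk.
apply: (@squeeze_cvgr _ _ _ _ (cst 0) (fun m => 9 * (t m) `^ (- (1 / 3)))).
- near=> m; have t1 : expR 1 < t m by near: m; exact: seq_near_gty.
  have f := scale_factsP t1; have e1 := expR_gt0 (1 : R); have t0 : 0 < t m by lra.
  have L1 := scale_ln f; have L0 : 0 < L m by lra.
  have a0 := scale_height f.
  apply/andP; split; first by rewrite divr_ge0 ?exprn_ge0 ?ltW.
  have L3 : L m <= 3 * t m `^ (1 / 3).
    have := ln_sublinear (powR_gt0 (1 / 3) t0); rewrite ln_powR; lra.
  have tL : 1 <= t m / L m by rewrite ler_pdivlMr// mul1r ltW// ln_sublinear.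
  have ak : (t m / L m) ^+ 2 <= a m ^+ k.
    rewrite -(powR_mulrn k (ltW a0)) /peak_height -powRrM -powR_mulrn; last by lra.
    by apply: ler_powR.
  apply: (@le_trans _ _ (t m / (t m / L m) ^+ 2)).
    by rewrite ler_pM2l// lef_pV2 ?posrE ?exprn_gt0//; lra.
  rewrite (_ : t m / (t m / L m) ^+ 2 = L m ^+ 2 / t m); last by field; lra.
  have -> : t m `^ (- (1 / 3)) = (t m `^ (1 / 3)) ^+ 2 / t m.
    rewrite -powR_mulrn ?powR_ge0// -powRrM -{3}(powRr1 (ltW t0)) -powRN.
    by rewrite -powRD; [congr powR; field | apply/implyP => _; rewrite gt_eqF].
  rewrite mulrA ler_pM2r ?invr_gt0// (_ : 9 * _ = (3 * t m `^ (1 / 3)) ^+ 2); last by ring.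
  by rewrite lerXn2r ?nnegrE//; lra.
- exact: cvg_cst.
- rewrite -(mulr0 9); apply: cvgM; first exact: cvg_cst.
  by apply: seq_powRN_cvg0 => //; lra.
Unshelve. all: by end_near. Qed.

End Scales.

Section EtaCut.
Context {R : realType} (alpha rho beta : R) (p : nat -> R).
Hypotheses (alpha2 : 2 <= alpha) (rho0 : 0 < rho) (rhoE : rho * (alpha - 1) = 1) (beta0 : 0 < beta).
Hypotheses (p01 : forall n, 0 <= p n <= 1)
  (etah : (fun n => etaPAM p n / (beta * kappa alpha n)) @ \oo --> (1 : R)).
Variable t : nat -> R.
Hypothesis ty : t @ \oo --> +oo.
Local Notation a m := (peak_height rho (t m)).
Local Notation r m := (peak_radius alpha rho (t m)).
Local Notation om m := (cut_ratio (t m)).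
Local Notation b m := (cut_level rho (t m)).
Local Notation N m := (cut_radius alpha rho (t m)).
Local Notation L m := (ln (t m)).
(** The power of omega in kappa(N) besides a^2. At alpha = 2, N is about a^2 omega and ln N is of
    order ln t = omega^4, hence 1 - 4 = - 3. *)
Definition eta_exponent : R := if 2 < alpha then 2 / alpha else - 3.
Local Notation x0 := eta_exponent.

Lemma etaPAM_ge0 n : 0 <= etaPAM p n.
Proof. by apply: sumr_ge0 => i _; have /andP[_ h] := p01 i; lra. Qed.

Lemma eta_cut_bound : \forall m \near \oo, etaPAM p (N m) <= 4 * beta * (a m ^+ 2 * om m `^ x0).
Proof.
have Ny : (fun m => N m) @ \oo --> \oo.
  apply/cvgrnyP; exact: (cut_radius_cvgy alpha2 rho0 rhoE ty).
have h := cvg_comp _ _ Ny etah.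
have lny := seq_ln_cvgy (peak_height_cvgy rho0 rhoE ty).
near=> m; have f : scale_facts alpha rho (t m) by near: m; exact: scale_near.
have a0 := scale_height f; have c1 := scale_cut f; have c0 : 0 < om m by lra.
have r1 : 1 <= r m by near: m; exact: (seq_near_gey _ (peak_radius_cvgy alpha2 rho0 rhoE ty)).
have h2 : etaPAM p (N m) / (beta * kappa alpha (N m)) <= 2.
  by near: m; apply: (cvgr_le _ h); lra.
have rc : 1 <= r m * om m by rewrite -[leLHS]mulr1; apply: ler_pM; lra.
have Nlb := scale_radius_lb f; have Nub := scale_radius_ub f.
have N2 : (N m)%:R <= 2 * (r m * om m) by lra.
have la1 : 1 < ln (a m) by near: m; exact: seq_near_gty lny.
have la0 : 0 < ln (a m) by lra.
have Nr : r m <= (N m)%:R by apply: le_trans Nlb; rewrite ler_peMr; lra.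
have rln : ln (r m) = alpha * ln (a m) by rewrite ln_powR.
have lnN : alpha * ln (a m) <= ln (N m)%:R by rewrite -rln ler_ln ?posrE//; lra.
have k0 : 0 < kappa alpha (N m).
  rewrite /kappa; case: ifP => _; first by rewrite powR_gt0; lra.
  have hh : 0 < alpha * ln (a m) by rewrite mulr_gt0//; have := alpha2; lra.
  by rewrite divr_gt0; lra.
move: h2; rewrite ler_pdivrMr ?mulr_gt0// => h2; apply: (le_trans h2).
suff : kappa alpha (N m) <= 2 * (a m ^+ 2 * om m `^ x0) by move: beta0; nra.
rewrite /kappa /eta_exponent; case: (ltP 2 alpha) => a2.
  apply: (@le_trans _ _ ((2 * (r m * om m)) `^ (2 / alpha))).
    by apply: ge0_ler_powR; rewrite ?nnegrE//; [rewrite divr_ge0//; lra | lra].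
  have al : 2 / alpha <= 1 by rewrite ler_pdivrMr; lra.
  rewrite powRM; [|by []|by lra]; rewrite powRM; [|by lra|by lra].
  have -> : r m `^ (2 / alpha) = a m ^+ 2.
    rewrite /peak_radius -powRrM (_ : alpha * _ = 2%:R); last by field; lra.
    by rewrite powR_mulrn// ltW.
  apply: ler_wpM2r; first by rewrite mulr_ge0 ?exprn_ge0 ?powR_ge0// ltW.
  by rewrite -[leRHS]powRr1//; apply: ler_powR => //; rewrite ler1n.
have ae : alpha = 2 by have := alpha2; lra.
have hl : om m * ln (L m) <= 1 / 2 * L m.
  by near: m; apply: (ln_ln_small rhoE ty); lra.
have L1 := scale_ln f.
have ll0 : 0 <= ln (L m) by rewrite ln_ge0 ?ltW.
have la : L m / 2 <= ln (a m).
  have re : rho = 1 by move: rhoE; rewrite ae; lra.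
  by rewrite (scale_ln_height f) re mul1r; nra.
rewrite ler_pdivrMr; last by nra.
apply: (le_trans N2).
have -> : r m = a m ^+ 2 by rewrite /peak_radius ae powR_mulrn// ltW.
have -> : om m `^ (- 3) = om m / L m.
  rewrite (scale_ln_cut f) powRN powR_mulrn ?(ltW c0)//; field; lra.
have : 2 * (a m ^+ 2 * (om m / L m)) * L m <= 2 * (a m ^+ 2 * (om m / L m)) * ln (N m)%:R.
  apply: ler_wpM2l; last by move: lnN; rewrite ae; lra.
  by rewrite !mulr_ge0 ?exprn_ge0 ?invr_ge0//; lra.
apply: le_trans; apply: eq_ler; field; lra.
Unshelve. all: by end_near. Qed.

Lemma cut_level_powR m : scale_facts alpha rho (t m) -> b m `^ (- alpha) = a m `^ (- alpha) * om m `^ alpha.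
Proof.
move=> f; have a0 := scale_height f; have c1 := scale_cut f.
rewrite /cut_level powRM ?invr_ge0; [|by lra|by lra].
by congr (_ * _); rewrite -powR_inv1 -?powRrM; [congr powR; ring | lra].
Qed.

(** This bounds the expected number of separately drawn values above the cut. For alpha > 2 a
    negative power of the height decides; at alpha = 2 only omega^(- 3) against the loss omega^2
    from the lower cut, so omega^(- 1) remains. *)
Lemma eta_cut_tail : (fun m => etaPAM p (N m) * b m `^ (- alpha)) @ \oo --> (0 : R).
Proof.
apply: (@squeeze_cvgr _ _ _ _ (cst 0)
  (fun m => 4 * beta * (a m `^ (- (alpha - 2)) * om m `^ (x0 + alpha)))).
- near=> m; have f : scale_facts alpha rho (t m) by near: m; exact: scale_near.
  have a0 := scale_height f; have c1 := scale_cut f; have c0 : 0 < om m by lra.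
  have hb : etaPAM p (N m) <= 4 * beta * (a m ^+ 2 * om m `^ x0) by near: m; exact: eta_cut_bound.
  rewrite (cut_level_powR f) mulr_ge0 ?mulr_ge0 ?etaPAM_ge0 ?powR_ge0//=.
  apply: le_trans (ler_wpM2r _ hb) _; first by rewrite mulr_ge0 ?powR_ge0.
  have am : a m `^ (- (alpha - 2)) = a m ^+ 2 * a m `^ (- alpha).
    rewrite (_ : - (alpha - 2) = 2%:R + - alpha); last by ring.
    by rewrite powRD ?powR_mulrn ?(ltW a0)//; apply/implyP => _; rewrite gt_eqF.
  have omE : om m `^ (x0 + alpha) = om m `^ x0 * om m `^ alpha.
    by apply: powRD; apply/implyP => _; rewrite (gt_eqF c0).
  rewrite am omE.
  move: (om m `^ x0) (om m `^ alpha) (a m `^ (- alpha)) (a m) => u v u' v'.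
  by apply: eq_ler; ring.
- exact: cvg_cst.
- rewrite -(mulr0 (4 * beta)); apply: cvgM; first exact: cvg_cst.
  have [a2|a2] := ltP 2 alpha; first by apply: (scale_power_cvg0 rho0 rhoE ty); lra.
  have ae : alpha = 2 by have := alpha2; lra.
  have e0 : x0 + alpha = - 1 by rewrite /eta_exponent ltNge a2 /= ae; ring.
  rewrite e0 ae subrr oppr0; under eq_fun do rewrite powRr0 mul1r.
  by apply: seq_powRN_cvg0 => //; exact: (cut_ratio_cvgy ty).
Unshelve. all: by end_near. Qed.

(** Serves the error of [log_ratio_bound]: the asymmetry of the potential is at most [b] per
    separate pair, and it is divided by the cube of a gap of order [a]. *)
Lemma eta_cut_mean : (fun m => etaPAM p (N m) * b m / a m ^+ 3) @ \oo --> (0 : R).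
Proof.
apply: (@squeeze_cvgr _ _ _ _ (cst 0) (fun m => 4 * beta * (om m `^ (- (1 - x0))))).
- near=> m; have f : scale_facts alpha rho (t m) by near: m; exact: scale_near.
  have a0 := scale_height f; have c1 := scale_cut f; have c0 : 0 < om m by lra.
  have hb : etaPAM p (N m) <= 4 * beta * (a m ^+ 2 * om m `^ x0) by near: m; exact: eta_cut_bound.
  have b0 : 0 < b m by rewrite divr_gt0.
  apply/andP; split; first exact: divr_ge0 (mulr_ge0 (etaPAM_ge0 _) (ltW b0)) (exprn_ge0 _ (ltW a0)).
  rewrite -mulrA; apply: le_trans (ler_wpM2r _ hb) _; first exact: divr_ge0 (ltW b0) (exprn_ge0 _ (ltW a0)).
  rewrite (_ : - (1 - x0) = x0 + - 1); last by ring.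
  rewrite powRD; last by apply/implyP => _; rewrite gt_eqF.
  rewrite powR_inv1 ?(ltW c0)// /cut_level; move: (om m `^ x0) => u.
  by apply: eq_ler; field; rewrite !gt_eqF.
- exact: cvg_cst.
- rewrite -(mulr0 (4 * beta)); apply: cvgM; first exact: cvg_cst.
  apply: seq_powRN_cvg0; last exact: (cut_ratio_cvgy ty).
  by rewrite /eta_exponent; case: (ltP 2 alpha) => a2; [rewrite subr_gt0 ltr_pdivrMr; lra | lra].
Unshelve. all: by end_near. Qed.

End EtaCut.

(** * Typical environments *)

Section Rare.
Context {R : realType} {d} {T : measurableType d} (P : probability T R).

Lemma prob_setU_le (A B : set T) (x y : R) : measurable A -> measurable B ->
  (P A <= x%:E)%E -> (P B <= y%:E)%E -> (P (A `|` B) <= (x + y)%:E)%E.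
Proof. by move=> mA mB PA PB; apply: (le_trans (measureU2 _ mA mB)); rewrite EFinD; exact: leeD. Qed.

Lemma prob_exists_seq (I : eqType) (s : seq I) (A : I -> set T) (u : I -> R) :
  (forall i, measurable (A i)) -> (forall i, i \in s -> (P (A i) <= (u i)%:E)%E) ->
  exists B, [/\ measurable B, (P B <= (\sum_(i <- s) u i)%:E)%E & forall i, i \in s -> A i `<=` B].
Proof.
move=> mA; elim: s => [|i s IH] Au.
  by exists set0; split => //; rewrite measure0 big_nil.
have [|B [mB PB sB]] := IH; first by move=> j js; apply: Au; rewrite inE js orbT.
exists (A i `|` B); split; first exact: measurableU.
  by rewrite big_cons; apply: prob_setU_le => //; apply: Au; rewrite inE eqxx.
move=> j; rewrite inE => /orP[/eqP ->|js] w Aw; [by left | right; exact: sB Aw].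
Qed.

Lemma prob_exists_nat (A : nat -> set T) (u : nat -> R) (S : R) :
  (forall i, measurable (A i)) -> (forall i, (P (A i) <= (u i)%:E)%E) ->
  (forall n, \sum_(i < n) u i <= S) -> (P (\bigcup_i A i) <= S%:E)%E.
Proof.
move=> mA Au uS; apply: (le_trans (generalized_Boole_inequality P mA _)).
  exact: bigcupT_measurable.
apply: (@le_trans _ _ (\sum_(0 <= i <oo) (u i)%:E)%E); first by apply: lee_nneseries => // *; exact: Au.
have u0 i : (0 <= (u i)%:E)%E by exact: le_trans (Au i).
apply: lime_le; first by apply: is_cvg_nneseries => n _ _.
by apply: nearW => n; rewrite sumEFin lee_fin big_mkord.
Qed.

(** The outer probability tends to 0; stated through measurable covers, it applies to events whose
    measurability has not been established. *)
Definition rare (E : nat -> set T) : Prop := forall eta : R, 0 < eta ->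
  \forall m \near \oo, exists A, [/\ measurable A, (P A <= eta%:E)%E & E m `<=` A].

Lemma rareU E F : rare E -> rare F -> rare (fun m => E m `|` F m).
Proof.
move=> hE hF eta eta0; have e2 : 0 < eta / 2 by lra.
near=> m.
have [A [mA PA EA]] : exists A, [/\ measurable A, (P A <= (eta / 2)%:E)%E & E m `<=` A] by near: m; exact: hE.
have [B [mB PB FB]] : exists A, [/\ measurable A, (P A <= (eta / 2)%:E)%E & F m `<=` A] by near: m; exact: hF.
exists (A `|` B); split; [exact: measurableU | | by move=> w [/EA|/FB]; [left|right]].
by rewrite (_ : eta = eta / 2 + eta / 2); [exact: prob_setU_le | field].
Unshelve. all: by end_near. Qed.

Lemma rare_bound E (u : nat -> R) : u @ \oo --> (0 : R) ->
  (\forall m \near \oo, exists A, [/\ measurable A, (P A <= (u m)%:E)%E & E m `<=` A]) -> rare E.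
Proof.
move=> u0 hE eta eta0; near=> m.
have [A [mA PA EA]] : exists A, [/\ measurable A, (P A <= (u m)%:E)%E & E m `<=` A] by near: m.
exists A; split => //; apply: (le_trans PA); rewrite lee_fin.
by near: m; apply: (cvgr_le _ u0).
Unshelve. all: by end_near. Qed.

Lemma rare_compl E : rare E -> forall eta : R, 0 < eta -> \forall m \near \oo,
  exists A, [/\ measurable A, ((1 - eta)%:E <= P A)%E & forall w, A w -> ~ E m w].
Proof.
move=> hE eta eta0; near=> m.
have [A [mA PA EA]] : exists A, [/\ measurable A, (P A <= eta%:E)%E & E m `<=` A] by near: m; exact: hE.
exists (~` A); split; [exact: measurableC | | by move=> w nA /EA].
by rewrite probability_setC// EFinB leeB.
Unshelve. all: by end_near. Qed.

End Rare.

Section GoodSites.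
Context {R : realType} {alpha : R} {p : nat -> R} {d} {T : measurableType d}
  {P : probability T R} {xi0 : int -> T -> R} {c : nat -> T -> bool}.
Hypothesis fld : pareto_field alpha p P xi0 c.
Let alpha2 := field_alpha fld.
Variables (rho beta : R).
Hypotheses (rho0 : 0 < rho) (rhoE : rho * (alpha - 1) = 1) (beta0 : 0 < beta).
Hypothesis etah : (fun n => etaPAM p n / (beta * kappa alpha n)) @ \oo --> (1 : R).
Hypothesis p1 : p @ \oo --> (1 : R).
Variable t : nat -> R.
Hypothesis ty : t @ \oo --> +oo.
Local Notation a m := (peak_height rho (t m)).
Local Notation r m := (peak_radius alpha rho (t m)).
Local Notation om m := (cut_ratio (t m)).
Local Notation b m := (cut_level rho (t m)).
Local Notation N m := (cut_radius alpha rho (t m)).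
Local Notation L m := (ln (t m)).

Lemma coin_site_prob i z (x : R) : (0 < i)%N -> 1 <= x ->
  P ([set w | ~~ c i w] `&` [set w | x < xi0 z w]) = ((1 - p i) * x `^ (- alpha))%:E.
Proof.
case: i => // i _ x1.
pose A (j : int + nat) : set T := if j is inl _ then [set w | x < xi0 z w] else [set w | ~~ c i.+1 w].
have := field_indep fld (J := [:: inl z; inr i]) (A := A).
rewrite bigcap_seq !big_cons !big_nil setIT mule1 /= setIC => -> //.
- rewrite (field_tail fld)// (_ : [set w | ~~ c i.+1 w] = ~` [set w | c i.+1 w]).
    rewrite probability_setC; last exact: (field_coin_meas fld).
    by rewrite (field_coin fld)// -EFinB -EFinM mulrC.
  by apply/seteqP; split => w /=; move/negP.
- move=> [y|k]; rewrite !inE //=.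
    rewrite orbF => /eqP[->]; exists `]x, +oo[%classic; split => //.
    by apply/seteqP; split => w /=; rewrite in_itv /= andbT.
  by move=> /eqP[->]; exists [set false]; apply/seteqP; split => w /=; case: (c _ w).
Qed.

Let mcoin i : measurable [set w | ~~ c i w].
Proof.
rewrite (_ : mkset _ = ~` [set w | c i w]); first exact: measurableC (field_coin_meas fld i).
by apply/seteqP; split => w /=; move/negP.
Qed.

Lemma rare_below1 : rare P (fun=> [set w | exists z, xi0 z w < 1]).
Proof.
pose A (n : nat) := (~` [set w | 1 < xi0 n%:Z w]) `|` (~` [set w | 1 < xi0 (Negz n) w]).
have mA n : measurable (A n).
  by apply: measurableU; apply: measurableC; exact: (measurable_gt fld).
have PA n : (P (A n) <= 0%:E)%E.
  have h z : (P (~` [set w | (1 < xi0 z w)%R]) <= 0%:E)%E.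
    by rewrite probability_setC ?(pareto_gt1 fld) ?subee//; exact: (measurable_gt fld).
  rewrite -[0%R]addr0; apply: prob_setU_le => //; by apply: measurableC; exact: (measurable_gt fld).
apply: (@rare_bound _ _ _ _ _ (fun=> 0)); first exact: cvg_cst.
apply: nearW => m; exists (\bigcup_n A n); split.
- exact: bigcupT_measurable.
- by apply: (@prob_exists_nat _ _ _ _ A (fun=> 0)) => // n; rewrite big1.
- move=> w [[n|n] h]; exists n => //; [left|right] => /=; lra.
Qed.

Lemma rare_big_pair : rare P (fun m => [set w | exists i,
  [/\ (0 < i <= N m)%N, ~~ c i w & b m < xi0 i%:Z w \/ b m < xi0 (- i%:Z) w]]).
Proof.
have h0 := eta_cut_tail alpha2 rho0 rhoE beta0 (field_p fld) etah ty.
apply: (@rare_bound _ _ _ _ _ (fun m => 2 * (etaPAM p (N m) * b m `^ (- alpha)))).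
  by rewrite -(mulr0 2); apply: cvgM => //; exact: cvg_cst.
near=> m.
have b1 : 1 <= b m by near: m; exact: seq_near_gey (cut_level_cvgy rho0 rhoE ty).
pose A i := ([set w | ~~ c i w] `&` [set w | b m < xi0 i%:Z w]) `|`
            ([set w | ~~ c i w] `&` [set w | b m < xi0 (- i%:Z) w]).
have mA2 i z : measurable ([set w | ~~ c i w] `&` [set w | b m < xi0 z w]).
  by apply: measurableI => //; exact: (measurable_gt fld).
have [||B [mB PB sB]] := @prob_exists_seq _ _ _ P _ (index_iota 1 (N m).+1) A
    (fun i => 2 * ((1 - p i) * b m `^ (- alpha))).
- by move=> i; apply: measurableU.
- move=> i; rewrite mem_index_iota => /andP[i0 _].
  by rewrite mulrDl mul1r; apply: prob_setU_le => //; rewrite coin_site_prob.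
exists B; split => //.
  by move: PB; rewrite -mulr_sumr -mulr_suml.
move=> w [i [iN ci h]]; apply: (sB i); first by rewrite mem_index_iota ltnS.
by case: h => h; [left|right].
Unshelve. all: by end_near. Qed.

Let inv_sq_sum (k n : nat) : (0 < k)%N -> \sum_(i < n) (k < i)%N%:R / (i%:R ^+ 2) <= (k%:R)^-1 :> R.
Proof.
move=> k0; have k0' : 0 < k%:R :> R by rewrite ltr0n.
suff : \sum_(i < n) (k < i)%N%:R / (i%:R ^+ 2) <= (k%:R)^-1 - (maxn k n.-1)%:R^-1 :> R.
  move=> h; apply: (le_trans h); rewrite gerBl invr_ge0//.
elim: n => [|n IH]; first by rewrite big_ord0 maxn0 subrr.
rewrite big_ord_recr /=; apply: (le_trans (lerD IH (lexx _))).
have [kn|kn] := ltnP k n; last first.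
  by rewrite mul0r addr0 (maxn_idPl _)// (leq_trans _ kn)// leq_pred.
case: n IH kn => // n _; rewrite ltnS => kn /=.
rewrite (maxn_idPr kn) mul1r.
have n0 : 0 < n%:R :> R by rewrite ltr0n (leq_trans k0).
have -> : (n.+1%:R : R) = n%:R + 1 by rewrite natr1.
rewrite -addrA lerD2l -subr_ge0.
rewrite (_ : _ - _ = 1 / (n%:R * (n%:R + 1) ^+ 2)); last by field; lra.
by rewrite divr_ge0// mulr_ge0 ?exprn_ge0//; lra.
Qed.

(** The threshold is half the travel cost a rho i / r, so that no such site can compete in [Psi].
    The union bound over all i beyond [N] is of order omega^(1 - alpha). *)
Lemma rare_far_site : rare P (fun m => [set w | exists i, (N m < i)%N /\
  (a m * rho * i%:R / (2 * r m) < xi0 i%:Z w \/ a m * rho * i%:R / (2 * r m) < xi0 (- i%:Z) w)]).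
Proof.
apply: (@rare_bound _ _ _ _ _ (fun m => 2 * (rho / 2) `^ (- alpha) * om m `^ (- (alpha - 1)))).
  rewrite -(mulr0 (2 * (rho / 2) `^ (- alpha))); apply: cvgM; first exact: cvg_cst.
  by apply: seq_powRN_cvg0 (cut_ratio_cvgy ty); have := alpha2; lra.
near=> m; have f : scale_facts alpha rho (t m) by near: m; exact: (scale_near rhoE ty).
have a0 := scale_height f; have c1 := scale_cut f; have r0 := scale_radius f.
have Nlb := scale_radius_lb f.
have a1 : 1 <= a m by near: m; exact: seq_near_gey (peak_height_cvgy rho0 rhoE ty).
have om2 : 2 / rho <= om m by near: m; exact: seq_near_gey (cut_ratio_cvgy ty).
have N0 : 0 < (N m)%:R :> R by rewrite ltr0n.
pose X (i : nat) : R := a m * rho * i%:R / (2 * r m).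
have X1 i : (N m < i)%N -> 1 <= X i.
  move=> Ni; have iN : (N m)%:R <= i%:R :> R by rewrite ler_nat ltnW.
  rewrite /X ler_pdivlMr ?mul1r; last by lra.
  apply: (@le_trans _ _ (1 * rho * (r m * om m))).
    by move: om2; rewrite ler_pdivrMr//; nra.
  apply: ler_pM; rewrite ?mul1r ?(ltW rho0)//; [by rewrite mulr_ge0 ?(ltW r0)//; lra | | by lra].
  by rewrite ler_peMl// (ltW rho0).
pose A i := if (N m < i)%N then [set w | X i < xi0 i%:Z w] `|` [set w | X i < xi0 (- i%:Z) w] else set0.
(* Write i^(- alpha) as i^(2 - alpha) / i^2 and bound the numerator by its value at [N]; the inverse
   squares beyond [N] sum to at most 1 / N. *)
pose C : R := 2 * (a m * rho / (2 * r m)) `^ (- alpha) * (N m)%:R `^ (2 - alpha).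
have C0 : 0 <= C by rewrite !mulr_ge0 ?powR_ge0.
have mA i : measurable (A i).
  by rewrite /A; case: ifP => // _; apply: measurableU; exact: (measurable_gt fld).
have PA i : (P (A i) <= (C * ((N m < i)%N%:R / i%:R ^+ 2))%:E)%E.
  rewrite /A; case: ifP => Ni; last by rewrite measure0 mul0r mulr0.
  have i0 : 0 < i%:R :> R by rewrite ltr0n (leq_ltn_trans _ Ni).
  have iN : (N m)%:R <= i%:R :> R by rewrite ler_nat ltnW.
  have XE : X i `^ (- alpha) = (a m * rho / (2 * r m)) `^ (- alpha) * (i%:R `^ (2 - alpha) / i%:R ^+ 2).
    rewrite (_ : X i = a m * rho / (2 * r m) * i%:R); last by rewrite /X; ring.
    rewrite powRM; [|by rewrite divr_ge0 ?(mulr_ge0 (ltW a0) (ltW rho0))//; lra|by lra]; congr (_ * _).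
    rewrite -powR_mulrn ?(ltW i0)// -powRN -powRD; first by congr powR; ring.
    by apply/implyP => _; rewrite (gt_eqF i0).
  apply: (@le_trans _ _ (X i `^ (- alpha) + X i `^ (- alpha))%:E).
    by apply: prob_setU_le; rewrite ?(field_tail fld) ?X1//; exact: (measurable_gt fld).
  rewrite lee_fin XE; set q := (_ / _) `^ (- alpha) in C C0 *.
  rewrite (_ : C * _ = q * (2 * ((N m)%:R `^ (2 - alpha) / i%:R ^+ 2))); last by rewrite /C (_ : true%:R = 1 :> R)//; ring.
  rewrite -mulrDr ler_wpM2l ?powR_ge0// -mulr2n -[leLHS]mulr_natl ler_pM2l//.
  rewrite ler_wpM2r ?invr_ge0 ?exprn_ge0 ?(ltW i0)//.
  have e (y : R) : y `^ (2 - alpha) = (y `^ (alpha - 2))^-1 by rewrite -powRN; congr powR; ring.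
  rewrite !e lef_pV2 ?posrE ?powR_gt0//.
  by apply: ge0_ler_powR => //; rewrite ?nnegrE ?(ltW i0) ?(ltW N0)//; have := alpha2; lra.
exists (\bigcup_i A i); split; first exact: bigcupT_measurable.
  apply: (@prob_exists_nat _ _ _ _ A _ _ mA PA) => n; rewrite -mulr_sumr.
  have h := inv_sq_sum n (ltn0Sn _ : (0 < N m)%N).
  apply: le_trans (ler_wpM2l C0 h) _; rewrite /C; set q := (a m * rho / _) `^ (- alpha); rewrite -!mulrA ler_pM2l//.
  have NE : (N m)%:R `^ (2 - alpha) / (N m)%:R = (N m)%:R `^ (- (alpha - 1)).
    rewrite -[X in _ / X]powRr1 ?(ltW N0)// -powRN -powRD; first by congr powR; ring.
    by apply/implyP => _; rewrite (gt_eqF N0).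
  rewrite NE.
  apply: (@le_trans _ _ (q * (r m * om m) `^ (- (alpha - 1)))).
    rewrite ler_wpM2l ?powR_ge0// !powRN lef_pV2 ?posrE ?powR_gt0//; last by rewrite mulr_gt0//; lra.
    have rc : 0 < r m * om m by rewrite mulr_gt0//; lra.
    by apply: ge0_ler_powR => //; rewrite ?nnegrE ?(ltW rc) ?(ltW N0)//; have := alpha2; lra.
  rewrite /q (_ : a m * rho / (2 * r m) = (rho / 2) * (a m / r m)); last by field; lra.
  rewrite powRM; [|by rewrite divr_ge0// (ltW rho0)|by rewrite divr_ge0 ?ltW].
  rewrite (powRM _ (ltW r0) (ltW (lt_trans ltr01 c1))).
  have e1 : (a m / r m) `^ (- alpha) * r m `^ (- (alpha - 1)) = 1.
    have -> : a m / r m = a m `^ (1 - alpha).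
      rewrite powRD ?powRr1 ?powRN ?(ltW a0)//.
      by apply/implyP => _; rewrite (gt_eqF a0).
    rewrite /peak_radius -!(powRrM (a m)) -powRD; last by apply/implyP => _; rewrite (gt_eqF a0).
    by rewrite (_ : _ + _ = 0) ?powRr0//; ring.
  by rewrite (mulrC (r m `^ _)) mulrACA e1 mulr1.
move=> w [i [Ni h]]; exists i => //; rewrite /A Ni.
by case: h => h; [left|right].
Unshelve. all: by end_near. Qed.

Definition duplicate_defects (n : nat) (w : T) : R := \sum_(1 <= i < n.+1) (~~ c i w)%:R.

(** Markov's inequality: the number of failed coins up to [N] has mean [etaPAM p (N m)]. *)
Lemma rare_defects (dl : R) : 0 < dl ->
  rare P (fun m => [set w | dl * a m ^+ 3 < b m * duplicate_defects (N m) w]).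
Proof.
move=> dl0; have h0 := eta_cut_mean alpha2 rho0 rhoE beta0 (field_p fld) etah ty.
apply: (@rare_bound _ _ _ _ _ (fun m => (etaPAM p (N m) * b m / a m ^+ 3) / dl)).
  by rewrite -(mul0r dl^-1); apply: cvgM => //; exact: cvg_cst.
near=> m; have f : scale_facts alpha rho (t m) by near: m; exact: (scale_near rhoE ty).
have a0 := scale_height f; have c1 := scale_cut f.
have b0 : 0 < b m by rewrite divr_gt0//; lra.
have bnc i : bmeas (fun w => (~~ c i w)%:R : R).
  apply: bmeas_bool; apply: (measurable_fun_bool true).
  by rewrite setTI (_ : _ @^-1` _ = [set w | ~~ c i w])//; apply/seteqP; split => w /=.
have bS : bmeas (duplicate_defects (N m)) by apply: bmeas_sum => i _; exact: bnc.
have ES : intT P (duplicate_defects (N m)) = etaPAM p (N m).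
  rewrite Rintegral_sum_prob//; rewrite /etaPAM !big_nat; apply: eq_bigr => i /andP[i0 _].
  transitivity (intT P (\1_[set w | ~~ c i w] : T -> R)).
    by apply: eq_Rintegral => w _; case: (boolP (~~ c i w)) => h; [rewrite /indic mem_set | rewrite /indic memNset//; exact/negP].
  rewrite Rintegral_indic_prob//.
  have := coin_site_prob 0 i0 (lexx 1); rewrite powR1 mulr1 => e1.
  have -> : P [set w | ~~ c i w] = P ([set w | ~~ c i w] `&` [set w | 1 < xi0 0 w]).
    apply: (prob_eq_ae (C := [set w | 1 < xi0 0 w])) => //.
    - by apply: measurableI => //; exact: (measurable_gt fld).
    - exact: (measurable_gt fld).
    - exact: (pareto_gt1 fld).
    - by move=> w h; apply/propext; split => [|[]].
  by rewrite e1.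
pose A := [set w | dl * a m ^+ 3 < b m * duplicate_defects (N m) w].
have mA : measurable A.
  rewrite (_ : A = (fun w => b m * duplicate_defects (N m) w) @^-1` `]dl * a m ^+ 3, +oo[%classic).
    have [mf _] := bmeasM (bmeas_cst (b m)) bS.
    by rewrite -[X in measurable X]setTI; exact: mf.
  by apply/seteqP; split => w /=; rewrite in_itv /= andbT.
exists A; split => //.
have da : 0 < dl * a m ^+ 3 by rewrite mulr_gt0// exprn_gt0.
rewrite -(fineK (fin_num_measure P _ mA)) lee_fin -Rintegral_indic_prob//.
have : intT P (fun w => dl * a m ^+ 3 * \1_A w) <=
       intT P (fun w => b m * duplicate_defects (N m) w).
  apply: le_Rintegral_prob.
  - by apply: bmeasM; [exact: bmeas_cst | exact: bmeas_indic].
  - by apply: bmeasM => //; exact: bmeas_cst.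
  move=> w; rewrite indicE; have [|_] := boolP (w \in A).
    by rewrite inE /A /= mulr1 => /ltW.
  by rewrite mulr0 mulr_ge0 ?(ltW b0)// sumr_ge0.
rewrite !RintegralZl_prob//; last exact: bmeas_indic.
rewrite ES => h; rewrite (_ : _ / dl = b m * etaPAM p (N m) / (dl * a m ^+ 3)).
  by rewrite ler_pdivlMr// mulrC.
by field; rewrite ?gt_eqF.
Unshelve. all: by end_near. Qed.

(** There are of order r candidate positions, each sufficiently high with probability of order 1 /
    r. The expected number of failed coins near a candidate is thus of the order of 1 - p(i) at far
    sites, which tends to 0. *)
Lemma rare_near_peak (e K : R) (k : nat) : 0 < e ->
  rare P (fun m => [set w | exists n i, [/\ e < n%:R / r m <= K, 2 * e * a m < xi0 n%:Z w,
     (i <= n + k)%N, (n <= i + k)%N & ~~ c i w]]).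
Proof.
move=> e0 eta eta0.
have [K0|K0] := ltP K 0.
  near=> m; have f : scale_facts alpha rho (t m) by near: m; exact: (scale_near rhoE ty).
  exists set0; split; rewrite ?measure0 ?lee_fin ?(ltW eta0)// => w [n [i [/andP[h1 h2] _ _ _ _]]]; lra.
pose D : R := (K + 1) * (2 * k.+1%:R) * (2 * e) `^ (- alpha).
have D0 : 0 < D by rewrite !mulr_gt0 ?powR_gt0//; lra.
have de : 0 < eta / D by rewrite divr_gt0.
have [M0 _ hM0] : \forall i \near \oo, 1 - p i <= eta / D.
  near=> i; apply: (le_trans (ler_norm _)); near: i.
  by have /cvgrPdist_le := p1; apply.
near=> m; have f : scale_facts alpha rho (t m) by near: m; exact: (scale_near rhoE ty).
have a0 := scale_height f; have r0 := scale_radius f.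
have r1 : 1 <= r m by near: m; exact: seq_near_gey (peak_radius_cvgy alpha2 rho0 rhoE ty).
have rM : (M0 + k + 1)%:R / e <= r m by near: m; exact: seq_near_gey (peak_radius_cvgy alpha2 rho0 rhoE ty).
have a1 : 1 / (2 * e) <= a m by near: m; exact: seq_near_gey (peak_height_cvgy rho0 rhoE ty).
have x1 : 1 <= 2 * e * a m by move: a1; rewrite ler_pdivrMr; lra.
(* [u] is a position with an offset: the coin has index [u.1 + u.2 - k], where [u.2] runs up to
   [2 * k]. The positions are large, so the subtraction is not truncated. *)
pose A (u : nat * nat) : set T := if e < u.1%:R / r m <= K then
  [set w | ~~ c (u.1 + u.2 - k)%N w] `&` [set w | 2 * e * a m < xi0 u.1%:Z w] else set0.
pose mx := Num.truncn (K * r m).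
have Kr : 0 <= K * r m by rewrite mulr_ge0// ltW.
have [||B [mB PB sB]] := @prob_exists_seq _ _ _ P _
    [seq (n, j) | n <- iota 0 mx.+1, j <- iota 0 (2 * k).+1] A
    (fun=> eta / D * (2 * e * a m) `^ (- alpha)).
- by move=> u; rewrite /A; case: ifP => // _; apply: measurableI => //; exact: (measurable_gt fld).
- move=> [n j] _; rewrite /A /=; case: ifP => [/andP[h1 h2]|_]; last first.
    by rewrite measure0 lee_fin mulr_ge0 ?powR_ge0// ltW.
  have nM : (M0 + k + 1 < n)%N.
    rewrite -(ltr_nat R); move: h1; rewrite ltr_pdivlMr//; apply: le_lt_trans.
    by move: rM; rewrite ler_pdivrMr//; lra.
  have [i0 iM] : (0 < n + j - k)%N /\ (M0 <= n + j - k)%N by move: nM; clear; lia.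
  rewrite (coin_site_prob n%:Z i0 x1) lee_fin; apply: ler_wpM2r; first exact: powR_ge0.
  exact: hM0.
exists B; split => //.
  apply: (le_trans PB); rewrite lee_fin big_const_seq count_predT size_allpairs !size_iota iter_addr_0.
  rewrite powRM; [|by lra|by lra].
  have -> : a m `^ (- alpha) = (r m)^-1 by rewrite powRN.
  rewrite -[leLHS]mulr_natr natrM.
  have mxK : mx.+1%:R <= (K + 1) * r m.
    rewrite -natr1 mulrDl mul1r lerD// truncn_le; exact: Kr.
  have kk : (2 * k).+1%:R <= 2 * k.+1%:R :> R by rewrite -natrM ler_nat mulnS addSn ltnS leq_addl.
  apply: (@le_trans _ _ (eta / D * ((2 * e) `^ (- alpha) / r m) * ((K + 1) * r m * (2 * k.+1%:R)))).
    rewrite ler_wpM2l ?mulr_ge0 ?powR_ge0 ?invr_ge0 ?(ltW r0) ?(ltW de)//; last exact: ler_pM.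
    by rewrite (ltW eta0).
    by rewrite (ltW D0).
  rewrite (_ : _ * _ * _ = eta / D * D); last first.
    by rewrite /D; move: (eta / _) => z; field; rewrite (gt_eqF r0).
  by rewrite divfK// gt_eqF.
move=> w [n [i [h1 h2 h3 h4 h5]]].
have [j1 j2] : (i + k - n <= 2 * k)%N /\ (n + (i + k - n) - k = i)%N by move: h3 h4; clear; lia.
apply: (sB (n, (i + k - n)%N)); last by rewrite /A /= h1 j2.
apply: allpairs_f; rewrite mem_iota add0n ltnS//.
by rewrite /mx truncn_ge_nat//; case/andP: h1 => _; rewrite ler_pdivrMr.
Unshelve. all: by end_near. Qed.

Record good_sites (e K dl : R) (k m : nat) (w : T) : Prop := GoodSites {
  good_ge1 : forall z, 1 <= xi0 z w;
  good_pair : forall i, (0 < i <= N m)%N -> ~~ c i w -> xi0 i%:Z w <= b m /\ xi0 (- i%:Z) w <= b m;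
  good_far : forall i, (N m < i)%N -> xi0 i%:Z w <= a m * rho * i%:R / (2 * r m) /\
    xi0 (- i%:Z) w <= a m * rho * i%:R / (2 * r m);
  good_defects : b m * duplicate_defects (N m) w <= dl * a m ^+ 3;
  good_near_peak : forall n i, e < n%:R / r m <= K -> 2 * e * a m < xi0 n%:Z w ->
    (i <= n + k)%N -> (n <= i + k)%N -> c i w }.

Lemma good_sites_near (e K dl eta : R) (k : nat) : 0 < e -> 0 < dl -> 0 < eta ->
  \forall m \near \oo, exists A, [/\ measurable A, ((1 - eta)%:E <= P A)%E &
    forall w, A w -> good_sites e K dl k m w].
Proof.
move=> e0 dl0 eta0.
have := rare_compl (rareU (rareU (rareU (rareU rare_below1 rare_big_pair) rare_far_site) (rare_defects dl0))
  (@rare_near_peak e K k e0)) eta0.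
apply: filterS => m [A [mA PA hA]]; exists A; split => // w /hA h; split.
- by move=> z; rewrite leNgt; apply/negP => z1; apply: h; do 4 left; exists z.
- move=> i iN ci; split; rewrite leNgt; apply/negP => z1; apply: h; do 3 left; right; exists i; split => //.
    by left.
  by right.
- move=> i iN; split; rewrite leNgt; apply/negP => z1; apply: h; do 2 left; right; exists i; split => //.
    by left.
  by right.
- by rewrite leNgt; apply/negP => z1; apply: h; left; right.
- move=> n i h1 h2 h3 h4; apply/negPn/negP => ci; apply: h; right; exists n, i; split => //.
Qed.

End GoodSites.

(** * Deterministic estimates in a typical environment *)

Section PeakArithmetic.
Context {R : realType}.
Variables (a r L t rho e K s : R) (n : nat).
Local Notation x := (n%:R / r).
Local Notation y := (a * (s + rho * x)).
Hypotheses (a1 : 1 <= a) (r0 : 0 < r) (L1 : 1 < L) (rho0 : 0 < rho) (e0 : 0 < e).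
Hypotheses (rate : r * L = a * t) (lnaE : ln a = rho * (L - ln L)).
Hypotheses (xb : e < x <= K) (sb : 2 * e < s <= K).
Let a0 : 0 < a. Proof. by have h := a1; lra. Qed.
Let L0 : 0 < L. Proof. by have h := L1; lra. Qed.
Let l0 : 0 <= ln L. Proof. by rewrite ln_ge0// ltW. Qed.
Let t0 : 0 < t. Proof. by rewrite -(pmulr_rgt0 t a0) -rate mulr_gt0. Qed.
Let K0 : 0 < K. Proof. by have h := e0; case/andP: xb => h1 h2; lra. Qed.
Let s0 : 0 < s. Proof. by have h := e0; case/andP: sb => h1 h2; lra. Qed.
Let x0 : 0 < x. Proof. by have h := e0; case/andP: xb => h1 h2; lra. Qed.
Let y_le : y <= a * (K * (1 + rho)).
Proof.
have ro := rho0; case/andP: xb => _ xK; case/andP: sb => _ sK; rewrite ler_pM2l//.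
by have := ler_wpM2l (ltW ro) xK; rewrite mulrDr mulr1 (mulrC K); lra.
Qed.
Let y0 : 0 < y. Proof. by rewrite mulr_gt0// addr_gt0// mulr_gt0. Qed.

Let psiE (V : int -> R) (z : nat) :
  Psi V t z%:Z = V z%:Z - a * (z%:R / r) * (ln (V z%:Z) / L).
Proof.
rewrite /Psi absz_nat -[z%:R / t](_ : a * (z%:R / r) / L = _); first by ring.
have -> : t = r * L / a by rewrite rate mulrAC divff ?mul1r// gt_eqF.
by field; rewrite !gt_eqF.
Qed.

(** The peak has [Psi] at least a (s - e / 4), any competitor at most a (s - e / 2). The margin [e]
    of the barrier pays for replacing the logarithm of the potential by rho L in both travel
    costs. *)
Lemma peak_psi (V : int -> R) (N : nat) (om : R) :
  V n%:Z = y -> N%:R / r <= om ->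
  (forall z : nat, 1 <= V z%:Z) ->
  (forall z : nat, (z <= N)%N -> z != n -> V z%:Z <= a * (s - e + rho * (z%:R / r))) ->
  (forall z : nat, (N < z)%N -> V z%:Z <= a * rho * z%:R / (2 * r)) ->
  4 * K * `|ln (K * (1 + rho))| <= e * L ->
  2 * om * (rho * ln L + `|ln e|) <= e * L ->
  2 * (rho * ln L + `|ln e|) <= rho * L ->
  forall z : nat, z != n -> Psi V t z%:Z < Psi V t n%:Z.
Proof.
move=> Vn Nom V1 Vnear Vfar H1 H2 H3 z zn.
have ro := rho0; have he := e0; have hl := l0; have ha := a0; have hK := K0.
have /andP[xe xK] := xb; have /andP[se sK] := sb.
have up : Psi V t z%:Z <= a * (s - e / 2).
  rewrite psiE; have v1 := V1 z; set v := V z%:Z in v1 *.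
  have zr0 : 0 <= z%:R / r by rewrite divr_ge0// ltW.
  have lv : 0 <= ln v by rewrite ln_ge0.
  (* A value below this loses at once, since the travel cost is nonnegative. Above it, [ln v] is at
     least [ln a + ln e], so the cost is nearly the linear one. *)
  have [vs|vs] := leP v (a * (s - e)).
    apply: (@le_trans _ _ (a * (s - e))); last by rewrite ler_pM2l//; lra.
    by apply: le_trans vs; rewrite gerBl; exact: mulr_ge0 (mulr_ge0 (ltW a0) zr0) (divr_ge0 lv (ltW L0)).
  have lnv : ln a + ln e <= ln v.
    rewrite -lnM ?posrE// ler_ln ?posrE ?mulr_gt0//; last by lra.
    by apply/ltW; apply: le_lt_trans vs; rewrite ler_pM2l//; lra.
  have q : rho - (rho * ln L + `|ln e|) / L <= ln v / L.
    rewrite ler_pdivlMr// mulrBl divfK ?gt_eqF//; apply: le_trans lnv; rewrite lnaE.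
    by have := ler_norm (- ln e); rewrite normrN; lra.
  have {}q : a * (z%:R / r) * (rho - (rho * ln L + `|ln e|) / L) <= a * (z%:R / r) * (ln v / L).
    by rewrite ler_wpM2l// mulr_ge0// ltW.
  have [zN|zN] := leqP z N.
    have h1 := Vnear z zN zn; rewrite -/v in h1.
    have h2 : (z%:R / r) * ((rho * ln L + `|ln e|) / L) <= e / 2.
      apply: (@le_trans _ _ (om * ((rho * ln L + `|ln e|) / L))).
        rewrite ler_wpM2r//; first by rewrite divr_ge0 ?addr_ge0 ?mulr_ge0// ltW.
        by apply: le_trans Nom; rewrite ler_pM2r ?invr_gt0// ler_nat.
      by rewrite mulrA ler_pdivrMr//; lra.
    have h3 : a * ((z%:R / r) * ((rho * ln L + `|ln e|) / L)) <= a * (e / 2) by rewrite ler_pM2l.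
    by move: q h1 h3; rewrite !mulrBr !mulrDr -!mulrA; lra.
  (* Beyond [N] the potential is at most half of a rho z / r, and the true cost at least half of it,
     so [Psi] is not positive. *)
  have h1 := Vfar z zN; rewrite -/v in h1.
  have h2 : (rho * ln L + `|ln e|) / L <= rho / 2 by rewrite ler_pdivrMr//; lra.
  have h3 : a * (z%:R / r) * (rho / 2) <= a * (z%:R / r) * (rho - (rho * ln L + `|ln e|) / L).
    by rewrite ler_wpM2l//; [rewrite mulr_ge0// ltW | lra].
  have h4 : a * rho * z%:R / (2 * r) = a * (z%:R / r) * (rho / 2) by field; rewrite gt_eqF.
  have h5 : 0 < a * (s - e / 2) by rewrite mulr_gt0//; lra.
  by move: (ln v / L) q h3 => q'; lra.
apply: (le_lt_trans up).
suff : a * (s - e / 4) <= Psi V t n%:Z.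
  by apply: lt_le_trans; rewrite ltr_pM2l//; lra.
rewrite psiE Vn.
have h1 : ln y / L <= rho + `|ln (K * (1 + rho))| / L.
  rewrite ler_pdivrMr// mulrDl divfK ?gt_eqF//.
  have : ln y <= ln (a * (K * (1 + rho))).
    by rewrite ler_ln ?posrE//; rewrite mulr_gt0// mulr_gt0//; lra.
  have -> : ln (a * (K * (1 + rho))) = ln a + ln (K * (1 + rho)).
    by rewrite lnM ?posrE// mulr_gt0//; lra.
  have : 0 <= rho * ln L by rewrite mulr_ge0// ltW.
  have := ler_norm (ln (K * (1 + rho))); rewrite lnaE; lra.
have h2 : x * (`|ln (K * (1 + rho))| / L) <= e / 4.
  apply: (@le_trans _ _ (K * (`|ln (K * (1 + rho))| / L))).
    by rewrite ler_wpM2r// divr_ge0// ltW.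
  by rewrite mulrA ler_pdivrMr//; lra.
have h3 : a * x * (ln y / L) <= a * x * (rho + `|ln (K * (1 + rho))| / L).
  by rewrite ler_wpM2l// mulr_ge0// ltW.
have h4 : a * (x * (`|ln (K * (1 + rho))| / L)) <= a * (e / 4) by rewrite ler_pM2l.
move: h3 h4; move: (ln y / L) (`|_| / L) => u v; rewrite !mulrBr !mulrDr -!mulrA; lra.
Qed.

Let pow_fact (j : nat) : (0 < j)%N -> (2 * t) ^+ j / j`!%:R <= (2 * t / j%:R * expR 1) ^+ j.
Proof.
move=> j0; have j0' : 0 < j%:R :> R by rewrite ltr0n.
have h : j%:R ^+ j / j`!%:R <= expR 1 ^+ j :> R.
  rewrite -expRM_natl mulr1; case: j j0 {j0'} => // j _.
  have := @expR_ge1Dxn R j.+1%:R j; rewrite ler0n => /(_ isT); lra.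
have -> : (2 * t) ^+ j / j`!%:R = (2 * t / j%:R) ^+ j * (j%:R ^+ j / j`!%:R).
  by rewrite expr_div_n mulrA divfK// expf_neq0// gt_eqF.
by rewrite [leRHS]exprMn ler_wpM2l// exprn_ge0// divr_ge0 ?mulr_ge0// ltW.
Qed.

Definition tail_scale (delta : R) : R := delta * (expR ((y - 2) * t) * (y + 1) ^- n).

(** A detour of i = j - n extra jumps reaches sites at distance at most (j + n) / 2, whose higher
    potential can gain at most rho L i / 2 in the exponent, by r L = a t. The factor (2 t)^j / j!
    costs about ln a, that is rho L up to terms in ln L, per jump; [n] of these are matched by (y +
    1)^(- n), so the balance is about - rho L i / 2. As [i] is of order [r], lower order terms are
    absorbed. *)
Lemma peak_tail (V : int -> R) (delta : R) (mm j : nat) : 0 < delta ->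
  (forall z : int, V z <= a * (s + rho * (`|z|%N%:R / r))) ->
  e * r / (2 + 2 * rho) < mm.+1%:R -> (n + mm + mm + 2 <= j)%N ->
  let D1 := `|ln (4 * expR 1 / e)| in let D2 := `|ln (K * (1 + rho) + 1)| in
  D1 + (1 + rho) * ln L + K * (1 + rho) / e * (D1 + ln L + D2) + 1 <= rho / 2 * L ->
  ln 2 - ln delta <= e / (1 + rho) * r ->
  fk predT V n%:Z j t 0 <= tail_scale delta / 2 ^+ j.+1.
Proof.
move=> d0 hV hm hj D1 D2 H4 H5.
have ro := rho0; have he := e0; have hl := l0; have ha := a0; have hK := K0; have ht := t0.
have /andP[xe xK] := xb; have /andP[se sK] := sb.
have hr := r0; have hL := L0.
have nj : (n <= j)%N by move: hj; clear; lia.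
pose i : R := j%:R - n%:R.
have i0 : e / (1 + rho) * r <= i.
  have : (n%:R + mm.+1%:R + mm.+1%:R : R) <= j%:R by rewrite -!natrD ler_nat; move: hj; clear; lia.
  have : e / (1 + rho) * r = 2 * (e * r / (2 + 2 * rho)) by field; lra.
  by rewrite /i; lra.
have nr : n%:R = x * r by rewrite divfK// gt_eqF.
have n0 : (0 < n)%N by rewrite lt0n; apply/negP => /eqP n00; have := x0; rewrite n00 mul0r ltxx.
have j0 : (0 < j)%N by exact: leq_trans nj.
have j0' : 0 < j%:R :> R by rewrite ltr0n.
pose M := a * (s + rho * (j%:R + n%:R) / (2 * r)) - 2.
have f1 : fk predT V n%:Z j t 0 <= poisson_weight M j t.
  (* Exactly the sites that a path of [j] jumps from 0 to [n] can visit, so restricting to them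
     changes nothing and bounds the potential. *)
  pose B : pred int := fun z => (`|z| + `|z - n%:Z| <= j)%N.
  rewrite -(@fk_box R B V n%:Z j t 0); last by move=> z; rewrite /B -ltnNge subr0.
  apply: fk_crude; first exact: ltW.
  move=> z Bz _; rewrite /M lerD2r; apply: (le_trans (hV z)); rewrite ler_pM2l// lerD2l.
  have h : (2 * `|z|%N%:R : R) <= j%:R + n%:R by rewrite -natrM -natrD ler_nat; move: Bz; rewrite /B; clear; lia.
  rewrite [leRHS](_ : _ = rho * ((j%:R + n%:R) / 2 / r)); last by field; rewrite gt_eqF.
  by rewrite ler_pM2l// ler_pM2r ?invr_gt0//; lra.
apply: (le_trans f1).
have ME : M * t = (y - 2) * t + rho * L * i / 2.
  have tE : t = r * L / a by rewrite rate mulrAC divff ?mul1r// gt_eqF.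
  by rewrite /M /i tE; field; rewrite !gt_eqF.
rewrite /poisson_weight ME expRD /tail_scale.
rewrite -(mulrA (expR _)) (mulrCA delta) -(mulrA (expR _) (_ * _)) ler_pM2l ?expR_gt0//.
have y1 : 0 < y + 1 by have := y0; lra.
have q0 : 0 < 4 * expR 1 / e by rewrite divr_gt0 ?mulr_gt0 ?expR_gt0.
have C0 : 0 < K * (1 + rho) + 1 by rewrite addr_gt0 ?mulr_gt0//; lra.
have e1 : (2 * t) ^+ j / j`!%:R * 2 ^+ j.+1 <= 2 * expR (j%:R * (D1 + ln L - ln a)).
  apply: (@le_trans _ _ (2 * (4 * expR 1 / e * L / a) ^+ j)).
    rewrite exprS mulrCA ler_pM2l//.
    apply: le_trans (ler_wpM2r _ (pow_fact j0)) _; first by rewrite exprn_ge0.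
    rewrite -exprMn; apply: lerXn2r; rewrite ?nnegrE.
    - by rewrite !mulr_ge0 ?invr_ge0 ?expR_ge0// ltW.
    - exact: divr_ge0 (mulr_ge0 (ltW q0) (ltW hL)) (ltW ha).
    have -> : t = r * L / a by rewrite rate mulrAC divff ?mul1r// gt_eqF.
    rewrite [leLHS](_ : _ = 4 * expR 1 * L / a * (r / j%:R)); last by field; rewrite !gt_eqF.
    rewrite [leRHS](_ : _ = 4 * expR 1 * L / a * e^-1); last by field; rewrite !gt_eqF.
    apply: ler_wpM2l; first by rewrite divr_ge0 ?mulr_ge0 ?expR_ge0// ltW.
    rewrite -[r]invrK -invfM lef_pV2 ?posrE ?mulr_gt0 ?invr_gt0// mulrC.
    by apply: le_trans (ltW xe) _; rewrite ler_pM2r ?invr_gt0// ler_nat.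
  rewrite ler_pM2l// expRM_natl; apply: lerXn2r; rewrite ?nnegrE ?expR_ge0//.
    exact: divr_ge0 (mulr_ge0 (ltW q0) (ltW hL)) (ltW ha).
  have qL : 4 * expR 1 / e * L / a \in Num.pos by rewrite posrE; exact: divr_gt0 (mulr_gt0 q0 hL) ha.
  rewrite -[leLHS](lnK qL) ler_expR ln_div ?posrE ?(mulr_gt0 q0 hL)//.
  by rewrite lnM ?posrE// lerD2r lerD2r ler_norm.
have e2 : (y + 1) ^+ n <= expR (n%:R * (D2 + ln a)).
  rewrite expRM_natl; apply: lerXn2r; rewrite ?nnegrE ?expR_ge0// ?(ltW y1)//.
  apply: (@le_trans _ _ (a * (K * (1 + rho) + 1))).
    by rewrite [leRHS]mulrDr mulr1; exact: lerD y_le a1.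
  have aC : a * (K * (1 + rho) + 1) \in Num.pos by rewrite posrE mulr_gt0.
  rewrite -[leLHS](lnK aC) ler_expR lnM ?posrE// addrC lerD2r.
  exact: ler_norm.
have e3 : expR (rho * L * i / 2) * (2 * expR (j%:R * (D1 + ln L - ln a))) * expR (n%:R * (D2 + ln a)) <= delta.
  have two : 2 = expR (ln 2) :> R by rewrite lnK// posrE.
  rewrite [X in _ * (X * _)]two -!expRD -[leRHS]lnK ?posrE// ler_expR.
  have jE : j%:R = i + n%:R by rewrite /i subrK.
  have D10 : 0 <= D1 by exact: normr_ge0.
  have D20 : 0 <= D2 by exact: normr_ge0.
  have ni : n%:R <= K * (1 + rho) / e * i.
    apply: (@le_trans _ _ (K * r)); first by rewrite nr ler_pM2r.
    have -> : K * r = K * (1 + rho) / e * (e / (1 + rho) * r) by field; rewrite !gt_eqF//; lra.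
    by rewrite ler_wpM2l// divr_ge0 ?mulr_ge0//; lra.
  have ip : 0 <= i by apply: le_trans i0; rewrite mulr_ge0 ?divr_ge0//; lra.
  have h1 : n%:R * (D1 + ln L + D2) <= K * (1 + rho) / e * i * (D1 + ln L + D2).
    by rewrite ler_wpM2r// !addr_ge0.
  have h2 : i * (D1 + (1 + rho) * ln L + K * (1 + rho) / e * (D1 + ln L + D2) + 1) <= i * (rho / 2 * L).
    by rewrite ler_wpM2l.
  rewrite jE lnaE; move: h1 h2 H5 i0.
  move: (K * (1 + rho) / e) (e / (1 + rho) * r) (ln 2) (ln delta) (ln L) (n%:R : R) => k1 k2 k3 k4 k5 k6.
  by move=> g1 g2 g3 g4; clear ni e1 e2 jE ME f1; lra.
have p2 : 0 < 2 ^+ j.+1 :> R by rewrite exprn_gt0.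
rewrite ler_pdivlMr// ler_pdivlMr ?exprn_gt0//.
have p0 : 0 <= (2 * t) ^+ j / j`!%:R by rewrite divr_ge0// exprn_ge0// mulr_ge0// ltW.
apply: le_trans e3; apply: ler_pM => //.
- by rewrite mulr_ge0 ?(ltW p2)// mulr_ge0 ?expR_ge0.
- by rewrite exprn_ge0 ?(ltW y1).
- by rewrite -(mulrA (expR _)) ler_wpM2l ?expR_ge0.
Qed.

End PeakArithmetic.

Section PotentialCases.
Context {R : realType} {T : Type} (xi0 : int -> T -> R) (c : nat -> T -> bool) (w : T).
Local Notation V := (potential xi0 c w).

Lemma potential_neg (q : nat) : V (- q%:Z) = if (0 < q)%N && ~~ c q w then xi0 (- q%:Z) w else xi0 q%:Z w.
Proof. by case: q => [|q]; rewrite ?oppr0//= -NegzE; case: (c _ w). Qed.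

Lemma potential_cases z : V z = xi0 `|z|%N%:Z w \/
  [/\ (0 < `|z|)%N, ~~ c `|z|%N w & V z = xi0 (- `|z|%N%:Z) w].
Proof.
case: (intP z) => [|q|q]; [by left | by left |].
by rewrite potential_neg abszN absz_nat /=; case: (boolP (c _ w)) => h; [left | right].
Qed.

Lemma sum_rev_nat (n : nat) (F : int -> R) :
  \sum_(1 <= i < n.+1) F (n%:Z - i%:Z) = \sum_(0 <= j < n) F j%:Z.
Proof.
rewrite big_nat_rev big_add1 /=; apply: eq_big_nat => j jn; congr F.
by move: jn; clear; lia.
Qed.

Lemma le_sum_nat_sub (p q N : nat) (g : nat -> R) : (forall i, 0 <= g i) -> (q <= N)%N ->
  \sum_(p <= i < q) g i <= \sum_(0 <= i < N) g i.
Proof.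
move=> g0 qN; rewrite (big_nat_widen _ _ _ _ _ qN) (big_nat_widenl _ 0)// [leLHS]big_mkcond.
by apply: ler_sum => i _; case: ifP.
Qed.

(** Going from the peak through 0 to [- mm] meets each mirror pair at most twice, whence the factor
    2; a pair counts only if drawn separately, and then both values lie between 0 and [b]. *)
Lemma potential_asym_sum (n mm N : nat) (b : R) : (n + mm <= N)%N ->
  (forall z, 0 <= V z) -> (forall i, (0 < i <= N)%N -> ~~ c i w -> xi0 i%:Z w <= b /\ xi0 (- i%:Z) w <= b) ->
  0 <= b ->
  \sum_(1 <= i < (n + mm).+1) `|V (n%:Z - i%:Z) - V (- (n%:Z - i%:Z))| <= 2 * (b * \sum_(1 <= i < N.+1) (~~ c i w)%:R).
Proof.
move=> nN V0 hb b0; pose g q : R := ((0 < q)%N && ~~ c q w)%:R.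
have g0 q : 0 <= g q by [].
have hg (z : int) : (`|z| <= N)%N -> `|V z - V (- z)| <= b * g `|z|%N.
  move=> zN; wlog zE : z zN / z = `|z|%N%:Z.
    move=> h; case: (intP z) zN => [|q|q] zN; [exact: h|exact: h|].
    by rewrite distrC opprK abszN -{3}(absz_nat q.+1); apply: h; rewrite ?absz_nat// -(abszN q.+1%:Z).
  rewrite zE potential_neg absz_nat /g; set q := `|z|%N in zN *.
  case: (boolP (_ && _)) => [/andP[q0 cq]|_]; last by rewrite subrr normr0 mulr0.
  have [h1 h2] : xi0 q%:Z w <= b /\ xi0 (- q%:Z) w <= b by apply: hb; rewrite ?q0.
  have h3 := V0 q%:Z; have h4 := V0 (- q%:Z); rewrite potential_neg q0 cq /= in h4.
  by rewrite mulr1 ler_norml; move: h3 => /=; lra.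
have gN p q : (q <= N.+1)%N -> \sum_(p <= i < q) g i <= \sum_(1 <= i < N.+1) (~~ c i w)%:R.
  move=> qN; apply: (le_trans (le_sum_nat_sub p g0 qN)).
  rewrite big_ltn// /g /= add0r !big_nat.
  by apply: ler_sum => i /andP[-> _].
rewrite (big_cat_nat _ (n := n.+1))//=; last by rewrite ltnS leq_addr.
rewrite (sum_rev_nat n (fun z => `|V z - V (- z)|)) mulr_natl mulr2n; apply: lerD.
  apply: (@le_trans _ _ (b * \sum_(0 <= j < n) g j)); last first.
    by rewrite ler_wpM2l// gN// ltnW// ltnS (leq_trans _ nN)// leq_addr.
  rewrite mulr_sumr !big_nat; apply: ler_sum => j /andP[_ jn].
  by apply: (hg j%:Z); rewrite absz_nat; move: jn nN; clear; lia.
apply: (@le_trans _ _ (b * \sum_(1 <= j < mm.+1) g j)); last first.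
  by rewrite ler_wpM2l// gN// ltnS (leq_trans _ nN)// leq_addl.
rewrite -{1}[n.+1]add1n (_ : (n + mm).+1 = (mm.+1 + n)%N); last by rewrite addSn addnC.
rewrite big_addn addnK mulr_sumr !big_nat; apply: ler_sum => j /andP[_ jn].
have -> : n%:Z - (j + n)%N%:Z = - j%:Z by clear; lia.
by have := hg (- j%:Z); rewrite abszN absz_nat; apply; move: jn nN; clear; lia.
Qed.

End PotentialCases.

(** Inequalities between the scales that hold at all large times, collected so that the analysis
    concerns one environment at one time. The exponent in the last one is the power of 1 / G in the
    level error (16 / G^2)^k (8 / G). *)
Record peak_window {R : realType} (rho e K delta a r L t om b : R) (N k : nat) : Prop := PeakWindow {
  win_ln : 1 < L;
  win_cut : 1 < om;
  win_height : 1 <= a;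
  win_radius : 1 <= r;
  win_time : 0 < t;
  win_rate : r * L = a * t;
  win_ln_height : ln a = rho * (L - ln L);
  win_level : b = a / om;
  win_N_lb : r * om <= N%:R;
  win_N_ub : N%:R <= r * om + 1;
  win_gap : (8 + 32 / delta) * (2 / e) <= a;
  win_delta : (ln 2 - ln delta) / (e / (1 + rho)) <= r;
  win_ln_delta : - ln delta <= r;
  win_cut_range : K + e <= om;
  win_cut_inv : e^-1 <= om;
  win_ln_range : 4 * K * `|ln (K * (1 + rho))| / e <= L;
  win_ln_rate : 8 * (4 * K + 1) / e <= L;
  win_ln_ln : 1 <= ln L;
  win_psi_near : om * ln L * (4 * (rho + `|ln e|) / e) <= L;
  win_psi_far : om * ln L * (2 * (rho + `|ln e|) / rho) <= L;
  win_tail : om * ln L * (2 * (`|ln (4 * expR 1 / e)| + (1 + rho) + K * (1 + rho) / e *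
    (`|ln (4 * expR 1 / e)| + 1 + `|ln (K * (1 + rho) + 1)|) + 1) / rho) <= L;
  win_power : t / a ^+ (k + k).+1 <= delta / (16 ^+ k * 8 * (2 / e) ^+ (k + k).+1) }.

Local Notation site_sum V y n := (\sum_(1 <= i < n.+1)
  (ln (y - V (- (n%:Z - i%:Z))) - ln (y - V (n%:Z - i%:Z)))).

(** Of the 11 [delta], 2 come from the level error times [t], 8 from the bounds on the box for the
    two potentials, and 1 from the asymmetry along the arms. *)
Lemma peak_fixed {R : realType} {T : Type} (xi0 : int -> T -> R) (c : nat -> T -> bool) (w : T)
    (a r L t om b rho e K s delta : R) (N n k : nat) :
  0 < rho -> 0 < e -> 0 < K -> 0 < delta -> delta <= 1 / 8 ->
  peak_window rho e K delta a r L t om b N k ->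
  (forall z, 1 <= xi0 z w) ->
  (forall i, (0 < i <= N)%N -> ~~ c i w -> xi0 i%:Z w <= b /\ xi0 (- i%:Z) w <= b) ->
  (forall i, (N < i)%N -> xi0 i%:Z w <= a * rho * i%:R / (2 * r) /\
    xi0 (- i%:Z) w <= a * rho * i%:R / (2 * r)) ->
  b * \sum_(1 <= i < N.+1) (~~ c i w)%:R <= delta * e ^+ 3 / 384 * a ^+ 3 ->
  (forall i, (i <= n + k)%N -> (n <= i + k)%N -> c i w) ->
  e < n%:R / r <= K -> 2 * e < s <= K ->
  xi0 n%:Z w = a * (s + rho * (n%:R / r)) ->
  (forall i, (i <= N)%N -> i != n -> xi0 i%:Z w <= a * (s - e + rho * (i%:R / r))) ->
  let V := potential xi0 c w in
  [/\ V n%:Z = V (- n%:Z),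
  forall z : nat, z != n -> Psi V t z%:Z < Psi V t n%:Z,
  0 < fk_total n t V, 0 < fk_total n t (fun z => V (- z)) &
  `|ln (fk_total n t V) - ln (fk_total n t (fun z => V (- z))) -
    site_sum V (a * (s + rho * (n%:R / r))) n| <= 11 * delta].
Proof.
move=> rho0 e0 K0 d0 delta8 W g1 g2 g3 g4 g5 xb sb yE pk V.
pose D1 := `|ln (4 * expR 1 / e)|; pose D2 := `|ln (K * (1 + rho) + 1)|.
pose Cq := K * (1 + rho) / e; pose kk := (k + k).+1; pose ck : R := 16 ^+ k * 8 * (2 / e) ^+ kk.
have hL1 := win_ln W; have hom := win_cut W; have a1 := win_height W; have hr1 := win_radius W.
have t0 := win_time W; have hll := win_ln_ln W; have rate := win_rate W; have lnaE := win_ln_height W.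
have a0 : 0 < a by lra.
have r0 : 0 < r by lra.
have L0 : 0 < L by lra.
have om0 : 0 < om by lra.
have /andP[xe xK] := xb; have /andP[se sK] := sb.
set x := n%:R / r in xb xe xK yE *.
have x0 : 0 < x by lra.
have nE : n%:R = x * r by rewrite divfK// gt_eqF.
have n0 : (0 < n)%N by rewrite lt0n; apply/negP => /eqP n00; move: x0; rewrite /x n00 mul0r ltxx.
have rx0 : 0 < rho * x by rewrite mulr_gt0.
have Cq0 : 0 <= Cq by rewrite divr_ge0 ?mulr_ge0//; clear -K0 e0 rho0; lra.
have ck0 : 0 < ck by rewrite mulr_gt0 ?exprn_gt0 ?divr_gt0// mulr_gt0 ?exprn_gt0.
have cn : c n w by apply: g5; rewrite leq_addr.
have omr : 1 <= r * om by rewrite -[leLHS]mulr1; apply: ler_pM; clear -hr1 hom; lra.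
have b0 : 0 < b by rewrite (win_level W) divr_gt0.
have bae : b <= a * e.
  by rewrite (win_level W) ler_pM2l// -[leRHS]invrK lef_pV2 ?posrE ?invr_gt0// (win_cut_inv W).
have Vn : V (- n%:Z) = V n%:Z by rewrite /V potential_neg cn andbF.
have V1 z : 1 <= V z by case: (potential_cases xi0 c w z) => [h|[_ _ h]]; rewrite /V h; exact: g1.
have near_le z : (`|z| <= N)%N -> (`|z| != n)%N -> V z <= a * (s - e + rho * (`|z|%N%:R / r)).
  move=> zN zn; case: (potential_cases xi0 c w z) => [h|[z0 cz h]]; rewrite /V h.
    exact: pk.
  have [_ h2] : xi0 `|z|%N%:Z w <= b /\ xi0 (- `|z|%N%:Z) w <= b by apply: g2; rewrite ?z0.
  apply: (le_trans h2); apply: (le_trans bae); rewrite ler_pM2l//.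
  by have : 0 <= rho * (`|z|%N%:R / r) by [rewrite mulr_ge0 ?divr_ge0// ltW]; lra.
have far_le z : (N < `|z|)%N -> V z <= a * rho * `|z|%N%:R / (2 * r).
  move=> zN; have [h1 h2] := g3 _ zN.
  by case: (potential_cases xi0 c w z) => [h|[_ _ h]]; rewrite /V h.
have all_le z : V z <= a * (s + rho * (`|z|%N%:R / r)).
  have [zn|zn] := eqVneq `|z|%N n.
    have -> : V z = V n%:Z by have [->|->] : z = n%:Z \/ z = - n%:Z by move: zn; clear; lia.
    by rewrite zn /V /= yE.
  have q0 : 0 <= rho * (`|z|%N%:R / r) by rewrite mulr_ge0 ?divr_ge0// ltW.
  have [zN|zN] := leqP `|z|%N N.
    by apply: (le_trans (near_le z zN zn)); rewrite ler_pM2l//; lra.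
  apply: (le_trans (far_le z zN)).
  rewrite [leLHS](_ : _ = a * (rho * (`|z|%N%:R / r) / 2)); last by field; rewrite gt_eqF.
  by rewrite ler_pM2l//; lra.
have NomE : N%:R / r <= 2 * om.
  by rewrite ler_pdivrMr//; have := win_N_ub W; clear -omr; lra.
have lle : 0 <= `|ln e| by [].
have w1 : rho * ln L + `|ln e| <= ln L * (rho + `|ln e|).
  by rewrite mulrDr (mulrC rho) lerD2l ler_peMl.
have w2 : ln L <= om * ln L by rewrite ler_peMl; clear -hll hom; lra.
have X0 : 0 <= rho + `|ln e| by clear -rho0 lle; lra.
have psi_lt : forall z : nat, z != n -> Psi V t z%:Z < Psi V t n%:Z.
  apply: (@peak_psi R a r L t rho e K s n a1 r0 hL1 rho0 e0 rate
    lnaE xb sb V N (2 * om)) => //.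
  - by move=> z zN; apply: far_le.
  - by rewrite [leRHS]mulrC -ler_pdivrMr// (win_ln_range W).
  - move: (win_psi_near W); rewrite mulrA ler_pdivrMr// (mulrC L); apply: le_trans.
    have -> : 2 * (2 * om) = 4 * om by ring.
    by have := ler_wpM2l (ltW om0) w1; clear; lra.
  - move: (win_psi_far W); rewrite mulrA ler_pdivrMr// (mulrC L); apply: le_trans.
    rewrite mulrCA ler_pM2l//; apply: (le_trans w1); exact: ler_wpM2r.
(* Over [mm] sites beyond the peak the barrier line rises by at most [a * e / 2]; the other half of
   the margin is the gap [G]. *)
pose mm := Num.truncn (e * r / (2 + 2 * rho)).
have q0 : 0 <= e * r / (2 + 2 * rho) by rewrite divr_ge0 ?mulr_ge0//; clear -e0 r0 rho0; lra.
have mmle : mm%:R <= e * r / (2 + 2 * rho) by rewrite truncn_le.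
have mmlt : e * r / (2 + 2 * rho) < mm.+1%:R by exact: truncnS_gt.
have mmr : (2 + 2 * rho) * mm%:R <= e * r by move: mmle; rewrite ler_pdivlMr; clear -rho0; lra.
have mm2 : 2 * mm%:R <= e * r :> R by apply: le_trans mmr; rewrite ler_wpM2r//; clear -rho0; lra.
have rmm : rho * (mm%:R / r) <= e / 2.
  have h : 2 * rho * mm%:R <= e * r by apply: le_trans mmr; rewrite ler_wpM2r//; clear -rho0; lra.
  by rewrite mulrA ler_pdivrMr//; clear -h; lra.
have mmn : (mm < n)%N.
  have h1 : e * r < x * r by rewrite ltr_pM2r.
  have h2 : 0 < e * r by rewrite mulr_gt0.
  by rewrite -(ltr_nat R) nE; clear -h1 h2 mm2; lra.
have nmN : (n + mm <= N)%N.
  rewrite -(ler_nat R) natrD; apply: le_trans ((win_N_lb W)); rewrite nE.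
  have h1 : x * r <= K * r by rewrite ler_pM2r.
  have h2 : r * (K + e) <= r * om by rewrite ler_pM2l// (win_cut_range W).
  have h3 : 0 < e * r by rewrite mulr_gt0.
  by clear -h1 h2 h3 mm2; lra.
pose y := a * (s + rho * x); pose G := a * e / 2.
have Gbig : 8 + 32 / delta <= G.
  by rewrite /G ler_pdivlMr// -ler_pdivrMr// -mulrA (win_gap W).
have d32 : 0 < 32 / delta by rewrite divr_gt0.
have G8 : 8 <= G by clear -Gbig d32; lra.
have G0 : 0 < G by clear -G8; lra.
have box_le z : box n%:Z (n + mm) mm z -> z != n%:Z -> V z <= y - G /\ V (- z) <= y - G.
  rewrite /box => zb zn.
  have [zN [zn' zl]] : (`|z| <= N)%N /\ (`|z|%N != n) /\ (`|z| <= n + mm)%N.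
    by move: zb zn nmN mmn; clear; lia.
  have h : a * (s - e + rho * (`|z|%N%:R / r)) <= y - G.
    rewrite (_ : y - G = a * (s + rho * x - e / 2)); last by rewrite /y /G; ring.
    rewrite ler_pM2l//.
    have : rho * (`|z|%N%:R / r) <= rho * x + rho * (mm%:R / r); last by clear -rmm; lra.
    by rewrite -mulrDr -mulrDl ler_pM2l// ler_pM2r ?invr_gt0// -natrD ler_nat.
  by split; apply: le_trans h; [|rewrite -abszN; move: zN zn'; rewrite -abszN => zN zn']; exact: near_le.
have pkV : peaked n mm y G V.
  by split; [rewrite /V /= yE | move=> z zb zn; case: (box_le z zb zn) | move=> z; exact: le_trans (V1 z)].
have pkV' : peaked n mm y G (fun z => V (- z)).
  split; [by rewrite /= Vn /V /= yE | by move=> z zb zn; case: (box_le z zb zn) | ].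
  by move=> z; exact: le_trans (V1 (- z)).
have loc z : (`|(z - n%:Z)%R| <= k)%N -> V z = V (- z).
  move=> zk; case: (intP z) zk => [|q|q] zk; rewrite ?oppr0 ?opprK//.
    rewrite /V potential_neg (_ : c q.+1 w) ?andbF//.
    by apply: g5; move: zk; clear; lia.
  rewrite /V potential_neg (_ : c q.+1 w) ?andbF//.
  by apply: g5; move: zk; clear; lia.
have H4 : D1 + (1 + rho) * ln L + K * (1 + rho) / e * (D1 + ln L + D2) + 1 <= rho / 2 * L.
  have D10 : 0 <= D1 by exact: normr_ge0.
  have D20 : 0 <= D2 by exact: normr_ge0.
  apply: (@le_trans _ _ (ln L * (D1 + (1 + rho) + Cq * (D1 + 1 + D2) + 1))).
    have p1 : D1 <= ln L * D1 by rewrite ler_peMl.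
    have p2 : D2 <= ln L * D2 by rewrite ler_peMl.
    have p3 : Cq * (D1 + ln L + D2) <= Cq * (ln L * (D1 + 1 + D2)) by rewrite ler_wpM2l//; clear -p1 p2 hll; lra.
    by rewrite -/Cq; clear -p1 p2 p3 hll rho0; lra.
  have hQ : 0 <= D1 + (1 + rho) + Cq * (D1 + 1 + D2) + 1.
    have h : 0 <= Cq * (D1 + 1 + D2) by rewrite mulr_ge0//; clear -D10 D20; lra.
    by clear -h D10 rho0; lra.
  have := ler_wpM2r hQ w2; move: (win_tail W); rewrite mulrA ler_pdivrMr//.
  by rewrite -/Cq -/D1 -/D2; move: (_ + 1) => Q; move: (ln L) => l'; clear; lra.
have tail U : (forall z, U z <= a * (s + rho * (`|z|%N%:R / r))) -> forall j, (n + mm + mm + 2 <= j)%N ->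
    fk predT U n%:Z j t 0 <= @tail_scale R a r t rho s n delta / 2 ^+ j.+1.
  move=> hW j hj; apply: (@peak_tail R a r L t rho e K s n a1 r0 hL1 rho0 e0 rate
    lnaE xb sb U delta mm j d0 hW mmlt hj H4).
  by rewrite mulrC -ler_pdivrMr ?(win_delta W)// divr_gt0//; clear -rho0; lra.
have y1 : 0 < y + 1 by rewrite addr_gt0// mulr_gt0//; clear -se e0 rx0; lra.
have ts0 : 0 <= @tail_scale R a r t rho s n delta.
  by rewrite mulr_ge0 ?(ltW d0)// mulr_ge0 ?expR_ge0// invr_ge0 exprn_ge0// ltW.
have dd : 0 <= delta <= 1 / 8 by rewrite ltW ?delta8.
have GG : G <= G ^+ 2 by rewrite expr2 ler_peMl ?(ltW G0)//; clear -G8; lra.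
have Glarge : 32 / G ^+ 2 <= delta.
  rewrite ler_pdivrMr ?exprn_gt0// mulrC -ler_pdivrMr//; clear -GG Gbig; lra.
have Gtime : 4 ^+ n * expR (- (G / 4 * t)) <= delta.
  have l4 : ln 4 < 4 :> R by apply: ln_sublinear.
  have -> : 4 ^+ n = expR (n%:R * ln 4) :> R by rewrite expRM_natl lnK// posrE.
  rewrite -expRD -[leRHS]lnK ?posrE// ler_expR.
  have -> : G / 4 * t = r * (e * L / 8).
    rewrite (_ : G / 4 * t = (a * t) * e / 8); last by rewrite /G; field.
    by rewrite -rate; ring.
  have h1 : n%:R * ln 4 <= K * r * 4.
    rewrite nE; apply: ler_pM; rewrite ?ln_ge0 ?ler_pM2r ?(ltW l4)//; last by clear; lra.
    by rewrite mulr_ge0 ?(ltW x0) ?(ltW r0).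
  have h2 : 4 * K + 1 <= e * L / 8 by move: (win_ln_rate W); rewrite ler_pdivrMr//; clear; lra.
  have h3 : r * (4 * K + 1) <= r * (e * L / 8) by rewrite ler_pM2l.
  by have := win_ln_delta W; clear -h1 h3; lra.
have G16 : 16 / G ^+ 2 <= 1 by clear -Glarge delta8; lra.
have G16' : 0 <= 16 / G ^+ 2 by rewrite divr_ge0// sqr_ge0.
have errG : (16 / G ^+ 2) ^+ k * (8 / G) <= G / 4.
  apply: (@le_trans _ _ (1 * (8 / G))).
    by rewrite ler_wpM2r ?exprn_ile1// divr_ge0// ltW.
  rewrite mul1r ler_pdivrMr// mulrAC ler_pdivlMr//.
  by have : 8 * G <= G * G by [rewrite ler_pM2r]; clear -G8; lra.
have [U0 U'0 UE] := log_ratio_bound n0 G8 (ltW t0) dd ts0 (lexx _) Glarge Gtime pkV pkV' loc errG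
  (tail V all_le) (tail (fun z => V (- z)) (fun z => eq_ind _ (fun q => V (- z) <= a * (s + rho * (q%:R / r)))
     (all_le (- z)) _ (abszN z))).
split => //.
apply: (le_trans UE).
have E1 : (16 / G ^+ 2) ^+ k * (8 / G) * t <= delta.
  have -> : (16 / G ^+ 2) ^+ k * (8 / G) * t = ck * (t / a ^+ kk).
    have Gi : G^-1 = 2 / e * a^-1 by rewrite /G; field; rewrite !gt_eqF.
    rewrite -exprVn Gi -[(a ^+ kk)^-1]exprVn /ck; move: (2 / e) a^-1 => u v.
    by rewrite exprMn -exprM mul2n -addnn !exprMn [u ^+ kk]exprS [v ^+ kk]exprS; ring.
  by rewrite mulrC -ler_pdivlMr// (win_power W).
(* The 384 in the bound on failed coins is 24 times 2 times 2^3: the constant of the arm estimate,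
   the two encounters of a pair, and the cube of the 2 in [G = a * e / 2]. *)
have E2 : 24 / G ^+ 3 * \sum_(1 <= i < (n + mm).+1) `|V (n%:Z - i%:Z) - V (- (n%:Z - i%:Z))| <= delta.
  have h := potential_asym_sum nmN (fun z => le_trans ler01 (V1 z)) g2 (ltW b0).
  apply: (@le_trans _ _ (24 / G ^+ 3 * (2 * (delta * e ^+ 3 / 384 * a ^+ 3)))).
    rewrite ler_wpM2l ?divr_ge0 ?exprn_ge0 ?(ltW G0)//; apply: (le_trans h).
    by rewrite ler_pM2l//; exact: g4.
  apply: eq_ler; rewrite /G; field; rewrite !gt_eqF//.
by clear -E1 E2; lra.
Qed.

Section PeakSite.
Context {R : realType} {alpha : R} {d} {T : measurableType d}
  {xi0 : int -> T -> R} {c : nat -> T -> bool}.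
Variable rho : R.
Hypotheses (alpha2 : 2 <= alpha) (rho0 : 0 < rho) (rhoE : rho * (alpha - 1) = 1).
Variable t : nat -> R.
Hypothesis ty : t @ \oo --> +oo.
Local Notation a m := (peak_height rho (t m)).
Local Notation r m := (peak_radius alpha rho (t m)).
Local Notation om m := (cut_ratio (t m)).
Local Notation b m := (cut_level rho (t m)).
Local Notation N m := (cut_radius alpha rho (t m)).
Local Notation L m := (ln (t m)).
Local Notation good := (@good_sites R alpha d T xi0 c rho t).
Local Notation peak := (@peak_event R alpha d T xi0 rho (fun m => a m) (fun m => N m)).
Local Notation phase b N n w := (@total_phase R d T xi0 c b N n w).

(** Pairs with coin 1 cancel, and a separate pair has both values at most [b], so the truncation in
    [pair_phase] is not felt. *)
Lemma total_phaseE (b y : R) (N n : nat) w : (n <= N)%N -> xi0 n%:Z w = y ->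
  (forall i, (0 < i <= N)%N -> ~~ c i w -> xi0 i%:Z w <= b /\ xi0 (- i%:Z) w <= b) ->
  \sum_(1 <= i < n.+1) (ln (y - potential xi0 c w (- (n%:Z - i%:Z))) -
    ln (y - potential xi0 c w (n%:Z - i%:Z))) = phase b N n w.
Proof.
move=> nN yE hb.
rewrite (sum_rev_nat n (fun z => ln (y - potential xi0 c w (- z)) - ln (y - potential xi0 c w z))).
rewrite /total_phase -[iota 0 N.+1]/(index_iota 0 N.+1) yE.
rewrite [RHS](@big_cat_nat _ _ _ n)//=; last exact: leqW.
have -> : \sum_(n <= i < N.+1 | i != n) cut_phase (xi0 := xi0) (c := c) n b y i w = 0.
  rewrite big_nat_cond big1// => i /andP[/andP[ni _] _].
  by rewrite /cut_phase [(i < n)%N]ltnNge ni andbF mul0r.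
rewrite addr0 [RHS]big_mkcond !big_nat; apply: eq_bigr => i /andP[_ iN].
rewrite (ltn_eqF iN) /= /cut_phase iN andbT potential_neg /site_phase /pair_phase /=.
case: (posnP i) => [->|i0] /=; first by rewrite subrr mul0r.
case: (boolP (c i w)) => ci /=; first by rewrite subrr mul0r mulr0.
have [h1 h2] := hb i (introT andP (conj i0 (leq_trans (ltnW iN) nN))) ci.
by rewrite h1 h2 !mul1r.
Qed.

Lemma log_log_scale (q : R) : \forall m \near \oo, om m * ln (L m) * q <= L m.
Proof.
have q1 : 0 < `|q| + 1 by rewrite ltr_wpDl.
have h := ln_ln_small rhoE ty (_ : 0 < (`|q| + 1)^-1).
near=> m; have f : scale_facts alpha rho (t m) by near: m; exact: (scale_near rhoE ty).
have c1 := scale_cut f; have L1 := scale_ln f.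
have : om m * ln (L m) <= (`|q| + 1)^-1 * L m by near: m; apply: h; rewrite invr_gt0.
rewrite [X in _ <= X -> _]mulrC ler_pdivlMr//; apply: le_trans; rewrite ler_wpM2l//.
  by rewrite mulr_ge0 ?ln_ge0 ?ltW//; lra.
by have := ler_norm q; lra.
Unshelve. all: by end_near. Qed.

Lemma peak_site (e K eps : R) : 0 < e -> 0 < K -> 0 < eps ->
  exists k dl, 0 < dl /\ \forall m \near \oo, forall w n, good e K dl k m w -> (n <= N m)%N ->
    peak e K m n w ->
    [/\ Dset (potential xi0 c w) n,
        forall z : nat, z != n -> Psi (potential xi0 c w) (t m) z%:Z < Psi (potential xi0 c w) (t m) n%:Z,
        0 < fk_total n (t m) (potential xi0 c w),
        0 < fk_total n (t m) (fun z => potential xi0 c w (- z)) &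
        `|ln (fk_total n (t m) (potential xi0 c w)) -
          ln (fk_total n (t m) (fun z => potential xi0 c w (- z))) - phase (b m) (N m) n w| <= eps].
Proof.
move=> e0 K0 eps0; have ro := rho0.
(* With [k] above 2 / rho, t / a^(2 k + 1) tends to 0, as the level error demands. *)
pose k := (Num.truncn (2 / rho)).+1.
pose kk := (k + k).+1.
have hkk : 2 <= rho * kk%:R.
  have h : 2 / rho < k%:R by exact: truncnS_gt.
  rewrite mulrC -ler_pdivrMr//; apply: (le_trans (ltW h)); rewrite ler_nat /kk; lia.
pose delta := Num.min (1 / 8) (eps / 11).
have d0 : 0 < delta by rewrite lt_min; apply/andP; split; lra.
have d8 : delta <= 1 / 8 by rewrite ge_min lexx.
have d11 : 11 * delta <= eps by have : delta <= eps / 11 by [rewrite ge_min lexx orbT]; lra.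
pose dl := delta * e ^+ 3 / 384.
have e3 : 0 < e ^+ 3 by rewrite exprn_gt0.
have dl0 : 0 < dl by apply: divr_gt0; [exact: mulr_gt0 | rewrite ltr0n].
exists k, dl; split => //.
have ck0 : 0 < 16 ^+ k * 8 * (2 / e) ^+ kk by rewrite mulr_gt0 ?exprn_gt0 ?divr_gt0// mulr_gt0 ?exprn_gt0.
have tk := time_height_cvg0 rhoE ty hkk.
have ay := peak_height_cvgy rho0 rhoE ty; have ry := peak_radius_cvgy alpha2 rho0 rhoE ty.
have Ly := log_cvgy ty; have oy := cut_ratio_cvgy ty; have lly := seq_ln_cvgy Ly.
near=> m.
have f : scale_facts alpha rho (t m) by near: m; exact: (scale_near rhoE ty).
have a0 := scale_height f.
have W : peak_window rho e K delta (a m) (r m) (L m) (t m) (om m) (b m) (N m) k.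
  split; rewrite ?(scale_ln f, scale_cut f, scale_rate f, scale_ln_height f, scale_radius_lb f, scale_radius_ub f)//.
  all: try by near: m; solve [exact: seq_near_gey ay | exact: seq_near_gey ry | exact: seq_near_gey Ly |
    exact: seq_near_gey oy | exact: seq_near_gey lly | exact: log_log_scale | exact: seq_near_gty].
  by near: m; apply: (cvgr_le _ tk); rewrite divr_gt0.
move=> w n gd nN /and3P[xb sb /allP pk0].
have pk i : (i <= N m)%N -> i != n -> xi0 i%:Z w <= @barrier R (a m) (r m) rho e (@excess R d T xi0 (a m) (r m) rho n w) i.
  by move=> iN ni; have := pk0 i; rewrite mem_iota add0n ltnS iN ni => /(_ isT).
set s := @excess _ _ _ _ _ _ _ n w in sb pk.
have yE : xi0 n%:Z w = a m * (s + rho * (n%:R / r m)).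
  by rewrite -(@height_excess R d T xi0 (a m) (r m) rho a0 n w).
have y2 : 2 * e * a m < xi0 n%:Z w.
  have /andP[xe _] := xb; have /andP[se _] := sb.
  have : 0 < rho * (n%:R / r m) by rewrite mulr_gt0//; exact: lt_trans xe.
  by move=> h; rewrite yE [X in X < _]mulrC ltr_pM2l//; apply: lt_trans se _; rewrite ltrDl.
have [h1 h2 h3 h4 h5] := peak_fixed rho0 e0 K0 d0 d8 W (good_ge1 gd) (good_pair gd) (good_far gd)
  (good_defects gd) (fun i => good_near_peak gd xb y2) xb sb yE pk.
split => //.
by rewrite -(total_phaseE nN yE (good_pair gd)); apply: le_trans h5 d11.
Unshelve. all: by end_near. Qed.

End PeakSite.

Lemma gauss_sin0 {R : realType} (a : R) :
  intT (@std_normal R) (fun x => sin (a * x)) = 0.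
Proof.
have bs : bmeas (fun x : measurableTypeR R => sin (a * x)).
  by apply: bmeas_sin; apply: measurable_scale; exact: measurable_id.
rewrite std_normalE//; pose F (x : R) := sin (a * x) * gauss_pdf x.
have iF : (@lebesgue_measure R).-integrable setT (EFin \o F).
  by apply: (@gauss_mul_integrable R _ 1); [exact: bs.1 | move=> x; exact: sin_max].
have FN x : F (- x) = - F x by rewrite /F mulrN sinN /gauss_pdf sqrrN mulNr.
have mN : measT (-%R : R -> measurableTypeR R) by exact: oppr_measurable.
have e : intT lebesgue_measure F = intT lebesgue_measure (fun x => F (- x)).
  rewrite /Rintegral; congr fine.
  transitivity (\int[pushforward lebesgue_measure (-%R : R -> measurableTypeR R)]_x (F x)%:E)%E.
    by apply: eq_measure_integral => A mA _; exact/esym/lebesgue_measureN.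
  rewrite integral_pushforward//=; first by case/integrableP : iF.
  rewrite (_ : _ \o _ = (fun x => - (EFin \o F) x)%E); first exact: integrableN.
  by apply/funext => x /=; rewrite FN EFinN.
move: e; under [X in _ = X]eq_Rintegral do rewrite FN -mulN1r.
by rewrite RintegralZl// mulN1r; lra.
Qed.

Section LawOf.
Context {R : realType} {d} {T : measurableType d} (P : probability T R) (X : T -> R).
Hypothesis mX : measT X.
HB.instance Definition _ := isMeasurableFun.Build _ _ _ _ X mX.

Definition law_of : probability R R := distribution P X.

Lemma Rintegral_law (f : R -> R) : bmeas f ->
  intT law_of f = intT P (fun w => f (X w)).
Proof.
move=> bf; rewrite /Rintegral integral_pushforward//; first by apply/measurable_EFinP; case: bf.
exact: (bmeas_integrable P (bmeas_comp mX bf)).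
Qed.

End LawOf.

(** * Assembly along a sequence of times *)

Section PeakAssembly.
Context {R : realType} {alpha : R} {p : nat -> R} {d} {T : measurableType d}
  {P : probability T R} {xi0 : int -> T -> R} {c : nat -> T -> bool}.
Hypothesis fld : pareto_field alpha p P xi0 c.
Let alpha2 := field_alpha fld.
Variables (beta : R) (u : (int -> R) -> R -> int -> R) (Z1 : R -> T -> nat).
Hypotheses (beta0 : 0 < beta) (p1 : p @ \oo --> (1 : R)).
Hypothesis etah : (fun n => etaPAM p n / (beta * kappa alpha n)) @ \oo --> (1 : R).
Hypothesis uE : forall V t z, 0 <= t -> u V t z = fine (\sum_(0 <= j <oo) (fk predT V z j t 0)%:E)%E.
Hypothesis Z1max : forall t w, (exists z, Dset (potential xi0 c w) z /\
    forall y, Dset (potential xi0 c w) y -> Psi (potential xi0 c w) t y <= Psi (potential xi0 c w) t z) ->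
  Dset (potential xi0 c w) (Z1 t w) /\
  forall y, Dset (potential xi0 c w) y ->
    Psi (potential xi0 c w) t y <= Psi (potential xi0 c w) t (Z1 t w).
Hypothesis mZ1 : forall t (n : nat), measurable [set w | Z1 t w = n].

Let rho := (alpha - 1)^-1.
Let rho0 : 0 < rho. Proof. by rewrite invr_gt0; have := alpha2; lra. Qed.
Let rhoE : rho * (alpha - 1) = 1. Proof. by rewrite mulVf// gt_eqF//; have := alpha2; lra. Qed.
Local Notation B := (@limit_B R alpha d T xi0 rho).
Let mB : measT B. Proof. exact: (measurable_limit_B fld). Qed.

Definition peak_law : probability R R := law_of P mB.

Lemma peak_law_gt0 : peak_law [set x | 0 < x] = 1%E.
Proof.
apply/eqP; rewrite eq_le probability_le1//=; last first.
  by rewrite (_ : mkset _ = `]0, +oo[%classic)//; apply/seteqP; split => x /=; rewrite in_itv/= andbT.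
have h : P ([set w | 1 < xi0 0 w] `&` [set w | 1 < xi0 1 w]) = 1%E.
  by apply: prob1_setI; rewrite ?(pareto_gt1 fld)//; exact: (measurable_gt fld).
rewrite -h; apply: le_measure; rewrite ?inE.
- by apply: measurableI; exact: (measurable_gt fld).
- rewrite (_ : mkset _ = `]0, +oo[%classic); first by rewrite -[X in measurable X]setTI; exact: mB.
  by apply/seteqP; split => x /=; rewrite in_itv/= andbT.
- by move=> w [h0 h1]; exact: (limit_B_gt0 fld rho0).
Qed.

Section AlongSequence.
Variable t : nat -> R.
Hypothesis ty : t @ \oo --> +oo.
Local Notation a := (fun m => peak_height rho (t m)).
Local Notation b := (fun m => cut_level rho (t m)).
Local Notation N := (fun m => cut_radius alpha rho (t m)).
Local Notation V := (potential xi0 c).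
Local Notation peak := (@peak_event R alpha d T xi0 rho a N).
Local Notation phase m n w := (@total_phase R d T xi0 c (b m) (N m) n w).
Let ay := peak_height_cvgy rho0 rhoE ty.
Let by_ := cut_level_cvgy rho0 rhoE ty.
Let ba := cut_level_ratio rhoE ty.
Let lnba := cut_level_ln rho0 rhoE ty.
Let Ny := cut_radius_ratio rhoE ty.

(** In a typical environment a peak event makes [n] the strict maximum of [Psi] over the nonnegative
    sites, so [Z1] equals [n] whichever maximiser has been selected. *)
Lemma peak_transfer e K ep eta : 0 < e -> 2 * e < K -> 0 < ep -> 0 < eta ->
  \forall m \near \oo, exists A : set T, [/\ measurable A, ((1 - eta)%:E <= P A)%E &
    forall w n, A w -> (n <= N m)%N -> peak e K m n w ->
    [/\ Z1 (t m) w = n, 0 <= xi0 n%:Z w & exists2 X,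
      u (V w) (t m) n%:Z / u (V w) (t m) (- n%:Z) = expR X & `|X - phase m n w| <= ep]].
Proof.
move=> e0 eK ep0 eta0; have K0 : 0 < K by lra.
have [k [dl [dl0 hS]]] := peak_site alpha2 rho0 rhoE ty e0 K0 ep0 (xi0 := xi0) (c := c).
have hG := @good_sites_near R alpha p d T P xi0 c fld rho beta rho0 rhoE beta0 etah p1 t ty e K dl eta k e0 dl0 eta0.
near=> m.
have t0 : 0 <= t m by near: m; exact: seq_near_gey ty.
have hSm : forall w n, @good_sites R alpha d T xi0 c rho t e K dl k m w -> (n <= N m)%N -> peak e K m n w ->
    [/\ Dset (V w) n, forall z : nat, z != n -> Psi (V w) (t m) z%:Z < Psi (V w) (t m) n%:Z,
        0 < fk_total n (t m) (V w), 0 < fk_total n (t m) (fun z => V w (- z)) &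
        `|ln (fk_total n (t m) (V w)) - ln (fk_total n (t m) (fun z => V w (- z))) - phase m n w| <= ep].
  by near: m; exact: hS.
have [A [mA PA gA]] : exists A, [/\ measurable A, ((1 - eta)%:E <= P A)%E &
    forall w, A w -> @good_sites R alpha d T xi0 c rho t e K dl k m w].
  by near: m; exact: hG.
exists A; split => // w n /gA gd nN pk.
have [Dn Psin f1 f2 hX] := hSm w n gd nN pk; split.
- have [|DZ Zmax] := Z1max (t := t m) (w := w).
    exists n; split => // y _; have [->//|yn] := eqVneq y n; exact/ltW/Psin.
  by apply/eqP/negPn/negP => /Psin; rewrite ltNge Zmax.
- exact: le_trans (good_ge1 gd _).
exists (ln (fk_total n (t m) (V w)) - ln (fk_total n (t m) (fun z => V w (- z)))) => //.
rewrite expRD expRN !lnK ?posrE// !uE//; congr (_ / fine _).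
(* Reflection fixes the starting point 0 and turns the value at [- n] into the value at [n] for the
   mirrored potential. *)
by apply: eq_eseriesr => j _; congr EFin; rewrite -[X in fk _ _ _ _ _ X]oppr0 fk_reflect.
Unshelve. all: by end_near. Qed.

(** The case [th = 0] of the limit theorem for the phase, with [f] as test function. *)
Lemma peak_ratio_law (f : R -> R) (M : R) : continuous f -> (forall x, `|f x| <= M) ->
  (fun m => intT P (fun w => f ((Z1 (t m) w)%:R `^ (1 / alpha) / V w (Z1 (t m) w)))) @ \oo -->
  intT P (fun w => f (B w)).
Proof.
move=> cf fM.
have := @peak_limit_cos R alpha p d T P xi0 c fld rho beta a b N rho0 rhoE beta0 etah ay by_ ba lnba Ny
  0 f M (fun m w => f ((Z1 (t m) w)%:R `^ (1 / alpha) / V w (Z1 (t m) w))) cf fM (fun m w => fM _).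
have -> : intT P (fun w => f (B w) *
    expR (- (beta * sigmaPAM alpha ^+ 2 * 0 ^+ 2 * B w ^+ 2))) = intT P (fun w => f (B w)).
  by apply: eq_Rintegral => w _; rewrite expr0n /= mulr0 mul0r oppr0 expR0 mulr1.
apply=> e K eta e0 eK eta0; apply: filterS (peak_transfer e0 eK ltr01 eta0) => m [A [mA PA h]].
exists A; split => // w n Aw nN pk; have [-> x0 _] := h w n Aw nN pk.
by rewrite mul0r cos0 mulr1 powR_inv1.
Qed.

(** A measurable substitute for the logarithm of the ratio; [Z1] takes countably many values, each
    on a measurable set. *)
Let G m w := phase m (Z1 (t m) w) w.

Let mG m : measT (G m).
Proof.
move=> _ Y mY; rewrite setTI.
rewrite (_ : _ @^-1` _ = \bigcup_n ([set w | Z1 (t m) w = n] `&` ((fun w => phase m n w) @^-1` Y))).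
  apply: bigcupT_measurable => n; apply: measurableI => //.
  by rewrite -[X in measurable X]setTI; exact: (measurable_total_phase fld b N m n).
by apply/seteqP; split => w /=; [exists (Z1 (t m) w) | move=> [n _ [/= <-]]].
Qed.

Let phase_transfer tr a' : @good_transfer R alpha d T P xi0 c rho a b N tr a' (cst 1)
  (fun m w => tr (a' * G m w)).
Proof.
move=> e K eta e0 eK eta0; apply: filterS (peak_transfer e0 eK ltr01 eta0) => m [A [mA PA h]].
exists A; split => // w n Aw nN pk; have [Zn _ _] := h w n Aw nN pk.
by rewrite /G Zn /cst mul1r.
Qed.

Let kap := Num.sqrt (2 * beta) * sigmaPAM alpha.
(** The product with a standard normal law makes the second coordinate independent of [B]. *)
Let H (v : T * R) := kap * B v.1 * v.2.

Let mH : measT (H : T * measurableTypeR R -> R).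
Proof.
apply: measurable_funM; last exact: measurable_snd.
apply: measurable_scale.
exact: measurableT_comp mB measurable_fst.
Qed.

(** Given [B], the limit is centred normal with variance 2 beta sigma^2 B^2, whose characteristic
    function is the one found for the phase; sine means vanish on both sides by symmetry. The ratio
    is close to exp of the phase when a peak event occurs in a typical environment, which has
    probability at least [1 - e]. *)
Lemma peak_phase_law (f : R -> R) (M : R) : continuous f -> (forall x, `|f x| <= M) ->
  (fun m => intT P (fun w => f (u (V w) (t m) (Z1 (t m) w) / u (V w) (t m) (- (Z1 (t m) w)%:Z))))
    @ \oo --> Rintegral (P \x @std_normal R)%E setT (fun v => f (expR (H v))).
Proof.
move=> cf fM.
have c1 : continuous (cst 1 : R -> R) by exact: cst_continuous.
have n1 x : `|(cst 1 : R -> R) x| <= 1 by rewrite normr1.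
have maH a' : measT (fun v : T * measurableTypeR R => a' * H v).
  by apply: measurable_funM => //; exact: measurable_cst.
have HE a' w x : a' * H (w, x) = a' * (kap * B w) * x by rewrite /H /=; ring.
apply: (@slutsky_nonmeas R _ _ _ _ P (P \x @std_normal R)%E G H (fun x => f (expR x)) M) => //.
- move=> a'.
  have -> : cosfn (P \x @std_normal R)%E H a' = intT P (fun w => (cst 1 : R -> R) (B w) *
      expR (- (beta * sigmaPAM alpha ^+ 2 * a' ^+ 2 * B w ^+ 2))).
    rewrite /cosfn Rintegral_prod; last exact: bmeas_cos.
    apply: eq_Rintegral => w _; under eq_Rintegral do rewrite HE.
    rewrite std_normalE ?normal_fourier; last first.
      by apply: bmeas_cos; apply: measurable_scale; exact: measurable_id.
    rewrite mul1r; congr expR; rewrite /kap !exprMn sqr_sqrtr; last by have := beta0; lra.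
    by field.
  exact: (@peak_limit_cos R alpha p d T P xi0 c fld rho beta a b N rho0 rhoE beta0 etah ay by_ ba lnba Ny
    a' (cst 1) 1 (fun m w => cos (a' * G m w)) c1 n1 (fun m w => cos_max _) (phase_transfer _ _)).
- move=> a'.
  have -> : sinfn (P \x @std_normal R)%E H a' = 0.
    rewrite /sinfn Rintegral_prod; last exact: bmeas_sin.
    under eq_Rintegral => w _ do (under eq_Rintegral do rewrite HE; rewrite gauss_sin0).
    exact: Rintegral_prob_cst.
  exact: (@peak_limit_sin R alpha p d T P xi0 c fld rho beta a b N rho0 rhoE beta0 etah ay by_ ba lnba Ny
    a' (cst 1) 1 (fun m w => sin (a' * G m w)) c1 n1 (fun m w => sin_max _) (phase_transfer _ _)).
- by move=> x; apply: continuous_comp; [exact: continuous_expR | exact: cf].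
- move=> e e0; have e2 : 0 < e / 2 by lra.
  have [e' [K [e'0 eK hp]]] := peak_event_prob fld rho0 rhoE beta0 etah ay by_ ba lnba Ny e2.
  near=> m.
  have [A1 [mA1 PA1 h1]] : exists A : set T, [/\ measurable A, ((1 - e / 2)%:E <= P A)%E &
      forall w, A w -> exists2 n, (n <= N m)%N & peak e' K m n w] by near: m; exact: hp.
  have [A2 [mA2 PA2 h2]] : exists A : set T, [/\ measurable A, ((1 - e / 2)%:E <= P A)%E &
    forall w n, A w -> (n <= N m)%N -> peak e' K m n w ->
    [/\ Z1 (t m) w = n, 0 <= xi0 n%:Z w & exists2 X,
      u (V w) (t m) n%:Z / u (V w) (t m) (- n%:Z) = expR X & `|X - phase m n w| <= e]].
    by near: m; exact: peak_transfer.
  exists (A1 `&` A2); split; first exact: measurableI.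
    have q (A : set T) : measurable A -> ((1 - e / 2)%:E <= P A)%E -> (P (~` A) <= (e / 2)%:E)%E.
      move=> mA; rewrite probability_setC// -(fineK (fin_num_measure P _ mA)) -EFinB !lee_fin; lra.
    have := prob_setU_le (measurableC mA1) (measurableC mA2) (q _ mA1 PA1) (q _ mA2 PA2).
    rewrite -setCI probability_setC; last exact: measurableI.
    by rewrite -(fineK (fin_num_measure P _ (measurableI _ _ mA1 mA2))) -EFinB !lee_fin; lra.
  move=> w [/h1[n nN pk] A2w]; have [Zn _ [X XE Xp]] := h2 w n A2w nN pk.
  by exists X; rewrite ?Zn ?XE// /G Zn.
Unshelve. all: by end_near. Qed.

End AlongSequence.

Lemma gauss_mixture_law (f : R -> R) (M : R) : continuous f -> (forall x, `|f x| <= M) ->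
  Rintegral (P \x @std_normal R)%E setT
    (fun v => f (expR (Num.sqrt (2 * beta) * sigmaPAM alpha * B v.1 * v.2))) =
  intT (peak_law) (fun x => intT lebesgue_measure
    (fun y => f (expR (Num.sqrt (2 * beta) * sigmaPAM alpha * x * y)) * gauss_pdf y)).
Proof.
move=> cf fM; set kap := _ * sigmaPAM alpha.
have mf : measT (fun x => f (expR x)).
  by apply: continuous_measurable_fun => x; apply: continuous_comp; [exact: continuous_expR | exact: cf].
have bf d0 (S : measurableType d0) (X : S -> R) : measT X -> bmeas (fun s => f (expR (X s))).
  by move=> mX; split; [exact: measurableT_comp mf mX | exists M].
have by_ x : bmeas (fun y : measurableTypeR R => f (expR (kap * x * y))).
  by apply: bf; apply: measurable_scale; exact: measurable_id.
rewrite Rintegral_prod; last first.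
  apply: bf; apply: measurable_funM; last exact: measurable_snd.
  apply: measurable_scale.
  exact: measurableT_comp mB measurable_fst.
have bxy : bmeas (fun v : R * measurableTypeR R => f (expR (kap * v.1 * v.2))).
  apply: bf; apply: measurable_funM; last exact: measurable_snd.
  by apply: measurable_scale; exact: measurable_fst.
have [b1 _ _ _] := prob_fubini (peak_law) (@std_normal R) bxy.
rewrite -(Rintegral_law P mB b1); apply: eq_Rintegral => x _; exact: (std_normalE (by_ x)).
Qed.

End PeakAssembly.

Theorem theorem1p4 (R : realType) (alpha beta : R) (p : nat -> R)
  (d : measure_display) (Omega : measurableType d) (P : probability Omega R)
  (xi0 : int -> Omega -> R) (c : nat -> Omega -> bool)
  (d' : measure_display) (Omega' : measurableType d') (Q : probability Omega' R)
  (tau : nat -> Omega' -> R) (eps : nat -> Omega' -> bool)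
  (Z1 : R -> Omega -> nat) :
  (* alpha >= 2; p eventually nondecreasing, p -> 1 *)
  2 <= alpha ->
  (forall n, 0 <= p n <= 1) ->
  (exists N : nat, forall m n : nat, (N <= m)%N -> (m <= n)%N -> p m <= p n) ->
  p @ \oo --> (1 : R) ->
  (* xi0(z), z in Z, i.i.d. Pareto(alpha) *)
  (forall z, measurable_fun setT (xi0 z)) ->
  (forall z (x : R), 1 <= x -> P [set w | x < xi0 z w] = (x `^ (- alpha))%:E) ->
  (* coins c n (n >= 1): c n = true means xi(-n) = xi0(n), probability p(n) *)
  (forall n, measurable [set w | c n w]) ->
  (forall n, (0 < n)%N -> P [set w | c n w] = (p n)%:E) ->
  mutually_indep P (fun i : int + nat => match i with
                                        | inl z => sigmaR (xi0 z)
                                        | inr n => sigmaB (c n.+1) end) ->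
  (* random walk: holding times i.i.d. Exp(2), steps i.i.d. fair signs *)
  (forall k, measurable_fun setT (tau k)) ->
  (forall k (x : R), 0 <= x -> Q [set w | x < tau k w] = (expR (- (2 * x)))%:E) ->
  (forall k, measurable [set w | eps k w]) ->
  (forall k, Q [set w | eps k w] = (1 / 2)%:E) ->
  mutually_indep Q (fun i : nat + nat => match i with
                                        | inl k => sigmaR (tau k)
                                        | inr k => sigmaB (eps k) end) ->
  (* Z1 t is a (measurable) maximiser of Psi_t over D, whenever one exists *)
  (forall t w, (exists z, Dset (potential xi0 c w) z /\
                  forall y, Dset (potential xi0 c w) y ->
                    Psi (potential xi0 c w) t y <= Psi (potential xi0 c w) t z) ->
     Dset (potential xi0 c w) (Z1 t w) /\
     forall y, Dset (potential xi0 c w) y ->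
       Psi (potential xi0 c w) t y <= Psi (potential xi0 c w) t (Z1 t w)) ->
  (forall t (n : nat), measurable [set w | Z1 t w = n]) ->
  (* eta(n) ~ beta kappa(n) *)
  0 < beta ->
  (fun n => etaPAM p n / (beta * kappa alpha n)) @ \oo --> (1 : R) ->
  exists mu : probability R R,
    (* B with law mu is strictly positive a.s. *)
    mu [set x | 0 < x] = 1%E /\
    (* Z1^(1/alpha) / xi(Z1) converges in law to mu *)
    (forall f : R -> R, bounded_continuous f ->
       (fun t => Rintegral P setT
          (fun w => f ((Z1 t w)%:R `^ (1 / alpha) / potential xi0 c w (Z1 t w))))
       @ +oo --> Rintegral mu setT f) /\
    (* u(t,Z1)/u(t,-Z1) converges in law to exp(sqrt(2 beta) sigma B N),
       N standard normal independent of B *)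
    (forall f : R -> R, bounded_continuous f ->
       (fun t => Rintegral P setT
          (fun w => f (pam_u Q tau eps (potential xi0 c w) t (Z1 t w)
                       / pam_u Q tau eps (potential xi0 c w) t (- (Z1 t w)%:Z))))
       @ +oo -->
       Rintegral mu setT (fun b => Rintegral lebesgue_measure setT
          (fun x => f (expR (Num.sqrt (2 * beta) * sigmaPAM alpha * b * x))
                    * gauss_pdf x))).
Proof.
move=> a2 p01 _ p1 mxi txi mc pc ind mtau ttau meps teps indQ Z1max mZ1 beta0 etah.
have fld : pareto_field alpha p P xi0 c by split.
have uE (V : int -> R) s z : 0 <= s ->
  pam_u Q tau eps V s z = fine (\sum_(0 <= j <oo) (fk predT V z j s 0)%:E)%E.
  exact: (feynman_kac V z mtau meps ttau teps indQ).
exists (peak_law fld); split; first exact: (peak_law_gt0 fld).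
(* The limit at infinity is tested along arbitrary sequences of times, as the limit theorems for
   integrals are sequential; the limit law does not depend on the sequence. *)
split=> f [cf [M fM]]; apply/cvg_pinftyP => t ty.
  rewrite /peak_law Rintegral_law; last by split; [exact: continuous_measurable_fun | exists M].
  exact: (peak_ratio_law fld beta0 p1 etah uE Z1max ty cf fM).
rewrite -(gauss_mixture_law fld beta cf fM).
exact: (peak_phase_law fld beta0 p1 etah uE Z1max mZ1 ty cf fM).
Qed.
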